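(* Let $f$ be locally distributionally integrable over $\mathbb R$. Then the formula $$\psi\mapsto(\mathfrak{dist})\int_{-\infty}^\infty f(x)\psi(x)\,dx,\qquad\psi\in\mathcal D(\mathbb R),$$ (where the integral is the distributional integral over any compact interval containing $\operatorname{supp}\psi$) defines a distribution $\mathsf f\in\mathcal D'(\mathbb R)$. Actually, for any fixed $a\in\mathbb R$, $\mathsf f=\mathsf F'$, where $F\leftrightarrow\mathsf F$ and $F(x)=(\mathfrak{dist})\int_a^xf(t)\,dt$. Furthermore, $\mathsf f(x)=f(x)$ almost everywhere in $\mathbb R$, where $\mathsf f(x)$ denotes the distributional point value.
   Context: Distributions are real. Notation: $\overline{\mathbb R}=\mathbb R\cup\{-\infty,\infty\}$; $\mathcal E'[a,b]$ is the space of distributions on $\mathbb R$ with support contained in $[a,b]$; $\langle \mathsf g(x+ty),\phi(y)\rangle:=|t|^{-1}\langle \mathsf g(y),\phi((y-x)/t)\rangle$ for $t\ne0$. Point values. For $\mathsf g\in\mathcal D'(\mathbb R)$, the distributional (Łojasiewicz) point value $\mathsf g(x_0)$ exists and equals $\gamma\in\mathbb R$ if $\lim_{\varepsilon\to0}\langle \mathsf g(x_0+\varepsilon y),\phi(y)\rangle=\gamma\int_{-\infty}^\infty\phi(y)\,dy$ for every $\phi\in\mathcal D(\mathbb R)$. A Łojasiewicz distribution is one having a point value at every point of $\mathbb R$. A function $G:\mathbb R\to\mathbb R$ is a Łojasiewicz function if there is a (necessarily unique) Łojasiewicz distribution $\mathsf G$ with $\mathsf G(x)=G(x)$ for all $x\in\mathbb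 R$; write $G\leftrightarrow\mathsf G$. Test classes. $\mathcal T_0$: functions $\phi\in C^\infty(\mathbb R)$, $\phi\ge0$, $\int\phi=1$, such that for some $\alpha<-1$, $\phi^{(m)}(x)=O(|x|^{\alpha-m})$ as $|x|\to\infty$ for all $m\ge0$. $\mathcal T_1$: those $\phi\in\mathcal T_0$ with $x\phi'(x)\le0$ for all $x$. For $\mathsf g\in\mathcal E'(\mathbb R)$, $\phi\in\mathcal T_0$: $\mathsf g^{+}_{\phi,0}(x)=\limsup_{t\to0^+}\langle \mathsf g(x+ty),\phi(y)\rangle$ and $\mathsf g^{-}_{\phi,0}(x)=\liminf_{t\to0^+}\langle \mathsf g(x+ty),\phi(y)\rangle$. Integral. Let $f:[a,b]\to\overline{\mathbb R}$. A major distributional pair $(\mathsf u,\mathsf U)$ for $f$ consists of $\mathsf u\in\mathcal E'[a,b]$ and a Łojasiewicz distribution $\mathsf U$ with $\mathsf U'=\mathsf u$, $\mathsf U(a)=0$, such that there exist a countable set $E$ and a Lebesgue null set $Z$ with $\mathsf u^-_{\phi,0}(x)\ge f(x)$ for all $x\in[a,b]\setminus Z$, $\phi\in\mathcal T_0$, and $\mathsf u^-_{\phi,0}(x)>-\infty$ for all $x\in[a,b]\setminus E$, $\phi\in\mathcal T_1$. A minor distributional pair $(\mathsf v,\mathsf V)$ for $f$ consists of $\mathsf v\in\mathcal E'[a,b]$ and a Łojasiewicz distribution $\mathsf V$ with $\mathsf V'=\mathsf v$, $\mathsf V(a)=0$, such that there exist a countable set $E$ and a null set $Z$ with $\mathsf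 v^+_{\phi,0}(x)\le f(x)$ for all $x\in[a,b]\setminus Z$, $\phi\in\mathcal T_0$, and $\mathsf v^+_{\phi,0}(x)<\infty$ for all $x\in[a,b]\setminus E$, $\phi\in\mathcal T_1$. The function $f$ is distributionally integrable over $[a,b]$ if it has both major and minor pairs and $\sup\mathsf V(b)=\inf\mathsf U(b)$ (sup over minor pairs, inf over major pairs); the common value is $(\mathfrak{dist})\int_a^bf(x)\,dx$. Integrability and the integral do not change if $f$ is modified on a null set; integrable functions are finite almost everywhere. A function $f:\mathbb R\to\overline{\mathbb R}$ is locally distributionally integrable over $\mathbb R$ if it is distributionally integrable over every compact interval. The usual convention $\int_a^x=-\int_x^a$ is used when $x<a$. The function $F$ is a Łojasiewicz function. *)

(* Defs.v *)
From HB Require Import structures.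
From mathcomp Require Import all_boot all_order all_algebra.
From mathcomp Require Import all_classical all_reals all_analysis.

Set Implicit Arguments.
Unset Strict Implicit.
Unset Printing Implicit Defensive.

Import Order.TTheory GRing.Theory Num.Theory.
Import numFieldNormedType.Exports.

Local Open Scope ring_scope.
Local Open Scope classical_set_scope.

Section Distributions.
Context {R : realType}.
Implicit Types (phi psi chi : R -> R).

Definition smooth phi := forall n x, derivable (phi^`(n)%classic) x 1.

Definition tsupp phi : set R := closure [set x | phi x != 0].

Definition test_fun phi := smooth phi /\ compact (tsupp phi).

Definition Ck_norm (k : nat) phi : R :=
  \sum_(n < k.+1) sup (range (fun x => `|phi^`(n)%classic x|)).

(* Only the values of a distribution at test functions are meaningful: its
   values at other functions are arbitrary, and two distributions are the same
   when they agree on all test functions. Continuity on D(R) is expressed by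
   the usual seminorm estimate on each compact set. *)
Record schwartz_distr := Distribution {
  distr_fun :> (R -> R) -> R ;
  distr_linear : forall (c : R) phi psi, test_fun phi -> test_fun psi ->
    distr_fun (fun x => c * phi x + psi x) = c * distr_fun phi + distr_fun psi ;
  distr_continuous : forall K : set R, compact K ->
    exists (C : R) (k : nat), forall phi, test_fun phi -> tsupp phi `<=` K ->
      `|distr_fun phi| <= C * Ck_norm k phi }.

Implicit Types (g h u v U V : schwartz_distr).

(* For closed K: g vanishes on the open complement of K, i.e. supp g is
   contained in K. *)
Definition supported_in g (K : set R) :=
  forall phi, test_fun phi -> tsupp phi `<=` ~` K -> g phi = 0.

Definition is_distr_derivative g h :=
  forall phi, test_fun phi -> h phi = - g (phi^`()%classic).

(* <g(x + t y), phi(y)>, for phi in D(R). *)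
Definition pairing_scaled g (x t : R) phi : R :=
  `|t|^-1 * g (fun y => phi ((y - x) / t)).

Definition has_point_value g (x0 gamma : R) :=
  forall phi, test_fun phi ->
    pairing_scaled g x0 e phi @[e --> 0^'] -->
      gamma * \int[@lebesgue_measure R]_y phi y.

(* G <-> g; then g is a Lojasiewicz distribution, G a Lojasiewicz function. *)
Definition lojasiewicz_assoc (G : R -> R) g := forall x, has_point_value g x (G x).

Definition lojasiewicz_distr g := exists G : R -> R, lojasiewicz_assoc G g.

(* Distributions supported in [a, b] act on every smooth function phi by
   <g, phi> := <g, chi phi>, where chi is any test function equal to 1 on a
   neighbourhood of [a, b]; the value does not depend on chi. *)
Definition is_cutoff (a b : R) chi :=
  test_fun chi /\ exists W : set R,
    [/\ open W, `[a, b]%classic `<=` W & forall x, W x -> chi x = 1].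

Definition cutoff (a b : R) : R -> R := xget (fun=> 0) [set chi | is_cutoff a b chi].

Definition cpairing (a b : R) g phi : R := g (fun y => cutoff a b y * phi y).

(* <g(x + t y), phi(y)>, for g in E'[a, b] and phi smooth. *)
Definition cpairing_scaled (a b : R) g (x t : R) phi : R :=
  `|t|^-1 * cpairing a b g (fun y => phi ((y - x) / t)).

Definition test_class0 phi :=
  [/\ smooth phi, forall x, 0 <= phi x,
      (\int[@lebesgue_measure R]_x (phi x)%:E = 1)%E &
      exists2 alpha : R, alpha < -1 & forall m : nat, exists C M : R,
        forall x, M < `|x| -> `|phi^`(m)%classic x| <= C * `|x| `^ (alpha - m%:R)].

Definition test_class1 phi :=
  test_class0 phi /\ forall x, x * phi^`()%classic x <= 0.

Definition upper_value (a b : R) g phi (x : R) : \bar R :=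
  limf_esup (fun t => (cpairing_scaled a b g x t phi)%:E) 0^'+.

Definition lower_value (a b : R) g phi (x : R) : \bar R :=
  limf_einf (fun t => (cpairing_scaled a b g x t phi)%:E) 0^'+.

Definition major_pair (f : R -> \bar R) (a b : R) u U :=
  [/\ supported_in u `[a, b]%classic, lojasiewicz_distr U,
      is_distr_derivative U u, has_point_value U a 0 &
      exists E Z : set R,
        [/\ countable E, (@lebesgue_measure R).-negligible Z,
            forall x phi, (`[a, b]%classic `\` Z) x -> test_class0 phi ->
              (f x <= lower_value a b u phi x)%E &
            forall x phi, (`[a, b]%classic `\` E) x -> test_class1 phi ->
              (-oo < lower_value a b u phi x)%E]].

Definition minor_pair (f : R -> \bar R) (a b : R) v V :=
  [/\ supported_in v `[a, b]%classic, lojasiewicz_distr V,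
      is_distr_derivative V v, has_point_value V a 0 &
      exists E Z : set R,
        [/\ countable E, (@lebesgue_measure R).-negligible Z,
            forall x phi, (`[a, b]%classic `\` Z) x -> test_class0 phi ->
              (upper_value a b v phi x <= f x)%E &
            forall x phi, (`[a, b]%classic `\` E) x -> test_class1 phi ->
              (upper_value a b v phi x < +oo)%E]].

Definition major_values (f : R -> \bar R) (a b : R) : set (\bar R) :=
  [set c%:E | c in [set c | exists u U, major_pair f a b u U /\ has_point_value U b c]].

Definition minor_values (f : R -> \bar R) (a b : R) : set (\bar R) :=
  [set c%:E | c in [set c | exists v V, minor_pair f a b v V /\ has_point_value V b c]].

Definition dist_integrable (f : R -> \bar R) (a b : R) :=
  [/\ exists u U, major_pair f a b u U, exists v V, minor_pair f a b v V &
      ereal_sup (minor_values f a b) = ereal_inf (major_values f a b)].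

(* When f is integrable, the supremum is finite, since both sets of values are
   nonempty; the definition is meaningful for a <= b only. *)
Definition dist_integral (f : R -> \bar R) (a b : R) : R :=
  fine (ereal_sup (minor_values f a b)).

Definition oriented_dist_integral (f : R -> \bar R) (a x : R) : R :=
  if a <= x then dist_integral f a x else - dist_integral f x a.

Definition locally_dist_integrable (f : R -> \bar R) :=
  forall a b : R, a <= b -> dist_integrable f a b.

End Distributions.

Arguments schwartz_distr : clear implicits.

(* Main.v *)
(* Testing against the Gaussian in the conditions on a major pair (u, U) and a
   minor pair (v, V) shows that u - v is a positive functional: its Gaussian
   means solve the heat equation, U - V having point values makes them
   negligible at the corners, and the parabolic maximum principle spreads
   positivity over the gaps of the set of bad points, a Baire-type nested
   interval argument taking care of the countable exceptional set and a small
   absolutely continuous penalty of the null set.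

   A distribution in E'[a, b] is handled as a functional T on smooth functions,
   and the value at b of its primitive vanishing at a is T 1. If T is major for
   f, S is major for - f, and mu = T + S has small mass mu 1, then
   (psi + C) T + C S is major for f psi whenever C >= 0 and psi + C >= 0. So
   int f psi differs from T psi by at most 2 C mu 1, which gives the integrability
   of f psi, the linearity and the continuity of psi |-> int f psi, and, after
   gluing major functionals at x, the point value at x of its primitive.
   Vitali's covering lemma bounds the maximal function of mu, hence f is finite
   almost everywhere and the averages of int f psi converge to f almost
   everywhere. *)

From HB Require Import structures.
From mathcomp Require Import all_boot all_order all_algebra.
From mathcomp Require Import all_classical all_reals all_analysis.
From mathcomp Require Import measurable_realfun ring lra zify.
Require Import Defs.

Set Implicit Arguments.
Unset Strict Implicit.
Unset Printing Implicit Defensive.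

Import Order.TTheory GRing.Theory Num.Theory.
Import numFieldNormedType.Exports.

Local Open Scope classical_set_scope.
Local Open Scope ring_scope.

(** Two lacks of uniformity shape the proof. The width below which a Gaussian mean of [u - v] is
    bounded below depends on the point; the Baire argument yields an interval in which one width
    serves all points near which positivity fails. And a point value of [U - V] controls [u - v] on
    [theta ((x - x0) / s)] for one compactly supported [theta] at a time, without the factor [s^-1]
    of a mean. So the maximum principle runs on [u - v] applied to smoothed indicators of intervals
    [[x, y]], with [x], [y] and the width as variables, instead of on the means; and a
    Banach-Steinhaus bound, uniform in the scale, together with a dyadic decomposition extends the
    control to tests without compact support. The same decomposition serves the tests of
    [test_class0] when functionals are glued or multiplied. In [(psi + C) T + C S] the coefficients
    are nonnegative, so lower bounds are preserved, and where [f] is finite they add up to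
    [(psi + C) f - C f = f psi]. This is why the maximal inequality and finiteness almost everywhere
    come before products. *)

(* Sealed: conversion would otherwise unfold iterated limits whenever two
   derivatives are compared. *)
HB.lock Definition D {R : realType} (n : nat) (f : R -> R) : R -> R := derive1n n f.

HB.lock Definition Cinf {R : realType} (f : R -> R) : Prop := smooth f.

(** * Calculus of smooth functions and their iterated derivatives *)

Section SmoothCalculus.
Context {R : realType}.
Implicit Types (f g : R -> R) (x y h : R) (n k m : nat).

Local Notation der f g := (forall x : R, is_derive x 1 f (g x)).

Lemma der_derive1 f g : der f g -> derive1 f = g.
Proof. by move=> fg; apply/funext => x; rewrite derive1E (@derive_val _ _ _ _ _ _ _ (fg x)). Qed.

Lemma DE n f : D n f = derive1n n f.
Proof. by rewrite D.unlock. Qed.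

Lemma D1E f : D 1 f = derive1 f.
Proof. by rewrite D.unlock. Qed.

Lemma D0 f : D 0 f = f.
Proof. by rewrite D.unlock. Qed.

Lemma DS f n : D n.+1 f = D n (D 1 f).
Proof. by rewrite D.unlock /derive1n iterSr. Qed.

Lemma DSr f n : D n.+1 f = D 1 (D n f).
Proof. by rewrite D.unlock derive1nS. Qed.

Lemma der_D1 f g : der f g -> D 1 f = g.
Proof. by move=> fg; rewrite D.unlock; exact: der_derive1. Qed.

Lemma smooth_der f n : Cinf f -> der (D n f) (D n.+1 f).
Proof.
rewrite Cinf.unlock D.unlock => sf x; rewrite derive1nS derive1E.
exact/derivableP/sf.
Qed.

Lemma smooth_der0 f : Cinf f -> der f (D 1 f).
Proof. by move=> sf; have := smooth_der 0 sf; rewrite D0. Qed.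

Lemma smooth_D1 f : Cinf f -> Cinf (D 1 f).
Proof.
by rewrite Cinf.unlock => sf n x; have := sf n.+1 x; rewrite -DE DS DE.
Qed.

Lemma smooth_D f n : Cinf f -> Cinf (D n f).
Proof.
by move=> sf; elim: n => [|n IH]; [rewrite D0|rewrite DSr; exact: smooth_D1].
Qed.

(** Smoothness by coinduction: a class closed under differentiation contains smooth functions only.
    The closure properties below are obtained by exhibiting such a class, so no formula for higher
    derivatives is involved. *)
Lemma smooth_of_class (S : (R -> R) -> Prop) :
  (forall f, S f -> exists2 g, S g & der f g) -> forall f, S f -> Cinf f.
Proof.
move=> HS f Sf; rewrite Cinf.unlock => n; elim: n f Sf => [|n IH] f Sf x.
  by have [g _ fg] := HS _ Sf; have := fg x; case.
have [g Sg fg] := HS _ Sf; rewrite -DE DS (der_D1 fg) DE; exact: IH.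
Qed.

Lemma smooth_primitive f g : der f g -> Cinf g -> Cinf f.
Proof.
rewrite Cinf.unlock => fg sg [|n] x; first by have := fg x; case.
by rewrite -DE DS (der_D1 fg) DE; exact: sg.
Qed.

Lemma smooth_continuous f : Cinf f -> continuous f.
Proof.
move=> sf x; apply/differentiable_continuous/derivable1_diffP.
by have := smooth_der0 sf x; case.
Qed.

Lemma der_continuous f g : der f g -> continuous f.
Proof.
move=> fg x; apply/differentiable_continuous/derivable1_diffP.
by have := fg x; case.
Qed.

Lemma derD f df g dg x : is_derive x 1 f df -> is_derive x 1 g dg ->
  is_derive x 1 (fun x => f x + g x) (df + dg).
Proof. by move=> Df Dg; exact: is_deriveD. Qed.

Lemma derN f df x : is_derive x 1 f df -> is_derive x 1 (fun x => - f x) (- df).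
Proof. by move=> Df; exact: is_deriveN. Qed.

Lemma derB f df g dg x : is_derive x 1 f df -> is_derive x 1 g dg ->
  is_derive x 1 (fun x => f x - g x) (df - dg).
Proof. by move=> Df Dg; exact: is_deriveB. Qed.

Lemma derM f df g dg x : is_derive x 1 f df -> is_derive x 1 g dg ->
  is_derive x 1 (fun x => f x * g x) (df * g x + f x * dg).
Proof.
move=> Df Dg; apply: (is_derive_eq (is_deriveM Df Dg)).
by rewrite /GRing.scale /= addrC mulrC.
Qed.

Lemma derZ c f df x : is_derive x 1 f df ->
  is_derive x 1 (fun x => c * f x) (c * df).
Proof. by move=> Df; exact: (@is_deriveZ _ _ _ _ c x 1 _ Df). Qed.

Lemma der_cst (c x : R) : is_derive x 1 (fun=> c) 0.
Proof. exact: is_derive_cst. Qed.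

Lemma der_comp f df g dg x : is_derive (g x) 1 f df -> is_derive x 1 g dg ->
  is_derive x 1 (fun x => f (g x)) (dg * df).
Proof. by move=> Df Dg; rewrite mulrC; exact: (is_derive1_comp Df Dg). Qed.

Lemma der_scale (c t y : R) : is_derive y 1 (fun y => (y - c) / t) t^-1.
Proof.
under eq_fun do rewrite mulrC.
apply: (is_derive_eq (derZ t^-1 (derB (is_derive_id y 1) (der_cst c y)))).
by rewrite subr0 mulr1.
Qed.

Lemma der_affine (c t y : R) : is_derive y 1 (fun y => c + t * y) t.
Proof.
apply: (is_derive_eq (derD (der_cst c y) (derZ t (is_derive_id y 1)))).
by rewrite add0r mulr1.
Qed.

Lemma D_cst (c : R) n : D n.+1 (fun=> c : R) = fun=> 0.
Proof.
have E c' : D 1 (fun=> c' : R) = fun=> 0 by apply: der_D1 => x; exact: der_cst.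
by elim: n c => [|n IH] c; [rewrite E|rewrite DS E IH].
Qed.

Lemma smooth_cst (c : R) : Cinf (fun=> c : R).
Proof.
apply: (@smooth_of_class (fun f => exists c, f = fun=> c)); last by exists c.
by move=> _ [d ->]; exists (fun=> 0); [exists 0|move=> x; exact: der_cst].
Qed.

Lemma smooth_id : Cinf (fun x : R => x).
Proof.
have D (x : R) : is_derive x 1 (fun y : R => y) 1 by exact: is_derive_id.
exact: (smooth_primitive D (@smooth_cst 1)).
Qed.

Lemma smoothD f g : Cinf f -> Cinf g -> Cinf (fun x => f x + g x).
Proof.
move=> sf sg; apply: (@smooth_of_class (fun F : R -> R => exists f g,
  [/\ Cinf f, Cinf g & F = fun x => f x + g x])); last by exists f, g.
move=> _ [f1 [g1 [s1 s2 ->]]].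
exists (fun x => D 1 f1 x + D 1 g1 x).
  by exists (D 1 f1), (D 1 g1); split; [exact: smooth_D1|exact: smooth_D1|].
by move=> x; apply: derD; exact: smooth_der0.
Qed.

Lemma D_D f g n : Cinf f -> Cinf g ->
  D n (fun x => f x + g x) = fun x => D n f x + D n g x.
Proof.
elim: n f g => [|n IH] f g sf sg; first by rewrite !D0.
have E : D 1 (fun x => f x + g x) = fun x => D 1 f x + D 1 g x.
  by apply: der_D1 => x; apply: derD; exact: smooth_der0.
by rewrite DS E IH; [apply/funext => x; rewrite !(DS _ n)|exact: smooth_D1..].
Qed.

Lemma smoothZ c f : Cinf f -> Cinf (fun x => c * f x).
Proof.
move=> sf; apply: (@smooth_of_class (fun F : R -> R => exists2 f, Cinf f & F = fun x => c * f x)).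
  move=> _ [f1 s1 ->]; exists (fun x => c * D 1 f1 x).
    by exists (D 1 f1) => //; exact: smooth_D1.
  by move=> x; apply: derZ; exact: smooth_der0.
by exists f.
Qed.

Lemma D_Z c f n : Cinf f ->
  D n (fun x => c * f x) = fun x => c * D n f x.
Proof.
elim: n f => [|n IH] f sf; first by rewrite !D0.
have E : D 1 (fun x => c * f x) = fun x => c * D 1 f x.
  by apply: der_D1 => x; apply: derZ; exact: smooth_der0.
by rewrite DS E IH; [apply/funext => x; rewrite (DS _ n)|exact: smooth_D1].
Qed.

Lemma smoothN f : Cinf f -> Cinf (fun x => - f x).
Proof. by move=> sf; under eq_fun do rewrite -mulN1r; exact: smoothZ. Qed.

Lemma D_N f n : Cinf f ->
  D n (fun x => - f x) = fun x => - D n f x.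
Proof.
move=> sf; under eq_fun do rewrite -mulN1r.
by rewrite D_Z//; apply/funext => x; rewrite mulN1r.
Qed.

Lemma smoothB f g : Cinf f -> Cinf g -> Cinf (fun x => f x - g x).
Proof. by move=> sf sg; apply: smoothD => //; exact: smoothN. Qed.

Lemma D_B f g n : Cinf f -> Cinf g ->
  D n (fun x => f x - g x) = fun x => D n f x - D n g x.
Proof. by move=> sf sg; rewrite D_D ?D_N//; exact: smoothN. Qed.

(** The derivative of a product is a sum of two products, so the class given to [smooth_of_class]
    has to be closed under sums. *)
Inductive prod_span : (R -> R) -> Prop :=
| prod_span_mul f g : Cinf f -> Cinf g -> prod_span (fun x => f x * g x)
| prod_span_add f g : prod_span f -> prod_span g -> prod_span (fun x => f x + g x).

Lemma smoothM f g : Cinf f -> Cinf g -> Cinf (fun x => f x * g x).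
Proof.
move=> sf sg; apply: (@smooth_of_class prod_span); last exact: prod_span_mul.
move=> F; elim=> {F} [f1 g1 s1 s2|f1 g1 _ [f2 p1 d1] _ [g2 p2 d2]].
  exists (fun x => D 1 f1 x * g1 x + f1 x * D 1 g1 x).
    by apply: prod_span_add; apply: prod_span_mul => //; exact: smooth_D1.
  by move=> x; apply: derM; exact: smooth_der0.
exists (fun x => f2 x + g2 x); first exact: prod_span_add.
by move=> x; exact: derD.
Qed.

Lemma D1M f g : Cinf f -> Cinf g ->
  D 1 (fun x => f x * g x) = fun x => D 1 f x * g x + f x * D 1 g x.
Proof. by move=> sf sg; apply: der_D1 => x; apply: derM; exact: smooth_der0. Qed.

(* Cruder than Leibniz' formula, but stable under localisation to any point. *)
Lemma leibniz_bound f g n x (A B : R) : Cinf f -> Cinf g ->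
  (forall k, (k <= n)%N -> `|D k f x| <= A) ->
  (forall k, (k <= n)%N -> `|D k g x| <= B) ->
  `|D n (fun x => f x * g x) x| <= 2 ^+ n * (A * B).
Proof.
elim: n f g => [|n IH] f g sf sg fA gB.
  by rewrite D0 expr0 mul1r normrM ler_pM//; [rewrite -(D0 f); exact: fA|rewrite -(D0 g); exact: gB].
rewrite DS D1M// D_D; try (by apply: smoothM => //; exact: smooth_D1).
rewrite (le_trans (ler_normD _ _))// exprS -mulrA mulr_natl mulr2n lerD//; apply: IH => //;
 try exact: smooth_D1; move=> k kn; rewrite -?(DS _ k);
 by [apply: fA|apply: gB|apply: fA; exact: leqW|apply: gB; exact: leqW].
Qed.

Lemma smooth_comp_affine f (a : R -> R) (r : R) : Cinf f -> (forall y, is_derive y 1 a r) ->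
  Cinf (fun y => f (a y)).
Proof.
move=> sf da.
apply: (@smooth_of_class (fun F : R -> R => exists c f, Cinf f /\ F = fun y => c * f (a y))).
  move=> _ [c [f1 [s1 ->]]]; exists (fun y => c * (r * D 1 f1 (a y))).
    exists (c * r), (D 1 f1); split; first exact: smooth_D1.
    by apply/funext => y; rewrite mulrA.
  by move=> z; exact: (derZ c (der_comp (smooth_der0 s1 _) (da z))).
by exists 1, f; split => //; apply/funext => z; rewrite mul1r.
Qed.

Lemma D_comp_affine f (a : R -> R) (r : R) n : Cinf f -> (forall y, is_derive y 1 a r) ->
  D n (fun y => f (a y)) = fun y => r ^+ n * D n f (a y).
Proof.
elim: n f => [|n IH] f sf da; first by apply/funext => y; rewrite !D0 expr0 mul1r.
have E : D 1 (fun y => f (a y)) = fun y => r * D 1 f (a y).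
  by apply: der_D1 => y; exact: (der_comp (smooth_der0 sf _) (da y)).
have sf1 := smooth_D1 sf.
rewrite DS E D_Z; last exact: (smooth_comp_affine sf1 da).
by rewrite (IH _ sf1 da); apply/funext => y; rewrite (DS _ n) exprS mulrA.
Qed.

Lemma smooth_scale f c t : Cinf f -> Cinf (fun y => f ((y - c) / t)).
Proof. by move=> sf; apply: smooth_comp_affine => // y; exact: der_scale. Qed.

Lemma D_scale f c t n : Cinf f ->
  D n (fun y => f ((y - c) / t)) = fun y => t^-1 ^+ n * D n f ((y - c) / t).
Proof. by move=> sf; apply: D_comp_affine => // y; exact: der_scale. Qed.

Lemma smooth_affine f c t : Cinf f -> Cinf (fun y => f (c + t * y)).
Proof. by move=> sf; apply: smooth_comp_affine => // y; exact: der_affine. Qed.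

Lemma D_affine f c t n : Cinf f ->
  D n (fun y => f (c + t * y)) = fun y => t ^+ n * D n f (c + t * y).
Proof. by move=> sf; apply: D_comp_affine => // y; exact: der_affine. Qed.

Lemma mvt f g x y : der f g ->
  exists c, [/\ Num.min x y <= c, c <= Num.max x y & f y - f x = g c * (y - x)].
Proof.
move=> fg; have cf a b : {within `[a, b], continuous f}.
  by apply: continuous_subspaceT; exact: der_continuous fg.
case: (leP x y) => xy.
  have [c] := @MVT_segment _ f g x y xy (fun z _ => fg z) (cf _ _).
  by rewrite in_itv /= => /andP[? ?] ?; exists c.
have [c] := @MVT_segment _ f g y x (ltW xy) (fun z _ => fg z) (cf _ _).
rewrite in_itv /= => /andP[? ?] E; exists c; split => //.
by rewrite -opprB E -mulrN opprB.
Qed.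

Lemma mvt_norm f g x y : der f g ->
  exists2 c, `|c - x| <= `|y - x| & f y - f x = g c * (y - x).
Proof.
move=> /(mvt x y)[c [c1 c2 E]]; exists c => //.
by move: c1 c2; case: (leP x y) => xy c1 c2;
   [rewrite !ger0_norm|rewrite !ler0_norm]; lra.
Qed.

Lemma mvt_le f g x y (C : R) : der f g -> (forall c, `|g c| <= C) ->
  `|f y - f x| <= C * `|y - x|.
Proof.
by move=> /(mvt_norm x y)[c _ ->] gC; rewrite normrM ler_wpM2r.
Qed.

Lemma der_nondecreasing f g x y : der f g -> x <= y ->
  (forall z, x <= z <= y -> 0 <= g z) -> f x <= f y.
Proof.
move=> /(mvt x y)[c []]; case: (leP x y) => // xy c1 c2 E _ g0.
by rewrite -subr_ge0 E mulr_ge0 ?subr_ge0//; apply: g0; rewrite c1.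
Qed.

(** Two applications of the mean value theorem; the constant [C] instead of [C / 2] is good enough
    to recognise a derivative. *)
Lemma taylor1 f g g' x h (C : R) : der f g -> der g g' ->
  (forall y, `|y - x| <= `|h| -> `|g' y| <= C) ->
  `|f (x + h) - f x - h * g x| <= C * h ^+ 2.
Proof.
move=> fg gg' g'C.
have [c c1 ->] := mvt_norm x (x + h) fg.
have xh : x + h - x = h by lra.
rewrite xh in c1 *; rewrite mulrC -mulrBr.
have [d d1 ->] := mvt_norm x c gg'.
have H : `|g' d| * `|c - x| <= C * `|h|.
  by apply: ler_pM => //; apply: g'C; exact: le_trans c1.
rewrite -[h ^+ 2]real_normK ?num_real// !normrM (_ : C * _ = `|h| * (C * `|h|)); last by ring.
by rewrite ler_wpM2l.
Qed.

(** A quadratic remainder with a constant free of [h] is a form of differentiability that survives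
    limits of series and the application of a continuous functional. *)
Lemma is_derive_quad f x (d C e : R) : 0 < e ->
  (forall h, `|h| < e -> `|f (x + h) - f x - h * d| <= C * h ^+ 2) ->
  is_derive x 1 f d.
Proof.
move=> e0 fC.
have H : h^-1 *: (f (h *: 1 + x) - f x) @[h --> 0^'] --> d.
  apply/cvgrPdist_le => /= eps eps0; near=> h.
  have h0 : h != 0 by near: h; exact: nbhs_dnbhs_neq.
  have he : `|h| < e by near: h; apply: dnbhs0_lt.
  have hC : `|h| < eps / (`|C| + 1).
    by near: h; apply: dnbhs0_lt; rewrite divr_gt0// ltr_wpDl.
  rewrite /GRing.scale /= mulr1 (addrC h x) distrC.
  rewrite (_ : _ - d = h^-1 * (f (x + h) - f x - h * d)); last by field.
  rewrite normrM normfV ler_pdivrMl ?normr_gt0//.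
  apply: le_trans (fC _ he) _.
  rewrite -real_normK ?num_real// expr2 mulrCA ler_wpM2l//.
  rewrite (le_trans (ler_wpM2r _ (ler_norm C)))//.
  rewrite (@le_trans _ _ ((`|C| + 1) * `|h|))//.
    by rewrite ler_wpM2r// lerDl.
  by rewrite mulrC -ler_pdivlMr ?ltr_wpDl//; exact: ltW.
apply: DeriveDef; first by apply/cvg_ex; exists d.
by apply/cvg_lim.
Unshelve. all: by end_near. Qed.

Lemma D_local f g n x (e : R) : Cinf f -> Cinf g -> 0 < e ->
  (forall y, `|y - x| < e -> f y = g y) -> D n f x = D n g x.
Proof.
move=> sf sg; elim: n x e => [|n IH] x e e0 fg.
  by rewrite !D0; apply: fg; rewrite subrr normr0.
have d1 := smooth_der n sf x; have d2 := smooth_der n sg x.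
suff d3 : is_derive x 1 (D n f) (D n.+1 g x).
  by rewrite -(@derive_val _ _ _ _ _ _ _ d1) (@derive_val _ _ _ _ _ _ _ d3).
apply: near_eq_is_derive d2; near=> y.
(* Half of [e] is kept in reserve: each such [y] still has a neighbourhood on which [f] and [g]
   agree, as the induction hypothesis asks. *)
have ye : `|y - x| < e / 2.
  near: y; apply/nbhs_ballP; exists (e / 2) => /=; first by rewrite divr_gt0.
  by move=> z; rewrite /ball /= distrC.
apply/esym; apply: (IH y (e / 2)); first by rewrite divr_gt0.
move=> z zy; apply: fg; rewrite -(subrK y z) -addrA.
by rewrite (le_lt_trans (ler_normD _ _))// [ltRHS]splitr ltrD.
Unshelve. all: by end_near. Qed.

End SmoothCalculus.

(** * Test functions, their primitives and integrals *)

Section Primitives.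
Context {R : realType}.
Implicit Types (f g : R -> R) (x y h : R) (n k m : nat).
Local Notation der f g := (forall x : R, is_derive x 1 f (g x)).
Local Notation mu := (@lebesgue_measure R).

(** The class [test_fun], by [testfP], with the support bounded by a radius instead of being a
    compact closure. *)
Definition testf f := Cinf f /\ exists M : R, forall x, M < `|x| -> f x = 0.

Lemma testfP f : test_fun f <-> testf f.
Proof.
rewrite /test_fun /testf Cinf.unlock; split=> -[sf cf]; split => //.
  have [M [_ HM]] := compact_bounded cf; exists (M + 1) => x xM.
  apply/eqP; apply/negP => /negP fx0.
  have /(_ x) := HM (M + 1) (ltr_pwDr ltr01 (lexx M)).
  by move/(_ (@subset_closure _ [set x | f x != 0] _ fx0)); rewrite /= leNgt xM.
case: cf => M HM; apply: (@subclosed_compact _ _ `[- M, M]).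
- exact: closed_closure.
- exact: segment_compact.
- apply: (@subset_trans _ (closure `[- M, M])).
    apply: closureS => x /= fx0; rewrite in_itv /= -ler_norml leNgt; apply/negP => xM.
    by rewrite HM ?eqxx in fx0.
  by rewrite -(proj1 (closure_id _)) //; exact: itv_closed.
Qed.

Lemma testfD f g : testf f -> testf g -> testf (fun x => f x + g x).
Proof.
move=> [sf [M HM]] [sg [N HN]]; split; first exact: smoothD.
by exists (Num.max M N) => x; rewrite gt_max => /andP[? ?]; rewrite HM// HN// addr0.
Qed.

Lemma testfMl f g : Cinf f -> testf g -> testf (fun x => f x * g x).
Proof.
move=> sf [sg [M HM]]; split; first exact: smoothM.
by exists M => x xM; rewrite HM// mulr0.
Qed.

Lemma testfMr f g : testf f -> Cinf g -> testf (fun x => f x * g x).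
Proof. by move=> tf sg; under eq_fun do rewrite mulrC; exact: testfMl. Qed.

Lemma testfZ (c : R) f : testf f -> testf (fun x => c * f x).
Proof. by move=> tf; apply: testfMl tf; exact: smooth_cst. Qed.

Lemma testfN f : testf f -> testf (fun x => - f x).
Proof. by move=> tf; under eq_fun do rewrite -mulN1r; exact: testfZ. Qed.

Lemma testfB f g : testf f -> testf g -> testf (fun x => f x - g x).
Proof. by move=> tf tg; apply: testfD => //; exact: testfN. Qed.

Lemma testf_scale f (c t : R) : t != 0 -> testf f -> testf (fun y => f ((y - c) / t)).
Proof.
move=> t0 [sf [M HM]]; split; first exact: smooth_scale.
exists (`|M| * `|t| + `|c|) => x xM; apply: HM.
rewrite normrM normfV ltr_pdivlMr ?normr_gt0//.
rewrite (@le_lt_trans _ _ (`|M| * `|t|))//; first by rewrite ler_wpM2r// ler_norm.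
rewrite -ltrBrDr in xM; apply: lt_le_trans xM _; exact: lerB_dist.
Qed.

Lemma testf_affine f (c t : R) : t != 0 -> testf f -> testf (fun y => f (c + t * y)).
Proof.
move=> t0 tf; have := testf_scale (- t^-1 * c) (invr_neq0 t0) tf.
congr testf; apply/funext => y; congr f; field; exact: t0.
Qed.

Lemma D_out f n x (M : R) : Cinf f -> (forall x, M < `|x| -> f x = 0) ->
  M < `|x| -> D n f x = 0.
Proof.
move=> sf HM Mx.
have D0c : D n (fun=> 0 : R) x = 0 by case: n => [|n]; rewrite ?D0 ?D_cst.
rewrite -[RHS]D0c; apply: (@D_local _ _ _ _ _ (`|x| - M)) => //; first exact: smooth_cst.
  by rewrite subr_gt0.
move=> y yx; apply: HM; have := lerB_dist x y; rewrite distrC => H.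
by move: yx H; rewrite distrC; lra.
Qed.

Lemma testf_D f n : testf f -> testf (D n f).
Proof.
move=> [sf [M HM]]; split; first exact: smooth_D.
by exists M => x; exact: D_out.
Qed.

Lemma testf_test f : testf f -> test_fun f. Proof. by move/testfP. Qed.

Lemma test_testf f : test_fun f -> testf f. Proof. by move/testfP. Qed.

Lemma testf_tsupp f a b : (forall x, f x != 0 -> a <= x <= b) -> tsupp f `<=` `[a, b].
Proof.
move=> H; apply: (@subset_trans _ (closure `[a, b])).
  by apply: closureS => x /= /H; rewrite in_itv.
by rewrite -(proj1 (closure_id _)) //; exact: itv_closed.
Qed.

Definition prim f x : R := \int[mu]_(t in `]-oo, x]) f t.

Lemma prim_der f : continuous f -> mu.-integrable setT (EFin \o f) -> der (prim f) f.
Proof.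
move=> cf intf x.
have intfx : mu.-integrable `]-oo, x + 1] (EFin \o f).
  by apply: integrableS intf.
have xx : x < x + 1 by rewrite ltrDl.
have [|d1 d2] := continuous_FTC1 xx intfx _ (cf x); first by rewrite ltNyr.
by rewrite -d2 derive1E; exact/derivableP.
Qed.

Lemma testf_integrable f : testf f -> mu.-integrable setT (EFin \o f).
Proof.
move=> [sf [M HM]].
have mI : measurable `[- M, M]%classic by exact: measurable_itv.
have H := (@integrable_mkcond _ _ _ mu _ (EFin \o f) mI).
have E : EFin \o f = (fun x => if x \in `[- M, M]%classic then (EFin \o f) x else 0%E).
  apply/funext => x; case: ifPn => //; rewrite notin_setE /=.
  by rewrite in_itv /= -ler_norml => /negP; rewrite -ltNge => /HM ->.
rewrite E; apply: H.1.
apply: continuous_compact_integrable; first exact: segment_compact.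
by apply: continuous_subspaceT; exact: (smooth_continuous sf).
Qed.

Lemma testf_prim_der f : testf f -> der (prim f) f.
Proof.
move=> tf; apply: prim_der; first exact: (smooth_continuous tf.1).
exact: testf_integrable.
Qed.

Lemma Cinf_prim f : testf f -> Cinf (prim f).
Proof. by move=> tf; exact: (smooth_primitive (testf_prim_der tf) tf.1). Qed.

Lemma prim_left f a x : (forall y, y < a -> f y = 0) -> x < a -> prim f x = 0.
Proof.
move=> f0 xa; rewrite /prim (@eq_Rintegral _ _ _ _ _ (fun=> 0)).
  by rewrite /Rintegral integral0.
by move=> y /set_mem /=; rewrite in_itv /= => yx; apply: f0; exact: le_lt_trans xa.
Qed.

Lemma prim_right f b x : (forall y, b < y -> f y = 0) -> b <= x ->
  prim f x = \int[mu]_y f y.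
Proof.
move=> f0 bx; rewrite /prim Rintegral_mkcond; congr Rintegral.
apply/funext => y; rewrite patchE; case: ifPn => //; rewrite notin_setE /=.
rewrite in_itv /= => /negP; rewrite -ltNge => xy; rewrite f0//.
exact: le_lt_trans xy.
Qed.

Lemma der_unique f g d a : der f d -> der g d -> f a = g a -> f = g.
Proof.
move=> fd gd fga; apply/funext => x.
have H : der (fun x => f x - g x) (fun=> 0).
  by move=> y; rewrite -(subrr (d y)); exact: derB.
have [c [_ _]] := mvt a x H.
by rewrite mul0r fga subrr subr0 => /subr0_eq.
Qed.

Lemma Rint_ge0 f : (forall x, 0 <= f x) -> 0 <= \int[mu]_y f y.
Proof. by move=> f0; apply: Rintegral_ge0 => x _; exact: f0. Qed.

Lemma RintE f : testf f -> exists M, forall x, M <= x -> prim f x = \int[mu]_y f y.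
Proof.
move=> [sf [M HM]]; exists M => x Mx; apply: (prim_right _ Mx) => y My.
by apply: HM; apply: lt_le_trans My _; exact: ler_norm.
Qed.

Lemma prim_far f : testf f -> exists M, 0 < M /\ forall x, (x <= - M -> prim f x = 0) /\
  (M <= x -> prim f x = \int[mu]_y f y).
Proof.
move=> tf; have [M1 H1] := RintE tf; have [sf [M HM]] := tf.
exists (1 + `|M1| + `|M|); split; first by rewrite -addrA ltr_wpDr// addr_ge0.
move=> x; split=> xM.
  apply: (@prim_left _ (- `|M|)); last by have := normr_ge0 M1; lra.
  move=> y yM; apply: HM; apply: (@le_lt_trans _ _ `|M|); first exact: ler_norm.
  by rewrite (@ltr0_norm _ y); have := normr_ge0 M; lra.
by apply: H1; have := ler_norm M1; have := normr_ge0 M; lra.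
Qed.

Lemma RintZD (c : R) f g : testf f -> testf g ->
  \int[mu]_y (c * f y + g y) = c * \int[mu]_y f y + \int[mu]_y g y.
Proof.
move=> tf tg; rewrite RintegralD//=.
- by rewrite RintegralZl//; exact: testf_integrable.
- by apply: testf_integrable; exact: testfZ.
- exact: testf_integrable.
Qed.

Lemma Rint_derive f : testf f -> \int[mu]_y D 1 f y = 0.
Proof.
move=> [sf [M HM]].
have t1 : testf (D 1 f) by apply: testf_D; split; [|exists M].
have [N [N0 HN]] := prim_far t1.
have E : prim (D 1 f) = f.
  have [N' HM'] : exists N', N' <= - N /\ M < - N'.
    by exists (- (1 + `|M| + N)); have := ler_norm M; split; have := normr_ge0 M; lra.
  apply: (der_unique (testf_prim_der t1) (smooth_der0 sf) (a := N')).
  by rewrite (HN _).1 ?HM'.1// HM//; apply: lt_le_trans HM'.2 _; rewrite -normrN; exact: ler_norm.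
have /(HN _).2 <- : N <= Num.max N (M + 1) by rewrite le_max lexx.
rewrite E HM//; apply: lt_le_trans (ler_norm _).
by rewrite lt_max orbC ltrDl ltr01.
Qed.

End Primitives.

(** * Bumps, smooth steps and plateaus *)

Section SpecialFunctions.
Context {R : realType}.
Implicit Types (f g : R -> R) (x y h : R) (n k m : nat).
Local Notation der f g := (forall x : R, is_derive x 1 f (g x)).
Local Notation mu := (@lebesgue_measure R).

Lemma pow_expR n x : 0 <= x -> x ^+ n <= n`!%:R * expR x.
Proof.
move=> x0; case: n => [|n].
  by rewrite expr0 fact0 mul1r -expR0 ler_expR.
have := expR_ge1Dxn n x0; rewrite -ler_pdivrMl ?ltr0n ?fact_gt0// => H.
by rewrite mulrC; apply: le_trans H; rewrite lerDr.
Qed.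

(** The flat function [exp (- 1 / x)] with a factor [x ^- k]: differentiation produces such factors,
    so the span of the whole family is closed under derivatives. *)
Definition flat k x : R := if 0 < x then x ^- k * expR (- x^-1) else 0.

Lemma flat_ge0 k x : 0 <= flat k x.
Proof.
rewrite /flat; case: ifPn => // x0.
by rewrite mulr_ge0 ?expR_ge0// invr_ge0 exprn_ge0// ltW.
Qed.

(** [pow_expR] at [1 / h] with two spare powers of [h]. Quadratic vanishing at 0 is what
    [is_derive_quad] needs to differentiate there. *)
Lemma flat_quad k h : `|flat k h| <= (k.+2)`!%:R * h ^+ 2.
Proof.
rewrite ger0_norm ?flat_ge0// /flat; case: ifPn => [h0|_]; last first.
  by rewrite mulr_ge0// exprn_even_ge0.
have hi : 0 <= h^-1 by rewrite invr_ge0 ltW.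
have := pow_expR k.+2 hi => H.
have h2 : 0 < h ^+ 2 by rewrite exprn_gt0.
have E : h ^- k = h^-1 ^+ k.+2 * h ^+ 2.
  by rewrite -addn2 exprD -mulrA -exprMn mulVf ?gt_eqF// expr1n mulr1 exprVn.
rewrite expRN ler_pdivrMr ?expR_gt0// E [leRHS]mulrAC ler_wpM2r//; exact: ltW.
Qed.

Lemma flat_der k : der (flat k) (fun x => - k%:R * flat k.+1 x + flat k.+2 x).
Proof.
move=> x; have [x0|x0|<-] := ltgtP 0 x.
- have D1 : is_derive x 1 (fun x => x ^- k * expR (- x^-1))
     (- k%:R * flat k.+1 x + flat k.+2 x).
    have xn : x != 0 by rewrite gt_eqF.
    have dV : is_derive x 1 (fun y : R => y^-1) (- x ^- 2).
      have := @is_deriveV R (fun y => y) x 1 1 xn (is_derive_id x 1).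
      by rewrite /GRing.scale /= mulr1.
    have dE : is_derive x 1 (fun y => expR (- y^-1)) (x ^- 2 * expR (- x^-1)).
      by have := @der_comp _ _ _ (fun y => - y^-1) _ x (is_derive_expR (- x^-1)) (derN dV); rewrite opprK.
    have dk : is_derive x 1 (fun y : R => y ^- k) (- k%:R * x ^- k.+1).
      elim: k => [|k IH].
        have := der_cst (1 : R) x; rewrite mulNr mul0r oppr0.
        by congr is_derive; apply/funext => y; rewrite expr0 invr1.
      have := derM IH dV; rewrite (_ : _ + _ = - k.+1%:R * x ^- k.+2).
        by congr is_derive; apply/funext => y; rewrite -!exprVn exprSr.
      by rewrite -!exprVn -natr1 !exprS !expr0; ring.
    apply: (is_derive_eq (derM dk dE)).
    rewrite /flat x0 -!exprVn !exprS; ring.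
  apply: near_eq_is_derive D1; near=> y.
  rewrite /flat ifT//; near: y; exact: lt_nbhsr.
- apply: (is_derive_eq (_ : is_derive x 1 (flat k) 0)); last first.
    by rewrite /flat ltNge (ltW x0)/= mulr0 addr0.
  apply: (@near_eq_is_derive _ _ _ (fun=> 0 : R)); near=> y.
  have y0 : y < 0 by near: y; exact: lt_nbhsl.
  by rewrite /flat ltNge (ltW y0).
- have -> : - k%:R * flat k.+1 0 + flat k.+2 0 = 0 by rewrite /flat ltxx mulr0 addr0.
  apply: (@is_derive_quad _ _ _ _ (k.+2)`!%:R 1) => // h _.
  rewrite add0r mulr0 subr0 [flat k 0]/flat ltxx subr0; exact: flat_quad.
Unshelve. all: by end_near. Qed.

Inductive flat_span : (R -> R) -> Prop :=
| flat_spanZ (c : R) k : flat_span (fun x => c * flat k x)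
| flat_spanD f g : flat_span f -> flat_span g -> flat_span (fun x => f x + g x).

Lemma Cinf_flat k : Cinf (flat k).
Proof.
apply: (@smooth_of_class _ flat_span).
  move=> F; elim=> {F} [c n|f1 g1 _ [f2 p1 d1] _ [g2 p2 d2]].
    exists (fun x => (c * - n%:R) * flat n.+1 x + c * flat n.+2 x).
      by apply: flat_spanD; exact: flat_spanZ.
    by move=> x; rewrite -mulrA -mulrDr; exact: (derZ c (flat_der n x)).
  by exists (fun x => f2 x + g2 x); [exact: flat_spanD|move=> x; exact: derD].
by have := flat_spanZ 1 k; congr flat_span; apply/funext => x; rewrite mul1r.
Qed.

Definition hump x : R := flat 0 x * flat 0 (1 - x).

Lemma Cinf_hump : Cinf hump.
Proof.
apply: smoothM; first exact: Cinf_flat.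
by have := smooth_affine 1 (-1) (Cinf_flat 0); under eq_fun do rewrite mulN1r.
Qed.

Lemma hump_ge0 x : 0 <= hump x. Proof. by rewrite mulr_ge0// flat_ge0. Qed.

Lemma hump_out x : x <= 0 \/ 1 <= x -> hump x = 0.
Proof.
rewrite /hump /flat; case=> x0; first by rewrite ltNge x0 mul0r.
by rewrite subr_gt0 [X in _ * (if X then _ else _)]ltNge x0 mulr0.
Qed.

Lemma testf_hump : testf hump.
Proof.
split; first exact: Cinf_hump.
exists 1 => x; rewrite lter_normr => /orP[x1|x1]; apply: hump_out; [right|left]; lra.
Qed.

Lemma hump_gt0 : 0 < hump 2^-1.
Proof.
have H : 0 < 2^-1 :> R by rewrite invr_gt0.
have H2 : 1 - 2^-1 = 2^-1 :> R by field.
by rewrite /hump H2 /flat H mulr_gt0// expr0 invr1 mul1r expR_gt0.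
Qed.

Lemma prim_hump_le x y : x <= y -> prim hump x <= prim hump y.
Proof.
move=> xy; apply: (der_nondecreasing (testf_prim_der testf_hump) xy) => z _.
exact: hump_ge0.
Qed.

Lemma prim_hump0 x : x <= 0 -> prim hump x = 0.
Proof.
have H y : y < 0 -> prim hump y = 0.
  by apply: prim_left => z z0; apply: hump_out; left; exact: ltW.
rewrite le_eqVlt => /predU1P[->|/H//].
rewrite /prim /Rintegral integral0_eq// => z /=; rewrite in_itv /= => z0.
by rewrite hump_out//; left.
Qed.

Lemma prim_hump1 x : 1 <= x -> prim hump x = \int[mu]_y hump y.
Proof. by apply: prim_right => y y1; apply: hump_out; right; exact: ltW. Qed.

Lemma int_hump_gt0 : 0 < \int[mu]_y hump y.
Proof.
rewrite lt0r Rint_ge0 ?andbT; last exact: hump_ge0.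
apply/eqP => I0; have P0 x : prim hump x = 0.
  apply/eqP; rewrite eq_le; apply/andP; split.
    have [x1|x1] := leP 1 x; first by rewrite prim_hump1 ?I0.
    by rewrite -I0 -(prim_hump1 (lexx 1)) prim_hump_le// ltW.
  have [x0|x0] := leP x 0; first by rewrite prim_hump0.
  by rewrite -(prim_hump0 (lexx 0)) prim_hump_le// ltW.
have := der_D1 (testf_prim_der testf_hump).
have -> : prim hump = fun=> 0 by apply/funext.
rewrite D_cst => /(congr1 (fun f => f 2^-1)) E.
by have := hump_gt0; rewrite -E ltxx.
Qed.

Definition step x : R := (\int[mu]_y hump y)^-1 * prim hump x.

Lemma Cinf_step : Cinf step.
Proof. apply: smoothZ; exact: (Cinf_prim testf_hump). Qed.

Lemma step0 x : x <= 0 -> step x = 0.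
Proof. by move=> x0; rewrite /step prim_hump0// mulr0. Qed.

Lemma step1 x : 1 <= x -> step x = 1.
Proof. by move=> x1; rewrite /step prim_hump1// mulVf// gt_eqF// int_hump_gt0. Qed.

Lemma step_le x y : x <= y -> step x <= step y.
Proof.
by move=> xy; rewrite ler_wpM2l ?prim_hump_le// invr_ge0 ltW// int_hump_gt0.
Qed.

Lemma step_ge0 x : 0 <= step x.
Proof.
by have [x0|x0] := leP x 0; [rewrite step0|rewrite -(step0 (lexx 0)) step_le// ltW].
Qed.

Lemma step_le1 x : step x <= 1.
Proof.
by have [x0|x0] := leP 1 x; [rewrite step1|rewrite -(step1 (lexx 1)) step_le// ltW].
Qed.

Lemma D1_step : D 1 step = fun x => (\int[mu]_y hump y)^-1 * hump x.
Proof.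
by apply: der_D1 => x; apply: derZ; exact: (testf_prim_der testf_hump x).
Qed.

Lemma Cinf_bounded f k (M : R) : Cinf f -> exists2 B, 0 <= B &
  forall j x, (j <= k)%N -> `|x| <= M -> `|D j f x| <= B.
Proof.
move=> sf.
have H j : exists2 B, 0 <= B & forall x, `|x| <= M -> `|D j f x| <= B.
  have cD : continuous (fun x => `|D j f x|).
    move=> x; apply: (@continuous_comp _ _ _ (D j f)) => //.
      exact: (smooth_continuous (smooth_D j sf)).
    exact: norm_continuous.
  have ne : `[- `|M|, `|M|]%classic !=set0.
    by exists 0; rewrite /= in_itv /= oppr_le0 normr_ge0.
  have := @segment_compact R (- `|M|) `|M|.
  move=> /(compact_EVT_max ne)/(_ (continuous_subspaceT cD))[c _ Hc].
  exists `|D j f c| => // x xM; apply: Hc; rewrite inE /= in_itv /= -ler_norml.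
  exact: le_trans xM (ler_norm _).
elim: k => [|k [B B0 HB]].
  by have [B B0 HB] := H 0; exists B => // j x; rewrite leqn0 => /eqP ->; exact: HB.
have [C C0 HC] := H k.+1; exists (Num.max B C); first by rewrite le_max B0.
move=> j x; rewrite leq_eqVlt => /predU1P[->|jk] xM; rewrite le_max.
  by rewrite (HC _ xM) orbT.
by rewrite HB.
Qed.

Lemma testf_bounded f k : testf f -> exists2 B, 0 <= B &
  forall j x, (j <= k)%N -> `|D j f x| <= B.
Proof.
move=> [sf [M HM]]; have [B B0 HB] := Cinf_bounded k M sf.
exists B => // j x jk; have [xM|xM] := leP `|x| M; first exact: HB.
by rewrite (D_out j sf HM xM) normr0.
Qed.

Definition plateau x : R := step (x + 2) * step (2 - x).

Lemma Cinf_stepB (c : R) : Cinf (fun x => step (c - x)).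
Proof.
by have := smooth_affine c (-1) Cinf_step; under eq_fun do rewrite mulN1r.
Qed.

Lemma Cinf_stepD (c : R) : Cinf (fun x => step (x + c)).
Proof.
have := smooth_affine c 1 Cinf_step.
by congr Cinf; apply/funext => x; rewrite mul1r addrC.
Qed.

Lemma Cinf_plateau : Cinf plateau.
Proof. by apply: smoothM; [exact: Cinf_stepD|exact: Cinf_stepB]. Qed.

Lemma plateau1 x : `|x| <= 1 -> plateau x = 1.
Proof. by rewrite ler_norml => /andP[? ?]; rewrite /plateau !step1 ?mulr1//; lra. Qed.

Lemma plateau0 x : 2 <= `|x| -> plateau x = 0.
Proof.
rewrite lter_normr => /orP[?|?]; rewrite /plateau.
  by rewrite [step (2 - x)]step0 ?mulr0//; lra.
by rewrite step0 ?mul0r//; lra.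
Qed.

Lemma plateau_ge0 x : 0 <= plateau x.
Proof. by rewrite mulr_ge0// step_ge0. Qed.

Lemma plateau_le1 x : plateau x <= 1.
Proof. by rewrite /plateau mulr_ile1// ?step_ge0// step_le1. Qed.

Lemma testf_plateau : testf plateau.
Proof. by split; [exact: Cinf_plateau|exists 2 => x x2; rewrite plateau0// ltW]. Qed.

(** The sign condition of [test_class1]: the normalised plateau replaces the Gaussian in the maximal
    inequality, where compact support is essential. *)
Lemma plateau_decr x : x * D 1 plateau x <= 0.
Proof.
have c0 : 0 <= (\int[mu]_y hump y)^-1 :> R by rewrite invr_ge0 ltW// int_hump_gt0.
have d1 : D 1 (fun x => step (x + 2)) = fun x => (\int[mu]_y hump y)^-1 * hump (x + 2).
  apply: der_D1 => y; have := @der_comp _ _ _ (fun z : R => z + 2) 1 y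
    (smooth_der0 Cinf_step (y + 2)); rewrite D1_step mul1r; apply.
  rewrite -[X in is_derive _ _ _ X]addr0; apply: derD; exact: is_derive_id.
have d2 : D 1 (fun x => step (2 - x)) = fun x => - ((\int[mu]_y hump y)^-1 * hump (2 - x)).
  apply: der_D1 => y; have := @der_comp _ _ _ (fun z : R => 2 - z) (-1) y
    (smooth_der0 Cinf_step (2 - y)); rewrite D1_step mulN1r; apply.
  rewrite -[X in is_derive _ _ _ X]add0r; apply: derB; exact: is_derive_id.
rewrite /plateau D1M; [|exact: Cinf_stepD|exact: Cinf_stepB].
rewrite d1 d2; have [x0|x0] := leP 0 x.
  rewrite hump_out; last by right; lra.
  rewrite mulr0 mul0r add0r mulrN mulrN oppr_le0.
  by rewrite mulr_ge0// mulr_ge0 ?step_ge0// mulr_ge0 ?hump_ge0.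
rewrite [hump (2 - x)]hump_out; last by right; lra.
rewrite mulr0 oppr0 mulr0 addr0; apply: mulr_le0_ge0; first exact: ltW.
by rewrite mulr_ge0 ?step_ge0// mulr_ge0 ?hump_ge0.
Qed.

Lemma cutoff_exists (a b e : R) : 0 < e -> exists f, [/\ testf f,
  forall x, 0 <= f x <= 1, forall x, a - e <= x <= b + e -> f x = 1 &
  forall x, x <= a - 2 * e \/ b + 2 * e <= x -> f x = 0].
Proof.
move=> e0; have en : e != 0 by rewrite gt_eqF.
pose f x : R := step ((x - (a - 2 * e)) / e) * step ((x - (b + 2 * e)) / - e).
have out x : x <= a - 2 * e \/ b + 2 * e <= x -> f x = 0.
  case=> H; rewrite /f; first by rewrite step0 ?mul0r// pmulr_lle0 ?invr_gt0//; lra.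
  rewrite [step (_ / - e)]step0 ?mulr0// nmulr_lle0 ?invr_lt0 ?oppr_lt0//; lra.
exists f; split => //.
- split; first by apply: smoothM; apply: smooth_scale; exact: Cinf_step.
  exists (`|a - 2 * e| + `|b + 2 * e|) => x.
  have := ler_norm (b + 2 * e); have := ler_norm (- (a - 2 * e)); rewrite normrN.
  have := normr_ge0 (b + 2 * e); have := normr_ge0 (a - 2 * e).
  move=> ? ? ? ?; rewrite [_ < `|x|]lter_normr => /orP[?|?]; apply: out; [right|left]; lra.
- by move=> x; rewrite mulr_ge0 ?step_ge0//= mulr_ile1// ?step_ge0// step_le1.
- move=> x /andP[? ?]; rewrite /f !step1 ?mulr1//.
    by rewrite invrN mulrN -mulNr ler_pdivlMr//; lra.
  by rewrite ler_pdivlMr//; lra.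
Qed.

End SpecialFunctions.

(** * The Gaussian, its derivatives and its primitive *)

Section Gaussian.
Context {R : realType}.
Implicit Types (f g : R -> R) (x y h : R) (n k m : nat).
Local Notation der f g := (forall x : R, is_derive x 1 f (g x)).
Local Notation mu := (@lebesgue_measure R).

Definition gauss x : R := normal_pdf 0 1 x.

Lemma gaussE x : gauss x = normal_peak 1 * expR (- (2^-1 * x ^+ 2)).
Proof.
rewrite /gauss normal_pdfE ?oner_eq0//; congr (_ * _); rewrite /normal_fun.
by congr expR; rewrite subr0 expr1n -mulr_natl mulr1 mulNr mulrC.
Qed.

Lemma gauss_gt0 x : 0 < gauss x.
Proof. by rewrite gaussE mulr_gt0 ?expR_gt0// normal_peak_gt0// oner_eq0. Qed.

Lemma gauss_der : der gauss (fun x => - (x * gauss x)).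
Proof.
move=> x; have d1 : is_derive x 1 (fun x : R => - (2^-1 * x ^+ 2)) (- x).
  have d2 : is_derive x 1 (fun x : R => x * x) (1 * x + x * 1) by exact: derM.
  have := derN (derZ 2^-1 d2); rewrite (_ : - (2^-1 * _) = - x); last by field.
  by congr is_derive; apply/funext => y; rewrite expr2.
have := derZ (normal_peak 1) (der_comp (is_derive_expR _) d1).
rewrite mulrCA -gaussE mulNr; congr is_derive.
by apply/funext => y; rewrite gaussE.
Qed.

Lemma gauss_poly_der (p : {poly R}) :
  der (fun x => p.[x] * gauss x) (fun x => (p^`() - 'X * p).[x] * gauss x).
Proof.
move=> x; apply: (is_derive_eq (derM (is_derive_poly p x) (gauss_der x))).
by rewrite hornerD hornerN hornerM hornerX; ring.
Qed.

Lemma Cinf_gauss_poly (p : {poly R}) : Cinf (fun x => p.[x] * gauss x).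
Proof.
apply: (@smooth_of_class _ (fun F => exists p : {poly R}, F = fun x => p.[x] * gauss x)).
  move=> _ [q ->]; exists (fun x => (q^`() - 'X * q).[x] * gauss x).
    by exists (q^`() - 'X * q).
  exact: gauss_poly_der.
by exists p.
Qed.

Lemma gauss1E : gauss = fun x => (1%:P : {poly R}).[x] * gauss x.
Proof. by apply/funext => x; rewrite hornerC mul1r. Qed.

Lemma Cinf_gauss : Cinf gauss.
Proof. by rewrite gauss1E; exact: Cinf_gauss_poly. Qed.

Lemma D_gauss m : exists p : {poly R}, D m gauss = fun x => p.[x] * gauss x.
Proof.
elim: m => [|m [p Hp]]; first by exists 1; rewrite D0 -gauss1E.
by exists (p^`() - 'X * p); rewrite DSr Hp; apply: der_D1; exact: gauss_poly_der.
Qed.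

Lemma gauss_pow_bounded n : exists2 C : R, 0 <= C & forall x, `|x| ^+ n * gauss x <= C.
Proof.
(* The summand 1 serves [|x| <= 1]. Beyond, [|x| ^+ n <= |x| ^+ (2 n)], and [y ^+ n <= n! exp y] is
   used at [y = x ^+ 2 / 2]. *)
exists (normal_peak 1 * (1 + 2 ^+ n * n`!%:R)).
  rewrite mulr_ge0 ?addr_ge0 ?mulr_ge0// ?exprn_ge0//.
  exact/ltW/normal_peak_gt0/oner_neq0.
move=> x; rewrite gaussE mulrCA ler_wpM2l//.
  exact/ltW/normal_peak_gt0/oner_neq0.
have e1 : expR (- (2^-1 * x ^+ 2)) <= 1.
  by rewrite -expR0 ler_expR oppr_le0 mulr_ge0// exprn_even_ge0.
have [x1|x1] := leP `|x| 1.
  apply: (@le_trans _ _ 1); last by rewrite lerDl mulr_ge0// exprn_ge0.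
  by rewrite mulr_ile1// ?exprn_ge0 ?expR_ge0// exprn_ile1.
have y0 : 0 <= 2^-1 * x ^+ 2 by rewrite mulr_ge0// exprn_even_ge0.
have := pow_expR n y0; rewrite expRN ler_pdivrMr ?expR_gt0// => H.
apply: (@le_trans _ _ (2 ^+ n * (2^-1 * x ^+ 2) ^+ n)).
  rewrite -exprMn mulrA divff// mul1r -real_normK ?num_real// -exprM mulnC.
  by apply: ler_weXn2l; [exact: ltW|rewrite leq_pmulr].
rewrite mulrDl (le_trans (ler_wpM2l _ H)) ?exprn_ge0// mulrA lerDr.
by rewrite mul1r expR_ge0.
Qed.

Lemma gauss_poly_bounded (p : {poly R}) n :
  exists2 C : R, 0 <= C & forall x, `|x| ^+ n * `|p.[x] * gauss x| <= C.
Proof.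
elim/poly_ind: p n => [|p c IH] n.
  by exists 0 => // x; rewrite horner0 mul0r normr0 mulr0.
have [C C0 HC] := IH n.+1; have [B B0 HB] := gauss_pow_bounded n.
exists (C + `|c| * B); first by rewrite addr_ge0// mulr_ge0.
move=> x; rewrite hornerMXaddC mulrDl (le_trans (ler_wpM2l _ (ler_normD _ _))) ?exprn_ge0//.
rewrite mulrDr lerD//.
  by have := HC x; rewrite exprS !normrM; apply: le_trans; rewrite le_eqVlt; apply/orP; left; apply/eqP; ring.
by rewrite normrM mulrCA ler_wpM2l// (gtr0_norm (gauss_gt0 x)).
Qed.

Lemma D_gauss_bounded m n :
  exists2 C : R, 0 <= C & forall x, `|x| ^+ n * `|D m gauss x| <= C.
Proof. by have [p ->] := D_gauss m; exact: gauss_poly_bounded. Qed.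

Definition erfn : R -> R := prim gauss.

Lemma erfn_der : der erfn gauss.
Proof.
apply: prim_der; first exact: (smooth_continuous Cinf_gauss).
exact: integrable_normal_pdf.
Qed.

Lemma Cinf_erfn : Cinf erfn.
Proof. exact: (smooth_primitive erfn_der Cinf_gauss). Qed.

Lemma D_erfn n : D n.+1 erfn = D n gauss.
Proof. by rewrite DS (der_D1 erfn_der). Qed.

Lemma erfn_le x y : x <= y -> erfn x <= erfn y.
Proof.
by move=> xy; apply: (der_nondecreasing erfn_der xy) => z _; exact/ltW/gauss_gt0.
Qed.

Lemma erfn_lt x y : x < y -> erfn x < erfn y.
Proof.
move=> xy; have [c [_ _]] := mvt x y erfn_der.
by rewrite -subr_gt0 => ->; rewrite mulr_gt0 ?gauss_gt0// subr_gt0.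
Qed.

(* Decreasing primitives of C / y^2 dominate the tails of [erfn]. *)
Lemma erfn_tail : exists2 C : R, 0 < C & forall x y, x <= y -> 0 < x \/ y < 0 ->
  erfn y - erfn x <= C * `|x^-1 - y^-1|.
Proof.
have [C C0 HC] := D_gauss_bounded 0 2; exists (C + 1); first by rewrite ltr_wpDl.
move=> x y xy H.
have dv (z : R) : z != 0 -> is_derive z 1 (fun y : R => y^-1) (- z ^- 2).
  move=> z0; have := @is_deriveV R (fun y => y) z 1 1 z0 (is_derive_id z 1).
  by rewrite /GRing.scale /= mulr1.
have nz (z : R) : x <= z <= y -> z != 0.
  by case/andP => xz zy; case: H => H; [rewrite gt_eqF|rewrite lt_eqF]; lra.
have xyV : y^-1 <= x^-1.
  case: H => H; first by rewrite lef_pV2 ?posrE// (lt_le_trans H).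
  by rewrite lef_nV2 ?negrE// (le_lt_trans xy).
rewrite ger0_norm ?subr_ge0//.
have dF (z : R) : z \in `]x, y[ -> is_derive z 1 (fun z => erfn z + (C + 1) * z^-1)
   (gauss z - (C + 1) * z ^- 2).
  rewrite in_itv /= => /andP[/ltW xz /ltW zy].
  have z0 : z != 0 by apply: nz; rewrite xz.
  apply: (is_derive_eq (derD (erfn_der z) (derZ (C + 1) (dv z z0)))).
  by rewrite mulrN.
have cF : {within `[x, y], continuous (fun z => erfn z + (C + 1) * z^-1)}.
  apply: continuous_in_subspaceT => z; rewrite inE /= in_itv /= => zxy.
  have z0 := nz _ zxy.
  apply/differentiable_continuous/derivable1_diffP.
  by have [] := derD (erfn_der z) (derZ (C + 1) (dv z z0)).
have [c] := MVT_segment xy dF cF.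
rewrite in_itv /= => cxy E.
have c0 := nz _ cxy.
have : (gauss c - (C + 1) * c ^- 2) * (y - x) <= 0.
  rewrite mulr_le0_ge0 ?subr_ge0// subr_le0 ler_pdivlMr ?exprn_even_gt0// mulrC.
  have := HC c; rewrite D0 (gtr0_norm (gauss_gt0 c)) real_normK ?num_real// => /le_trans.
  by apply; rewrite lerDl.
by rewrite -E; clear; lra.
Qed.

(** The Gaussian lies in the smaller class, so both conditions on a pair, off a null set and off a
    countable set, may be tested on it. *)
Lemma gauss_test1 : test_class1 (gauss : R -> R).
Proof.
split; last first.
  move=> x; rewrite -D1E (der_D1 gauss_der) mulrN mulrA oppr_le0 mulr_ge0 -?expr2 ?exprn_even_ge0//.
  exact/ltW/gauss_gt0.
split.
- by have := Cinf_gauss; rewrite Cinf.unlock.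
- by move=> x; exact/ltW/gauss_gt0.
- exact: integral_normal_pdf.
- exists (-2); first by lra.
  move=> m; have [C C0 HC] := D_gauss_bounded m (m + 2); exists C, 1 => x x1.
  have x0 : 0 < `|x| by rewrite (lt_trans ltr01).
  rewrite -DE (_ : -2 - m%:R = - (m + 2)%:R :> R); last by rewrite natrD; ring.
  rewrite powRN (powR_mulrn _ (ltW x0)) ler_pdivlMr ?exprn_gt0// mulrC.
  exact: HC.
Qed.

End Gaussian.

(** * Compactly supported distributions as functionals on smooth functions *)

Section Edist.
Context {R : realType}.
Implicit Types (f g phi psi : R -> R) (T S : (R -> R) -> R) (a b x y : R) (n k m j : nat).
Local Notation mu := (@lebesgue_measure R).

(* Compactly supported distributions, as functionals on all smooth functions. *)
Definition edist a b T : Prop :=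
  [/\ forall (c : R) f g, Cinf f -> Cinf g -> T (fun x => c * f x + g x) = c * T f + T g,
      exists C k, 0 <= C /\ forall f B, Cinf f ->
        (forall j x, (j <= k)%N -> a - 1 <= x <= b + 1 -> `|D j f x| <= B) -> `|T f| <= C * B
    & forall f e, Cinf f -> 0 < e -> (forall x, a - e <= x <= b + e -> f x = 0) -> T f = 0].

Lemma D_zero n x : D n (fun=> 0 : R) x = 0.
Proof. by case: n => [|n]; rewrite ?D0 ?D_cst. Qed.

Section EdistTheory.
Variables (a b : R) (T : (R -> R) -> R).
Hypothesis eT : edist a b T.

Lemma edistZD (c : R) f g : Cinf f -> Cinf g ->
  T (fun x => c * f x + g x) = c * T f + T g.
Proof. by case: eT => H _ _; exact: H. Qed.

Lemma edist0 : T (fun=> 0) = 0.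
Proof. by case: eT => _ _ /(_ (fun=> 0) 1); apply => //; exact: smooth_cst. Qed.

Lemma edistD f g : Cinf f -> Cinf g -> T (fun x => f x + g x) = T f + T g.
Proof.
move=> sf sg; have := edistZD 1 sf sg; rewrite mul1r => <-; congr T.
by apply/funext => x; rewrite mul1r.
Qed.

Lemma edistZ (c : R) f : Cinf f -> T (fun x => c * f x) = c * T f.
Proof.
move=> sf; have := edistZD c sf (@smooth_cst R 0); rewrite edist0 addr0 => <-.
by congr T; apply/funext => x; rewrite addr0.
Qed.

Lemma edistN f : Cinf f -> T (fun x => - f x) = - T f.
Proof.
move=> sf; rewrite -mulN1r -edistZ//; congr T.
by apply/funext => x; rewrite mulN1r.
Qed.

Lemma edistB f g : Cinf f -> Cinf g -> T (fun x => f x - g x) = T f - T g.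
Proof. by move=> sf sg; rewrite edistD ?edistN//; exact: smoothN. Qed.

Lemma edist_local f g e : Cinf f -> Cinf g -> 0 < e ->
  (forall x, a - e <= x <= b + e -> f x = g x) -> T f = T g.
Proof.
move=> sf sg e0 fg; apply/eqP; rewrite -subr_eq0 -edistB//; apply/eqP.
case: eT => _ _ /(_ _ e); apply => //; first exact: smoothB.
by move=> x /fg ->; rewrite subrr.
Qed.

Lemma edist_bound : exists C k, 0 <= C /\ forall f B, Cinf f ->
  (forall j x, (j <= k)%N -> a - 1 <= x <= b + 1 -> `|D j f x| <= B) -> `|T f| <= C * B.
Proof. by case: eT => _ H _; exact: H. Qed.

Lemma edist_mul psi : Cinf psi -> edist a b (fun f => T (fun x => psi x * f x)).
Proof.
move=> spsi; split.
- move=> c f g sf sg; rewrite -edistZD; [congr T|exact: smoothM..].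
  by apply/funext => x; ring.
- have [C [k [C0 HC]]] := edist_bound.
  have [B B0 HB] := Cinf_bounded k (`|a| + `|b| + 1) spsi.
  exists (C * (2 ^+ k * B)), k; split; first by rewrite !mulr_ge0// exprn_ge0.
  move=> f A sf HA; rewrite -mulrA; apply: HC; first exact: smoothM.
  move=> j x jk xab.
  have A0 : 0 <= A by apply: le_trans (HA 0 x _ xab).
  have : `|x| <= `|a| + `|b| + 1.
    have := ler_norm b; have := ler_norm (- a); rewrite normrN.
    have := normr_ge0 a; have := normr_ge0 b; move: xab => /andP[? ?] ? ? ? ?.
    by rewrite ler_norml; apply/andP; split; lra.
  move=> xM; apply: (le_trans (@leibniz_bound _ _ _ j x B A spsi sf _ _)).
  + by move=> i ij; apply: HB => //; exact: leq_trans jk.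
  + by move=> i ij; apply: HA => //; exact: leq_trans jk.
  + by rewrite -mulrA ler_wpM2r ?mulr_ge0// ler_weXn2l// ler1n.
- move=> f e sf e0 f0; case: eT => _ _ /(_ _ e); apply => //; first exact: smoothM.
  by move=> x /f0 ->; rewrite mulr0.
Qed.

Lemma edist_widen a2 b2 : a2 <= a -> b <= b2 -> edist a2 b2 T.
Proof.
move=> aa bb; case: eT => lT [C [k [C0 HC]]] oT; split => //.
- exists C, k; split => // f B sf HB; apply: HC => // j x jk /andP[? ?].
  by apply: HB => //; apply/andP; split; lra.
- move=> f e sf e0 f0; apply: (oT f e) => // x /andP[? ?].
  by apply: f0; apply/andP; split; lra.
Qed.

End EdistTheory.

Lemma edist_lin a b (c : R) T S : edist a b T -> edist a b S ->
  edist a b (fun f => c * T f + S f).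
Proof.
move=> eT eS; split.
- by move=> d f g sf sg; rewrite (edistZD eT)// (edistZD eS)//; ring.
- have [C [k [C0 HC]]] := edist_bound eT; have [E [m [E0 HE]]] := edist_bound eS.
  exists (`|c| * C + E), (maxn k m); split; first by rewrite addr_ge0 ?mulr_ge0.
  move=> f B sf HB; rewrite (le_trans (ler_normD _ _))// mulrDl lerD//.
    rewrite normrM -mulrA ler_wpM2l//; apply: HC => // j x jk; apply: HB.
    by rewrite leq_max jk.
  by apply: HE => // j x jk; apply: HB; rewrite leq_max jk orbT.
- move=> f e sf e0 f0; rewrite (edist_local eT sf (@smooth_cst R 0) e0 f0).
  rewrite (edist_local eS sf (@smooth_cst R 0) e0 f0).
  by rewrite (edist0 eT) (edist0 eS) mulr0 addr0.
Qed.

Lemma edist_sub a b T S : edist a b T -> edist a b S -> edist a b (fun f => T f - S f).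
Proof.
move=> eT eS; have := edist_lin (-1) eS eT; congr edist.
by apply/funext => f; rewrite mulN1r addrC.
Qed.

Lemma edist_opp a b T : edist a b T -> edist a b (fun f => - T f).
Proof.
move=> eT; have := edist_lin (-2) eT eT; congr edist.
by apply/funext => f; ring.
Qed.

(** The trace on [T = U'] of a point value of [U] at [x0]: [T] applied to [theta ((x - x0) / s)] is
    minus a mean of [U] against the derivative of [theta], whose integral is 0. It excludes a Dirac
    mass at [x0]. *)
Definition null_at T x0 := forall theta, testf theta -> forall eps : R, 0 < eps ->
  exists2 d, 0 < d & forall s, 0 < s -> s < d -> `|T (fun x => theta ((x - x0) / s))| <= eps.

Lemma null_at_lin (c : R) T S x0 : null_at T x0 -> null_at S x0 ->
  null_at (fun f => c * T f + S f) x0.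
Proof.
move=> nT nS th tth e e0; have e2 : 0 < e / 2 / (`|c| + 1) by rewrite !divr_gt0// ltr_wpDl.
have [d1 d10 H1] := nT _ tth _ e2; have [d2 d20 H2] := nS _ tth (e / 2) (divr_gt0 e0 (ltr0n _ 2)).
exists (Num.min d1 d2); first by rewrite lt_min d10.
move=> s s0; rewrite lt_min => /andP[s1 s2].
rewrite (le_trans (ler_normD _ _))// [leRHS]splitr lerD//; last exact: H2.
rewrite normrM; have := H1 _ s0 s1; rewrite ler_pdivlMr ?ltr_wpDl// => H.
by apply: le_trans H; rewrite mulrC ler_wpM2l// lerDl.
Qed.

Lemma null_at_sub T S x0 : null_at T x0 -> null_at S x0 -> null_at (fun f => T f - S f) x0.
Proof.
move=> nT nS; have := null_at_lin (-1) nS nT; congr null_at.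
by apply/funext => f; rewrite mulN1r addrC.
Qed.

End Edist.

(** * Distributions supported in an interval, and one-sided point values *)

Section Schwartz.
Context {R : realType}.
Implicit Types (f g phi psi : R -> R) (u U : schwartz_distr R) (a b x y : R) (n k m j : nat).
Local Notation mu := (@lebesgue_measure R).

Lemma Ck_norm_le k phi (B : R) : (forall j x, (j <= k)%N -> `|D j phi x| <= B) ->
  Ck_norm k phi <= k.+1%:R * B.
Proof.
move=> HB; rewrite /Ck_norm mulr_natl -[X in _ *+ X](card_ord k.+1) -sumr_const.
apply: ler_sum => i _; apply: ge_sup; first by exists `|derive1n i phi 0|, 0.
by move=> _ [x _ <-]; rewrite -DE; apply: HB; rewrite -ltnS.
Qed.

Lemma Ck_norm_ge k phi j x : testf phi -> (j <= k)%N -> `|D j phi x| <= Ck_norm k phi.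
Proof.
move=> tp jk; have [B B0 HB] := testf_bounded k tp.
have sup_ge i y : (i < k.+1)%N -> `|D i phi y| <= sup (range (fun x => `|derive1n i phi x|)).
  move=> ik; rewrite DE; apply: ub_le_sup; last by exists y.
  by exists B => _ [z _ <-]; rewrite -DE; exact: HB.
rewrite /Ck_norm (bigD1 (Ordinal (jk : (j < k.+1)%N)))//= -[leLHS]addr0 lerD//.
  exact: sup_ge.
by apply: sumr_ge0 => i _; apply: le_trans (sup_ge i 0 _) => //; exact: ltn_ord.
Qed.

Lemma distrZD u (c : R) phi psi : testf phi -> testf psi ->
  u (fun x => c * phi x + psi x) = c * u phi + u psi.
Proof. by move=> tp ts; apply: distr_linear; exact: testf_test. Qed.

Lemma testf0 : testf (fun=> 0 : R).
Proof. by split; [exact: smooth_cst|exists 0]. Qed.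

Lemma distr0 u : u (fun=> 0) = 0.
Proof.
have : u (fun=> 0) = 1 * u (fun=> 0) + u (fun=> 0).
  rewrite -distrZD; [|exact: testf0..]; congr (distr_fun u).
  by apply/funext => x; rewrite mulr0 addr0.
by rewrite mul1r -{1}[u _]addr0 => /addrI.
Qed.

Lemma distrZ u (c : R) phi : testf phi -> u (fun x => c * phi x) = c * u phi.
Proof.
move=> tp; have := distrZD u c tp testf0; rewrite distr0 addr0 => <-.
by congr (distr_fun u); apply/funext => x; rewrite addr0.
Qed.

Lemma distrB u phi psi : testf phi -> testf psi ->
  u (fun x => phi x - psi x) = u phi - u psi.
Proof.
move=> tp ts; have := distrZD u (-1) ts tp; rewrite mulN1r addrC => <-.
by congr (distr_fun u); apply/funext => x; rewrite mulN1r addrC.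
Qed.

Lemma distr_bound u (M : R) : exists C k, 0 <= C /\ forall phi B, testf phi ->
  (forall x, M < `|x| -> phi x = 0) ->
  (forall j x, (j <= k)%N -> `|D j phi x| <= B) -> `|u phi| <= C * B.
Proof.
have [C [k HC]] := distr_continuous u (@segment_compact R (- M) M).
exists (`|C| * k.+1%:R), k; split; first by rewrite mulr_ge0.
move=> phi B tp pM HB; apply: (le_trans (HC _ (testf_test tp) _)).
  apply: testf_tsupp => x px; rewrite -ler_norml leNgt; apply/negP => xM.
  by rewrite pM ?eqxx in px.
have := Ck_norm_le HB => H; have n0 : 0 <= Ck_norm k phi.
  exact: le_trans (Ck_norm_ge 0 tp (leq0n k)).
apply: (le_trans (ler_wpM2r n0 (ler_norm C))).
by rewrite -mulrA ler_wpM2l.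
Qed.

(** A cutoff exists for all [a] and [b], so the default value of [xget] in [cutoff] is never
    reached. *)
Lemma cutoffP a b : is_cutoff a b (cutoff a b).
Proof.
have [f [tf _ f1 _]] := cutoff_exists a b (@ltr01 R).
apply: (@xgetPex _ (fun=> 0) [set chi | is_cutoff a b chi]); exists f.
split; first exact: testf_test.
exists `]a - 1, b + 1[%classic; split; first exact: interval_open.
  by move=> x /=; rewrite !in_itv /= => /andP[? ?]; apply/andP; split; lra.
move=> x /=; rewrite in_itv /= => /andP[? ?].
by apply: f1; apply/andP; split; lra.
Qed.

Lemma testf_cutoff a b : testf (cutoff a b).
Proof. by have [tf _] := cutoffP a b; exact/testfP. Qed.

Lemma cutoff1 a b : exists2 e, 0 < e & forall x, a - e <= x <= b + e -> cutoff a b x = 1.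
Proof.
have [_ [W [oW sW W1]]] := cutoffP a b.
have [ab|ba] := leP a b; last first.
  (* For [b < a] the thickened interval has to stay empty; a quarter of the distance ensures it. *)
  exists ((a - b) / 4); first by rewrite divr_gt0// subr_gt0.
  by move=> x /andP[? ?]; exfalso; lra.
have op c : W c -> exists2 e, 0 < e & forall y, `|y - c| <= e -> W y.
  move=> Wc; have /nbhs_ballP[e /= e0 He] := oW c Wc.
  exists (e / 2); first by rewrite divr_gt0.
  move=> y yc; apply: He; rewrite /ball /= distrC (le_lt_trans yc)//.
  by rewrite ltr_pdivrMr// mulr_natr mulr2n ltrDl.
have Wa : W a by apply: sW; rewrite /= in_itv /= lexx.
have Wb : W b by apply: sW; rewrite /= in_itv /= lexx ab.
have [e1 e10 H1] := op a Wa; have [e2 e20 H2] := op b Wb.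
exists (Num.min e1 e2); first by rewrite lt_min e10.
have m1 : Num.min e1 e2 <= e1 by rewrite ge_min lexx.
have m2 : Num.min e1 e2 <= e2 by rewrite ge_min lexx orbT.
move=> x /andP[? ?]; apply: W1; have [xa|xa] := ltP x a.
  by apply: H1; rewrite ler_norml; apply/andP; split; lra.
have [xb|xb] := ltP b x; first by apply: H2; rewrite ler_norml; apply/andP; split; lra.
by apply: sW; rewrite /= in_itv /= xa xb.
Qed.

Lemma supported_out u a b phi (e : R) : supported_in u `[a, b] -> testf phi -> 0 < e ->
  (forall x, a - e <= x <= b + e -> phi x = 0) -> u phi = 0.
Proof.
move=> su tp e0 p0; apply: su; first exact: testf_test.
have H : closed (~` `]a - e, b + e[%classic : set R).
  by apply: open_closedC; exact: interval_open.
apply: (@subset_trans _ (~` `]a - e, b + e[%classic)).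
  rewrite [X in _ `<=` X](proj1 (closure_id _) H); apply: closureS => x /= px.
  rewrite in_itv /= => /andP[? ?]; move: px; rewrite p0 ?eqxx//.
  by apply/andP; split; lra.
move=> x /= xe xab; apply: xe; move: xab; rewrite !in_itv /= => /andP[? ?].
by apply/andP; split; lra.
Qed.

Lemma cpairing_cutoff u a b chi f (e : R) : supported_in u `[a, b] -> testf chi ->
  0 < e -> (forall x, a - e <= x <= b + e -> chi x = 1) -> Cinf f ->
  cpairing a b u f = u (fun x => chi x * f x).
Proof.
move=> su tc e0 c1 sf; have tc2 := testf_cutoff a b; have [e1 e10 He1] := cutoff1 a b.
apply/eqP; rewrite -subr_eq0 /cpairing -distrB; [|exact: testfMr..]; apply/eqP.
apply: (@supported_out _ _ _ _ (Num.min e e1) su); last 2 first.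
- by rewrite lt_min e0.
- have m1 : Num.min e e1 <= e by rewrite ge_min lexx.
  have m2 : Num.min e e1 <= e1 by rewrite ge_min lexx orbT.
  move=> x /andP[? ?]; rewrite c1 ?He1 ?subrr//; apply/andP; split; lra.
- by apply: testfB; exact: testfMr.
Qed.

Lemma cpairing_test u a b phi : supported_in u `[a, b] -> testf phi ->
  cpairing a b u phi = u phi.
Proof.
move=> su tp; have tc := testf_cutoff a b; have [e e0 He] := cutoff1 a b.
apply/eqP; rewrite -subr_eq0 /cpairing -distrB//; last exact: (testfMr tc tp.1).
apply/eqP; apply: (@supported_out _ _ _ _ e su) => //.
  by apply: testfB => //; exact: (testfMr tc tp.1).
by move=> x /He ->; rewrite mul1r subrr.
Qed.

Lemma edist_cpairing u a b : a <= b -> supported_in u `[a, b] ->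
  edist a b (cpairing a b u).
Proof.
move=> ab su; have tc := testf_cutoff a b; have [e1 e10 He1] := cutoff1 a b; split.
- move=> c f g sf sg; rewrite /cpairing -distrZD; [congr (distr_fun u)|exact: testfMr..].
  by apply/funext => x; ring.
(* With [e = 2^-1] this cutoff is supported in [[a - 1, b + 1]], the interval on which [edist]
   grants bounds on [f]. *)
- have e2 : 0 < 2^-1 :> R by rewrite invr_gt0.
  have [chi [tchi chi01 chi1 chi0]] := cutoff_exists a b e2.
  have [C [k [C0 HC]]] := distr_bound u (`|a| + `|b| + 1).
  have [B B0 HB] := testf_bounded k tchi.
  exists (C * (2 ^+ k * B)), k; split; first by rewrite !mulr_ge0// exprn_ge0.
  move=> f A sf HA.
  have A0 : 0 <= A.
    by apply: le_trans (HA 0 a (leq0n k) _) => //; apply/andP; split; clear -ab; lra.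
  have e22 : 2 * 2^-1 = 1 :> R by rewrite divff.
  have out x : x < a - 1 \/ b + 1 < x -> chi x * f x = 0.
    by move=> H; rewrite chi0 ?mul0r// e22; case: H => /ltW ?; [left|right].
  rewrite (cpairing_cutoff su tchi e2 chi1 sf) -mulrA; apply: HC.
  + exact: testfMr.
  + have := ler_norm b; have := ler_norm (- a); rewrite normrN.
    have := normr_ge0 a; have := normr_ge0 b => ? ? ? ? x.
    by rewrite [_ < `|x|]lter_normr => /orP[?|?]; apply: out; [right|left]; lra.
  + move=> j x jk; have [xab|] := boolP (a - 1 <= x <= b + 1).
      apply: (le_trans (@leibniz_bound _ _ _ j x B A tchi.1 sf _ _)).
      - by move=> i ij; apply: HB => //; exact: leq_trans jk.
      - by move=> i ij; apply: HA => //; exact: leq_trans jk.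
      - by rewrite -mulrA ler_wpM2r ?mulr_ge0// ler_weXn2l// ler1n.
    rewrite negb_and -!ltNge => xab.
    rewrite (@D_local _ _ (fun=> 0) j x (Num.max (a - 1 - x) (x - (b + 1)))).
    - by rewrite D_zero normr0 !mulr_ge0// exprn_ge0.
    - exact: smoothM tchi.1 sf.
    - exact: smooth_cst.
    - by rewrite lt_max !subr_gt0.
    - move=> y; rewrite lt_max !ltr_norml => H; apply: out.
      by case/orP: H => /andP[? ?]; [left|right]; lra.
- move=> f e sf e0 f0; have [m1 m2] : Num.min e e1 <= e /\ Num.min e e1 <= e1.
    by rewrite !ge_min !lexx orbT.
  apply: (@supported_out _ _ _ _ (Num.min e e1) su).
  + exact: testfMr.
  + by rewrite lt_min e0.
  + by move=> x /andP[? ?]; rewrite f0 ?mulr0//; apply/andP; split; lra.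
Qed.

Lemma mkdistr_linear a b (T : (R -> R) -> R) : edist a b T ->
  forall (c : R) phi psi, test_fun phi -> test_fun psi ->
  T (fun x => c * phi x + psi x) = c * T phi + T psi.
Proof.
by move=> eT c phi psi /test_testf[? _] /test_testf[? _]; exact: (edistZD eT).
Qed.

Lemma mkdistr_continuous a b (T : (R -> R) -> R) : edist a b T ->
  forall K : set R, compact K -> exists (C : R) (k : nat), forall phi, test_fun phi ->
  tsupp phi `<=` K -> `|T phi| <= C * Ck_norm k phi.
Proof.
move=> eT K _; have [C [k [C0 HC]]] := edist_bound eT; exists C, k => phi tp _.
have {}tp := test_testf tp; apply: HC; first exact: tp.1.
by move=> j x jk _; exact: Ck_norm_ge.
Qed.

Definition mkdistr a b T (eT : edist a b T) : schwartz_distr R :=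
  Distribution (mkdistr_linear eT) (mkdistr_continuous eT).

(** [edist] asks for vanishing on a thickened interval. Only the two endpoints have to be thickened,
    since the points between them already lie off the support of [phi]. *)
Lemma mkdistr_supported a b T (eT : edist a b T) : supported_in (mkdistr eT) `[a, b].
Proof.
move=> phi tp sp /=; have {}tp := test_testf tp.
have [ba|ab] := ltP b a.
  have e0 : 0 < (a - b) / 4 by rewrite divr_gt0// subr_gt0.
  case: eT => _ _ /(_ _ _ tp.1 e0); apply => x /andP[? ?]; exfalso; lra.
have clo : open (~` tsupp phi) by apply: closed_openC; exact: closed_closure.
have out c : c \in `[a, b] -> exists2 e, 0 < e & forall y, `|y - c| <= e -> phi y = 0.
  move=> cab; have /clo/nbhs_ballP[e /= e0 He] : (~` tsupp phi) c by move=> /sp; apply.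
  exists (e / 2); first by rewrite divr_gt0.
  move=> y yc; apply/eqP; apply/negPn/negP => py.
  apply: (He y); last exact: subset_closure.
  rewrite /ball /= distrC (le_lt_trans yc)//.
  by rewrite ltr_pdivrMr// mulr_natr mulr2n ltrDl.
have [e1 e10 H1] : exists2 e, 0 < e & forall y, `|y - a| <= e -> phi y = 0.
  by apply: out; rewrite in_itv /= lexx.
have [e2 e20 H2] : exists2 e, 0 < e & forall y, `|y - b| <= e -> phi y = 0.
  by apply: out; rewrite in_itv /= lexx ab.
case: eT => _ _ /(_ _ (Num.min e1 e2) tp.1); apply; first by rewrite lt_min e10.
have m1 : Num.min e1 e2 <= e1 by rewrite ge_min lexx.
have m2 : Num.min e1 e2 <= e2 by rewrite ge_min lexx orbT.
move=> x /andP[? ?]; have [xa|xa] := ltP x a.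
  by apply: H1; rewrite ler_norml; apply/andP; split; lra.
have [xb|xb] := ltP b x; first by apply: H2; rewrite ler_norml; apply/andP; split; lra.
have [e e0 He] : exists2 e, 0 < e & forall y, `|y - x| <= e -> phi y = 0.
  by apply: out; rewrite in_itv /= xa xb.
by apply: He; rewrite subrr normr0 ltW.
Qed.

Lemma is_distr_derivativeE U u phi : is_distr_derivative U u -> testf phi ->
  u phi = - U (D 1 phi).
Proof. by move=> dU tp; rewrite dU ?D1E//; exact: testf_test. Qed.

Lemma Rint_FTC phi F : testf phi -> (forall x, is_derive x 1 F (phi x)) ->
  exists M, forall N, M <= N -> \int[mu]_y phi y = F N - F (- N).
Proof.
move=> tp dF; have [M [M0 HM]] := prim_far tp; exists M => N MN.
have E : prim phi = fun x => F x - F (- N).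
  apply: (der_unique (testf_prim_der tp) _ (a := - N)).
    by move=> x; have := derB (dF x) (der_cst (F (- N)) x); rewrite subr0.
  by rewrite subrr (HM _).1// lerN2.
by rewrite -((HM N).2 MN) E.
Qed.

Lemma Rint_reflect phi : testf phi -> \int[mu]_y phi (- y) = \int[mu]_y phi y.
Proof.
move=> tp; have tq : testf (fun y => phi (- y)).
  have := testf_affine 0 (_ : -1 != 0) tp; rewrite oppr_eq0 oner_eq0 => /(_ isT).
  by congr testf; apply/funext => x; rewrite add0r mulN1r.
have dp := testf_prim_der tp.
have dq x : is_derive x 1 (fun x => - prim phi (- x)) (phi (- x)).
  have dN : is_derive x 1 (fun x : R => - x) (-1) by apply: derN; exact: is_derive_id.
  by have := derN (@der_comp _ _ _ (fun x : R => - x) _ x (dp (- x)) dN); rewrite mulN1r opprK.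
have [M HM] := Rint_FTC tp dp; have [N HN] := Rint_FTC tq dq.
rewrite (HM (Num.max M N)) ?le_max ?lexx// (HN (Num.max M N)) ?le_max ?lexx ?orbT//.
by rewrite !opprK addrC.
Qed.

Lemma near_right0P (P : R -> Prop) :
  (\forall t \near 0^'+, P t) <-> exists2 d : R, 0 < d & forall t, 0 < t -> t < d -> P t.
Proof.
split.
  move=> /nbhs_ballP[d /= d0 H]; exists d => // t t0 td; apply: H => //.
  by rewrite /ball /= sub0r normrN gtr0_norm.
move=> [d d0 H]; near=> t; apply: H; first by near: t; exact: nbhs_right_gt.
by near: t; exact: nbhs_right_lt.
Unshelve. all: by end_near. Qed.

(* By reflecting the test function, the limit from the right is enough. *)
Definition pval (g : schwartz_distr R) (x0 c : R) := forall phi, testf phi ->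
  forall eps : R, 0 < eps -> exists2 d, 0 < d & forall s, 0 < s -> s < d ->
    `|s^-1 * g (fun y => phi ((y - x0) / s)) - c * \int[mu]_y phi y| <= eps.

Lemma pvalP (g : schwartz_distr R) x0 (c : R) : has_point_value g x0 c <-> pval g x0 c.
Proof.
split=> H phi tp.
  move=> eps e0; have := H _ (testf_test tp).
  move=> /cvgrPdist_le/(_ _ e0)/nbhs_ballP[d /= d0 Hd]; exists d => // s s0 sd.
  rewrite distrC; have := Hd s; rewrite /ball /= sub0r normrN gtr0_norm//.
  by move=> /(_ sd); rewrite (gt_eqF s0) => /(_ isT); rewrite /pairing_scaled (gtr0_norm s0).
have {}tp := test_testf tp.
have tq : testf (fun y => phi (- y)).
  have := testf_affine 0 (_ : -1 != 0) tp; rewrite oppr_eq0 oner_eq0 => /(_ isT).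
  by congr testf; apply/funext => x; rewrite add0r mulN1r.
apply/cvgrPdist_le => eps e0; have [d1 d10 H1] := H _ tp _ e0.
have [d2 d20 H2] := H _ tq _ e0.
near=> e; rewrite distrC.
have en : e != 0 by near: e; exact: nbhs_dnbhs_neq.
have e1 : `|e| < d1 by near: e; exact: dnbhs0_lt.
have e2 : `|e| < d2 by near: e; exact: dnbhs0_lt.
rewrite /pairing_scaled; move: en e1 e2; rewrite neq_lt => /orP[en|en].
  rewrite (ltr0_norm en) => _ /(H2 _ _); rewrite oppr_gt0 => /(_ en).
  rewrite Rint_reflect// => {}H2; apply: le_trans H2; rewrite le_eqVlt; apply/orP; left.
  apply/eqP; congr (`|_ * distr_fun g _ - _|).
  by apply/funext => y; rewrite invrN mulrN opprK.
by rewrite (gtr0_norm en) => /(H1 _ en).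
Unshelve. all: by end_near. Qed.

Lemma pval_unique (g : schwartz_distr R) x0 (c d : R) : pval g x0 c -> pval g x0 d -> c = d.
Proof.
move=> Hc Hd; have th := @testf_hump R; have I0 := @int_hump_gt0 R.
apply/eqP/negPn/negP => cd; have cd0 : 0 < `|c - d| by rewrite normr_gt0 subr_eq0.
have e0 : 0 < `|c - d| * \int[mu]_y hump y / 4 by rewrite divr_gt0// mulr_gt0.
have [d1 d10 H1] := Hc _ th _ e0; have [d2 d20 H2] := Hd _ th _ e0.
pose s := Num.min d1 d2 / 2.
have m0 : 0 < Num.min d1 d2 by rewrite lt_min d10.
have s0 : 0 < s by rewrite divr_gt0.
have [s1 s2] : s < d1 /\ s < d2.
  have : s < Num.min d1 d2 by rewrite /s; clear -m0; lra.
  by rewrite lt_min => /andP.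
have := H1 _ s0 s1; have := H2 _ s0 s2; rewrite distrC => h2 h1.
have := le_trans (ler_normD _ _) (lerD h2 h1).
rewrite addrA subrK -mulrBl normrM (gtr0_norm I0) distrC.
have := mulr_gt0 cd0 I0; clear; lra.
Qed.

Lemma null_of_pval U u a b x0 (c : R) : a <= b -> supported_in u `[a, b] ->
  is_distr_derivative U u -> pval U x0 c -> null_at (cpairing a b u) x0.
Proof.
move=> ab su dU pU th tth eps e0.
have [d d0 Hd] := pU _ (testf_D 1 tth) _ e0.
exists d => // s s0 sd; have sn : s != 0 by rewrite gt_eqF.
have ts := testf_scale x0 sn tth.
rewrite (cpairing_test su ts) (is_distr_derivativeE dU ts) normrN.
have := Hd s s0 sd; rewrite (Rint_derive tth) mulr0 subr0; congr (`|_| <= _).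
rewrite -distrZ; last by apply: testf_scale => //; exact: testf_D.
congr (distr_fun U); rewrite D_scale; last exact: tth.1.
by rewrite expr1.
Qed.

End Schwartz.

(** * Smooth sums of series and a Banach-Steinhaus theorem for test functions *)

Section GlidingHump.
Context {R : realType}.
Implicit Types (f g phi psi : R -> R) (x y B C : R) (n k m j : nat).

(** The intervals of centre [s n] and radius [2 * delta n] are nested from [N0] on; the supremum of
    their left ends lies in all of them. *)
Lemma geometric_limit (s delta : nat -> R) (N0 : nat) :
  (forall n, 0 <= delta n) -> (forall n, delta n.+1 <= delta n / 2) ->
  (forall n, (N0 <= n)%N -> `|s n.+1 - s n| <= delta n) ->
  exists l, forall n, (N0 <= n)%N -> `|l - s n| <= 2 * delta n.
Proof.
move=> d0 dd sd.
have lo n p : (N0 <= n)%N -> s n - 2 * delta n <= s (n + p)%N - 2 * delta (n + p)%N.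
  move=> Nn; elim: p => [|p IH]; first by rewrite addn0.
  apply: (le_trans IH); rewrite addnS.
  have := sd (n + p)%N (leq_trans Nn (leq_addr _ _)); have := dd (n + p)%N.
  by rewrite ler_norml => ? /andP[? ?]; lra.
have hi n p : (N0 <= n)%N -> s (n + p)%N + 2 * delta (n + p)%N <= s n + 2 * delta n.
  move=> Nn; elim: p => [|p IH]; first by rewrite addn0.
  apply: le_trans IH; rewrite addnS.
  have := sd (n + p)%N (leq_trans Nn (leq_addr _ _)); have := dd (n + p)%N.
  by rewrite ler_norml => ? /andP[? ?]; lra.
have lohi n m : (N0 <= n)%N -> (N0 <= m)%N -> s n - 2 * delta n <= s m + 2 * delta m.
  move=> Nn Nm; apply: (le_trans (lo n m Nn)).
  apply: (@le_trans _ _ (s (n + m)%N + 2 * delta (n + m)%N)).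
    by have := d0 (n + m)%N; lra.
  by rewrite addnC; exact: hi.
pose A := [set s n - 2 * delta n | n in [set n | (N0 <= n)%N]].
have An : A !=set0 by exists (s N0 - 2 * delta N0), N0 => //=.
have Au : has_ubound A.
  by exists (s N0 + 2 * delta N0) => _ [n /= Nn <-]; exact: lohi.
exists (sup A) => n Nn; rewrite ler_norml; apply/andP; split.
  rewrite lerBrDr addrC; apply: ub_le_sup => //; exists n => //.
rewrite lerBlDr addrC; apply: ge_sup => // _ [m /= Nm <-]; exact: lohi.
Qed.

(** Passage to the limit: [delta n] is at most [delta 0 / 2 ^+ n]. *)
Lemma le_of_halving (a b c : R) (delta : nat -> R) (N0 : nat) :
  (forall n, 0 <= delta n) -> (forall n, delta n.+1 <= delta n / 2) ->
  (forall n, (N0 <= n)%N -> a <= b + c * delta n) -> a <= b.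
Proof.
move=> d0 dd H; have dn n : delta n * 2 ^+ n <= delta 0%N.
  elim: n => [|n IH]; first by rewrite expr0 mulr1.
  apply: le_trans IH; rewrite exprS mulrA ler_wpM2r ?exprn_ge0//.
  by have := dd n; lra.
rewrite leNgt; apply/negP => ba.
have [n Hn] : exists n, `|c| * delta 0%N < (a - b) * n%:R.
  have ab : 0 < a - b by rewrite subr_gt0.
  exists (Num.truncn (`|c| * delta 0%N / (a - b))).+1.
  rewrite -ltr_pdivrMl// mulrC; exact: truncnS_gt.
have := H (maxn N0 n) (leq_maxl _ _); set N := maxn N0 n.
have nN : (n%:R <= 2 ^+ N :> R).
  rewrite -natrX ler_nat; apply: leq_trans (leq_maxr N0 n) _.
  exact/ltnW/ltn_expl.
have p0 : 0 < 2 ^+ N :> R by rewrite exprn_gt0.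
rewrite -(ler_pM2r p0) => H2.
have h1 : `|c| * (delta N * 2 ^+ N) <= `|c| * delta 0%N by rewrite ler_wpM2l.
have h2 : c * (delta N * 2 ^+ N) <= `|c| * (delta N * 2 ^+ N).
  by rewrite ler_wpM2r ?ler_norm// mulr_ge0// exprn_ge0.
have h3 : (a - b) * n%:R <= (a - b) * 2 ^+ N by rewrite ler_wpM2l// subr_ge0 ltW.
move: H2; rewrite mulrDl -mulrA => H2; have : (a - b) * 2 ^+ N <= `|c| * delta 0%N.
  by rewrite mulrBl; lra.
by lra.
Qed.

Lemma D_sum n N (phi : nat -> R -> R) : (forall m, Cinf (phi m)) ->
  Cinf (fun x => \sum_(m < N) phi m x) /\
  D n (fun x => \sum_(m < N) phi m x) = fun x => \sum_(m < N) D n (phi m) x.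
Proof.
move=> sphi; elim: N => [|N [IH1 IH2]].
  have -> : (fun x => \sum_(m < 0) phi m x) = fun=> 0 by apply/funext => x; rewrite big_ord0.
  by split; [exact: smooth_cst|apply/funext => x; rewrite big_ord0 D_zero].
have -> : (fun x => \sum_(m < N.+1) phi m x) = fun x => \sum_(m < N) phi m x + phi N x.
  by apply/funext => x; rewrite big_ord_recr.
split; first exact: smoothD.
by rewrite D_D// IH2; apply/funext => x; rewrite big_ord_recr.
Qed.

(* Termwise differentiation: Taylor's estimate with a uniform constant passes
   to the limit. *)
Lemma smooth_series (phi : nat -> R -> R) (kappa : nat -> nat) (delta : nat -> R) :
  (forall n, testf (phi n)) -> (forall n, (n <= kappa n)%N) ->
  (forall n m, (n <= m)%N -> (kappa n <= kappa m)%N) ->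
  (forall n, 0 <= delta n) -> (forall n, delta n.+1 <= delta n / 2) ->
  (forall n j x, (j <= kappa n)%N -> `|D j (phi n) x| <= delta n) ->
  exists F, Cinf F /\ forall N j x, (j <= kappa N)%N ->
    `|D j F x - \sum_(m < N) D j (phi m) x| <= 2 * delta N.
Proof.
move=> tphi kn kmono d0 dd Hphi.
have lim j x : exists l, forall N, (j <= kappa N)%N ->
    `|l - \sum_(m < N) D j (phi m) x| <= 2 * delta N.
  (* The first index from which derivatives of order [j] are controlled; it exists because
     [n <= kappa n]. *)
  pose N0 := ex_minn (ex_intro (fun N => (j <= kappa N)%N) j (kn j)).
  have [HN0 N0min] : (j <= kappa N0)%N /\ forall N, (j <= kappa N)%N -> (N0 <= N)%N.
    by rewrite /N0; case: ex_minnP.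
  have [|l Hl] := @geometric_limit (fun N => \sum_(m < N) D j (phi m) x) delta N0 d0 dd.
    move=> n Nn; rewrite big_ord_recr /= addrAC subrr add0r; apply: Hphi.
    exact: leq_trans HN0 (kmono _ _ Nn).
  by exists l => N jN; apply: Hl; exact: N0min.
have [F HF] := choice (fun jx : nat * R => lim jx.1 jx.2).
pose G j x := F (j, x).
have HG j x N : (j <= kappa N)%N -> `|G j x - \sum_(m < N) D j (phi m) x| <= 2 * delta N.
  by move=> jN; exact: (HF (j, x)).
have sphi m : Cinf (phi m) by have [] := tphi m.
have dG j x : is_derive x 1 (G j) (G j.+1 x).
  (* From this index on orders up to [j.+2] are controlled, which bounds the second derivatives of
     all later partial sums of [D j (phi m)] at once. *)
  pose N0 := j.+2.
  have [B B0 HB] : exists2 B, 0 <= B & forall y, `|\sum_(m < N0) D j.+2 (phi m) y| <= B.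
    elim: N0 => [|N0 [B B0 IH]]; first by exists 0 => // y; rewrite big_ord0 normr0.
    have [C C0 HC] := testf_bounded j.+2 (tphi N0).
    exists (B + C); first by rewrite addr_ge0.
    by move=> y; rewrite big_ord_recr/= (le_trans (ler_normD _ _))// lerD// HC.
  have HB2 N y : (N0 <= N)%N -> `|\sum_(m < N) D j.+2 (phi m) y| <= B + 4 * delta N0.
    move=> NN; have h1 := HG j.+2 y N0 (kn N0).
    have h2 := HG j.+2 y N (leq_trans (kn N0) (kmono _ _ NN)).
    have dNN : delta N <= delta N0.
      rewrite -(subnKC NN); elim: (N - N0)%N => [|p IH]; first by rewrite addn0.
      by rewrite addnS; have := dd (N0 + p)%N; have := d0 (N0 + p)%N; lra.
    move: h1 h2 (HB y); rewrite !ler_norml => /andP[? ?] /andP[? ?] /andP[? ?].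
    by apply/andP; split; lra.
  apply: (@is_derive_quad _ _ _ _ (B + 4 * delta N0) 1) => // h _.
  apply: (@le_of_halving _ _ (4 + 2 * `|h|) delta N0) => // N NN.
  have jk i : (i <= j.+2)%N -> (i <= kappa N)%N.
    by move=> ij; apply: (leq_trans ij); apply: leq_trans (kn N0) (kmono _ _ NN).
  have [sS _] := @D_sum 0 N phi sphi.
  have E i : D i (fun x => \sum_(m < N) phi m x) = fun x => \sum_(m < N) D i (phi m) x.
    by have [] := @D_sum i N phi sphi.
  have := @taylor1 _ _ _ _ x h (B + 4 * delta N0) (smooth_der j sS) (smooth_der j.+1 sS).
  rewrite !E => /(_ (fun y _ => HB2 N y NN)).
  set S0 := \sum_(m < N) D j (phi m) (x + h); set S1 := \sum_(m < N) D j (phi m) x.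
  set S2 := \sum_(m < N) D j.+1 (phi m) x => H.
  have -> : G j (x + h) - G j x - h * G j.+1 x = (S0 - S1 - h * S2) +
    ((G j (x + h) - S0) - (G j x - S1) - h * (G j.+1 x - S2)) by ring.
  rewrite (le_trans (ler_normD _ _))// lerD//.
  rewrite (le_trans (ler_normB _ _))// mulrDl lerD//.
    rewrite (le_trans (ler_normB _ _))//.
    have := HG j (x + h) N (jk j (leqW (leqnSn j))); have := HG j x N (jk j (leqW (leqnSn j))).
    by rewrite -/S0 -/S1; lra.
  rewrite normrM [2 * _]mulrC -mulrA ler_wpM2l//.
  exact: HG (jk j.+1 (leqnSn _)).
have sG j : Cinf (G j).
  apply: (@smooth_of_class _ (fun F => exists j, F = G j)); last by exists j.
  by move=> _ [i ->]; exists (G i.+1); [exists i.+1|exact: dG].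
have DG j : D j (G 0%N) = G j.
  elim: j => [|j IH]; first by rewrite D0.
  by rewrite DSr IH; apply: der_D1; exact: dG.
by exists (G 0%N); split => // N j x jN; rewrite DG; exact: HG.
Qed.

Definition testM (M : R) phi := testf phi /\ forall x, M < `|x| -> phi x = 0.

(** Gliding hump. If no common bound exists, there are functions [phi n], with derivatives up to
    order [kappa n] below [delta n], on which some functional exceeds [L n]. The choice of [L n]
    dominates all functionals on the earlier functions, and that of [delta n.+1] makes the later
    ones harmless for the functional of stage [n]; on the sum of the series the functionals are then
    unbounded. *)
Lemma banach_steinhaus (I : Type) (T : I -> (R -> R) -> R) (M : R) :
  (forall i (c : R) phi psi, testM M phi -> testM M psi ->
    T i (fun x => c * phi x + psi x) = c * T i phi + T i psi) ->
  (forall i, exists C k, 0 <= C /\ forall phi B, testM M phi ->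
    (forall j x, (j <= k)%N -> `|D j phi x| <= B) -> `|T i phi| <= C * B) ->
  (forall phi, testM M phi -> exists B, forall i, `|T i phi| <= B) ->
  exists C k, 0 <= C /\ forall i phi B, testM M phi ->
    (forall j x, (j <= k)%N -> `|D j phi x| <= B) -> `|T i phi| <= C * B.
Proof.
move=> lT cT bT; apply: contrapT => nbd.
have tz : testM M (fun=> 0) by split; [exact: testf0|].
have T0 i : T i (fun=> 0) = 0.
  by have := lT i (-1) _ _ tz tz; rewrite mulr0 addr0 => ->; rewrite mulN1r addNr.
have pick (p : nat * R * R) : exists q : I * (R -> R), 0 < p.1.2 ->
    [/\ testM M q.2, forall j x, (j <= p.1.1)%N -> `|D j q.2 x| <= p.1.2 &
     p.2 < `|T q.1 q.2|].
  case: p => -[k delta] L /=.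
  have [d0|d0] := ltP 0 delta; last first.
    have [i _] : exists i : I, True.
      apply: contrapT => ne; apply: nbd; exists 0, 0%N; split => // i; exfalso.
      by apply: ne; exists i.
    by exists (i, fun=> 0) .
  (* [N] is both the constant and the order in the bound assumed to fail; a function violating it is
     rescaled by [delta / B]. *)
  pose N := maxn k (Num.truncn (`|L| / delta)).+1.
  have NL : `|L| < N%:R * delta.
    rewrite -ltr_pdivrMr//; apply: lt_le_trans (truncnS_gt _) _.
    by rewrite ler_nat leq_maxr.
  apply: contrapT => nq; apply: nbd; exists N%:R, N; split => // i phi B tp HB.
  rewrite leNgt; apply/negP => HT; apply: nq.
  have B0 : 0 <= B by apply: le_trans (HB 0%N 0 (leq0n _)).
  have {}B0 : 0 < B.
    rewrite lt0r B0 andbT; apply/eqP => BE; move: HT; rewrite BE mulr0.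
    have -> : phi = fun=> 0.
      by apply/funext => x; apply/eqP; rewrite -normr_le0 -BE -(D0 phi) HB.
    by rewrite T0 normr0 ltxx.
  exists (i, fun x => delta / B * phi x) => _; split=> /=.
  - split; first by apply: testfZ; case: tp.
    by move=> x xM; case: tp => _ ->//; rewrite mulr0.
  - move=> j x jk; rewrite D_Z; last by case: tp => -[].
    rewrite normrM gtr0_norm ?divr_gt0// -mulrA ger_pMr//.
    rewrite mulrC ler_pdivrMr// mul1r; apply: HB.
    exact: leq_trans jk (leq_maxl _ _).
  - have := lT i (delta / B) _ _ tp tz; rewrite T0 addr0 => E.
    have -> : (fun x => delta / B * phi x) = fun x => delta / B * phi x + 0.
      by apply/funext => x; rewrite addr0.
    rewrite E normrM gtr0_norm ?divr_gt0//.
    apply: (le_lt_trans (ler_norm L)); apply: (lt_trans NL).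
    rewrite mulrC -mulrA ltr_pM2l// mulrC ltr_pdivlMr//.
have [P HP] := choice pick.
have [CC HCC] := choice cT; have [kk Hkk] := choice HCC.
(* A pointwise bound chosen as a function of [phi]; the value 0 outside [testM M] is a mere
   default. *)
have [MM HMM] := choice (fun phi : R -> R => (fun H : exists B, testM M phi -> forall i, `|T i phi| <= B => H)
   (match pselect (testM M phi) with
    | left tp => let: ex_intro B HB := bT phi tp in ex_intro _ B (fun _ => HB)
    | right ntp => ex_intro _ 0 (fun tp => False_ind _ (ntp tp)) end)).
(* State [(kappa, delta, L)]: the order moves past the order [kk] of the functional just chosen,
   [delta] shrinks by twice its constant plus 2, and [L] absorbs the pointwise bound of the function
   just chosen. *)
pose next (p : nat * R * R) : nat * R * R :=
  (maxn p.1.1.+1 (kk (P p).1), p.1.2 / (2 * (CC (P p).1 + 1)), p.2 + `|MM (P p).2| + 1).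
pose st n := iter n next (0%N, 1, 2).
pose kappa n := (st n).1.1; pose delta n := (st n).1.2; pose L n := (st n).2.
pose idx n := (P (st n)).1; pose phi n := (P (st n)).2.
have C0 i : 0 <= CC i by have [] := Hkk i.
have d0 n : 0 < delta n.
  elim: n => [|n IH]; first by rewrite /delta /= ltr01.
  rewrite /delta /st iterS /= divr_gt0// mulr_gt0// ltr_wpDl//.
have HPn n : [/\ testM M (phi n), forall j x, (j <= kappa n)%N -> `|D j (phi n) x| <= delta n &
     L n < `|T (idx n) (phi n)|] by exact: (HP _ (d0 n)).
have dS n : delta n.+1 * (CC (idx n) + 1) = delta n / 2.
  rewrite /delta {1}/st iterS /= -/(st n) -/(idx n).
  have : CC (idx n) + 1 != 0 by rewrite gt_eqF// ltr_wpDl.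
  by move=> ?; field.
have dd n : delta n.+1 <= delta n / 2.
  by have := dS n; have := C0 (idx n); have := d0 n.+1; nra.
have kS n : (kappa n.+1 = maxn (kappa n).+1 (kk (idx n)))%N by [].
have kn n : (n <= kappa n)%N.
  by elim: n => // n IH; rewrite kS leq_max ltnS IH.
have kmono n m : (n <= m)%N -> (kappa n <= kappa m)%N.
  move=> /subnKC <-; elim: (m - n)%N => [|p IH]; first by rewrite addn0.
  by rewrite addnS kS (leq_trans IH)// (leq_trans (leqnSn _))// leq_maxl.
have [F [sF HF]] := @smooth_series phi kappa delta (fun n => let: And3 H _ _ := HPn n in H.1) kn kmono
  (fun n => ltW (d0 n)) dd (fun n j x => let: And3 _ H _ := HPn n in H j x).
have phi0 n x : M < `|x| -> phi n x = 0 by move=> xM; have [[_ ->]] := HPn n.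
have tF : testM M F.
  have F0 x : M < `|x| -> F x = 0.
    move=> xM; apply/eqP; rewrite -normr_le0.
    apply: (@le_of_halving _ _ 2 delta 0 (fun n => ltW (d0 n)) dd) => n _.
    have := HF n 0%N x (leq0n _); rewrite D0 big1 ?subr0 ?add0r// => i _.
    by rewrite D0 phi0.
  by split => //; split => //; exists M.
have [B HB] := bT F tF.
have Lge n : n%:R + 2 + \sum_(m < n) `|MM (phi m)| <= L n.
  elim: n => [|n IH]; first by rewrite big_ord0 addr0 add0r.
  have -> : L n.+1 = L n + `|MM (phi n)| + 1 by [].
  by rewrite big_ord_recr /= -natr1; lra.
have lT2 i f g : testM M f -> testM M g -> T i (fun x => f x - g x) = T i f - T i g.
  move=> tf tg; have := lT i (-1) g f tg tf; rewrite mulN1r addrC => <-; congr (T i).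
  by apply/funext => x; rewrite mulN1r addrC.
have lT3 i f g : testM M f -> testM M g -> T i (fun x => f x + g x) = T i f + T i g.
  move=> tf tg; have := lT i 1 f g tf tg; rewrite mul1r => <-; congr (T i).
  by apply/funext => x; rewrite mul1r.
have tphi n : testM M (phi n) by have [] := HPn n.
have tS n : testM M (fun x => \sum_(m < n) phi m x) /\
    forall i, T i (fun x => \sum_(m < n) phi m x) = \sum_(m < n) T i (phi m).
  elim: n => [|n [IH1 IH2]].
    have E : (fun x => \sum_(m < 0) phi m x) = fun=> 0.
      by apply/funext => x; rewrite big_ord0.
    rewrite E; split => // i; rewrite big_ord0.
    exact: T0.
  have E : (fun x => \sum_(m < n.+1) phi m x) = fun x => \sum_(m < n) phi m x + phi n x.
    by apply/funext => x; rewrite big_ord_recr.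
  rewrite E; split.
    split; first by apply: testfD; [case: IH1|case: (tphi n)].
    by move=> x xM; rewrite phi0// addr0; case: IH1 => _ ->.
  by move=> i; rewrite lT3// IH2 big_ord_recr.
have HMphi i m : `|T i (phi m)| <= `|MM (phi m)|.
  by apply: le_trans (HMM (phi m) (tphi m) i) _; exact: ler_norm.
suff : forall n : nat, n%:R <= `|B|.
  move=> /(_ (Num.truncn `|B|).+1); rewrite leNgt => /negP; apply.
  exact: truncnS_gt.
move=> n; have [[tn _] _ Ln] := HPn n.
have [tS1 TS1] := tS n.+1.
pose rest x := F x - \sum_(m < n.+1) phi m x.
have trest : testM M rest.
  split; first by apply: testfB; [case: tF|case: tS1].
  by move=> x xM; rewrite /rest; case: tF => _ ->//; case: tS1 => _ ->//; rewrite subrr.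
have Trest : `|T (idx n) rest| <= 1.
  have := (Hkk (idx n)).2 rest (2 * delta n.+1) trest => H.
  apply: (le_trans (H _)).
    move=> j x jk; rewrite /rest D_B; [|exact: sF|by case: tS1 => -[]].
    rewrite (D_sum j n.+1 (fun m => (tphi m).1.1)).2; apply: HF.
    by rewrite kS leq_max jk orbT.
  have d1 : delta n <= 1.
    elim: n {tn Ln tS1 TS1 rest trest H} => [|n IH]; first by [].
    by have := dd n; have := d0 n; clear -IH; lra.
  have := dS n; have := d0 n.+1; have := C0 (idx n); nra.
have := HB (idx n); rewrite (_ : F = fun x => rest x + \sum_(m < n.+1) phi m x); last first.
  by apply/funext => x; rewrite /rest subrK.
rewrite lT3// TS1 big_ord_recr /= => HBn.
have Ssum : `|\sum_(m < n) T (idx n) (phi m)| <= \sum_(m < n) `|MM (phi m)|.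
  by rewrite (le_trans (ler_norm_sum _ _ _))// ler_sum.
have := Lge n; move: HBn Trest Ssum Ln; have := ler_norm B.
set X := \sum_(m < n) T (idx n) (phi m); set Y := \sum_(m < n) `|MM (phi m)|.
set t1 := T (idx n) rest; set t2 := T (idx n) (phi n) => ? HBn Trest Ssum Ln ?.
have E : t2 = (t1 + (X + t2)) - t1 - X by ring.
have := ler_normB (t1 + (X + t2) - t1) X; have := ler_normB (t1 + (X + t2)) t1.
by rewrite -E; lra.
Qed.

End GlidingHump.

(** * Bounds uniform in the scale at a point, and dyadic decomposition *)

Section DyadicCore.
Context {R : realType}.
Implicit Types (f g phi psi theta eta : R -> R) (a b x y s t B C : R) (n k m j J : nat).

Lemma D_scale_bound theta x0 s d B k j x : Cinf theta -> 0 < d -> d <= s -> (j <= k)%N ->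
  (forall y, `|D j theta y| <= B) ->
  `|D j (fun x => theta ((x - x0) / s)) x| <= (1 + d^-1) ^+ k * B.
Proof.
move=> st d0 ds jk HB; have s0 := lt_le_trans d0 ds.
rewrite D_scale// normrM; apply: ler_pM => //.
have i0 : 0 <= s^-1 by rewrite invr_ge0 ltW.
have id : s^-1 <= d^-1 by rewrite lef_pV2 ?posrE.
rewrite ger0_norm ?exprn_ge0//.
have h1 : 1 <= 1 + d^-1 by rewrite lerDl (le_trans i0).
apply: (@le_trans _ _ ((1 + d^-1) ^+ j)); last by rewrite ler_weXn2l.
by rewrite lerXn2r ?nnegrE ?addr_ge0 ?(le_trans i0 id)// (le_trans id)// lerDr.
Qed.

Section AtPoint.
Variables (a b : R) (T : (R -> R) -> R) (x0 : R).
Hypotheses (eT : edist a b T) (nT : null_at T x0).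

(** Banach-Steinhaus over the scales [0 < s <= S]. For a fixed [theta] small scales are bounded by
    [null_at], and scales away from 0 by the finite order of [T]; other indices carry the zero
    functional. *)
Lemma null_bound (M S : R) : exists C k, 0 <= C /\ forall s theta B,
  0 < s -> s <= S -> testM M theta -> (forall j x, (j <= k)%N -> `|D j theta x| <= B) ->
  `|T (fun x => theta ((x - x0) / s))| <= C * B.
Proof.
pose T2 s theta := if (0 < s) && (s <= S) then T (fun x => theta ((x - x0) / s)) else 0.
have [C0 [k0 [C00 HC0]]] := edist_bound eT.
have [||theta|C [k [C1 HC]]] := @banach_steinhaus R R T2 M.
- move=> s c phi psi [[sp _] _] [[ss _] _]; rewrite /T2.
  case: ifP => _; last by rewrite mulr0 addr0.
  by rewrite (edistZD eT)//; exact: smooth_scale.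
- move=> s; have [/andP[s0 sS]|/negbTE E] := boolP ((0 < s) && (s <= S)); last first.
    by exists 0, 0%N; split => // phi B _ _; rewrite /T2 E normr0 mul0r.
  exists (C0 * (1 + s^-1) ^+ k0), k0; split.
    by rewrite mulr_ge0 ?exprn_ge0 ?addr_ge0// invr_ge0 ltW.
  move=> phi B [[sp _] _] HB; rewrite /T2 s0 sS -mulrA; apply: HC0; first exact: smooth_scale.
  by move=> j x jk _; apply: D_scale_bound => // y; exact: HB.
- move=> [tt tM]; have [d d0 Hd] := nT tt (@ltr01 R).
  have [B B0 HB] := testf_bounded k0 tt.
  exists (1 + C0 * ((1 + d^-1) ^+ k0 * B)) => s; rewrite /T2.
  have H0 : 0 <= C0 * ((1 + d^-1) ^+ k0 * B).
    by rewrite !mulr_ge0 ?exprn_ge0 ?addr_ge0// invr_ge0 ltW.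
  case: ifP => [/andP[s0 sS]|_]; last by rewrite normr0 addr_ge0.
  have [sd|ds] := ltP s d.
    by rewrite (le_trans (Hd _ s0 sd))// lerDl.
  rewrite -[leLHS]add0r lerD//; apply: HC0; first exact: (smooth_scale _ _ tt.1).
  by move=> j x jk _; apply: D_scale_bound => //; [exact: tt.1|move=> y; exact: HB].
- exists C, k; split => // s theta B s0 sS tt HB.
  by have := HC s theta B tt HB; rewrite /T2 s0 sS.
Qed.

(** A piece of a dyadic partition of unity: supported in [2^-1 <= |y| <= 2], and its dilates by
    powers of 2 telescope to a difference of plateaus. *)
Definition ring_bump y : R := plateau y - plateau (2 * y).

Lemma testM_ring_bump : testM 2 ring_bump.
Proof.
have sp : Cinf (fun y : R => plateau (2 * y)).
  by have := smooth_affine 0 2 (@Cinf_plateau R); under eq_fun do rewrite add0r.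
have H x : 2 < `|x| -> ring_bump x = 0.
  move=> x2; rewrite /ring_bump !plateau0 ?subrr//; last exact: ltW.
  by rewrite normrM ger0_norm//; lra.
split=> //; split; first by apply: smoothB => //; exact: Cinf_plateau.
by exists 2.
Qed.

Lemma ring_bump0 y : `|y| <= 2^-1 -> ring_bump y = 0.
Proof.
move=> yh; rewrite /ring_bump !plateau1 ?subrr//.
  by rewrite normrM ger0_norm//; lra.
by lra.
Qed.

(* Dyadic decomposition: the part of [eta] at distance about [2 ^ j] is a test
   function of bounded size at scale [2 ^ j * t]. *)
Lemma dyadic_core (S : R) : 0 < S -> x0 - S <= a - 1 -> b + 1 <= x0 + S ->
  exists C k, 0 <= C /\ forall t J eta N r,
  0 < t -> 2 ^+ J * t <= S -> Cinf eta -> 0 <= N -> 0 < r -> r < 1 ->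
  (forall j m y, (J < j)%N -> 2 ^+ j * t <= 2 * S -> (m <= k)%N -> 2^-1 <= `|y| -> `|y| <= 2 ->
     (2 ^+ j) ^+ m * `|D m eta (2 ^+ j * y)| <= N * r ^+ j) ->
  `|T (fun x => eta ((x - x0) / t)) -
    T (fun x => plateau ((x - x0) / t / 2 ^+ J) * eta ((x - x0) / t))| <= C * N * (r ^+ J / (1 - r)).
Proof.
move=> S0 aS bS; have [C [k [C0 HC]]] := null_bound 2 (2 * S).
have [A A0 HA] := testf_bounded k testM_ring_bump.1.
exists (C * (2 ^+ k * A)), k; split; first by rewrite !mulr_ge0// exprn_ge0.
move=> t J eta N r t0 JS seta N0 r0 r1 Heta.
have r10 : 0 < 1 - r by rewrite subr_gt0.
pose P n := T (fun x => plateau ((x - x0) / t / 2 ^+ n) * eta ((x - x0) / t)).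
have two n : 0 < 2 ^+ n :> R by rewrite exprn_gt0.
have sP n : Cinf (fun x => plateau ((x - x0) / t / 2 ^+ n) * eta ((x - x0) / t)).
  apply: smoothM; last exact: smooth_scale.
  have := smooth_scale x0 (t * 2 ^+ n) (@Cinf_plateau R).
  by congr Cinf; apply/funext => x; rewrite invfM mulrA.
pose c := C * (2 ^+ k * A) * N.
have c0 : 0 <= c by rewrite !mulr_ge0// exprn_ge0.
have stepP n : (J <= n)%N -> 2 ^+ n.+1 * t <= 2 * S -> `|P n.+1 - P n| <= c * r ^+ n.+1.
  move=> Jn nS; rewrite /P -(edistB eT)//.
  pose th y := ring_bump y * eta (2 ^+ n.+1 * y).
  have seta2 : Cinf (fun y => eta (2 ^+ n.+1 * y)).
    by have := smooth_affine 0 (2 ^+ n.+1) seta; under eq_fun do rewrite add0r.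
  have tth : testM 2 th.
    split; first by apply: testfMr => //; exact: testM_ring_bump.1.
    by move=> x x2; rewrite /th testM_ring_bump.2// mul0r.
  rewrite (_ : (fun x => _) = fun x => th ((x - x0) / (2 ^+ n.+1 * t))); last first.
    apply/funext => x; rewrite /th /ring_bump.
    have -> : (x - x0) / (2 ^+ n.+1 * t) = (x - x0) / t / 2 ^+ n.+1.
      by rewrite invfM mulrCA mulrC -mulrA.
    have -> : 2 ^+ n.+1 * ((x - x0) / t / 2 ^+ n.+1) = (x - x0) / t.
      by rewrite mulrC divfK// gt_eqF.
    have -> : 2 * ((x - x0) / t / 2 ^+ n.+1) = (x - x0) / t / 2 ^+ n.
      by rewrite exprS invfM mulrCA (mulrA 2) divff ?pnatr_eq0// mul1r.
    by rewrite -mulrBl.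
  rewrite /c -!mulrA; apply: (le_trans (HC _ th (2 ^+ k * (A * (N * r ^+ n.+1))) _ nS tth _)).
    by rewrite mulr_gt0.
    move=> j y jk.
    have R0 : 0 <= 2 ^+ k * (A * (N * r ^+ n.+1)).
      by rewrite !mulr_ge0// exprn_ge0// ltW.
    have [y2|y2] := ltP 2 `|y|.
      by rewrite (@D_out _ _ _ _ 2) ?normr0//; [exact: tth.1.1|exact: tth.2].
    have [yh|yh] := ltP `|y| 2^-1.
      rewrite (@D_local _ _ (fun=> 0) j y (2^-1 - `|y|)).
      - by rewrite D_zero normr0.
      - exact: tth.1.1.
      - exact: smooth_cst.
      - by rewrite subr_gt0.
      - move=> z zy; rewrite /th ring_bump0 ?mul0r//.
        by have := ler_normD (z - y) y; rewrite subrK; clear -eT nT zy; lra.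
    apply: (le_trans (@leibniz_bound _ _ _ j y A (N * r ^+ n.+1) testM_ring_bump.1.1 seta2 _ _)).
    - by move=> i ij; apply: HA; exact: leq_trans jk.
    - move=> i ij; have E := D_affine 0 (2 ^+ n.+1) i seta.
      have -> : (fun y => eta (2 ^+ n.+1 * y)) = fun y => eta (0 + 2 ^+ n.+1 * y).
        by apply/funext => z; rewrite add0r.
      rewrite E add0r normrM (ger0_norm (exprn_ge0 i (ltW (two n.+1)))); apply: Heta => //.
      exact: leq_trans jk.
    - rewrite ler_wpM2r//; first by rewrite !mulr_ge0// exprn_ge0// ltW.
      by rewrite ler_weXn2l// ler1n.
  by rewrite ler_wpM2l.
have [n0 Hn0] : exists n, S <= 2 ^+ (J + n) * t.
  exists (Num.truncn (S / t)).+1; rewrite -ler_pdivrMr//.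
  apply/ltW/(lt_le_trans (truncnS_gt _)); rewrite -natrX ler_nat.
  set q := (Num.truncn _).+1; apply: leq_trans (ltnW (ltn_expl q (isT : 1 < 2)%N)) _.
  by rewrite leq_exp2l// leq_addl.
(* The number of doublings after which the plateau is 1 around the support of [T]; minimality keeps
   the scales below [2 * S], where [null_bound] applies. *)
pose p0 := ex_minn (ex_intro (fun n => S <= 2 ^+ (J + n) * t) n0 Hn0).
have [Hp0 p0min] : S <= 2 ^+ (J + p0) * t /\ forall n, S <= 2 ^+ (J + n) * t -> (p0 <= n)%N.
  by rewrite /p0; case: ex_minnP.
have below p : (p < p0)%N -> 2 ^+ (J + p).+1 * t <= 2 * S.
  move=> pp; rewrite exprS -mulrA ler_wpM2l// ltW// ltNge; apply/negP => /p0min.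
  by rewrite leqNgt pp.
have sum p : (p <= p0)%N -> `|P (J + p)%N - P J| <= c * ((r ^+ J - r ^+ (J + p)) / (1 - r)).
  elim: p => [_|p IH pp]; first by rewrite addn0 !subrr normr0 mul0r mulr0.
  rewrite addnS -(subrK (P (J + p)%N) (P (J + p).+1)) -addrA.
  rewrite (le_trans (ler_normD _ _))//.
  apply: (le_trans (lerD (stepP _ (leq_addr _ _) (below _ pp)) (IH (ltnW pp)))).
  rewrite -mulrDr ler_wpM2l// -lerBrDr -mulrBl ler_pdivlMr//.
  rewrite [leRHS](_ : _ = r ^+ (J + p) - r ^+ (J + p).+1); last by ring.
  rewrite exprS; have : 0 < r ^+ (J + p) by rewrite exprn_gt0.
  set q := r ^+ (J + p) => q0; have q1 : 0 <= q * ((1 - r) * (1 - r)).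
    by apply: mulr_ge0; [exact: ltW|apply: mulr_ge0; exact: ltW].
  by nra.
have -> : T (fun x => eta ((x - x0) / t)) = P (J + p0)%N.
  apply: (edist_local eT _ _ (@ltr01 R)) => //; first exact: smooth_scale.
  move=> x /andP[xa xb]; rewrite plateau1 ?mul1r// !normrM !normfV.
  rewrite (gtr0_norm t0) (gtr0_norm (two _)) -mulrA -invfM ler_pdivrMr; last by rewrite mulr_gt0.
  rewrite mul1r mulrC (le_trans _ Hp0)// ler_norml; apply/andP; split; clear -eT nT aS xa bS xb; lra.
apply: (le_trans (sum _ (leqnn _))); rewrite -/c ler_wpM2l//.
apply: ler_wpM2r; first by rewrite invr_ge0; exact: ltW.
by rewrite gerBl; apply: exprn_ge0; exact: ltW.
Qed.

(** At scale [s] the increment [psi (x0 + s * y) - psi x0] is [O(s)] together with its derivatives,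
    so [null_bound] makes its contribution small; the constant [psi x0] is covered by the hypothesis
    on [T]. *)
Lemma null_mul psi : Cinf psi -> null_at (fun f => T (fun x => psi x * f x)) x0.
Proof.
move=> sp th tth eps e0.
have [M HM] := tth.2; have tM : testM M th by split.
have [C [k [C0 HC]]] := null_bound M 1.
have [A A0 HA] := testf_bounded k tth.
have [Bp Bp0 HBp] := Cinf_bounded k.+1 (`|x0| + `|M|) sp.
have e2 : 0 < eps / 2 / (`|psi x0| + 1) by rewrite !divr_gt0// ltr_wpDl.
have [d d0 Hd] := nT tth e2.
pose K := C * (2 ^+ k * (Bp * (1 + `|M|) * A)).
have K0 : 0 <= K by rewrite !mulr_ge0 ?exprn_ge0 ?addr_ge0.
exists (Num.min 1 (Num.min d (eps / 2 / (K + 1)))).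
  by rewrite !lt_min ltr01 d0 !divr_gt0// ltr_wpDl.
move=> s s0; rewrite !lt_min => /and3P[s1 sd sK].
have sn : s != 0 by rewrite gt_eqF.
pose q y := psi (x0 + s * y) - psi x0.
have sq : Cinf q by apply: smoothB; [exact: smooth_affine|exact: smooth_cst].
have -> : T (fun x => psi x * th ((x - x0) / s)) = psi x0 * T (fun x => th ((x - x0) / s)) +
   T (fun x => q ((x - x0) / s) * th ((x - x0) / s)).
  rewrite -(edistZD eT).
  - congr T; apply/funext => x; rewrite /q.
    by rewrite (_ : x0 + s * ((x - x0) / s) = x); [ring|field].
  - exact: (smooth_scale _ _ tth.1).
  - by apply: smoothM; apply: smooth_scale => //; exact: tth.1.
rewrite (le_trans (ler_normD _ _))// [leRHS]splitr lerD//.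
  rewrite normrM; have := Hd s s0 sd; rewrite ler_pdivlMr ?ltr_wpDl// => H.
  by apply: le_trans H; rewrite mulrC ler_wpM2l// lerDl.
have tq : testM M (fun y => q y * th y).
  split; first exact: testfMl.
  by move=> y yM; rewrite HM ?mulr0.
have Bq j y : (j <= k)%N -> `|y| <= M -> `|D j q y| <= s * (Bp * (1 + `|M|)).
  move=> jk yM; have yM2 : `|y| <= `|M| by apply: le_trans yM (ler_norm _).
  have in1 z : `|z| <= `|y| -> `|x0 + s * z| <= `|x0| + `|M|.
    move=> zy; rewrite (le_trans (ler_normD _ _))// lerD2l normrM (gtr0_norm s0).
    by have := normr_ge0 z; nra.
  case: j jk => [_|j jk].
    rewrite D0 /q; have [c cy ->] := mvt_norm x0 (x0 + s * y) (smooth_der0 sp).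
    have xy : x0 + s * y - x0 = s * y by ring.
    rewrite xy in cy *; rewrite normrM [`|s * y|]normrM (gtr0_norm s0) mulrCA; apply: ler_wpM2l; first exact: ltW.
    apply: ler_pM => //; last by rewrite (le_trans yM2)// lerDr.
    apply: HBp => //; have := ler_normD (c - x0) x0; rewrite subrK => h1.
    rewrite addrC (le_trans h1)// lerD2r (le_trans cy)// normrM (gtr0_norm s0).
    by have := normr_ge0 y; nra.
  rewrite /q D_B; [|exact: smooth_affine|exact: smooth_cst].
  rewrite D_cst subr0 D_affine// exprS normrM normrM (gtr0_norm s0) -mulrA; apply: ler_wpM2l; first exact: ltW.
  apply: (@le_trans _ _ Bp); last by rewrite ler_peMr// lerDl.
  rewrite -[leRHS]mul1r ler_pM//; last by apply: HBp; [exact: leqW|exact: in1].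
  by rewrite ger0_norm ?exprn_ge0 ?exprn_ile1//; exact: ltW.
apply: (le_trans (HC s _ (s * (2 ^+ k * (Bp * (1 + `|M|) * A))) s0 (ltW s1) tq _)); last first.
  rewrite mulrCA -/K; move: sK; rewrite ltr_pdivlMr ?ltr_wpDl//; nra.
move=> j y jk; have R0 : 0 <= s * (2 ^+ k * (Bp * (1 + `|M|) * A)).
  by rewrite !mulr_ge0 ?exprn_ge0 ?addr_ge0// ltW.
have [yM|yM] := ltP M `|y|.
  by rewrite (@D_out _ _ _ _ M) ?normr0//; [exact: tq.1.1|exact: tq.2].
apply: (le_trans (@leibniz_bound _ _ _ j y (s * (Bp * (1 + `|M|))) A sq tth.1 _ _)).
- by move=> i ij; apply: Bq => //; exact: leq_trans jk.
- by move=> i ij; apply: HA; exact: leq_trans jk.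
rewrite [leRHS](_ : _ = 2 ^+ k * (s * (Bp * (1 + `|M|)) * A)); last by ring.
rewrite ler_wpM2r ?ler_weXn2l ?ler1n//.
by rewrite !mulr_ge0 ?addr_ge0// ltW.
Qed.

End AtPoint.
End DyadicCore.

(** * Differentiation of [T] in a parameter, and the heat equation *)

Section ParameterDerivatives.
Context {R : realType}.
Implicit Types (f g phi psi theta eta : R -> R) (a b x y z h s t p w B C d e : R) (n k m j : nat).

Lemma der_id x : is_derive x 1 (fun y : R => y) 1.
Proof. exact: is_derive_id. Qed.

(** Differentiability is asked between the two points only: the Gaussian kernel is differentiable in
    its width for positive widths. *)
Lemma mvt_loc f g x y : (forall z, Num.min x y <= z <= Num.max x y -> is_derive z 1 f (g z)) ->
  exists c, [/\ Num.min x y <= c, c <= Num.max x y & f y - f x = g c * (y - x)].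
Proof.
move=> fg.
have cf a b : Num.min x y = a -> Num.max x y = b -> {within `[a, b], continuous f}.
  move=> <- <-; apply: continuous_in_subspaceT => z; rewrite inE /= in_itv /= => /fg zD.
  by apply/differentiable_continuous/derivable1_diffP; case: zD.
have fg2 a b : Num.min x y = a -> Num.max x y = b -> forall z, z \in `]a, b[ -> is_derive z 1 f (g z).
  move=> <- <- z; rewrite in_itv /= => /andP[? ?]; apply: fg.
  by apply/andP; split; exact: ltW.
case: (leP x y) cf fg2 => xy cf fg2.
  have [c] := @MVT_segment _ f g x y xy (fg2 _ _ erefl erefl) (cf _ _ erefl erefl).
  by rewrite in_itv /= => /andP[? ?] ?; exists c.
have [c] := @MVT_segment _ f g y x (ltW xy) (fg2 _ _ erefl erefl) (cf _ _ erefl erefl).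
rewrite in_itv /= => /andP[? ?] E; exists c; split => //.
by rewrite -opprB E -mulrN opprB.
Qed.

Lemma mvt_loc_norm f g x y : (forall z, `|z - x| <= `|y - x| -> is_derive z 1 f (g z)) ->
  exists2 c, `|c - x| <= `|y - x| & f y - f x = g c * (y - x).
Proof.
have H z : Num.min x y <= z -> z <= Num.max x y -> `|z - x| <= `|y - x|.
  by case: (leP x y) => xy c1 c2; [rewrite !ger0_norm|rewrite !ler0_norm]; lra.
move=> fg; have [z /andP[z1 z2]|c [c1 c2 E]] := @mvt_loc f g x y.
  by apply: fg; exact: H.
by exists c => //; exact: H.
Qed.

Lemma taylor1_loc f g g1 x h C : (forall y, `|y - x| <= `|h| -> is_derive y 1 f (g y)) ->
  (forall y, `|y - x| <= `|h| -> is_derive y 1 g (g1 y)) ->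
  (forall y, `|y - x| <= `|h| -> `|g1 y| <= C) ->
  `|f (x + h) - f x - h * g x| <= C * h ^+ 2.
Proof.
move=> fg gg1 g1C; have xh : x + h - x = h by lra.
have [|c c1 ->] := @mvt_loc_norm f g x (x + h); first by rewrite xh.
rewrite xh in c1 *; rewrite mulrC -mulrBr.
have [|d d1 ->] := @mvt_loc_norm g g1 x c.
  by move=> z zc; apply: gg1; exact: le_trans c1.
have H : `|g1 d| * `|c - x| <= C * `|h|.
  by apply: ler_pM => //; apply: g1C; exact: le_trans c1.
rewrite -[h ^+ 2]real_normK ?num_real// !normrM (_ : C * _ = `|h| * (C * `|h|)); last by ring.
by rewrite ler_wpM2l.
Qed.

Lemma der_approx f x d : is_derive x 1 f d -> forall eps : R, 0 < eps ->
  exists2 e, 0 < e & forall h, `|h| < e -> `|f (x + h) - f x - h * d| <= eps * `|h|.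
Proof.
move=> [df dE] eps e0.
have : h^-1 *: (f (h *: 1 + x) - f x) @[h --> 0^'] --> d by rewrite -dE; exact: df.
move=> /cvgrPdist_le/(_ _ e0)/nbhs_ballP[e /= e1 He]; exists e => // h he.
have [->|h0] := eqVneq h 0; first by rewrite addr0 subrr mul0r subr0 !normr0 mulr0.
have := He h; rewrite /ball /= sub0r normrN => /(_ he h0).
rewrite /GRing.scale /= mulr1 (addrC h x) distrC => H.
rewrite (_ : _ - h * d = h * (h^-1 * (f (x + h) - f x) - d)); last by field.
by rewrite normrM mulrC ler_wpM2r.
Qed.

Lemma min_right f x d e : is_derive x 1 f d -> 0 < e ->
  (forall h, 0 < h -> h < e -> f x <= f (x + h)) -> 0 <= d.
Proof.
move=> df e0 H; rewrite leNgt; apply/negP => d0.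
have [|r r0 Hr] := der_approx df (_ : 0 < - d / 2); first by lra.
have m0 : 0 < Num.min e r by rewrite lt_min e0.
have [m1 m2] : Num.min e r <= e /\ Num.min e r <= r by rewrite !ge_min !lexx orbT.
pose h := Num.min e r / 2; have h0 : 0 < h by rewrite /h; lra.
have hr : `|h| < r by rewrite (gtr0_norm h0) /h; lra.
have := Hr h hr; rewrite (gtr0_norm h0) ler_norml => /andP[_ h1].
have he : h < e by rewrite /h; lra.
have := H h h0 he; nra.
Qed.

Lemma min_left f x d e : is_derive x 1 f d -> 0 < e ->
  (forall h, 0 < h -> h < e -> f x <= f (x - h)) -> d <= 0.
Proof.
move=> df e0 H; rewrite leNgt; apply/negP => d0.
have [|r r0 Hr] := der_approx df (_ : 0 < d / 2); first by lra.
have m0 : 0 < Num.min e r by rewrite lt_min e0.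
have [m1 m2] : Num.min e r <= e /\ Num.min e r <= r by rewrite !ge_min !lexx orbT.
pose h := Num.min e r / 2; have h0 : 0 < h by rewrite /h; lra.
have hr : `|- h| < r by rewrite normrN (gtr0_norm h0) /h; lra.
have := Hr (- h) hr; rewrite normrN (gtr0_norm h0) ler_norml => /andP[_ h1].
have he : h < e by rewrite /h; lra.
have := H h h0 he; nra.
Qed.

Lemma min_second f g x d e : (forall x, is_derive x 1 f (g x)) -> is_derive x 1 g d ->
  0 < e -> (forall h, `|h| < e -> f x <= f (x + h)) -> 0 <= d.
Proof.
move=> fg gd e0 H; rewrite leNgt; apply/negP => d0.
have gx : g x = 0.
  apply/eqP; rewrite eq_le; apply/andP; split.
    apply: (min_left (fg x) e0) => h h0 he; apply: H.
    by rewrite normrN (gtr0_norm h0).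
  by apply: (min_right (fg x) e0) => h h0 he; apply: H; rewrite (gtr0_norm h0).
have [|r r0 Hr] := der_approx gd (_ : 0 < - d / 2); first by lra.
have m0 : 0 < Num.min e r by rewrite lt_min e0.
have [m1 m2] : Num.min e r <= e /\ Num.min e r <= r by rewrite !ge_min !lexx orbT.
pose h := Num.min e r / 2; have h0 : 0 < h by rewrite /h; lra.
have xh : x < x + h by lra.
have [c] := @MVT _ f g x (x + h) xh (fun z _ => fg z)
  (continuous_subspaceT (der_continuous fg)).
rewrite in_itv /= => /andP[xc ch] E.
have he : `|h| < e by rewrite (gtr0_norm h0) /h; lra.
have := H h he; have := Hr (c - x); rewrite gtr0_norm; last by clear -xc; lra.
have -> : x + (c - x) = c by ring.
have cr : c - x < r by move: ch; rewrite /h; clear -r0 m2; lra.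
move=> /(_ cr); rewrite gx subr0 ler_norml => /andP[_ h1].
have gc : g c < 0 by nra.
by rewrite -subr_ge0 E; nra.
Qed.

Section OnEdist.
Variables (a b : R) (T : (R -> R) -> R).
Hypothesis eT : edist a b T.

(** Differentiation under [T]: as [T] has finite order, a quadratic remainder uniform in [z] for
    each derivative is enough. *)
Lemma edist_param (Phi : R -> R -> R) dPhi p : (forall p, Cinf (Phi p)) -> Cinf dPhi ->
  (forall j, exists C e, 0 < e /\ forall h z, `|h| < e ->
     `|D j (Phi (p + h)) z - D j (Phi p) z - h * D j dPhi z| <= C * h ^+ 2) ->
  is_derive p 1 (fun p => T (Phi p)) (T dPhi).
Proof.
move=> sPhi sd HP; have [C0 [k [C00 HC]]] := edist_bound eT.
have [C [e [e0 HCe]]] : exists C e, 0 < e /\ forall j h z, (j <= k)%N -> `|h| < e ->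
     `|D j (Phi (p + h)) z - D j (Phi p) z - h * D j dPhi z| <= C * h ^+ 2.
  elim: k {HC} => [|k [C [e [e0 IH]]]].
    have [C [e [e0 He]]] := HP 0%N; exists C, e; split => // j h z.
    by rewrite leqn0 => /eqP ->; exact: He.
  have [C1 [e1 [e10 He]]] := HP k.+1; exists (Num.max C C1), (Num.min e e1).
  split; first by rewrite lt_min e0.
  move=> j h z; rewrite leq_eqVlt lt_min => /predU1P[->|jk] /andP[h1 h2].
    apply: (le_trans (He h z h2)); rewrite ler_wpM2r ?exprn_even_ge0//.
    by rewrite le_max lexx orbT.
  apply: (le_trans (IH j h z jk h1)); rewrite ler_wpM2r ?exprn_even_ge0//.
  by rewrite le_max lexx.
apply: (@is_derive_quad _ _ _ _ (C0 * C) e) => // h he.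
have -> : T (Phi (p + h)) - T (Phi p) - h * T dPhi =
    T (fun z => Phi (p + h) z - Phi p z - h * dPhi z).
  rewrite (edistB eT); [|by apply: smoothB|exact: smoothZ].
  by rewrite (edistB eT)// (edistZ eT).
rewrite -mulrA; apply: HC; first by apply: smoothB; [exact: smoothB|exact: smoothZ].
move=> j z jk _; rewrite D_B; [|exact: smoothB|exact: smoothZ].
by rewrite D_B// D_Z//; exact: HCe.
Qed.

Lemma is_derive_transl F x t z : Cinf F ->
  is_derive x 1 (fun x => F ((z - x) / t)) (- t^-1 * D 1 F ((z - x) / t)).
Proof.
move=> sF; apply: (@der_comp _ _ _ (fun x => (z - x) / t)); first exact: smooth_der0.
have := derZ t^-1 (derB (der_cst z x) (is_derive_id x 1)).
by rewrite sub0r mulrN1; congr is_derive; apply/funext => y; rewrite mulrC.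
Qed.

Lemma edist_transl F x t : t != 0 -> Cinf F ->
  (forall j, exists B, forall y, `|D j.+2 F y| <= B) ->
  is_derive x 1 (fun x => T (fun z => F ((z - x) / t)))
    (- t^-1 * T (fun z => D 1 F ((z - x) / t))).
Proof.
move=> t0 sF bF; rewrite -(edistZ eT); last by apply: smooth_scale; exact: smooth_D.
apply: edist_param => [p||j].
- exact: smooth_scale.
- by apply: smoothZ; apply: smooth_scale; exact: smooth_D.
- have [B HB] := bF j; exists (`|t^-1| ^+ j.+2 * B), 1; split=> // h z _.
  rewrite !D_scale// D_Z; last by apply: smooth_scale; exact: smooth_D.
  rewrite D_scale; last exact: smooth_D.
  have -> : D j (D 1 F) = D j.+1 F by rewrite -DS.
  have d1 (y : R) : is_derive y 1 (fun y => t^-1 ^+ j * D j F ((z - y) / t))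
      (t^-1 ^+ j * (- t^-1 * D j.+1 F ((z - y) / t))).
    by rewrite DSr; apply: derZ; apply: is_derive_transl; exact: smooth_D.
  have d2 (y : R) : is_derive y 1 (fun y => t^-1 ^+ j * (- t^-1 * D j.+1 F ((z - y) / t)))
      (t^-1 ^+ j * (- t^-1 * (- t^-1 * D j.+2 F ((z - y) / t)))).
    by rewrite [D j.+2 F]DSr; apply: derZ; apply: derZ; apply: is_derive_transl; exact: smooth_D.
  have := @taylor1 _ _ _ _ x h (`|t^-1| ^+ j.+2 * B) d1 d2 => /=.
  rewrite (mulrCA (- t^-1) (t^-1 ^+ j) (D j.+1 F _)); apply => y _.
  rewrite !normrM normrX normrN !exprS !mulrA; have := HB ((z - y) / t).
  set u := `|t^-1|; set v := `|D _ _ _| => vB.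
  have -> : u ^+ j * u * u = u * u * u ^+ j by ring.
  have u0 : 0 <= u by rewrite /u.
  by apply: ler_wpM2l => //; rewrite !mulr_ge0 ?exprn_ge0.
Qed.

Lemma D_erfn_bounded j : exists2 B : R, 0 <= B & forall y, `|D j.+1 erfn y| <= B.
Proof.
have [C C0 HC] := @D_gauss_bounded R j 0; exists C => // y.
by have := HC y; rewrite expr0 mul1r D_erfn.
Qed.

(** The equation [E'' = - y E'] differentiated [j] times; it is the profile equation behind the
    self-similar solution [erfn (w / t)] of the heat equation. *)
Lemma erfn_ode j y : - j%:R * D j erfn y - y * D j.+1 erfn y = D j.+2 erfn y :> R.
Proof.
elim: j y => [|j IH] y.
  rewrite mulNr mul0r oppr0 sub0r !D_erfn D0 (der_D1 gauss_der)//.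
have sD i : Cinf (D i (@erfn R)) by apply: smooth_D; exact: Cinf_erfn.
have E : D j.+2 (@erfn R) = fun y => - j%:R * D j erfn y - y * D j.+1 erfn y.
  by apply/funext => z; rewrite IH.
have : D j.+3 (@erfn R) y = D 1 (fun y => - j%:R * D j erfn y - y * D j.+1 erfn y) y.
  by rewrite DSr E.
have d1 (z : R) : is_derive z 1 (fun y => - j%:R * D j erfn y - y * D j.+1 erfn y)
   (- j%:R * D j.+1 erfn z - (1 * D j.+1 erfn z + z * D j.+2 erfn z)).
  apply: derB; first by apply: derZ; apply: smooth_der; exact: Cinf_erfn.
  exact: (derM (der_id z) (smooth_der j.+1 (@Cinf_erfn R) z)).
by rewrite (der_D1 d1) => ->; rewrite -natr1; ring.
Qed.

(** Since [t] is a standard deviation, the heat equation carries a factor [t]: the usual time is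
    [t ^+ 2 / 2]. *)
Lemma erfn_heat j w t : 0 < t -> is_derive t 1 (fun t => t^-1 ^+ j * D j erfn (w / t))
  (t * (t^-1 ^+ j.+2 * D j.+2 erfn (w / t)) : R).
Proof.
move=> t0; have tn : t != 0 by rewrite gt_eqF.
have dV : is_derive t 1 (fun y : R => y^-1) (- t ^- 2).
  have := @is_deriveV R (fun y => y) t 1 1 tn (is_derive_id t 1).
  by rewrite /GRing.scale /= mulr1.
have dk : is_derive t 1 (fun y : R => y^-1 ^+ j) (- j%:R * t^-1 ^+ j.+1).
  elim: (j) => [|i IH].
    have := der_cst (1 : R) t; rewrite mulNr mul0r oppr0.
    by congr is_derive; apply/funext => y; rewrite expr0.
  have := derM IH dV; rewrite (_ : _ + _ = - i.+1%:R * t^-1 ^+ i.+2).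
    by congr is_derive; apply/funext => y; rewrite exprSr.
  by rewrite -exprVn -natr1 !exprS !expr0; ring.
have sD : Cinf (D j (@erfn R)) by apply: smooth_D; exact: Cinf_erfn.
have dw : is_derive t 1 (fun t => D j erfn (w / t)) (w * - t ^- 2 * D j.+1 erfn (w / t)).
  by rewrite DSr; exact: (@der_comp _ _ _ (fun t => w / t) _ t (smooth_der0 sD _) (derZ w dV)).
apply: (is_derive_eq (derM dk dw)).
rewrite -(erfn_ode j (w / t)) -exprVn !exprS !expr0.
set A := D j erfn _; set B := D j.+1 erfn _; set q := t^-1 ^+ j.
by field.
Qed.

Lemma edist_heat x t : 0 < t -> is_derive t 1 (fun t => T (fun z => erfn ((z - x) / t)))
    (t^-1 * T (fun z => D 1 gauss ((z - x) / t))).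
Proof.
move=> t0; have tn : t != 0 by rewrite gt_eqF.
have sG : Cinf (D 1 (@gauss R)) by apply: smooth_D; exact: Cinf_gauss.
rewrite -(edistZ eT); last exact: smooth_scale.
apply: edist_param => [p||j]; [by apply: smooth_scale; exact: Cinf_erfn|
  by apply: smoothZ; exact: smooth_scale|].
have [B2 B20 HB2] := D_erfn_bounded j.+1; have [B4 B40 HB4] := D_erfn_bounded j.+3.
(* Increments below [t / 2] keep the widths in [[t / 2, 2 * t]]; [u] bounds their inverses. *)
pose u := (t / 2)^-1.
have u0 : 0 < u by rewrite invr_gt0 divr_gt0.
exists (u ^+ j.+2 * B2 + (2 * t) ^+ 2 * (u ^+ j.+4 * B4)), (t / 2); split; first by rewrite divr_gt0.
move=> h z ht.
have sE : Cinf (@erfn R) by exact: Cinf_erfn.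
rewrite !D_scale// D_Z; last exact: smooth_scale.
rewrite D_scale//; have -> : D j (D 1 (@gauss R)) = D j.+2 erfn by rewrite D_erfn -DS.
pose f s := s^-1 ^+ j * D j erfn ((z - x) / s).
pose f1 s := s * (s^-1 ^+ j.+2 * D j.+2 erfn ((z - x) / s)).
pose f2 s := 1 * (s^-1 ^+ j.+2 * D j.+2 erfn ((z - x) / s)) +
   s * (s * (s^-1 ^+ j.+4 * D j.+4 erfn ((z - x) / s))).
have near_t y : `|y - t| <= `|h| -> t / 2 <= y /\ y <= 2 * t.
  by move=> yh; have := le_lt_trans yh ht; rewrite ltr_norml => /andP[? ?]; split; lra.
have := @taylor1_loc f f1 f2 t h (u ^+ j.+2 * B2 + (2 * t) ^+ 2 * (u ^+ j.+4 * B4)).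
rewrite /f /f1.
have -> : t * (t^-1 ^+ j.+2 * D j.+2 erfn ((z - x) / t)) = t^-1 * (t^-1 ^+ j * D j.+2 erfn ((z - x) / t)).
  by rewrite !exprS; set q := t^-1 ^+ j; field.
apply=> y /near_t[y1 y2]; have y0 : 0 < y by clear -eT t0 y1; lra.
- exact: erfn_heat.
- exact: (derM (der_id y) (erfn_heat j.+2 (z - x) y0)).
- have yu : y^-1 <= u by rewrite lef_pV2// posrE; clear -eT t0; lra.
  have yi : 0 <= y^-1 by rewrite invr_ge0; exact: ltW.
  have ypow i : y^-1 ^+ i <= u ^+ i by rewrite lerXn2r// nnegrE//; exact: ltW.
  have ypow0 i : 0 <= y^-1 ^+ i by rewrite exprn_ge0.
  rewrite /f2 mul1r (le_trans (ler_normD _ _))// lerD//.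
    by rewrite normrM (ger0_norm (ypow0 _)) ler_pM.
  rewrite mulrA -expr2 normrM [`|_ * D _ _ _|]normrM (ger0_norm (ypow0 _)).
  rewrite [`|y ^+ 2|]ger0_norm ?exprn_even_ge0//; apply: ler_pM; rewrite ?exprn_even_ge0//.
  + by rewrite mulr_ge0.
  + by rewrite lerXn2r ?nnegrE//; clear -eT t0 y1; lra.
  + by rewrite ler_pM.
Qed.

End OnEdist.
End ParameterDerivatives.

(** * Uniform smallness at a corner of a gap *)

Section UniformCorner.
Context {R : realType}.
Implicit Types (f g phi psi theta : R -> R) (a b c x y z h s t p w B C d e : R) (n k m j J : nat).

Lemma der_shift c y : is_derive y 1 (fun y => y - c) 1.
Proof. by have := derB (der_id y) (der_cst c y); rewrite subr0. Qed.

Lemma Cinf_shift f c : Cinf f -> Cinf (fun y => f (y - c)).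
Proof. by move=> sf; apply: smooth_comp_affine => // y; exact: der_shift. Qed.

Lemma D_shift f c n : Cinf f -> D n (fun y => f (y - c)) = fun y => D n f (y - c).
Proof.
move=> sf; rewrite (D_comp_affine _ sf (der_shift c)).
by apply/funext => y; rewrite expr1n mul1r.
Qed.

(** A decreasing step, 1 up to 1 and 0 from 2 on. It localises at a left corner, and
    [lam ((z - x) / s)] is also a smoothed indicator of [z <= x], used further on to express point
    values of primitives. *)
Definition lam y : R := 1 - step (y - 1).

Lemma Cinf_lam : Cinf lam.
Proof.
by apply: smoothB; [exact: smooth_cst|apply: Cinf_shift; exact: Cinf_step].
Qed.

Lemma lam1 y : y <= 1 -> lam y = 1.
Proof. by move=> y1; rewrite /lam step0 ?subr0//; lra. Qed.

Lemma lam0 y : 2 <= y -> lam y = 0.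
Proof. by move=> y1; rewrite /lam step1 ?subrr//; lra. Qed.

Lemma lam_ge0 y : 0 <= lam y.
Proof. by rewrite /lam subr_ge0 step_le1. Qed.

Lemma lam_le1 y : lam y <= 1.
Proof. by rewrite /lam gerBl step_ge0. Qed.

(** The indicator of [[c, d]] convolved with the Gaussian. *)
Definition erfn_slab c d y : R := erfn (y - c) - erfn (y - d).

Lemma Cinf_erfn_shift c : Cinf (fun y : R => erfn (y - c)).
Proof. by apply: Cinf_shift; exact: Cinf_erfn. Qed.

Lemma Cinf_slab c d : Cinf (erfn_slab c d).
Proof. by apply: smoothB; exact: Cinf_erfn_shift. Qed.

Lemma D_slab c d n y : D n (erfn_slab c d) y = D n erfn (y - c) - D n erfn (y - d).
Proof.
rewrite /erfn_slab D_B; [|exact: Cinf_erfn_shift..].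
by rewrite !D_shift//; exact: Cinf_erfn.
Qed.

(** A slab to the right of 0 may be arbitrarily long, but its tail on the left is no larger than
    that of a half line; hence a bound uniform in [c] and [d]. *)
Lemma slab_tail k : exists2 C, 0 <= C & forall m c d z, (m <= k)%N -> 0 <= c -> c <= d ->
  z < 0 -> `|z| ^+ m.+1 * `|D m (erfn_slab c d) z| <= C.
Proof.
have H m : exists2 C, 0 <= C & forall c d z, 0 <= c -> c <= d ->
  z < 0 -> `|z| ^+ m.+1 * `|D m (erfn_slab c d) z| <= C.
  case: m => [|m].
    have [C C0 HC] := @erfn_tail R; exists C; first exact: ltW.
    move=> c d z c0 cd z0; rewrite D_slab D0 expr1.
    have zc : z - c < 0 by lra.
    have zdc : z - d <= z - c by lra.
    have := HC _ _ zdc (or_intror zc).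
    have dE : 0 <= erfn (z - c) - erfn (z - d) by rewrite subr_ge0 erfn_le.
    rewrite (ger0_norm dE) => H.
    have zV : `|(z - d)^-1 - (z - c)^-1| <= `|z|^-1.
      have zd0 : z - d < 0 by clear -c0 cd z0; lra.
      have h1 : (z - c)^-1 <= (z - d)^-1 by rewrite lef_nV2.
      have h2 : (z - d)^-1 <= 0 by rewrite invr_le0 ltW.
      rewrite ger0_norm ?subr_ge0//.
      apply: (@le_trans _ _ (- (z - c)^-1)); first by clear -h2; lra.
      rewrite ltr0_norm// -invrN lef_pV2 ?posrE; clear -c0 z0; lra.
    have z1 : 0 < `|z| by rewrite normr_gt0 lt_eqF.
    apply: (@le_trans _ _ (`|z| * (C * `|z|^-1))).
      by rewrite ler_wpM2l// (le_trans H)// ler_wpM2l// ltW.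
    by rewrite mulrCA divff ?mulr1// gt_eqF.
  have [C C0 HC] := @D_gauss_bounded R m m.+2; exists (C + C); first by rewrite addr_ge0.
  move=> c d z c0 cd z0; rewrite D_slab !D_erfn.
  have key v : v <= z -> `|z| ^+ m.+2 * `|D m gauss v| <= C.
    move=> vz; apply: le_trans (HC v); rewrite ler_wpM2r// lerXn2r ?nnegrE//.
    by rewrite !ltr0_norm//; lra.
  rewrite (le_trans (ler_wpM2l _ (ler_normB _ _))) ?exprn_ge0// mulrDr lerD//; apply: key; lra.
elim: k => [|k [C C0 IH]].
  have [C C0 HC] := H 0%N; exists C => // m c d z.
  by rewrite leqn0 => /eqP ->; exact: HC.
have [B B0 HB] := H k.+1; exists (Num.max B C); first by rewrite le_max B0.
move=> m c d z; rewrite leq_eqVlt => /predU1P[->|mk] c0 cd z0; rewrite le_max.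
  by rewrite HB.
by rewrite (IH _ _ _ _ mk c0 cd z0) orbT.
Qed.

(** Compactness in [c]: nearby endpoints give nearby slabs, and endpoints far to the right cannot be
    told apart on [|y| <= M]. *)
Lemma erfn_net k (M eps : R) : 0 < eps -> exists delta n, 0 < delta /\ forall c, 0 <= c ->
  exists2 i, (i <= n)%N & forall m y, (m <= k)%N -> `|y| <= M ->
    `|D m (erfn_slab (i%:R * delta) c) y| <= eps.
Proof.
move=> e0.
have [B B0 HB] : exists2 B, 0 <= B & forall m y, (m <= k)%N -> `|D m.+1 (@erfn R) y| <= B.
  elim: k => [|k [B B0 IH]].
    by have [B B0 HB] := @D_erfn_bounded R 0; exists B => // m y; rewrite leqn0 => /eqP ->.
  have [C C0 HC] := @D_erfn_bounded R k.+1; exists (Num.max B C); first by rewrite le_max B0.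
  move=> m y; rewrite leq_eqVlt => /predU1P[->|mk]; rewrite le_max; first by rewrite HC orbT.
  by rewrite IH.
have [C C0 HC] := slab_tail k.
pose delta := eps / (B + 1).
have dl0 : 0 < delta by rewrite divr_gt0// ltr_wpDl.
(* At distance more than [1 + C / eps] to the left of a slab the tail bound [C / |v|] is below
   [eps]. *)
pose N0 := `|M| + 1 + C / eps.
exists delta, (Num.truncn (N0 / delta)).+1; split=> // c c0.
set n := (Num.truncn _).+1.
have nN : N0 < n%:R * delta by rewrite -ltr_pdivrMr//; exact: truncnS_gt.
have sE m : Cinf (D m (@erfn R)) by apply: smooth_D; exact: Cinf_erfn.
have [cn|nc] := leP c (n%:R * delta).
  have q0 : 0 <= c / delta by rewrite divr_ge0// ltW.
  have q1 : (Num.truncn (c / delta))%:R <= c / delta by rewrite truncn_le.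
  exists (Num.truncn (c / delta)).
    by rewrite -(ler_nat R) (le_trans q1)// ler_pdivrMr.
  move=> m y mk _; rewrite D_slab.
  have := q1; have := truncnS_gt (c / delta); rewrite -natr1.
  set i := (Num.truncn _)%:R; rewrite ler_pdivlMr// ltr_pdivrMr// => h1 h2.
  have := mvt_le (y - c) (y - i * delta) (smooth_der0 (sE m)).
  move=> /(_ B); rewrite -DSr => H; apply: (le_trans (H (fun v => HB m v mk))).
  have -> : y - i * delta - (y - c) = c - i * delta by ring.
  rewrite ger0_norm ?subr_ge0//.
  apply: (@le_trans _ _ (B * delta)); first by rewrite ler_wpM2l//; clear -h1; lra.
  by rewrite /delta mulrCA ger_pMr// ler_pdivrMr ?ltr_wpDl// mul1r lerDl.
exists n => // m y mk yM; have MM := ler_norm M.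
pose v := y - n%:R * delta.
have vN : v < - (1 + C / eps) by rewrite /v; move: yM; rewrite ler_norml /N0 in nN *; clear -MM nN; lra.
have Ce : 0 <= C / eps by rewrite divr_ge0// ltW.
have v0 : v < 0 by clear -vN Ce; lra.
have -> : D m (erfn_slab (n%:R * delta) c) y = D m (erfn_slab 0 (c - n%:R * delta)) v.
  rewrite !D_slab /v subr0; congr (_ - D m erfn _); ring.
have := HC m 0 (c - n%:R * delta) v mk (lexx 0); rewrite subr_ge0 => /(_ (ltW nc) v0).
have v1 : 1 + C / eps < `|v| by rewrite ltr0_norm//; clear -vN; lra.
have v2 : `|v| <= `|v| ^+ m.+1.
  by rewrite exprS ler_peMr// exprn_ege1//; clear -Ce v1; lra.
set q := `|D m _ _| => H.
have q0 : 0 <= q by rewrite /q.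
have : (C / eps) * q <= C by apply: le_trans H; rewrite ler_wpM2r//; clear -v1 v2; lra.
have vp : `|v| * q <= C by apply: le_trans H; rewrite ler_wpM2r.
have E : C / eps * eps = C by rewrite divfK// gt_eqF.
by rewrite leNgt => _; apply/negP => qe; nra.
Qed.

Section AtPoint.
Variables (a b : R) (T : (R -> R) -> R) (x0 : R).
Hypotheses (eT : edist a b T) (nT : null_at T x0).

(** [null_at] treats one test function at a time, while the slabs form a non-compact family. The
    dyadic decomposition with [slab_tail] disposes of large [|y|] uniformly; on the remaining
    bounded range a finite net of slabs suffices. The factor [lam] removes the right side, where
    slabs need not be small. *)
Lemma uniform_corner (eps : R) : 0 < eps -> exists2 tau, 0 < tau & forall t c d,
  0 < t -> t < tau -> 0 <= c -> c <= d ->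
  `|T (fun x => lam ((x - x0) / t) * erfn_slab c d ((x - x0) / t))| <= eps.
Proof.
move=> e0; pose S := `|x0| + `|a| + `|b| + 1.
have S0 : 0 < S by rewrite /S ltr_wpDl// !addr_ge0.
have [aS bS] : x0 - S <= a - 1 /\ b + 1 <= x0 + S.
  rewrite /S; have := ler_norm x0; have := ler_norm (- x0); have := ler_norm b.
  have := ler_norm (- a); have := ler_norm a; have := ler_norm (- b).
  by rewrite !normrN; split; clear -eT nT H H1 H2 H4 H0 H3; lra.
have [C [k [C0 HC]]] := dyadic_core eT nT S0 aS bS.
have [C1 C10 HC1] := slab_tail k.
pose N := 2 ^+ k.+1 * C1.
have N0 : 0 <= N by rewrite mulr_ge0// exprn_ge0.
have half : 0 < 2^-1 :> R by rewrite invr_gt0.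
have half1 : 2^-1 < 1 :> R by rewrite invf_lt1// ltr1n.
have two n : 0 < 2 ^+ n :> R by rewrite exprn_gt0.
have Htail c d : 0 <= c -> c <= d -> forall j m y, (2 < j)%N -> (m <= k)%N ->
    2^-1 <= `|y| -> `|y| <= 2 ->
    (2 ^+ j) ^+ m * `|D m (fun y => lam y * erfn_slab c d y) (2 ^+ j * y)| <= N * 2^-1 ^+ j.
  move=> c0 cd j m y j2 mk y1 y2.
  have j4 : 4 <= 2 ^+ j * 2^-1 :> R.
    rewrite ler_pdivlMr// (_ : 4 * 2 = 2 ^+ 3); last by rewrite !exprS expr0; ring.
    by rewrite ler_weXn2l// ler1n.
  have NR : 0 <= N * 2^-1 ^+ j by rewrite mulr_ge0// exprn_ge0// ltW.
  have s1 : Cinf (fun y => lam y * erfn_slab c d y).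
    by apply: smoothM; [exact: Cinf_lam|exact: Cinf_slab].
  set z := 2 ^+ j * y.
  have zj : 2 ^+ j * 2^-1 <= `|z|.
    by rewrite normrM (gtr0_norm (two j)); apply: ler_wpM2l => //; exact: ltW.
  have [z0|z0] := ltP 0 z.
    rewrite (@D_local _ _ (fun=> 0) m z 1)//; [|exact: smooth_cst|].
      by rewrite D_zero normr0 mulr0.
    move=> v; rewrite ltr_norml => /andP[? ?]; rewrite lam0 ?mul0r//.
    by move: zj; rewrite (gtr0_norm z0); lra.
  have zl : z <= -4.
    by move: zj; rewrite ler0_norm//; clear -eT nT j4; lra.
  rewrite (@D_local _ _ (erfn_slab c d) m z 1)//; [|exact: Cinf_slab|]; last first.
    by move=> v; rewrite ltr_norml => /andP[? ?]; rewrite lam1 ?mul1r//; lra.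
  have z00 : z < 0 by clear -eT nT zl; lra.
  have := HC1 m c d z mk c0 cd z00; have := normr_ge0 (D m (erfn_slab c d) z).
  set q := `|D m _ _| => q0 Hq.
  rewrite exprVn ler_pdivlMr// mulrAC -exprSr.
  apply: (@le_trans _ _ ((2 * `|z|) ^+ m.+1 * q)).
    rewrite ler_wpM2r// lerXn2r ?nnegrE ?mulr_ge0//.
    by move: zj; rewrite ler_pdivrMr//; clear -eT nT; lra.
  rewrite exprMn -mulrA /N; apply: ler_pM => //.
    by rewrite mulr_ge0// exprn_ge0.
  by rewrite ler_weXn2l// ler1n.
(* [2 <= J] gives [2 < j] for the scales beyond [J], as [Htail] requires: at distance at least 4 the
   factor [lam] is locally constant, 0 or 1. *)
have [J J2 HJ] : exists2 J, (2 <= J)%N & C * N * (2^-1 ^+ J / (1 - 2^-1)) <= eps / 2.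
  pose q := 4 * (C * N) / eps.
  have q0 : 0 <= q by rewrite divr_ge0 ?mulr_ge0// ltW.
  pose J := (Num.truncn q).+2; exists J; first by [].
  have qJ : q <= 2 ^+ J.
    apply: ltW; apply: (lt_le_trans (truncnS_gt q)); rewrite -natrX ler_nat.
    by apply: leq_trans (leqnSn _) _; exact/ltnW/ltn_expl.
  have -> : 1 - 2^-1 = 2^-1 :> R by field.
  rewrite invrK exprVn mulrA mulrAC ler_pdivrMr// mulrC.
  move: qJ; rewrite /q ler_pdivrMr//; clear -eT nT; lra.
pose pl y := plateau (y / 2 ^+ J) * lam y.
have tpl : testf pl.
  apply: testfMr; last exact: Cinf_lam.
  have := testf_scale 0 (_ : 2 ^+ J != 0) (@testf_plateau R).
  by rewrite gt_eqF// => /(_ isT); under eq_fun do rewrite subr0.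
pose M := 2 ^+ J.+1 : R.
have pl0 x : M < `|x| -> pl x = 0.
  move=> Mx; rewrite /pl plateau0 ?mul0r// normrM normfV (gtr0_norm (two J)) ler_pdivlMr//.
  by rewrite -exprS ltW.
have tM c d : testM M (fun y => pl y * erfn_slab c d y).
  split; first by apply: testfMr => //; exact: Cinf_slab.
  by move=> x Mx; rewrite pl0// mul0r.
have [C2 [k2 [C20 HC2]]] := null_bound eT nT M 1.
have [A A0 HA] := testf_bounded k2 tpl.
pose K := C2 * (2 ^+ k2 * A) + 1.
have K0 : 0 < K by rewrite ltr_wpDl// !mulr_ge0// ltW.
have e8 : 0 < eps / 8 by rewrite divr_gt0.
have ek : 0 < eps / 8 / K by rewrite !divr_gt0.
have [delta [n [dl0 Hnet]]] := erfn_net k2 M ek.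
have [tau0 tau00 Htau] : exists2 tau, 0 < tau & forall i t, (i <= n)%N -> 0 < t -> t < tau ->
    `|T (fun x => pl ((x - x0) / t) * erfn_slab 0 (i%:R * delta) ((x - x0) / t))| <= eps / 8.
  elim: (n) => [|n' [tau1 tau10 IH]].
    have [tau1 tau10 H] := nT (tM 0 (0%:R * delta)).1 e8.
    by exists tau1 => // i t; rewrite leqn0 => /eqP ->; exact: H.
  have [tau2 tau20 H] := nT (tM 0 (n'.+1%:R * delta)).1 e8.
  exists (Num.min tau1 tau2); first by rewrite lt_min tau10.
  move=> i t; rewrite leq_eqVlt lt_min => /predU1P[->|ni] t0 /andP[t1 t2]; first exact: H.
  exact: IH.
have Hloc c t : 0 <= c -> 0 < t -> t < Num.min tau0 1 ->
    `|T (fun x => pl ((x - x0) / t) * erfn_slab 0 c ((x - x0) / t))| <= eps / 4.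
  move=> c0 t0; rewrite lt_min => /andP[t1 t2].
  have [i ni Hi] := Hnet c c0.
  have sPs c1 d1 : Cinf (fun x => pl ((x - x0) / t) * erfn_slab c1 d1 ((x - x0) / t)).
    by apply: (@smooth_scale _ (fun y => pl y * erfn_slab c1 d1 y)); exact: (tM c1 d1).1.1.
  have -> : T (fun x => pl ((x - x0) / t) * erfn_slab 0 c ((x - x0) / t)) =
    T (fun x => pl ((x - x0) / t) * erfn_slab 0 (i%:R * delta) ((x - x0) / t)) +
    T (fun x => pl ((x - x0) / t) * erfn_slab (i%:R * delta) c ((x - x0) / t)).
    rewrite -(edistD eT)//; congr T; apply/funext => x; rewrite /erfn_slab; ring.
  rewrite (le_trans (ler_normD _ _))//.
  have h1 := Htau i t ni t0 t1.
  have h2 : `|T (fun x => pl ((x - x0) / t) * erfn_slab (i%:R * delta) c ((x - x0) / t))| <= eps / 8.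
    apply: (le_trans (HC2 t _ (2 ^+ k2 * (A * (eps / 8 / K))) t0 (ltW t2) (tM (i%:R * delta) c) _)).
      move=> j y jk; have R0 : 0 <= 2 ^+ k2 * (A * (eps / 8 / K)).
        by rewrite mulr_ge0 ?exprn_ge0// mulr_ge0//; exact: ltW.
      have [yM|yM] := ltP M `|y|.
        by rewrite (@D_out _ _ _ _ M) ?normr0//; [exact: (tM _ _).1.1|exact: (tM _ _).2].
      apply: (le_trans (@leibniz_bound _ _ _ j y A (eps / 8 / K) tpl.1 (Cinf_slab _ _) _ _)).
      + by move=> l lj; apply: HA; exact: leq_trans jk.
      + by move=> l lj; apply: Hi => //; exact: leq_trans jk.
      + apply: ler_wpM2r; first by apply: mulr_ge0 => //; exact: ltW.
        by rewrite ler_weXn2l// ler1n.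
    rewrite (_ : C2 * _ = (C2 * (2 ^+ k2 * A)) * (eps / 8 / K)); last by ring.
    rewrite mulrCA ger_pMr; last by clear -eT nT e0 K0; lra.
    by rewrite ler_pdivrMr// mul1r /K lerDl.
  clear -eT nT K0 h1 h2; lra.
exists (Num.min (Num.min tau0 1) (S / 2 ^+ J)).
  by rewrite !lt_min tau00 ltr01 divr_gt0.
move=> t c d t0; rewrite lt_min => /andP[t1 t2] c0 cd.
have JS : 2 ^+ J * t <= S by move: t2; rewrite ltr_pdivlMr// mulrC => /ltW.
have s1 : Cinf (fun y => lam y * erfn_slab c d y).
  by apply: smoothM; [exact: Cinf_lam|exact: Cinf_slab].
have := HC t J (fun y => lam y * erfn_slab c d y) N 2^-1 t0 JS s1 N0 half half1.
move=> H; have {}H : `|T (fun x => lam ((x - x0) / t) * erfn_slab c d ((x - x0) / t)) -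
    T (fun x => plateau ((x - x0) / t / 2 ^+ J) *
      (lam ((x - x0) / t) * erfn_slab c d ((x - x0) / t)))| <= eps / 2.
  apply: le_trans (H _) HJ => j m y j2 _ mk y1 y2.
  by apply: Htail => //; exact: leq_ltn_trans j2.
have sPs c1 d1 : Cinf (fun x => pl ((x - x0) / t) * erfn_slab c1 d1 ((x - x0) / t)).
  by apply: (@smooth_scale _ (fun y => pl y * erfn_slab c1 d1 y)); exact: (tM c1 d1).1.1.
have E : T (fun x => plateau ((x - x0) / t / 2 ^+ J) * (lam ((x - x0) / t) * erfn_slab c d ((x - x0) / t))) =
  T (fun x => pl ((x - x0) / t) * erfn_slab 0 d ((x - x0) / t)) -
  T (fun x => pl ((x - x0) / t) * erfn_slab 0 c ((x - x0) / t)).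
  rewrite -(edistB eT)//; congr T; apply/funext => x; rewrite /pl /erfn_slab; ring.
move: H; rewrite E; have := Hloc c t c0 t0 t1; have := Hloc d t (le_trans c0 cd) t0 t1.
set A1 := T _; set A2 := T _; set A3 := T _.
rewrite !ler_norml => /andP[l1 r1] /andP[l2 r2] /andP[l3 r3]; apply/andP; split; clear -eT l1 r1 l2 r2 l3 r3; lra.
Qed.

End AtPoint.
End UniformCorner.

(** * Positivity on an interval: gluing, and the bottom of a gap *)

Section LocalPositivity.
Context {R : realType}.
Implicit Types (f g phi psi theta : R -> R) (T : (R -> R) -> R) (a b c x y z h s t p q w B C d e : R) (n k m j J : nat).

Definition reflect T f := T (fun x => f (- x)).

Lemma der_opp x : is_derive x 1 (fun x : R => - x) (-1).
Proof. exact: (derN (der_id x)). Qed.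

Lemma Cinf_opp f : Cinf f -> Cinf (fun x => f (- x)).
Proof. by move=> sf; apply: smooth_comp_affine => // x; exact: der_opp. Qed.

Lemma D_opp f n : Cinf f -> D n (fun x => f (- x)) = fun x => (-1) ^+ n * D n f (- x).
Proof. by move=> sf; apply: D_comp_affine => // x; exact: der_opp. Qed.

Lemma testf_opp f : testf f -> testf (fun x => f (- x)).
Proof.
move=> [sf [M HM]]; split; first exact: Cinf_opp.
by exists M => x xM; apply: HM; rewrite normrN.
Qed.

Lemma edist_reflect a b T : edist a b T -> edist (- b) (- a) (reflect T).
Proof.
move=> eT; split.
- by move=> c f g sf sg; rewrite /reflect (edistZD eT)//; exact: Cinf_opp.
- have [C [k [C0 HC]]] := edist_bound eT; exists C, k; split => // f B sf HB.
  apply: HC; first exact: Cinf_opp.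
  move=> j x jk /andP[? ?]; rewrite D_opp// normrM normrX normrN1 expr1n mul1r.
  by apply: HB => //; apply/andP; split; lra.
- move=> f e sf e0 f0; rewrite /reflect (@edist_local _ _ _ _ eT _ (fun=> 0) e)//.
  + exact: (edist0 eT).
  + exact: Cinf_opp.
  + exact: smooth_cst.
  + by move=> x /andP[? ?]; apply: f0; apply/andP; split; lra.
Qed.

Lemma null_reflect T x0 : null_at T x0 -> null_at (reflect T) (- x0).
Proof.
move=> nT th tth eps e0; have [d d0 Hd] := nT _ (testf_opp tth) _ e0.
exists d => // s s0 sd; have := Hd s s0 sd; congr (`|T _| <= _).
by apply/funext => x; congr th; rewrite -mulNr; congr (_ / _); ring.
Qed.

(** Positivity on the open interval []p, q[]; the bounds [p1] and [q1] say that the support of [psi]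
    is a compact part of it. *)
Definition pos T p q := forall psi p1 q1, testf psi -> (forall x, 0 <= psi x) -> p < p1 -> q1 < q ->
  (forall x, x < p1 \/ q1 < x -> psi x = 0) -> 0 <= T psi.

Lemma pos_sub T p q p1 q1 : p <= p1 -> q1 <= q -> pos T p q -> pos T p1 q1.
Proof.
move=> pp qq H psi p2 q2 tp p0 h1 h2; apply: H => //; first exact: le_lt_trans h1.
exact: lt_le_trans h2 qq.
Qed.

Lemma erfn_odd v : erfn (- v) = 2 * erfn 0 - erfn v :> R.
Proof.
have H : (fun v => erfn (- v)) = fun v => 2 * erfn 0 - erfn v :> R.
  apply: (@der_unique _ _ _ (fun v => - gauss v) 0).
  - move=> x; have := @der_comp _ erfn _ (fun x => - x) _ x (erfn_der (- x)) (der_opp x).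
    by rewrite mulN1r !gaussE sqrrN.
  - by move=> x; have := derB (der_cst (2 * erfn 0) x) (erfn_der x); rewrite sub0r.
  - by rewrite oppr0; ring.
by have := congr1 (fun f => f v) H.
Qed.

Section WithEdist.
Variables (a b : R) (T : (R -> R) -> R).
Hypothesis eT : edist a b T.

Lemma pos_left p q : q <= a -> pos T p q.
Proof.
move=> qa psi p1 q1 [sp _] _ _ q1q H.
have e0 : 0 < (a - q1) / 2 by lra.
rewrite (edist_local eT sp (@smooth_cst R 0) e0) ?(edist0 eT)// => x /andP[? ?].
by apply: H; right; lra.
Qed.

Lemma pos_right p q : b <= p -> pos T p q.
Proof.
move=> bp psi p1 q1 [sp _] _ pp1 _ H.
have e0 : 0 < (p1 - b) / 2 by lra.
rewrite (edist_local eT sp (@smooth_cst R 0) e0) ?(edist0 eT)// => x /andP[? ?].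
by apply: H; left; lra.
Qed.

Lemma glue_overlap p q r s : r < q -> pos T p q -> pos T r s -> pos T p s.
Proof.
move=> rq H1 H2 psi p1 s1 tp p0 pp1 s1s Hsupp.
have w0 : 0 < (q - r) / 3 by lra.
pose l x := step ((x - (r + (q - r) / 3)) / ((q - r) / 3)).
have sl : Cinf l by apply: smooth_scale; exact: Cinf_step.
have l0 x : x <= r + (q - r) / 3 -> l x = 0.
  by move=> xr; apply: step0; rewrite pmulr_lle0 ?invr_gt0// subr_le0.
have l1 x : r + (q - r) / 3 + (q - r) / 3 <= x -> l x = 1.
  by move=> xr; apply: step1; rewrite ler_pdivlMr// mul1r; lra.
have sl2 : Cinf (fun x => 1 - l x) by apply: smoothB => //; exact: smooth_cst.
have -> : psi = fun x => (1 - l x) * psi x + l x * psi x by apply/funext => x; ring.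
have t1 := testfMl sl2 tp; have t2 := testfMl sl tp.
rewrite (edistD eT t1.1 t2.1) addr_ge0//.
  apply: (H1 _ p1 (r + (q - r) / 3 + (q - r) / 3)) => //.
  - by move=> x; rewrite mulr_ge0// subr_ge0 step_le1.
  - by lra.
  - by move=> x [xp|xr]; [rewrite Hsupp ?mulr0//; left|rewrite l1 ?subrr ?mul0r//; exact: ltW].
apply: (H2 _ (r + (q - r) / 3) s1) => //.
- by move=> x; rewrite mulr_ge0// step_ge0.
- by lra.
- by move=> x [xp|xr]; [rewrite l0 ?mul0r//; exact: ltW|rewrite Hsupp ?mulr0//; right].
Qed.

(** A partition of unity at scale [s] around [c]: the central piece contributes at most [eps] by
    [null_mul], and the other two are supported on either side of [c]. *)
Lemma glue_point p c q : null_at T c -> pos T p c -> pos T c q -> pos T p q.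
Proof.
move=> nc H1 H2 psi p1 q1 tp p0 pp1 q1q Hsupp.
pose l y := step (- y - 1); pose r y := step (y - 1).
have sl : Cinf l.
  by apply: (@Cinf_opp (fun y => step (y - 1))); apply: Cinf_shift; exact: Cinf_step.
have sr : Cinf r by apply: Cinf_shift; exact: Cinf_step.
pose th y := 1 - l y - r y.
have sth : Cinf th by apply: smoothB => //; apply: smoothB => //; exact: smooth_cst.
have tth : testf th.
  split=> //; exists 2 => x; rewrite lter_normr /th /l /r => /orP[x2|x2].
    by rewrite step0 ?step1; lra.
  by rewrite step1 ?step0; lra.
apply/ler_addgt0Pl => eps e0; rewrite addrC.
have [d d0 Hd] := null_mul eT nc tp.1 tth e0.
pose s := d / 2; have s0 : 0 < s by rewrite /s; lra.
have sd : s < d by rewrite /s; lra.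
have := Hd s s0 sd; rewrite ler_norml => /andP[h1 _].
have tls : testf (fun x => l ((x - c) / s) * psi x) by apply: testfMl => //; exact: smooth_scale.
have trs : testf (fun x => r ((x - c) / s) * psi x) by apply: testfMl => //; exact: smooth_scale.
have sts : Cinf (fun x => psi x * th ((x - c) / s)).
  by apply: smoothM; [exact: tp.1|exact: smooth_scale].
have E : T psi = T (fun x => psi x * th ((x - c) / s)) +
   T (fun x => l ((x - c) / s) * psi x) + T (fun x => r ((x - c) / s) * psi x).
  rewrite -(edistD eT sts tls.1) -(edistD eT (smoothD sts tls.1) trs.1).
  by congr T; apply/funext => x; rewrite /th; ring.
have L : 0 <= T (fun x => l ((x - c) / s) * psi x).
  apply: (H1 _ p1 (c - s)) => //.
  - by move=> x; rewrite mulr_ge0// step_ge0.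
  - by lra.
  - move=> x [xp|xr]; first by rewrite Hsupp ?mulr0//; left.
    rewrite /l step0 ?mul0r// subr_le0 -mulNr ler_pdivrMr//; clear -xr; lra.
have Rr : 0 <= T (fun x => r ((x - c) / s) * psi x).
  apply: (H2 _ (c + s) q1) => //.
  - by move=> x; rewrite mulr_ge0// step_ge0.
  - by clear -s0; lra.
  - move=> x [xp|xr]; last by rewrite Hsupp ?mulr0//; right.
    rewrite /r step0 ?mul0r// subr_le0 ler_pdivrMr//; clear -xp; lra.
rewrite E; clear -h1 L Rr; lra.
Qed.

(** Continuous induction along [[p1, q1]]: positivity reaches the supremum of the points attained,
    and the neighbourhood of that supremum carries it further by [glue_overlap]. *)
Lemma local_global p q : (forall c, p < c -> c < q -> exists2 e, 0 < e & pos T (c - e) (c + e)) ->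
  pos T p q.
Proof.
move=> Hloc psi p1 q1 tp p0 pp1 q1q Hsupp.
have [qp|pq] := ltP q1 p1.
  have -> : psi = fun=> 0.
    apply/funext => x; apply: Hsupp; have [xp|xp] := ltP x p1; first by left.
    by right; exact: lt_le_trans xp.
  by rewrite (edist0 eT).
have p1q : p1 < q by lra.
have [e e0 He] := Hloc p1 pp1 p1q.
pose A := [set x | p1 <= x <= q1 /\ exists2 y, x < y & pos T (p1 - e) y].
have Ap : A p1 by split; [rewrite lexx|exists (p1 + e) => //; rewrite ltrDl].
have Ane : A !=set0 by exists p1.
have Aub : has_ubound A by exists q1 => x [/andP[]].
pose s := sup A.
have p1s : p1 <= s by apply: ub_le_sup.
have sq1 : s <= q1 by apply: ge_sup => // x [/andP[]].
have [e1 e10 He1] := Hloc s (lt_le_trans pp1 p1s) (le_lt_trans sq1 q1q).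
have [x [xA [y xy Hy]] sx] : exists2 x, A x & s - e1 < x.
  by apply: sup_adherent => //; split.
have Hs : pos T (p1 - e) (s + e1).
  by apply: (glue_overlap _ Hy He1); exact: lt_trans xy.
have : q1 < s + e1.
  rewrite ltNge; apply/negP => sq.
  have : A (s + e1 / 2).
    split; first by apply/andP; split; clear -p1s e10 sq1 sq; lra.
    by exists (s + e1) => //; lra.
  by move=> /(ub_le_sup Aub); rewrite -/s; lra.
by move=> q1s; apply: (Hs psi p1 q1) => //; lra.
Qed.

(* Near the bottom of a gap the only possible negative contributions come
   from its endpoints, where [uniform_corner] applies. *)
Lemma gap_bottom x0 x1 eps : null_at T x0 -> null_at T x1 -> x0 < x1 -> pos T x0 x1 -> 0 < eps ->
  exists2 tau, 0 < tau & forall t x y, 0 < t -> t < tau -> x0 <= x -> x <= y -> y <= x1 ->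
    - eps <= T (fun z => erfn ((z - x) / t) - erfn ((z - y) / t)).
Proof.
move=> n0 n1 x01 Hpos e0; have e2 : 0 < eps / 2 by lra.
have [tau0 tau00 H0] := uniform_corner eT n0 e2.
(* The right corner is a left corner of the reflected functional; [erfn_odd] turns the reflected
   kernel into a slab again. *)
have [tau1 tau10 H1] := uniform_corner (edist_reflect eT) (null_reflect n1) e2.
(* Below a quarter of the gap the two corner cutoffs have disjoint supports. *)
exists (Num.min (Num.min tau0 tau1) ((x1 - x0) / 4)).
  by rewrite !lt_min tau00 tau10/=; lra.
move=> t x y t0; rewrite !lt_min => /andP[/andP[t1 t2] t3] xx xy yy.
have tn : t != 0 by rewrite gt_eqF.
pose Psi z := erfn ((z - x) / t) - erfn ((z - y) / t) : R.
have sPsi : Cinf Psi by apply: smoothB; apply: smooth_scale; exact: Cinf_erfn.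
have Psi0 z : 0 <= Psi z.
  by rewrite subr_ge0 erfn_le// ler_pM2r ?invr_gt0//; lra.
pose L z := lam ((z - x0) / t); pose Rr z := lam ((x1 - z) / t).
have sL : Cinf L by apply: smooth_scale; exact: Cinf_lam.
have sR : Cinf Rr.
  have := Cinf_opp (smooth_scale (- x1) t (@Cinf_lam R)); congr Cinf.
  by apply/funext => z; rewrite /Rr opprK addrC.
pose mid z := 1 - L z - Rr z.
have smid : Cinf mid by apply: smoothB => //; apply: smoothB => //; exact: smooth_cst.
have L1 z : z <= x0 + t -> L z = 1 by move=> ?; rewrite /L lam1// ler_pdivrMr//; lra.
have L0 z : x0 + 2 * t <= z -> L z = 0 by move=> ?; rewrite /L lam0// ler_pdivlMr//; lra.
have R1 z : x1 - t <= z -> Rr z = 1 by move=> ?; rewrite /Rr lam1// ler_pdivrMr//; lra.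
have R0 z : z <= x1 - 2 * t -> Rr z = 0 by move=> ?; rewrite /Rr lam0// ler_pdivlMr//; lra.
have mid0 z : z < x0 + t \/ x1 - t < z -> mid z = 0.
  by case=> ?; rewrite /mid; [rewrite L1 ?R0|rewrite L0 ?R1]; lra.
have mid_ge z : 0 <= mid z.
  have [zx|zx] := leP z (x1 - 2 * t).
    by rewrite /mid (R0 z zx) subr0 subr_ge0 lam_le1.
  rewrite /mid (L0 z); last by clear -t3 zx; lra.
  by rewrite subr0 subr_ge0 lam_le1.
have tmid : testf (fun z => mid z * Psi z).
  split; first exact: smoothM.
  exists (`|x0| + `|x1| + t) => z; rewrite lter_normr.
  have := ler_norm x1; have := ler_norm (- x0); rewrite normrN.
  have := normr_ge0 x0; have := normr_ge0 x1 => ? ? ? ? /orP[?|?]; rewrite mid0 ?mul0r//.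
    by right; lra.
  by left; lra.
have sLP : Cinf (fun z => L z * Psi z) by exact: smoothM.
have sRP : Cinf (fun z => Rr z * Psi z) by exact: smoothM.
have E : T Psi = T (fun z => mid z * Psi z) + T (fun z => L z * Psi z) + T (fun z => Rr z * Psi z).
  rewrite -(edistD eT tmid.1 sLP) -(edistD eT (smoothD tmid.1 sLP) sRP).
  by congr T; apply/funext => z; rewrite /mid; ring.
have M : 0 <= T (fun z => mid z * Psi z).
  apply: (Hpos _ (x0 + t) (x1 - t)) => //.
  - by move=> z; rewrite mulr_ge0.
  - by clear -t0; lra.
  - by clear -t0; lra.
  - by move=> z /mid0 ->; rewrite mul0r.
have HL : `|T (fun z => L z * Psi z)| <= eps / 2.
  have c0 : 0 <= (x - x0) / t by rewrite divr_ge0//; clear -xx t0; lra.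
  have cd : (x - x0) / t <= (y - x0) / t by rewrite ler_pM2r ?invr_gt0//; clear -xy; lra.
  have := H0 t _ _ t0 t1 c0 cd; congr (`|T _| <= _).
  by apply/funext => z; rewrite /L /Psi /erfn_slab; congr (_ * (erfn _ - erfn _)); field.
have HR : `|T (fun z => Rr z * Psi z)| <= eps / 2.
  have c0 : 0 <= (x1 - y) / t by rewrite divr_ge0//; clear -yy t0; lra.
  have cd : (x1 - y) / t <= (x1 - x) / t by rewrite ler_pM2r ?invr_gt0//; clear -xy; lra.
  have := H1 t _ _ t0 t2 c0 cd; congr (`|T _| <= _).
  apply/funext => z; rewrite /Rr /Psi /erfn_slab.
  have -> : (- z - - x1) / t = (x1 - z) / t by congr (_ / _); ring.
  have -> : (z - x) / t = - ((x1 - z) / t - (x1 - x) / t) by field.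
  have -> : (z - y) / t = - ((x1 - z) / t - (x1 - y) / t) by field.
  by rewrite !erfn_odd; congr (_ * _); ring.
move: HL HR; rewrite -/Psi E !ler_norml => /andP[? _] /andP[? _]; lra.
Qed.

End WithEdist.
End LocalPositivity.

(** * The parabolic maximum principle over a gap *)

Section MaximumPrinciple.
Context {R : realType}.
Implicit Types (f g phi psi theta : R -> R) (T : (R -> R) -> R) (a b c x y z h s t p q w B C d e : R) (n k m j J : nat).

(** [T] on the smoothed indicator of [[x, +oo[]; its derivative in [x] is [- gmean T x t]. The
    maximum principle is run on differences of [heat], because the factor [t^-1] of [gmean] is out
    of control at corners as [t] tends to 0. *)
Definition heat T x t := T (fun z => erfn ((z - x) / t)).

Definition gmean T x t := t^-1 * T (fun z => gauss ((z - x) / t)).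

Section WithEdist.
Variables (a b : R) (T : (R -> R) -> R).
Hypothesis eT : edist a b T.

Lemma heat_x x t : t != 0 -> is_derive x 1 (fun x => heat T x t) (- gmean T x t).
Proof.
move=> t0; have := edist_transl eT x t0 (@Cinf_erfn R); rewrite /gmean mulNr.
rewrite (der_D1 erfn_der); apply => j; have [B _ HB] := @D_erfn_bounded R j.+1.
by exists B.
Qed.

Lemma gmean_x x t : t != 0 -> is_derive x 1 (fun x => gmean T x t)
  (- (t^-1 ^+ 2 * T (fun z => D 1 gauss ((z - x) / t)))).
Proof.
move=> t0; have := edist_transl eT x t0 (@Cinf_gauss R) => /(_ _)/(derZ t^-1).
rewrite mulNr mulrN mulrA -expr2; apply => j; have [B _ HB] := @D_gauss_bounded R j.+2 0.
by exists B => y; have := HB y; rewrite expr0 mul1r.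
Qed.

Lemma heat_t x t : 0 < t -> is_derive t 1 (fun t => heat T x t)
  (t^-1 * T (fun z => D 1 gauss ((z - x) / t))).
Proof. exact: (edist_heat eT). Qed.

Lemma edist_scale_bound theta tau : Cinf theta -> 0 < tau ->
  (forall j, exists2 B, 0 <= B & forall y, `|D j theta y| <= B) ->
  exists2 C, 0 <= C & forall x t, tau <= t -> `|T (fun z => theta ((z - x) / t))| <= C.
Proof.
move=> sth tau0 Hb; have [C [k [C0 HC]]] := edist_bound eT.
have [B B0 HB] : exists2 B, 0 <= B & forall j y, (j <= k)%N -> `|D j theta y| <= B.
  elim: k {HC} => [|k [B B0 IH]].
    by have [B B0 HB] := Hb 0%N; exists B => // j y; rewrite leqn0 => /eqP ->.
  have [B1 B10 HB] := Hb k.+1; exists (B + B1); first exact: addr_ge0.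
  move=> j y; rewrite leq_eqVlt => /predU1P[->|/IH]; first by apply: le_trans (HB y) _; rewrite lerDr.
  by move=> H; apply: le_trans (H y) _; rewrite lerDl.
exists (C * ((1 + tau^-1) ^+ k * B)).
  by rewrite !mulr_ge0// exprn_ge0// addr_ge0// invr_ge0 ltW.
move=> x t taut; apply: HC; first exact: smooth_scale.
by move=> j z jk _; apply: D_scale_bound => // y; exact: HB.
Qed.

Lemma heat_lip tau : 0 < tau -> exists2 L, 0 <= L & forall x y s t, tau <= s -> tau <= t ->
  `|heat T x s - heat T y t| <= L * (`|x - y| + `|s - t|).
Proof.
move=> tau0.
have [C1 C10 H1] : exists2 C, 0 <= C & forall x t, tau <= t -> `|gmean T x t| <= C.
  have [|C C0 HC] := edist_scale_bound (@Cinf_gauss R) tau0.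
    by move=> j; have [B B0 HB] := @D_gauss_bounded R j 0; exists B => // y; have := HB y; rewrite expr0 mul1r.
  exists (tau^-1 * C); first by rewrite mulr_ge0// invr_ge0 ltW.
  move=> x t tt; have t0 : 0 < t by lra.
  rewrite /gmean normrM; apply: ler_pM => //; last exact: HC.
  by rewrite normfV (gtr0_norm t0) lef_pV2.
have [C2 C20 H2] : exists2 C, 0 <= C & forall x t, tau <= t ->
    `|t^-1 * T (fun z => D 1 gauss ((z - x) / t))| <= C.
  have [|C C0 HC] := edist_scale_bound (smooth_D 1 (@Cinf_gauss R)) tau0.
    move=> j; have [B B0 HB] := @D_gauss_bounded R j.+1 0; exists B => // y.
    by have := HB y; rewrite expr0 mul1r DS.
  exists (tau^-1 * C); first by rewrite mulr_ge0// invr_ge0 ltW.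
  move=> x t tt; have t0 : 0 < t by lra.
  rewrite normrM; apply: ler_pM => //; last exact: HC.
  by rewrite normfV (gtr0_norm t0) lef_pV2.
exists (C1 + C2); first exact: addr_ge0.
move=> x y s t ts tt.
have -> : heat T x s - heat T y t = (heat T x s - heat T y s) + (heat T y s - heat T y t) by ring.
have A1 : `|heat T x s - heat T y s| <= C1 * `|x - y|.
  apply: (@mvt_le _ (fun x => heat T x s) (fun x => - gmean T x s)).
    by move=> z; apply: heat_x; rewrite gt_eqF//; lra.
  by move=> c; rewrite normrN; exact: H1.
have A2 : `|heat T y s - heat T y t| <= C2 * `|s - t|.
  have [z|c [c1 _ ->]] := @mvt_loc _ (heat T y) (fun t => t^-1 * T (fun z => D 1 gauss ((z - y) / t))) t s.
    by move=> /andP[z1 _]; apply: heat_t; apply: lt_le_trans z1; rewrite lt_min; apply/andP; split; clear -tau0 tt ts; lra.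
  rewrite normrM ler_wpM2r//; apply: H2; apply: le_trans c1.
  by rewrite le_min tt.
apply: le_trans (ler_normD _ _) _; apply: le_trans (lerD A1 A2) _.
rewrite mulrDr lerD// ler_wpM2r//; clear -C20 C10; lra.
Qed.

(** The minimum is over the ordered pairs [x <= y]. Sorting the points by [min] and [max], and
    clipping [t] at [tau], extends the function continuously to the whole space, so the extreme
    value theorem applies on a box. *)
Lemma heat_min x0 x1 tau t1 kap : 0 < tau -> x0 <= x1 -> tau <= t1 ->
  exists x y t, [/\ x0 <= x, x <= y, y <= x1, tau <= t <= t1 &
  forall x' y' t', x0 <= x' -> x' <= y' -> y' <= x1 -> tau <= t' -> t' <= t1 ->
   heat T x t - heat T y t + kap * t <= heat T x' t' - heat T y' t' + kap * t'].
Proof.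
move=> tau0 x01 taut; have [L L0 HL] := heat_lip tau0.
pose F x y t := heat T x t - heat T y t + kap * t.
pose g (r : R * R * R) := F (Num.min r.1.1 r.1.2) (Num.max r.1.1 r.1.2) (Num.max r.2 tau).
have lipmin x y x' y' : `|Num.min x y - Num.min x' y'| <= `|x - x'| + `|y - y'|.
  have := ler_norm (x - x'); have := ler_norm (x' - x); rewrite distrC => h1 h2.
  have := ler_norm (y - y'); have := ler_norm (y' - y); rewrite distrC => h3 h4.
  by rewrite ler_norml; case: (leP x y); case: (leP x' y') => p q; apply/andP; split; clear -h1 h2 h3 h4 p q; lra.
have lipmax x y x' y' : `|Num.max x y - Num.max x' y'| <= `|x - x'| + `|y - y'|.
  have := ler_norm (x - x'); have := ler_norm (x' - x); rewrite distrC => h1 h2.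
  have := ler_norm (y - y'); have := ler_norm (y' - y); rewrite distrC => h3 h4.
  by rewrite ler_norml; case: (leP x y); case: (leP x' y') => p q; apply/andP; split; clear -h1 h2 h3 h4 p q; lra.
have cg : continuous g.
  move=> r; apply/cvgrPdist_le => eps e0; pose M := 6 * L + `|kap| + 1.
  have M0 : 0 < M by rewrite /M; have := normr_ge0 kap; clear -L0; lra.
  have eM : 0 < eps / M by rewrite divr_gt0.
  exists (ball r.1.1 (eps / M) `*` ball r.1.2 (eps / M), ball r.2 (eps / M)).
    split=> /=; last exact: nbhsx_ballx.
    by exists (ball r.1.1 (eps / M), ball r.1.2 (eps / M)) => //; split; exact: nbhsx_ballx.
  move=> r' [[h1 h2] h3].
  move: h1 h2 h3; rewrite /ball/= /ball/= => h1 h2 h3.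
  rewrite /g /F; set X := Num.min r.1.1 _; set Y := Num.max r.1.1 _; set S := Num.max r.2 _.
  set X' := Num.min r'.1.1 _; set Y' := Num.max r'.1.1 _; set S' := Num.max r'.2 _.
  have tS : tau <= S by rewrite /S le_max lexx orbT.
  have tS' : tau <= S' by rewrite /S' le_max lexx orbT.
  have HX := HL X X' _ _ tS tS'; have HY := HL Y Y' _ _ tS tS'.
  have dS : `|S - S'| <= eps / M by apply: le_trans (lipmax _ _ _ _) _; rewrite subrr normr0; clear -h3; lra.
  have dX : `|X - X'| <= 2 * (eps / M) by apply: le_trans (lipmin _ _ _ _) _; clear -h1 h2; lra.
  have dY : `|Y - Y'| <= 2 * (eps / M) by apply: le_trans (lipmax _ _ _ _) _; clear -h1 h2; lra.
  have -> : heat T X S - heat T Y S + kap * S - (heat T X' S' - heat T Y' S' + kap * S') =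
    (heat T X S - heat T X' S') - (heat T Y S - heat T Y' S') + kap * (S - S') by ring.
  have HX2 : `|heat T X S - heat T X' S'| <= L * (3 * (eps / M)).
    by apply: le_trans HX _; rewrite ler_wpM2l//; clear -dS dX; lra.
  have HY2 : `|heat T Y S - heat T Y' S'| <= L * (3 * (eps / M)).
    by apply: le_trans HY _; rewrite ler_wpM2l//; clear -dS dY; lra.
  have HK : `|kap * (S - S')| <= `|kap| * (eps / M) by rewrite normrM ler_wpM2l.
  apply: le_trans (ler_normD _ _) _; apply: le_trans (lerD (ler_normB _ _) (lexx _)) _.
  have E : M * (eps / M) = eps by field; rewrite gt_eqF.
  rewrite -[leRHS]E {1}/M; clear -eM HX2 HY2 HK; lra.
have cK : compact ((`[x0, x1] `*` `[x0, x1]) `*` `[tau, t1]).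
  by apply: compact_setX; [apply: compact_setX|]; exact: segment_compact.
have [|r] := compact_EVT_min _ cK (continuous_subspaceT cg).
  by exists (x0, x0, tau); split => //=; [split|]; rewrite /= in_itv/= lexx.
rewrite inE => -[[/=]]; rewrite !in_itv/= => /andP[r1 r2] /andP[r3 r4] /andP[r5 r6] Hmin.
exists (Num.min r.1.1 r.1.2), (Num.max r.1.1 r.1.2), r.2; split.
- by rewrite le_min r1.
- by rewrite ge_min le_max lexx.
- by rewrite ge_max r2.
- by rewrite r5.
move=> x' y' t' xx xy yy tt tt'; have := Hmin (x', y', t'); rewrite /g /= (max_l r5) (max_l tt) (min_l xy) (max_r xy).
apply; rewrite inE; split => /=; [split|]; rewrite /= in_itv/=; apply/andP; split; clear -xx xy yy tt tt'; lra.
Qed.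

(** Doubled variables: [heat T x t - heat T y t + kap * t] is minimised over [x <= y] and [t]. Were
    the minimum attained above the bottom with [x < y], then [x] and [y] would not lie on the sides,
    where positive means give a slope of the wrong sign; the second derivatives and the heat
    equation would make the time derivative at least [kap], against minimality. On the diagonal the
    value is nonnegative, and at the bottom [gap_bottom] applies. *)
Lemma max_principle x0 x1 t1 : null_at T x0 -> null_at T x1 -> x0 < x1 -> pos T x0 x1 ->
  (forall t, 0 < t -> t < t1 -> 0 < gmean T x0 t /\ 0 < gmean T x1 t) ->
  forall x y t, x0 <= x -> x <= y -> y <= x1 -> 0 < t -> t < t1 -> heat T y t <= heat T x t.
Proof.
move=> n0 n1 x01 Hpos Hside x y t xx xy yy t0 tt1.
rewrite -subr_ge0; apply/ler_addgt0Pl => e e0.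
have e2 : 0 < e / 2 by lra.
have [tau tau0 Hbot] := gap_bottom eT n0 n1 x01 Hpos e2.
pose tb := Num.min (tau / 2) t.
have tb0 : 0 < tb by rewrite lt_min t0; lra.
have [tb1 tb2] : tb <= tau / 2 /\ tb <= t by rewrite !ge_min !lexx orbT.
(* A strictly positive slope in time, costing exactly [e / 2] at the width [t] of interest. *)
pose kap := e / 2 / t; have kap0 : 0 < kap by rewrite !divr_gt0.
have [X [Y [S [X0 XY Y1 /andP[S0 S1] Hmin]]]] := heat_min kap tb0 (ltW x01) tb2.
have Sp : 0 < S by clear -tb0 S0; lra.
have Sn : S != 0 by rewrite gt_eqF.
suff H : - (e / 2) <= heat T X S - heat T Y S + kap * S.
  have := Hmin x y t xx xy yy tb2 (lexx _).
  have -> : kap * t = e / 2 by rewrite /kap; field; rewrite gt_eqF.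
  clear -H; lra.
have kS : 0 <= kap * S by rewrite mulr_ge0// ltW.
move: XY; rewrite le_eqVlt => /predU1P[<-|XY]; first by rewrite subrr; clear -e0 kS; lra.
move: S0; rewrite le_eqVlt => /predU1P[ES|S0].
  have Sta : S < tau by clear -tau0 tb1 ES; lra.
  have := Hbot S X Y Sp Sta X0 (ltW XY) Y1; rewrite /heat (edistB eT); try (clear -kS; lra).
    by apply: smooth_scale; exact: Cinf_erfn.
  by apply: smooth_scale; exact: Cinf_erfn.
have St1 : S < t1 by clear -tt1 S1; lra.
have [g0 g1] := Hside S Sp St1.
pose dX := S^-1 ^+ 2 * T (fun z => D 1 gauss ((z - X) / S)).
pose dY := S^-1 ^+ 2 * T (fun z => D 1 gauss ((z - Y) / S)).
have HX : 0 <= dX.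
  move: X0; rewrite le_eqVlt => /predU1P[E|X0].
    have : 0 <= - gmean T X S; last by rewrite -E; clear -g0; lra.
    apply: (@min_right _ (fun x => heat T x S) X _ (Y - X)); first exact: heat_x.
      by clear -XY; lra.
    move=> h h0 hY; have := Hmin (X + h) Y S; clear -Y1 S1 S0 E h0 hY; lra.
  have m0 : 0 < Num.min (X - x0) (Y - X) by rewrite lt_min; apply/andP; split; clear -X0 XY; lra.
  apply: (@min_second _ (fun x => heat T x S) (fun x => - gmean T x S) X dX _ _ _ m0).
  - by move=> z; exact: heat_x.
  - by have := derN (gmean_x X Sn); rewrite opprK.
  - move=> h; rewrite lt_min ltr_norml => /andP[/andP[h1 h2]]; rewrite ltr_norml => /andP[h3 h4].
    have := Hmin (X + h) Y S; clear -Y1 S1 S0 h1 h4; lra.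
have HY : dY <= 0.
  move: Y1; rewrite le_eqVlt => /predU1P[E|Y1].
    have : - - gmean T Y S <= 0; last by rewrite E; clear -g1; lra.
    apply: (@min_left _ (fun x => - heat T x S) Y _ (Y - X)); first by apply: derN; exact: heat_x.
      by clear -XY; lra.
    move=> h h0 hY; have := Hmin X (Y - h) S; clear -X0 S1 S0 E h0 hY; lra.
  have m0 : 0 < Num.min (x1 - Y) (Y - X) by rewrite lt_min; apply/andP; split; clear -Y1 XY; lra.
  suff : 0 <= - dY by clear; lra.
  apply: (@min_second _ (fun x => - heat T x S) (fun x => - - gmean T x S) Y (- dY) _ _ _ m0).
  - by move=> z; apply: derN; exact: heat_x.
  - by have := derN (derN (gmean_x Y Sn)); rewrite opprK.
  - move=> h; rewrite lt_min ltr_norml => /andP[/andP[h1 h2]]; rewrite ltr_norml => /andP[h3 h4].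
    have := Hmin X (Y + h) S; clear -X0 S1 S0 h2 h3; lra.
have : S^-1 * T (fun z => D 1 gauss ((z - X) / S)) - S^-1 * T (fun z => D 1 gauss ((z - Y) / S)) + kap <= 0.
  apply: (@min_left _ (fun t => heat T X t - heat T Y t + kap * t) S _ (S - tb)).
  - apply: derD; first by apply: derB; exact: heat_t.
    by have := derZ kap (der_id S); rewrite mulr1.
  - by clear -S0; lra.
  - move=> h h0 hS; have := Hmin X Y (S - h); clear -X0 Y1 S1 XY h0 hS; lra.
have -> : S^-1 * T (fun z => D 1 gauss ((z - X) / S)) = S * dX by rewrite /dX; field.
have -> : S^-1 * T (fun z => D 1 gauss ((z - Y) / S)) = S * dY by rewrite /dY; field.
have : 0 <= S * dX by rewrite mulr_ge0// ltW.
have : S * dY <= 0 by rewrite mulr_ge0_le0// ltW.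
clear -kap0; lra.
Qed.

Lemma gap_gmean x0 x1 t1 : null_at T x0 -> null_at T x1 -> x0 < x1 -> pos T x0 x1 ->
  (forall t, 0 < t -> t < t1 -> 0 < gmean T x0 t /\ 0 < gmean T x1 t) ->
  forall x t, x0 <= x -> x <= x1 -> 0 < t -> t < t1 -> 0 <= gmean T x t.
Proof.
move=> n0 n1 x01 Hpos Hside x t; rewrite le_eqVlt => /predU1P[<- _ t0 tt|x0x].
  by have [/ltW] := Hside t t0 tt.
rewrite le_eqVlt => /predU1P[-> t0 tt|xx1 t0 tt]; first by have [_ /ltW] := Hside t t0 tt.
have tn : t != 0 by rewrite gt_eqF.
have m0 : 0 < x1 - x by lra.
suff : 0 <= - - gmean T x t by rewrite opprK.
apply: (@min_right _ (fun x => - heat T x t) x _ _ _ m0); first by apply: derN; exact: heat_x.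
move=> h h0 hx; rewrite lerN2; apply: (max_principle n0 n1 x01 Hpos Hside) => //; lra.
Qed.

End WithEdist.
End MaximumPrinciple.

(** * Recovering [T] on test functions from its Gaussian means *)

Section Mollification.
Context {R : realType}.
Implicit Types (f g phi psi theta F : R -> R) (T : (R -> R) -> R) (a b c x y z h s t p q w B C d e M : R) (n k m j J : nat).

Lemma primZD c f g : testf f -> testf g ->
  prim (fun x => c * f x + g x) = fun x => c * prim f x + prim g x.
Proof.
move=> tf tg; have [M1 [M10 H1]] := prim_far tf; have [M2 [M20 H2]] := prim_far tg.
have tfg : testf (fun x => c * f x + g x) by apply: testfD => //; exact: testfZ.
have [M3 [M30 H3]] := prim_far tfg.
pose x0 := - (M1 + M2 + M3).
apply: (@der_unique _ _ _ (fun x => c * f x + g x) x0).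
- exact: testf_prim_der.
- by move=> x; apply: derD; [apply: derZ|]; exact: testf_prim_der.
by rewrite (H3 x0).1 ?(H1 x0).1 ?(H2 x0).1; rewrite /x0; clear -M10 M30 M20; lra.
Qed.

Lemma prim_bound f M B w : testf f -> 0 <= M -> (forall x, M < `|x| -> f x = 0) ->
  (forall x, `|f x| <= B) -> `|prim f w| <= 2 * (M + 1) * B.
Proof.
move=> tf M0 fM fB; have B0 : 0 <= B by apply: le_trans (fB 0).
have key v : `|v| <= M + 1 -> `|prim f v| <= 2 * (M + 1) * B.
  move=> vM; have p0 : prim f (- (M + 1)) = 0.
    apply: (@prim_left _ _ (- M)); last by lra.
    by move=> y yM; apply: fM; rewrite lter_normr; apply/orP; right; lra.
  have := mvt_le (- (M + 1)) v (testf_prim_der tf) fB; rewrite p0 subr0 => h1.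
  apply: le_trans h1 _; rewrite mulrC ler_wpM2r//.
  apply: le_trans (ler_normB _ _) _; rewrite normrN (@ger0_norm _ (M + 1)); lra.
have [wM|wM] := leP w (- (M + 1)).
  rewrite (@prim_left _ _ (- M)) ?normr0; [by rewrite !mulr_ge0//; lra| |lra].
  by move=> y yM; apply: fM; rewrite lter_normr; apply/orP; right; lra.
have [wM'|wM'] := leP w (M + 1).
  by apply: key; rewrite ler_norml; apply/andP; split; lra.
have fr y : M < y -> f y = 0 by move=> My; apply: fM; rewrite lter_normr My.
have -> : prim f w = prim f (M + 1).
  by rewrite (prim_right fr) ?(prim_right fr)//; lra.
by apply: key; rewrite ger0_norm; lra.
Qed.

(** The convolution stopped at [w]. Differentiating in this upper limit, as [conv_w] does, exchanges
    [T] with the integral. *)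
Definition conv psi F t w z := prim (fun x => psi x * F ((z - x) / t)) w.

Definition bsmooth F := Cinf F /\ forall j, exists2 B, 0 <= B & forall y, `|D j F y| <= B.

Lemma bsmooth_D F n : bsmooth F -> bsmooth (D n F).
Proof.
move=> [sF HF]; split; first exact: smooth_D.
move=> j; have [B B0 HB] := HF (n + j)%N; exists B => // y.
have -> : D j (D n F) = D (n + j) F; last exact: HB.
by elim: j {HB} => [|j IH]; rewrite ?D0 ?addn0// DSr IH addnS [in RHS]DSr.
Qed.

Lemma bsmooth_gauss : bsmooth gauss.
Proof.
split; first exact: Cinf_gauss.
by move=> j; have [B B0 HB] := @D_gauss_bounded R j 0; exists B => // y; have := HB y; rewrite expr0 mul1r.
Qed.

Lemma Cinf_rscale F z t : Cinf F -> Cinf (fun x => F ((z - x) / t)).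
Proof.
move=> sF; apply: (@smooth_comp_affine _ _ (fun x => (z - x) / t) (- t^-1)) => // y.
have := derZ t^-1 (derB (der_cst z y) (is_derive_id y 1)).
by rewrite sub0r mulrN1; congr is_derive; apply/funext => x; rewrite mulrC.
Qed.

Section Conv.
Variables (t : R).

Lemma testf_conv psi F z : testf psi -> Cinf F -> testf (fun x => psi x * F ((z - x) / t)).
Proof. by move=> tp sF; apply: testfMr => //; exact: Cinf_rscale. Qed.

Lemma conv_der psi F w z : testf psi -> bsmooth F ->
  is_derive z 1 (conv psi F t w) (t^-1 * conv psi (D 1 F) t w z).
Proof.
move=> tp [sF bF]; have sF1 := smooth_D 1 sF.
have [P P0 HP] := testf_bounded 0 tp; have [B B0 HB] := bF 2%N.
have [M0 HM0] := tp.2; pose M := Num.max M0 0.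
have M0' : 0 <= M by rewrite le_max lexx orbT.
have HM x : M < `|x| -> psi x = 0 by rewrite gt_max => /andP[/HM0].
apply: (@is_derive_quad _ _ _ _ (2 * (M + 1) * (P * (`|t^-1| ^+ 2 * B))) 1) => // h _.
pose f y := fun x => psi x * F ((y - x) / t).
pose g := fun x => psi x * D 1 F ((z - x) / t).
have tf y : testf (f y) by exact: testf_conv.
have tg : testf g by exact: testf_conv.
have tr : testf (fun x => -1 * (f z x) + f (z + h) x) by apply: testfD => //; exact: testfZ.
have -> : conv psi F t w (z + h) - conv psi F t w z - h * (t^-1 * conv psi (D 1 F) t w z) =
    prim (fun x => - (h * t^-1) * g x + (-1 * f z x + f (z + h) x)) w.
  by rewrite (primZD _ tg tr) (primZD _ (tf z) (tf _)) /conv -/f -/g; ring.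
rewrite -mulrA; apply: prim_bound => //.
- by apply: testfD => //; exact: testfZ.
- by move=> x xM; rewrite /f /g HM//; ring.
move=> x.
have -> : - (h * t^-1) * g x + (-1 * f z x + f (z + h) x) =
  psi x * (F ((z + h - x) / t) - F ((z - x) / t) - h * (t^-1 * D 1 F ((z - x) / t))).
  by rewrite /f /g; ring.
rewrite normrM -!mulrA; apply: ler_pM => //; first by have := HP 0%N x (leqnn _); rewrite D0.
have d1 y : is_derive y 1 (fun y => F ((y - x) / t)) (t^-1 * D 1 F ((y - x) / t)).
  by apply: (@der_comp _ _ _ (fun y => (y - x) / t)); [exact: smooth_der0|exact: der_scale].
have d2 y : is_derive y 1 (fun y => t^-1 * D 1 F ((y - x) / t)) (t^-1 * (t^-1 * D 2 F ((y - x) / t))).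
  apply: derZ; apply: (@der_comp _ _ _ (fun y => (y - x) / t)); last exact: der_scale.
  exact: smooth_der.
have := @taylor1 _ _ _ _ z h (`|t^-1| ^+ 2 * B) d1 d2; rewrite !mulrA; apply => y _.
by rewrite mulrA -expr2 normrM normrX ler_wpM2l ?exprn_ge0.
Qed.

Lemma conv_Cinf psi F w : testf psi -> bsmooth F -> Cinf (conv psi F t w).
Proof.
move=> tp bF.
pose S f := exists c F, bsmooth F /\ f = fun z => c * conv psi F t w z.
apply: (@smooth_of_class _ S); last by exists 1, F; split=> //; apply/funext => z; rewrite mul1r.
move=> f [c [F1 [bF1 ->]]]; exists (fun z => (c * t^-1) * conv psi (D 1 F1) t w z).
  by exists (c * t^-1), (D 1 F1); split=> //; exact: bsmooth_D.
by move=> z; rewrite -mulrA; apply: derZ; exact: conv_der.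
Qed.

Lemma D_conv psi F w n : testf psi -> bsmooth F ->
  D n (conv psi F t w) = fun z => t^-1 ^+ n * conv psi (D n F) t w z.
Proof.
move=> tp bF; elim: n => [|n IH]; first by apply/funext => z; rewrite !D0 mul1r.
rewrite DSr IH; apply: der_D1 => z; rewrite exprSr -mulrA; apply: derZ.
by rewrite [D n.+1 F]DSr; apply: conv_der => //; exact: bsmooth_D.
Qed.

(* Integration by parts moves the derivatives to [psi] once all of its
   support has been swept. *)
Lemma conv_parts psi F M N z : testf psi -> bsmooth F -> (forall x, M < `|x| -> psi x = 0) ->
  0 <= M -> M < N -> t^-1 * conv psi (D 1 F) t N z = conv (D 1 psi) F t N z.
Proof.
move=> tp [sF bF] psiN M0 MN; have sF1 := smooth_D 1 sF; have tp1 := testf_D 1 tp.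
have tf := testf_conv z tp sF; have tg := testf_conv z tp1 sF; have th := testf_conv z tp sF1.
suff E : (fun w => psi w * F ((z - w) / t)) =
    (fun w => - t^-1 * conv psi (D 1 F) t w z + conv (D 1 psi) F t w z).
  have := congr1 (fun f => f N) E; rewrite psiN ?mul0r; last by rewrite ger0_norm//; lra.
  by rewrite /=; lra.
have [M1 [M10 H1]] := prim_far th; have [M2 [M20 H2]] := prim_far tg.
pose x0 := - (M1 + M2 + N).
apply: (@der_unique _ _ _ (fun w => - t^-1 * (psi w * D 1 F ((z - w) / t)) + D 1 psi w * F ((z - w) / t)) x0).
- move=> w; have d1 := smooth_der0 tp.1 w.
  have d2 : is_derive w 1 (fun w => F ((z - w) / t)) (- t^-1 * D 1 F ((z - w) / t)).
    exact: is_derive_transl.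
  apply: (is_derive_eq (derM d1 d2)); ring.
- by move=> w; apply: derD; [apply: derZ|]; exact: testf_prim_der.
rewrite psiN ?mul0r; last by rewrite lter_normr; apply/orP; right; rewrite /x0; lra.
rewrite /conv (H1 x0).1 ?(H2 x0).1; rewrite /x0; clear -M0 MN M10 M20; lra.
Qed.

(** A derivative falling on the Gaussian costs a factor [t^-1]. Transferred to [psi] it costs
    nothing, so [conv_approx] applies to each derivative of [psi] separately. *)
Lemma D_conv_parts psi n M N z : testf psi -> (forall x, M < `|x| -> psi x = 0) ->
  0 <= M -> M < N -> D n (conv psi gauss t N) z = conv (D n psi) gauss t N z.
Proof.
move=> tp psiN M0 MN; elim: n psi tp psiN => [|n IH] psi tp psiN; first by rewrite !D0.
rewrite DS [D n.+1 psi]DS -IH; [|exact: testf_D|].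
- congr (D n _ z); apply/funext => y; rewrite -(conv_parts _ tp _ psiN)//; last exact: bsmooth_gauss.
  by rewrite (D_conv _ 1 tp)//; exact: bsmooth_gauss.
- by move=> x; apply: D_out => //; exact: tp.1.
Qed.

End Conv.

Lemma gauss_even y : gauss (- y) = gauss y :> R.
Proof. by rewrite !gaussE sqrrN. Qed.

Lemma erfn_bounded : exists2 C, 0 <= C & forall x y, erfn y - erfn x <= C :> R.
Proof.
have [C C0 HC] := @erfn_tail R; exists (erfn 1 - erfn (- 1) + 2 * C).
  by rewrite addr_ge0 ?subr_ge0 ?erfn_le//; lra.
move=> x y.
have H1 : erfn y <= erfn 1 + C :> R.
  have [y1|y1] := leP y 1; first by have := erfn_le y1; lra.
  have := HC 1 y (ltW y1) (or_introl ltr01); rewrite invr1 => H.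
  have y0 : 0 < y^-1 by rewrite invr_gt0; lra.
  have y2 : y^-1 <= 1 by rewrite invf_le1; clear -y1; lra.
  have : `|1 - y^-1| <= 1 by rewrite ger0_norm; clear -y0 y2; lra.
  by move=> /(ler_wpM2l (ltW C0)); lra.
have H2 : erfn (- 1) - C <= erfn x :> R.
  have [x1|x1] := leP (- 1) x; first by have := erfn_le x1; clear -C0; lra.
  have n1 : -1 < 0 :> R by lra.
  have := HC x (- 1) (ltW x1) (or_intror n1); rewrite invrN invr1 => H.
  have y0 : 0 < (- x)^-1 by rewrite invr_gt0; clear -x1; lra.
  have y2 : (- x)^-1 <= 1 by rewrite invf_le1; clear -x1; lra.
  move: y0 y2; rewrite invrN => y0 y2.
  have : `|x^-1 - - 1| <= 1 by rewrite ger0_norm; clear -y0 y2; lra.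
  by move=> /(ler_wpM2l (ltW C0)); clear -H; lra.
clear -H1 H2; lra.
Qed.

(* Since [|x - z| <= t + (x - z)^2 / t], the increments of
   [int (psi - psi z) E'] are dominated by those of
   [L t (2 erfn + gauss')((x - z) / t)]. *)
Lemma conv_approx L : 0 <= L -> exists2 C, 0 <= C & forall t psi M N z, 0 < t -> t <= 1 ->
  testf psi -> 0 <= M -> M < N -> (forall x, M < `|x| -> psi x = 0) ->
  (forall x, `|D 1 psi x| <= L) -> (forall x, `|psi x| <= L) -> `|z| <= N - 1 ->
  `|t^-1 * conv psi gauss t N z - psi z * (erfn t^-1 - erfn (- t^-1))| <= C * t.
Proof.
move=> L0; have [C1 C10 HC1] := erfn_bounded; have [C2 C20 HC2] := @erfn_tail R.
have [C3 C30 HC3] := @D_gauss_bounded R 1 0.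
exists (L * (2 * C1 + 2 * C3) + L * (2 * C2)).
  by rewrite addr_ge0// mulr_ge0//; clear -C10 C30 C20; lra.
move=> t psi M N z t0 t1 tp M0 MN psiM HL1 HL zN.
have tn : t != 0 by rewrite gt_eqF.
pose u x := (x - z) / t.
pose f x := psi x * gauss ((z - x) / t).
have tf : testf f by apply: testf_conv => //; exact: Cinf_gauss.
have du x : is_derive x 1 u t^-1 by exact: der_scale.
have dE x : is_derive x 1 (fun x => erfn (u x)) (t^-1 * gauss (u x)).
  exact: (@der_comp _ erfn _ u _ x (erfn_der _) (du x)).
have dG x : is_derive x 1 (fun x => u x * gauss (u x)) (t^-1 * gauss (u x) + u x * (t^-1 * - (u x * gauss (u x)))).
  exact: (derM (du x) (@der_comp _ gauss _ u _ x (gauss_der _) (du x))).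
pose K x := t^-1 * prim f x - psi z * erfn (u x).
pose K' x := t^-1 * f x - psi z * (t^-1 * gauss (u x)).
have dK x : is_derive x 1 K (K' x) by exact: (derB (derZ _ (testf_prim_der tf x)) (derZ _ (dE x))).
pose W x := L * t * (2 * erfn (u x) - u x * gauss (u x)).
pose W' x := L * t * (2 * (t^-1 * gauss (u x)) - (t^-1 * gauss (u x) + u x * (t^-1 * - (u x * gauss (u x))))).
have dW x : is_derive x 1 W (W' x) by exact: (derZ (L * t) (derB (derZ 2 (dE x)) (dG x))).
have KW x : `|K' x| <= W' x.
  have -> : K' x = (psi x - psi z) * t^-1 * gauss (u x).
    by rewrite /K' /f -[gauss ((z - x) / t)]gauss_even -mulNr opprB -/(u x); ring.
  have -> : W' x = L * ((1 + u x ^+ 2) * gauss (u x)) by rewrite /W'; field.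
  rewrite !normrM (gtr0_norm (gauss_gt0 _)) mulrA ler_wpM2r ?(ltW (gauss_gt0 _))//.
  have := mvt_le z x (smooth_der0 tp.1) HL1 => h.
  apply: le_trans (_ : L * `|x - z| * `|t^-1| <= _); first by rewrite ler_wpM2r.
  rewrite -mulrA -normrM -/(u x) ler_wpM2l//.
  by rewrite ler_norml; apply/andP; split; nra.
have HKW : `|K N - K (- N)| <= W N - W (- N).
  have NN : - N <= N by clear -M0 MN; lra.
  have := @der_nondecreasing _ _ _ _ _ (fun x => derB (dW x) (dK x)) NN.
  have := @der_nondecreasing _ _ _ _ _ (fun x => derD (dW x) (dK x)) NN.
  move=> h1 h2; have {}h1 : W (- N) + K (- N) <= W N + K N.
    by apply: h1 => x _; have := KW x; rewrite ler_norml => /andP[h _]; clear -h; lra.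
  have {}h2 : W (- N) - K (- N) <= W N - K N.
    by apply: h2 => x _; have := KW x; rewrite ler_norml => /andP[_ h]; clear -h; lra.
  by rewrite ler_norml; apply/andP; split; clear -h1 h2; lra.
have WB : W N - W (- N) <= L * (2 * C1 + 2 * C3) * t.
  have -> : W N - W (- N) = L * t * (2 * (erfn (u N) - erfn (u (- N))) - u N * gauss (u N) + u (- N) * gauss (u (- N))).
    by rewrite /W; ring.
  have -> : L * (2 * C1 + 2 * C3) * t = L * t * (2 * C1 + 2 * C3) by ring.
  rewrite ler_wpM2l ?mulr_ge0 ?(ltW t0)//.
  have := HC1 (u (- N)) (u N).
  have := HC3 (u N); have := HC3 (u (- N)); rewrite !expr0 !mul1r (der_D1 gauss_der).
  by rewrite !ler_norml => /andP[h1 h2] /andP[h3 h4] h5; clear -h1 h2 h3 h4 h5; lra.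
have p0 : prim f (- N) = 0.
  apply: (@prim_left _ _ (- M)); last by clear -MN; lra.
  by move=> y yM; rewrite /f psiM ?mul0r// lter_normr; apply/orP; right; clear -yM; lra.
have EKN : t^-1 * conv psi gauss t N z - psi z * (erfn (u N) - erfn (u (- N))) = K N - K (- N).
  by rewrite /K p0 /conv -/f; ring.
move: zN; rewrite ler_norml => /andP[z1 z2].
have it : 0 < t^-1 by rewrite invr_gt0.
have E1 : `|erfn (u N) - erfn t^-1| <= C2 * t.
  have uN : t^-1 <= u N by rewrite /u ler_pdivlMr// mulVf//; clear -z2; lra.
  rewrite ger0_norm ?subr_ge0 ?erfn_le//.
  apply: le_trans (HC2 _ _ uN (or_introl it)) _; rewrite ler_wpM2l ?(ltW C20)// invrK.
  have uN0 : 0 < u N by clear -it uN; lra.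
  have : 0 < (u N)^-1 by rewrite invr_gt0.
  have : (u N)^-1 <= t by rewrite -[leRHS]invrK lef_pV2// posrE.
  by move=> h1 h2; rewrite ger0_norm; clear -h1 h2; lra.
have E2 : `|erfn (- t^-1) - erfn (u (- N))| <= C2 * t.
  have uN : u (- N) <= - t^-1 by rewrite /u ler_pdivrMr// mulNr mulVf//; clear -z1; lra.
  have nt : - t^-1 < 0 by rewrite oppr_lt0.
  rewrite ger0_norm ?subr_ge0 ?erfn_le//.
  apply: le_trans (HC2 _ _ uN (or_intror nt)) _; rewrite ler_wpM2l ?(ltW C20)// invrN invrK.
  have uN0 : 0 < - u (- N) by clear -it uN; lra.
  have : 0 < (- u (- N))^-1 by rewrite invr_gt0.
  have : (- u (- N))^-1 <= t by rewrite -[leRHS]invrK lef_pV2// ?posrE//; clear -uN; lra.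
  by rewrite invrN => h1 h2; rewrite ger0_norm; clear -h1 h2; lra.
have -> : t^-1 * conv psi gauss t N z - psi z * (erfn t^-1 - erfn (- t^-1)) =
  (K N - K (- N)) + psi z * ((erfn (u N) - erfn t^-1) + (erfn (- t^-1) - erfn (u (- N)))).
  by rewrite -EKN; ring.
apply: le_trans (ler_normD _ _) _; rewrite mulrDl lerD//; first exact: le_trans WB.
rewrite normrM -mulrA; apply: ler_pM => //.
by apply: le_trans (ler_normD _ _) _; clear -E1 E2; lra.
Qed.

Lemma conv_w a b T psi t w : edist a b T -> testf psi ->
  is_derive w 1 (fun w => T (conv psi gauss t w)) (psi w * T (fun z => gauss ((z - w) / t))).
Proof.
move=> eT tp; have sG : Cinf (@gauss R) by exact: Cinf_gauss.
have bG := bsmooth_gauss.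
rewrite -(edistZ eT); last exact: smooth_scale.
apply: (edist_param eT) => [v||j]; [exact: conv_Cinf|by apply: smoothZ; exact: smooth_scale|].
have [_ bj] := bG; have [B0 B00 HB0] := bj j; have [B1 B10 HB1] := bj j.+1.
have [P P0 HP] := testf_bounded 1 tp.
exists (`|t^-1| ^+ j * (P * B0 + P * (`|t^-1| * B1))), 1; split=> // h z _.
rewrite !D_conv// D_Z; last exact: smooth_scale.
rewrite D_scale//.
have -> : t^-1 ^+ j * conv psi (D j gauss) t (w + h) z - t^-1 ^+ j * conv psi (D j gauss) t w z -
    h * (psi w * (t^-1 ^+ j * D j gauss ((z - w) / t))) =
  t^-1 ^+ j * (conv psi (D j gauss) t (w + h) z - conv psi (D j gauss) t w z -
    h * (psi w * D j gauss ((z - w) / t))) by ring.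
rewrite normrM normrX -mulrA ler_wpM2l ?exprn_ge0//.
have sj : Cinf (D j (@gauss R)) by exact: smooth_D.
have d1 := testf_prim_der (testf_conv t z tp sj).
have d2 (x : R) : is_derive x 1 (fun x => psi x * D j gauss ((z - x) / t))
   (D 1 psi x * D j gauss ((z - x) / t) + psi x * (- t^-1 * D j.+1 gauss ((z - x) / t))).
  by apply: derM; [exact: smooth_der0 tp.1 _|rewrite DSr; exact: is_derive_transl].
apply: (taylor1 d1 d2) => y _.
apply: le_trans (ler_normD _ _) _; rewrite !normrM normrN.
apply: lerD; first by apply: ler_pM => //; exact: HP.
have := HP 0%N y isT; rewrite D0 => HPy.
by apply: ler_pM => //; apply: ler_pM.
Qed.

(** [T] of the stopped convolution starts from 0 and has derivative [psi w] times a nonnegative mean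
    in [w], so its final value is nonnegative. As [t] tends to 0 the convolution approaches a
    positive multiple of [psi] with all derivatives, hence [T psi] cannot be negative. *)
Lemma pos_of_gmean a b T p q t1 : edist a b T -> 0 < t1 ->
  (forall x t, p <= x -> x <= q -> 0 < t -> t < t1 -> 0 <= gmean T x t) -> pos T p q.
Proof.
move=> eT t10 HG psi p1 q1 tp psi0 pp qq Hs.
have [C0 [k [C00 HC0]]] := edist_bound eT.
have [L L0 HL] := testf_bounded k.+1 tp.
have [C C0' HC] := conv_approx L0.
(* [N] is large enough for [|z| <= N - 1] on [[a - 1, b + 1]], as [conv_approx] requires. *)
pose M := `|p1| + `|q1|; pose N := M + 2 + `|a| + `|b|.
have [na nb np nq] : [/\ 0 <= `|a|, 0 <= `|b|, 0 <= `|p1| & 0 <= `|q1|] by [].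
have M0 : 0 <= M by rewrite addr_ge0.
have MN : M < N by rewrite /N; clear -na nb; lra.
have psiM x : M < `|x| -> psi x = 0.
  rewrite lter_normr => /orP[h|h]; apply: Hs; move: h; rewrite /M.
    by have := ler_norm q1; right; clear -np H h; lra.
  by have := ler_norm (- p1); rewrite normrN; left; clear -nq H h; lra.
have Jpos t : 0 < t -> t < t1 -> 0 <= T (conv psi gauss t N).
  move=> t0 tt1; have NN : - N <= N by clear -M0 MN; lra.
  have := der_nondecreasing (fun w => conv_w t w eT tp) NN.
  have -> : conv psi gauss t (- N) = fun=> 0.
    apply/funext => z; apply: (@prim_left _ _ (- M)); last by clear -MN; lra.
    by move=> y yM; rewrite psiM ?mul0r// lter_normr; apply/orP; right; clear -yM; lra.
  rewrite (edist0 eT); apply => w _.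
  have [h|h] := boolP ((w < p1) || (q1 < w)).
    by rewrite Hs ?mul0r//; apply/orP.
  move: h; rewrite negb_or -!leNgt => /andP[h1 h2].
  have := HG w t; rewrite /gmean pmulr_rge0 ?invr_gt0// => h.
  by rewrite mulr_ge0//; apply: h => //; clear -pp h1 qq h2; lra.
rewrite leNgt; apply/negP => Tneg.
(* The Gaussian mass of [[-1, 1]] bounds the factor [c] below for every [t <= 1]. *)
pose c1 := erfn 1 - erfn (- 1) : R.
have c10 : 0 < c1 by rewrite subr_gt0 erfn_lt//; clear; lra.
pose q0 := - (c1 * T psi) / (2 * (C0 * C + 1)).
have CC : 0 <= C0 * C by exact: mulr_ge0.
have q00 : 0 < q0 by rewrite divr_gt0//; [nra|clear -CC; lra].
pose t := Num.min (Num.min 1 (t1 / 2)) q0.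
have t0 : 0 < t by rewrite !lt_min ltr01 q00; clear -t10; lra.
have [t1' t2 t3] : [/\ t <= 1, t <= t1 / 2 & t <= q0].
  by split; rewrite !ge_min ?lexx ?orbT.
have tt1 : t < t1 by clear -t10 t2; lra.
have J0 := Jpos t t0 tt1.
pose c := erfn t^-1 - erfn (- t^-1) : R.
have c1c : c1 <= c.
  have it : 1 <= t^-1 by rewrite invf_ge1.
  by rewrite /c1 /c lerB// erfn_le//; clear -it; lra.
have sJ : Cinf (conv psi gauss t N) by apply: conv_Cinf => //; exact: bsmooth_gauss.
have : `|T (fun z => t^-1 * conv psi gauss t N z - c * psi z)| <= C0 * (C * t).
  apply: HC0; first by apply: smoothB; apply: smoothZ => //; exact: tp.1.
  move=> j z jk /andP[z1 z2].
  rewrite D_B; [|exact: smoothZ|by apply: smoothZ; exact: tp.1].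
  rewrite !D_Z//; last exact: tp.1.
  rewrite (D_conv_parts t j z tp psiM M0 MN) [c * _]mulrC; apply: (HC _ _ M) => //.
  - exact: testf_D.
  - by move=> x; apply: D_out => //; exact: tp.1.
  - by move=> x; rewrite -DSr; exact: HL.
  - by move=> x; apply: HL; exact: leqW.
  - rewrite /N; have := ler_norm b; have := ler_norm (- a); rewrite normrN => h1 h2.
    by rewrite ler_norml; apply/andP; split; clear -M0 z1 z2 h1 h2 na nb; lra.
rewrite (edistB eT); [|exact: smoothZ|by apply: smoothZ; exact: tp.1].
rewrite !(edistZ eT)//; last exact: tp.1.
rewrite ler_norml => /andP[_ h].
have h2 : 0 <= t^-1 * T (conv psi gauss t N) by rewrite mulr_ge0// invr_ge0 ltW.
have h3 : c * T psi <= c1 * T psi by rewrite ler_wnM2r// ltW.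
have h4 : (C0 * C + 1) * q0 = - (c1 * T psi) / 2 by rewrite /q0; field; clear -CC; lra.
have h5 : (C0 * C + 1) * t <= (C0 * C + 1) * q0 by rewrite ler_wpM2l//; clear -CC; lra.
have h6 : 0 <= C0 * C * t by rewrite mulr_ge0// ltW.
clear -t0 h h2 h3 h4 h5 h6; lra.
Qed.

End Mollification.

(** * The Baire argument: positivity off a countable set is positivity *)

Section Positivity.
Context {R : realType}.
Implicit Types (f g phi psi theta F : R -> R) (T : (R -> R) -> R) (a b c x y z h s t p q w B C d e M : R) (n k m j J : nat).

Definition open_pred (P : R -> Prop) := forall z, P z -> exists2 e, 0 < e & forall w, `|w - z| < e -> P w.

Lemma last_point (P : R -> Prop) y x : open_pred (fun z => ~ P z) -> P y -> y <= x ->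
  exists s, [/\ y <= s, s <= x, P s & forall w, s < w -> w <= x -> ~ P w].
Proof.
move=> oP Py yx; pose A := [set z | P z /\ z <= x].
have Ay : A y by [].
have Ane : A !=set0 by exists y.
have Aub : has_ubound A by exists x => z [].
have ys : y <= sup A by apply: ub_le_sup.
have sx : sup A <= x by apply: ge_sup => // z [].
exists (sup A); split => //.
  apply: contrapT => nP; have [e e0 He] := oP _ nP.
  have [z Az zs] : exists2 z, A z & sup A - e < z by apply: sup_adherent.
  have zsup : z <= sup A by apply: ub_le_sup.
  apply: (He z); last by case: Az.
  by rewrite ltr_norml; apply/andP; split; lra.
by move=> w sw wx Pw; have : w <= sup A; [apply: ub_le_sup|lra].
Qed.

Lemma first_point (P : R -> Prop) y x : open_pred (fun z => ~ P z) -> P y -> x <= y ->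
  exists s, [/\ x <= s, s <= y, P s & forall w, x <= w -> w < s -> ~ P w].
Proof.
move=> oP Py xy; have [|||s [s1 s2 Ps Hs]] := @last_point (fun z => P (- z)) (- y) (- x) _ _ _.
- move=> z /oP[e e0 He]; exists e => // w wz; apply: He.
  by rewrite -opprD normrN.
- by rewrite opprK.
- by rewrite lerN2.
- exists (- s); split => //; try lra.
  by move=> w xw ws; have := Hs (- w); rewrite opprK; apply; lra.
Qed.

Section WithEdist.
Variables (a b : R) (T : (R -> R) -> R).
Hypothesis eT : edist a b T.
Hypothesis nT : forall x, null_at T x.

Definition good x := exists2 e, 0 < e & pos T (x - e) (x + e).

Lemma open_good : open_pred good.
Proof.
move=> x [e e0 He]; exists (e / 2); first by lra.
move=> w; rewrite ltr_norml => /andP[w1 w2]; exists (e / 2); first by lra.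
by apply: pos_sub He; lra.
Qed.

Lemma open_bad : open_pred (fun x => ~ ~ good x).
Proof.
by move=> x /contrapT/open_good[e e0 He]; exists e => // w /He gw; apply.
Qed.

Lemma pos_of_good p q : (forall x, p < x -> x < q -> good x) -> pos T p q.
Proof. by move=> H; apply: (local_global eT) => c pc cq; exact: H. Qed.

(** A single integer measures both the threshold and the lower bound, which leaves countably many
    closed sets for the Baire argument. *)
Definition above n x := forall t, 0 < t -> t < n.+1%:R^-1 -> n.+1%:R^-1 <= gmean T x t.

Lemma open_not_above n : open_pred (fun x => ~ above n x).
Proof.
move=> x /existsNP[t] /not_implyP[t0] /not_implyP[tn] /negP; rewrite -ltNge => gx.
have tn0 : t != 0 by rewrite gt_eqF.
have c : continuous (fun x => gmean T x t) by apply: (@der_continuous _ _ (fun x => _)) => y; exact: (gmean_x eT y tn0).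
have e0 : 0 < n.+1%:R^-1 - gmean T x t by rewrite subr_gt0.
have /cvgrPdist_lt/(_ _ e0)/nbhs_ballP[e /= ep He] := c x.
exists e => // w wx Hw; have := He w; rewrite /ball/= distrC => /(_ wx).
have := Hw t t0 tn; move: (gmean T w t) (gmean T x t) => u v h; rewrite ltr_norml => /andP[h1 _].
by move: h1; rewrite opprB ltrD2l ltrN2 ltNge h.
Qed.

(** Between the first and the last bad point of a slightly smaller interval every point is bad, with
    a mean bounded below, or lies in a gap whose endpoints are bad; [gap_gmean] then gives
    nonnegative means with one threshold. The two outer pieces consist of good points and are glued
    at the extreme bad points. *)
Lemma pos_of_above n p q : (forall x, p < x -> x < q -> ~ good x -> above n x) -> pos T p q.
Proof.
move=> H psi p1 q1 tp psi0 pp qq Hs.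
have n0 : 0 < n.+1%:R^-1 :> R by rewrite invr_gt0.
pose p' := (p + p1) / 2; pose q' := (q + q1) / 2.
suff Hpq : pos T p' q' by apply: (Hpq psi p1 q1) => //; rewrite /p' /q'; lra.
have [[y [yp yq yb]]|nob] := pselect (exists y, [/\ p' <= y, y <= q' & ~ good y]); last first.
  apply: pos_of_good => x px xq; apply: contrapT => xb; apply: nob; exists x.
  by split => //; exact: ltW.
have [x0 [px0 x0y x0b H0]] := first_point open_bad yb yp.
have [x1 [yx1 x1q x1b H1]] := last_point open_bad yb yq.
have bad_above x : x0 <= x -> x <= x1 -> ~ good x -> above n x.
  by move=> ? ?; apply: H; rewrite /p' /q' in px0 x1q; lra.
have G x t : x0 <= x -> x <= x1 -> 0 < t -> t < n.+1%:R^-1 -> 0 <= gmean T x t.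
  move=> x0x xx1 t0 tn; have [gx|bx] := pselect (good x); last first.
    by apply: le_trans (ltW n0) _; exact: bad_above.
  have [y0 [xy0 y0x by0 Hy0]] := last_point open_bad x0b x0x.
  have [y1 [xy1 y1x by1 Hy1]] := first_point open_bad x1b xx1.
  have y0x' : y0 < x by rewrite lt_neqAle y0x andbT; apply/eqP => E; rewrite E in by0.
  have xy1' : x < y1 by rewrite lt_neqAle xy1 andbT; apply/eqP => E; rewrite -E in by1.
  apply: (gap_gmean eT (nT y0) (nT y1) _ _ _ y0x xy1 t0 tn).
  - by clear -xy1 y0x'; lra.
  - apply: pos_of_good => w w0 w1; apply: contrapT.
    by have [wx|wx] := leP w x; [apply: Hy0|apply: Hy1 => //; exact: ltW].
  - move=> s s0 sn; split; apply: (lt_le_trans n0); apply: bad_above => //; clear -xx1 y0x x0x xy1; lra.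
have P01 := pos_of_gmean eT n0 G.
have P0 : pos T p' x0.
  apply: pos_of_good => w w0 w1; apply: contrapT.
  by apply: H0 => //; exact: ltW.
have P1 : pos T x1 q'.
  apply: pos_of_good => w w0 w1; apply: contrapT.
  by apply: H1 => //; exact: ltW.
exact: (glue_point eT (nT x1) (glue_point eT (nT x0) P0 P01) P1).
Qed.

(** One exceptional point is dealt with by gluing its two sides; the nested intervals remove the
    countable set one point at a time. *)
Lemma pos_of_above1 n e p q :
  (forall x, p < x -> x < q -> ~ good x -> above n x \/ x = e) -> pos T p q.
Proof.
move=> H; have [ep|pe] := leP e p.
  apply: (@pos_of_above n) => x px xq bx; have [//|E] := H x px xq bx; lra.
have [qe|eq] := leP q e.
  apply: (@pos_of_above n) => x px xq bx; have [//|E] := H x px xq bx; lra.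
apply: (glue_point eT (nT e)).
  apply: (@pos_of_above n) => x px xe bx; have [|//|E] := H x px _ bx; lra.
apply: (@pos_of_above n) => x xe xq bx; have [|//|E] := H x _ xq bx; lra.
Qed.

(** If positivity fails, [pos_of_above1] yields a bad point outside [above n] and different from
    [e]. As [above n] is closed, a small interval around this point avoids both, and positivity
    still fails on it because the point is bad. *)
Lemma shrink n e p q : ~ pos T p q -> exists r : R * R,
  [/\ ~ pos T r.1 r.2, p <= r.1, r.1 <= r.2, r.2 <= q &
   r.2 - r.1 <= n.+1%:R^-1 /\ forall x, r.1 <= x -> x <= r.2 -> ~ above n x /\ x <> e].
Proof.
move=> npos.
have [x [px xq bx nA ne]] : exists x, [/\ p < x, x < q, ~ good x, ~ above n x & x <> e].
  apply: contrapT => nx; apply: npos; apply: (@pos_of_above1 n e) => x px xq bx.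
  by apply: contrapT => /not_orP[? ?]; apply: nx; exists x; split.
have [d d0 Hd] := open_not_above nA.
have n0 : 0 < n.+1%:R^-1 :> R by rewrite invr_gt0.
have xe : 0 < `|x - e| by rewrite normr_gt0 subr_eq0; apply/eqP.
pose r := Num.min (Num.min (Num.min (x - p) (q - x)) (Num.min d `|x - e|)) n.+1%:R^-1 / 2.
have r0 : 0 < r by rewrite divr_gt0// !lt_min d0 xe n0 !subr_gt0 px xq.
have [r1 r2 [r3 r4 r5]] : [/\ 2 * r <= x - p, 2 * r <= q - x & [/\ 2 * r <= d, 2 * r <= `|x - e| & 2 * r <= n.+1%:R^-1]].
  have -> : 2 * r = Num.min (Num.min (Num.min (x - p) (q - x)) (Num.min d `|x - e|)) n.+1%:R^-1.
    by rewrite /r; field.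
  by split; [| |split]; rewrite !ge_min !lexx ?orbT.
exists (x - r, x + r); split => /=; try (clear -px r1 r0 xq r2; lra).
  by move=> Hp; apply: bx; exists r.
split; first by rewrite (_ : x + r - (x - r) = 2 * r)//; ring.
move=> y y1 y2; split; first by apply: Hd; rewrite ltr_norml; apply/andP; split; clear -d0 r3 y1 y2; lra.
move=> E; have : `|x - y| <= r by rewrite ler_norml; apply/andP; split; clear -y2 y1; lra.
by rewrite E; clear -xe r4; lra.
Qed.

(** The nested intervals have lengths tending to 0 and positivity fails on each, so their common
    point is bad. It therefore lies in [[a, b]], yet it avoids every [above n] and every [E n]. *)
Lemma pos_everywhere (E : nat -> R) :
  (forall x, a <= x -> x <= b -> (exists n, above n x) \/ exists n, x = E n) ->
  forall p q, pos T p q.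
Proof.
move=> HE p0 q0; apply: contrapT => npos.
pose Q (v : nat * (R * R)) (r : R * R) := ~ pos T v.2.1 v.2.2 ->
  [/\ ~ pos T r.1 r.2, v.2.1 <= r.1, r.1 <= r.2, r.2 <= v.2.2 & r.2 - r.1 <= v.1.+1%:R^-1 /\
   forall x, r.1 <= x -> x <= r.2 -> ~ above v.1 x /\ x <> E v.1].
have [v|st Hst] := @choice _ _ Q.
  have [h|h] := pselect (pos T v.2.1 v.2.2); first by exists v.2.
  by have [r Hr] := shrink v.1 (E v.1) h; exists r.
pose fix r n : R * R := if n is n'.+1 then st (n', r n') else (p0, q0).
have npr n : ~ pos T (r n).1 (r n).2.
  by elim: n => [//|n IH]; have [] := Hst (n, r n) IH.
have Hr n := Hst (n, r n) (npr n).
have mono1 n m : (r n).1 <= (r (n + m)%N).1.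
  elim: m => [|m IH]; first by rewrite addn0.
  by rewrite addnS; apply: le_trans IH _; have [] := Hr (n + m)%N.
have mono2 n m : (r (n + m)%N).2 <= (r n).2.
  elim: m => [|m IH]; first by rewrite addn0.
  by rewrite addnS; apply: le_trans IH; have [] := Hr (n + m)%N.
have cross n m : (r n.+1).1 <= (r m.+1).2.
  apply: le_trans (mono1 n.+1 m.+1) _; apply: le_trans (mono2 m.+1 n.+1).
  by rewrite [(m.+1 + _)%N]addnC addSn; have [] := Hr (n + m.+1)%N.
pose A := [set (r n.+1).1 | n in [set: nat]].
have Ane : A !=set0 by exists (r 1).1; exists 0%N.
have Aub m : ubound A (r m.+1).2 by move=> _ [n _ <-].
pose s := sup A.
have s1 n : (r n.+1).1 <= s by apply: ub_le_sup; [exists (r 1).2; exact: Aub|exists n].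
have s2 n : s <= (r n.+1).2 by apply: ge_sup.
have sbad : ~ good s.
  move=> [e e0 He]; have /= [n _ ne] := near_infty_natSinv_lt (PosNum e0).
  apply: (npr n.+1).
  have h : (r n.+1).2 - (r n.+1).1 < e.
    by apply: le_lt_trans (ne n (leqnn _)); have [_ _ _ _ []] := Hr n.
  have := s1 n; have := s2 n; move: h.
  set u := (r _).1; set v := (r _).2 => ? ? ?.
  by apply: pos_sub He; lra.
have sa : a <= s.
  rewrite leNgt; apply/negP => sa; apply: sbad; exists (a - s); first by lra.
  by apply: (pos_left eT); lra.
have sb : s <= b.
  rewrite leNgt; apply/negP => sb; apply: sbad; exists (s - b); first by lra.
  by apply: (pos_right eT); lra.
have H n : ~ above n s /\ s <> E n.
  by have [_ _ _ _ [_ h]] := Hr n; apply: h; [exact: s1|exact: s2].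
by have [[n An]|[n En]] := HE s sa sb; have [] := H n.
Qed.

Lemma positivity (E : set R) : countable E ->
  (forall x, a <= x -> x <= b -> ~ E x -> exists c d, [/\ 0 < c, 0 < d &
     forall t, 0 < t -> t < d -> c <= gmean T x t]) ->
  forall psi, testf psi -> (forall x, 0 <= psi x) -> 0 <= T psi.
Proof.
move=> cE HE psi tp psi0.
have [f Hf] : exists f : nat -> R, E `<=` range f.
  have [E0|Ene] := eqVneq E set0; first by exists (fun=> 0); rewrite E0.
  have /pfcard_geP[E0|[g]] := cE.
    by rewrite E0 eqxx in Ene.
  by exists g => x /(@surj _ _ _ _ g)[n _ <-]; exists n.
have Hpos : forall p q, pos T p q.
  apply: (@pos_everywhere f) => x ax xb; have [Ex|nEx] := pselect (E x).
    by right; have [n _ <-] := Hf x Ex; exists n.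
  left; have [c [d [c0 d0 H]]] := HE x ax xb nEx.
  have m0 : 0 < Num.min c d by rewrite lt_min c0.
  have /= [n _ ne] := near_infty_natSinv_lt (PosNum m0).
  have := ne n (leqnn _) => /=; rewrite lt_min => /andP[n1 n2].
  by exists n => t t0 tn; apply: le_trans (ltW n1) _; apply: H => //; exact: lt_trans n2.
have [_ [M HM]] := tp.
apply: (Hpos (- `|M| - 1) (`|M| + 1) psi (- `|M|) `|M|) => //; try lra.
move=> x Hx; apply: HM; apply: le_lt_trans (ler_norm M) _; rewrite lter_normr.
by case: Hx => ?; apply/orP; [right|left]; lra.
Qed.

End WithEdist.
End Positivity.

(** * An absolutely continuous penalty measure *)

Section PenaltyMeasure.
Context {R : realType}.
Implicit Types (D : set R) (f g phi psi theta F : R -> R) (T : (R -> R) -> R) (a b c x y z h s t p q w B C d e M K : R) (n k m j J N : nat).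
Local Notation mu := (@lebesgue_measure R).

Lemma lower_gt (f : R -> \bar R) c : (c%:E < limf_einf f 0^'+)%E ->
  exists2 d, 0 < d & forall t, 0 < t -> t < d -> (c%:E <= f t)%E.
Proof.
rewrite limf_einfE => /ereal_sup_gt[_ [V /= VF <-]] cV.
have [d d0 Hd] := (near_right0P V).1 VF; exists d => // t t0 td.
apply: le_trans (ltW cV) _; apply: ereal_inf_lbound; exists t => //; exact: Hd.
Qed.

Lemma upper_lt (f : R -> \bar R) c : (limf_esup f 0^'+ < c%:E)%E ->
  exists2 d, 0 < d & forall t, 0 < t -> t < d -> (f t <= c%:E)%E.
Proof.
rewrite limf_esupE => /ereal_inf_lt[_ [V /= VF <-]] cV.
have [d d0 Hd] := (near_right0P V).1 VF; exists d => // t t0 td.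
apply: le_trans (ltW cV); apply: ereal_sup_ubound; exists t => //; exact: Hd.
Qed.

Lemma lower_ge (f : R -> \bar R) c d : 0 < d -> (forall t, 0 < t -> t < d -> (c%:E <= f t)%E) ->
  (c%:E <= limf_einf f 0^'+)%E.
Proof.
move=> d0 H; rewrite limf_einfE; apply: (@le_trans _ _ (ereal_inf (f @` [set t | 0 < t < d]))); last first.
  apply: ereal_sup_ubound.
  exists [set t | 0 < t < d] => //=; apply/near_right0P; exists d => // t t0 td.
  by rewrite /= t0.
by apply: le_ereal_inf_tmp => _ [t /= /andP[t0 td] <-]; exact: H.
Qed.

Lemma cvg_of_geometric (s : nat -> R) l c : (forall n, `|l - s n| <= c * 2^-1 ^+ n) ->
  s @ \oo --> l.
Proof.
move=> H; apply/cvgrPdist_le => eps e0.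
have q1 : `|2^-1| < 1 :> R by rewrite gtr0_norm ?invf_lt1//; lra.
have := @cvg_geometric R c 2^-1 q1; move=> /cvgrPdist_le/(_ _ e0); apply: filterS => n /=.
rewrite sub0r normrN => h; apply: le_trans (H n) _; apply: le_trans h; exact: ler_norm.
Qed.

Lemma mu_itv x y : x <= y -> mu `[x, y] = (y - x)%:E.
Proof.
rewrite lebesgue_measure_itv/= lte_fin le_eqVlt => /predU1P[->|->]; last by rewrite EFinB.
by rewrite ltxx subrr.
Qed.

Lemma half_small c e : 0 < e -> exists N, c * 2^-1 ^+ N <= e.
Proof.
move=> e0; have q1 : `|2^-1| < 1 :> R by rewrite gtr0_norm ?invf_lt1//; lra.
have := @cvg_geometric R c 2^-1 q1; move=> /cvgrPdist_le/(_ _ e0)/filter_ex[N /=].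
by rewrite sub0r normrN => h; exists N; apply: le_trans h; exact: ler_norm.
Qed.

Section Density.
Variables (a b : R).

Lemma integrable_sub D f : measurable D -> D `<=` `[a, b] -> Cinf f ->
  mu.-integrable D (EFin \o f).
Proof.
move=> mD Dab sf; apply: (@integrableS _ _ _ mu `[a, b]) => //.
apply: continuous_compact_integrable; first exact: segment_compact.
by apply: continuous_subspaceT; exact: smooth_continuous.
Qed.

Lemma Rint_bound D f B : measurable D -> D `<=` `[a, b] -> Cinf f -> 
  (forall x, a <= x -> x <= b -> `|f x| <= B) -> `|\int[mu]_(x in D) f x| <= B * fine (mu D).
Proof.
move=> mD Dab sf fB; have iD := integrable_sub mD Dab sf.
apply: le_trans (@le_normr_Rintegral _ _ _ mu D f mD iD) _; rewrite -(@Rintegral_cst _ _ _ mu D mD B).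
apply: le_Rintegral => //.
- exact: integrable_norm.
- by apply: (integrable_sub (f := fun=> B)) => //; exact: smooth_cst.
- by move=> x /Dab; rewrite /= in_itv/= => /andP[? ?]; exact: fB.
Qed.

(** On [[x - t, x + t]], of length [2 * t], the integrand is at least [gauss 1]. *)
Lemma gauss_mass D x t : measurable D -> D `<=` `[a, b] -> 0 < t -> `[x - t, x + t] `<=` D ->
  2 * gauss 1 <= t^-1 * \int[mu]_(y in D) gauss ((y - x) / t).
Proof.
move=> mD Dab t0 xD; have sg : Cinf (fun y => gauss ((y - x) / t)).
  by apply: smooth_scale; exact: Cinf_gauss.
have iD := integrable_sub mD Dab sg.
have mI : measurable (`[x - t, x + t] : set R) by [].
have Iab : `[x - t, x + t] `<=` `[a, b] by exact: subset_trans Dab.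
have iI := integrable_sub mI Iab sg.
rewrite ler_pdivlMl//; apply: (@le_trans _ _ (\int[mu]_(y in `[x - t, x + t]) gauss ((y - x) / t))).
  have -> : t * (2 * gauss 1) = \int[mu]_(y in `[x - t, x + t]) gauss 1.
    have xt : x - t <= x + t by lra.
    transitivity (gauss 1 * fine (mu `[x - t, x + t])); last by rewrite Rintegral_cst.
    by rewrite (mu_itv xt)/=; ring.
  apply: le_Rintegral => //.
    by apply: (integrable_sub (f := fun=> gauss 1)) => //; exact: smooth_cst.
  move=> y; rewrite /= in_itv/= => /andP[y1 y2]; rewrite !gaussE ler_wpM2l ?normal_peak_ge0//.
  rewrite ler_expR lerN2 ler_wpM2l//.
  have : `|(y - x) / t| <= 1.
    by rewrite ler_norml ler_pdivlMr// ler_pdivrMr//; apply/andP; split; lra.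
  by rewrite -(real_normK (num_real ((y - x) / t))) => h; rewrite ler_pXn2r ?nnegrE.
rewrite /Rintegral fine_le//.
- exact: integrable_fin_num.
- exact: integrable_fin_num.
- apply: ge0_subset_integral => //; first by have /integrableP[] := iD.
  by move=> y _; rewrite lee_fin ltW// gauss_gt0.
Qed.

End Density.

Section PenaltySeries.
Variables (a b : R) (D : nat -> set R) (K : R).
Hypotheses (ab : a <= b) (mD : forall n, measurable (D n)) (Dab : forall n, D n `<=` `[a, b]).
Hypotheses (K0 : 0 <= K) (muD : forall n, fine (mu (D n)) <= K * 2^-1 ^+ n).

Let part f N := \sum_(n < N) \int[mu]_(x in D n) f x.

(** Integration against the sum of the indicators of the [D n], an integrable density that is
    infinite where all of them overlap. *)
Definition penalty f : R := limn (part f).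

Lemma half_ge0 n : 0 <= 2^-1 ^+ n :> R.
Proof. by rewrite exprn_ge0. Qed.

Lemma halfS n : 2^-1 ^+ n.+1 <= 2^-1 ^+ n / 2 :> R.
Proof. by rewrite exprSr. Qed.

Lemma penalty_approx f B N : Cinf f -> 0 <= B -> (forall x, a <= x -> x <= b -> `|f x| <= B) ->
  `|penalty f - part f N| <= 2 * B * K * 2^-1 ^+ N.
Proof.
move=> sf B0 fB; have BK : 0 <= B * K by exact: mulr_ge0.
have [||n _|l Hl] := @geometric_limit R (part f) (fun n => B * K * 2^-1 ^+ n) 0.
- by move=> n; rewrite mulr_ge0// half_ge0.
- by move=> n; rewrite -[leRHS]mulrA ler_wpM2l// halfS.
- rewrite /part big_ord_recr/= addrAC subrr add0r -mulrA.
  by apply: le_trans (Rint_bound (mD n) (@Dab n) sf fB) _; rewrite ler_wpM2l.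
have -> : penalty f = l.
  apply: cvg_lim => //; apply: (@cvg_of_geometric _ _ (2 * B * K)) => n.
  by have := Hl n isT; rewrite !mulrA.
by have := Hl N isT; rewrite !mulrA.
Qed.

Lemma part_lin c f g N : Cinf f -> Cinf g ->
  part (fun x => c * f x + g x) N = c * part f N + part g N.
Proof.
move=> sf sg; rewrite /part big_distrr/= -big_split/=; apply: eq_bigr => n _.
have iF := integrable_sub (mD n) (@Dab n) sf; have iG := integrable_sub (mD n) (@Dab n) sg.
have iZ := integrable_sub (mD n) (@Dab n) (smoothZ c sf).
rewrite (@RintegralD _ _ _ mu _ (fun x => c * f x) g (mD n) iZ iG).
by rewrite (@RintegralZl _ _ _ mu _ f c (mD n) iF).
Qed.

Lemma Cinf_bounded_on f : Cinf f -> exists2 B, 0 <= B & forall x, a <= x -> x <= b -> `|f x| <= B.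
Proof.
move=> sf; have [B B0 HB] := Cinf_bounded 0 (`|a| + `|b|) sf; exists B => // x ax xb.
have := HB 0%N x isT; rewrite D0; apply.
have := ler_norm b; have := ler_norm (- a); rewrite normrN.
by have := normr_ge0 a; have := normr_ge0 b => *; rewrite ler_norml; apply/andP; split; lra.
Qed.

Lemma part_bound f B N : Cinf f -> 0 <= B -> (forall x, a <= x -> x <= b -> `|f x| <= B) ->
  `|part f N| <= 2 * B * K.
Proof.
move=> sf B0 fB; have BK : 0 <= B * K by exact: mulr_ge0.
suff H : `|part f N| <= 2 * B * K - 2 * (B * K) * 2^-1 ^+ N.
  by apply: le_trans H _; rewrite gerBl mulr_ge0 ?half_ge0// mulr_ge0.
rewrite /part; elim: N => [|n IH]; first by rewrite big_ord0 normr0 expr0; lra.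
rewrite big_ord_recr/=; apply: le_trans (ler_normD _ _) _.
have := Rint_bound (mD n) (@Dab n) sf fB => h1.
have h2 : B * fine (mu (D n)) <= B * (K * 2^-1 ^+ n) by rewrite ler_wpM2l.
by rewrite exprSr; lra.
Qed.

Lemma edist_penalty : edist a b penalty.
Proof.
have le0 x c : (forall N, (0 <= N)%N -> `|x| <= 0 + c * 2^-1 ^+ N) -> x = 0.
  move=> H; apply/eqP; rewrite -normr_le0.
  exact: (@le_of_halving _ _ _ _ _ _ half_ge0 halfS H).
split.
- move=> c f g sf sg; have [B1 B10 H1] := Cinf_bounded_on sf.
  have [B2 B20 H2] := Cinf_bounded_on sg.
  have B3 : 0 <= `|c| * B1 + B2 by rewrite addr_ge0// mulr_ge0.
  have H3 x : a <= x -> x <= b -> `|c * f x + g x| <= `|c| * B1 + B2.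
    move=> ax xb; apply: le_trans (ler_normD _ _) _; rewrite normrM lerD ?ler_wpM2l//.
      exact: H1.
    exact: H2.
  apply/eqP; rewrite -subr_eq0; apply/eqP.
  apply: (le0 _ (2 * (`|c| * B1 + B2) * K + `|c| * (2 * B1 * K) + 2 * B2 * K)) => N _.
  have sfg : Cinf (fun x => c * f x + g x) by apply: smoothD => //; exact: smoothZ.
  have := penalty_approx N sfg B3 H3; have := penalty_approx N sf B10 H1.
  have := penalty_approx N sg B20 H2; rewrite part_lin//.
  move: (penalty _) (penalty f) (penalty g) (part f N) (part g N) => u v w p q h1 h2 h3.
  have -> : u - (c * v + w) = (u - (c * p + q)) - c * (v - p) - (w - q) by ring.
  have h4 : `|c| * `|v - p| <= `|c| * (2 * B1 * K * 2^-1 ^+ N) by rewrite ler_wpM2l.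
  rewrite add0r; apply: le_trans (ler_normB _ _) _.
  have := ler_normB (u - (c * p + q)) (c * (v - p)); rewrite normrM; clear -ab mD Dab K0 muD h1 h3 h4; lra.
- exists (2 * K), 0%N; split; first by rewrite mulr_ge0.
  move=> f B sf HB.
  have fB x : a <= x -> x <= b -> `|f x| <= B.
    by move=> ax xb; have := HB 0%N x isT; rewrite D0; apply; apply/andP; split; lra.
  have B0 : 0 <= B by apply: le_trans (fB a _ _).
  apply: (@le_of_halving _ _ _ (2 * B * K) _ 0 half_ge0 halfS) => N _.
  have := penalty_approx N sf B0 fB; have := part_bound N sf B0 fB => h1 h2.
  rewrite -[penalty f](subrK (part f N)); apply: le_trans (ler_normD _ _) _.
  by lra.
- move=> f e sf e0 f0; apply: (le0 _ 0) => N _.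
  have := penalty_approx N sf (lexx 0); rewrite mulr0 !mul0r => H.
  have {}H : `|penalty f - part f N| <= 0.
    by apply: H => x ax xb; rewrite f0 ?normr0//; apply/andP; split; lra.
  have : `|part f N| <= 2 * 0 * K.
    by apply: part_bound => // x ax xb; rewrite f0 ?normr0//; apply/andP; split; lra.
  move: H; rewrite mulr0 mul0r !normr_le0 subr_eq0 => /eqP -> /eqP ->.
  by rewrite normr0 addr0.
Qed.

Lemma penalty_ge f N : Cinf f -> (forall x, 0 <= f x) -> part f N <= penalty f.
Proof.
move=> sf f0; have [B B0 HB] := Cinf_bounded_on sf.
apply: (@le_of_halving _ _ _ (2 * B * K) _ N half_ge0 halfS) => M NM.
have := penalty_approx M sf B0 HB; rewrite ler_norml => /andP[h _].
apply: (@le_trans _ _ (part f M)); last by lra.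
rewrite /part -(subnKC NM); elim: (M - N)%N => [|m IH]; first by rewrite addn0.
by apply: le_trans IH _; rewrite addnS big_ord_recr/= lerDl Rintegral_ge0.
Qed.

(** The remainder of the series is small uniformly in [s]; each of the first [N] terms sees an
    interval of length [2 * M * s] only. *)
Lemma null_penalty x : null_at penalty x.
Proof.
move=> th tth eps e0; have [B B0 HB] := testf_bounded 0 tth.
have [M0 HM0] := tth.2; pose M := Num.max M0 1.
have M1 : 1 <= M by rewrite le_max lexx orbT.
have HM y : M < `|y| -> th y = 0 by rewrite gt_max => /andP[/HM0].
have e2 : 0 < eps / 2 by lra.
have [N HN] := half_small (2 * B * K) e2.
have c0 : 0 <= N%:R * (B * (2 * M)) by rewrite !mulr_ge0//; lra.
exists (eps / 2 / (N%:R * (B * (2 * M)) + 1)); first by rewrite divr_gt0//; lra.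
move=> s s0; rewrite ltr_pdivlMr; last by lra.
move=> sd; have sn : s != 0 by rewrite gt_eqF.
pose f y := th ((y - x) / s).
have sf : Cinf f by apply: smooth_scale; exact: tth.1.
have fB y : a <= y -> y <= b -> `|f y| <= B.
  by move=> _ _; have := HB 0%N ((y - x) / s) isT; rewrite D0.
have HP n : `|\int[mu]_(y in D n) f y| <= B * (2 * M) * s.
  pose I := `[x - M * s, x + M * s]%classic.
  have -> : \int[mu]_(y in D n) f y = \int[mu]_(y in D n `&` I) f y.
    rewrite Rintegral_mkcondr; congr (Rintegral mu _ _); apply/funext => y; rewrite patchE.
    case: ifPn => // /negP; rewrite inE /I /= in_itv/= => h; apply: HM; rewrite lter_normr.
    rewrite ltr_pdivlMr// -mulNr ltr_pdivlMr//; apply/negP => /negP h2; apply: h.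
    by move: h2; rewrite negb_or -!leNgt => /andP[? ?]; apply/andP; split; lra.
  have mI : measurable I by exact: measurable_itv.
  have mDI : measurable (D n `&` I) by exact: measurableI.
  have DIab : D n `&` I `<=` `[a, b] by move=> y [/Dab].
  have Ms : 0 <= M * s by rewrite mulr_ge0 ?(ltW s0)//; clear -ab mD Dab K0 muD M1; lra.
  have II : x - M * s <= x + M * s by clear -ab mD Dab K0 muD Ms; lra.
  apply: le_trans (Rint_bound mDI DIab sf fB) _; rewrite -mulrA ler_wpM2l//.
  have -> : 2 * M * s = fine (mu I) by rewrite /I (mu_itv II)/=; ring.
  have muI : mu I = (2 * M * s)%:E by rewrite /I (mu_itv II); congr EFin; ring.
  have DII : (mu (D n `&` I) <= mu I)%E by apply: le_measure; rewrite ?inE.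
  apply: fine_le => //; last by rewrite muI.
  by rewrite ge0_fin_numE//; apply: le_lt_trans DII _; rewrite muI ltry.
have h1 := penalty_approx N sf B0 fB.
have h2 : `|part f N| <= N%:R * (B * (2 * M) * s).
  apply: le_trans (ler_norm_sum _ _ _) _.
  rewrite mulr_natl -[X in _ *+ X](card_ord N) -sumr_const.
  by apply: ler_sum => n _; exact: HP.
rewrite -/f -[penalty f](subrK (part f N)); apply: le_trans (ler_normD _ _) _.
nra.
Qed.

End PenaltySeries.

End PenaltyMeasure.

(** * Minor pairs lie below major pairs *)

Section MajorMinor.
Context {R : realType}.
Implicit Types (D E G Z : set R) (f g phi psi theta F : R -> R) (T : (R -> R) -> R) (a b c x y z h s t p q w B C d e M K : R) (n k m j J N : nat).
Local Notation mu := (@lebesgue_measure R).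

Lemma countable_setU D E : countable D -> countable E -> countable (D `|` E).
Proof.
move=> cD cE; rewrite -bigcup2E; apply: bigcup_countable => // -[|[|n]] _ //.
Qed.

Lemma negligible_cover Z e : mu.-negligible Z -> 0 < e ->
  exists G, [/\ open G, Z `<=` G & (mu G <= e%:E)%E].
Proof.
move=> nZ e0; have [A [mA A0 ZA]] : exists A : set R, [/\ measurable A, mu A = 0 & Z `<=` A] := nZ.
have Afin : (mu A < +oo)%E by rewrite A0.
have [G [oG AG mG]] := lebesgue_regularity_outer mA Afin e0.
exists G; split => //; first exact: subset_trans AG.
have mG' : measurable G by exact: open_measurable.
have -> : mu G = (mu (G `\` A) + mu (G `&` A))%E by exact: measureDI.
rewrite -[leRHS]adde0; apply: leeD; first exact: ltW.
by rewrite -A0; apply: le_measure; rewrite ?inE//; exact: measurableI.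
Qed.

Lemma open_itv_sub G x : open G -> G x -> exists2 d, 0 < d & forall t, t < d -> `[x - t, x + t] `<=` G.
Proof.
move=> oG Gx; have /nbhs_ballP[d /= d0 Hd] := oG x Gx; exists d => // t td y.
rewrite /= in_itv/= => /andP[y1 y2]; apply: Hd; rewrite /ball/= ltr_norml.
by apply/andP; split; lra.
Qed.

(** [D 0] is []a, b[] and [D n.+1] an open set of measure at most [2^-1 ^+ n] containing [Z] inside
    the interval. Near a point of [Z] any finite number of these sets contains a whole
    neighbourhood, so the means exceed any [K]; elsewhere [D 0] alone gives [2 * gauss 1]. *)
Lemma penalty_exists a b Z : a <= b -> mu.-negligible Z -> exists P : (R -> R) -> R,
  [/\ edist a b P, forall x, null_at P x,
   forall x, a < x -> x < b -> exists2 d, 0 < d & forall t, 0 < t -> t < d -> 2 * gauss 1 <= gmean P x t &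
   forall x K, a < x -> x < b -> Z x -> exists2 d, 0 < d & forall t, 0 < t -> t < d -> K <= gmean P x t].
Proof.
move=> ab nZ.
have [n|G HG] := @choice nat (set R) (fun n G => [/\ open G, Z `<=` G & (mu G <= (2^-1 ^+ n)%:E)%E]).
  by apply: negligible_cover => //; rewrite exprn_gt0.
pose I := `]a, b[%classic : set R.
pose D n := if n is n'.+1 then G n' `&` I else I.
have oI : open I by exact: interval_open.
have oD n : open (D n) by case: n => //= n; apply: openI => //; have [] := HG n.
have mD n : measurable (D n) by exact: open_measurable.
have Iab : I `<=` `[a, b] by exact: subset_itv_oo_cc.
have Dab n : D n `<=` `[a, b] by case: n => //= n x [_ /Iab].
(* [b - a] accounts for [D 0]; the 2 turns the bound [2^-1 ^+ n] on [D n.+1] into one with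
   [2^-1 ^+ n.+1]. *)
pose K := b - a + 2; have K0 : 0 <= K by rewrite /K; lra.
have muI : mu I = (b - a)%:E.
  rewrite /I lebesgue_measure_itv/= lte_fin; move: ab; rewrite le_eqVlt => /predU1P[->|->]; last by rewrite EFinB.
  by rewrite ltxx subrr.
have muD n : fine (mu (D n)) <= K * 2^-1 ^+ n.
  case: n => [|n]; first by rewrite /= muI expr0 /K/=; lra.
  have [oG _ Gn] := HG n.
  have h : (mu (D n.+1) <= (2^-1 ^+ n)%:E)%E.
    apply: le_trans Gn; apply: le_measure; rewrite ?inE//.
    - exact: (mD n.+1).
    - exact: open_measurable.
    - exact: subIsetl.
  have fin : mu (D n.+1) \is a fin_num.
    by rewrite ge0_fin_numE//; apply: le_lt_trans h _; rewrite ltry.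
  have := fine_le fin _ h => /(_ isT) /= h2; apply: le_trans h2 _.
  rewrite exprSr /K; have := @half_ge0 R n; nra.
exists (penalty D).
have low x N : (forall n, (n < N)%N -> D n x) -> exists2 d, 0 < d &
    forall t, 0 < t -> t < d -> N%:R * (2 * gauss 1) <= gmean (penalty D) x t.
  move=> HN; have [d d0 Hd] : exists2 d, 0 < d & forall n t, (n < N)%N -> t < d -> `[x - t, x + t] `<=` D n.
    elim: N HN => [|N IH] HN; first by exists 1.
    have [d d0 Hd] := IH (fun n nN => HN n (leqW nN)).
    have [d' d'0 Hd'] := open_itv_sub (oD N) (HN N (leqnn _)).
    exists (Num.min d d'); first by rewrite lt_min d0.
    move=> n t; rewrite ltnS leq_eqVlt lt_min => /predU1P[->|nN] /andP[td td']; first exact: Hd'.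
    exact: Hd.
  exists d => // t t0 td; rewrite /gmean.
  have sg : Cinf (fun y => gauss ((y - x) / t)) by apply: smooth_scale; exact: Cinf_gauss.
  have := penalty_ge mD Dab K0 muD N sg (fun y => ltW (gauss_gt0 _)).
  rewrite -(ler_pM2l (x := t^-1)) ?invr_gt0// => h; apply: le_trans h.
  rewrite mulr_sumr -[N in N%:R](card_ord N) -sum1_card natr_sum mulr_suml.
  apply: ler_sum => n _; rewrite mul1r; apply: (gauss_mass (mD n) (Dab n) t0).
  exact: Hd.
have DI x : a < x -> x < b -> D 0%N x by move=> ax xb; rewrite /D /I /= in_itv/= ax.
split.
- exact: (edist_penalty ab mD Dab K0 muD).
- exact: (null_penalty mD Dab K0 muD).
- move=> x ax xb; have [|d d0 Hd] := low x 1%N.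
    by case=> // _; exact: DI.
  by exists d => // t t0 td; have := Hd t t0 td; rewrite mul1r.
- move=> x C ax xb Zx.
  have g0 : 0 < 2 * gauss 1 :> R by rewrite mulr_gt0// gauss_gt0.
  pose N := (Num.truncn (`|C| / (2 * gauss 1))).+1.
  have NC : C <= N%:R * (2 * gauss 1).
    rewrite -ler_pdivrMr//; apply: (@le_trans _ _ (`|C| / (2 * gauss 1))).
      by rewrite ler_pM2r ?invr_gt0// ler_norm.
    by apply: ltW; rewrite truncnS_gt// divr_ge0// ltW.
  have [|d d0 Hd] := low x N.
    move=> [_|n _]; first exact: DI.
    by have [_ ZG _] := HG n; split; [exact: ZG|exact: DI].
  by exists d => // t t0 td; apply: le_trans NC _; exact: Hd.
Qed.

Lemma gmean_pairing a b u x t : 0 < t ->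
  cpairing_scaled a b u x t gauss = gmean (cpairing a b u) x t.
Proof. by move=> t0; rewrite /cpairing_scaled gtr0_norm. Qed.

Lemma null_of_loj a b u U : a <= b -> supported_in u `[a, b] -> lojasiewicz_distr U ->
  is_distr_derivative U u -> forall x, null_at (cpairing a b u) x.
Proof.
by move=> ab su [G HG] dU x; apply: (null_of_pval ab su dU (c := G x)); apply/pvalP.
Qed.

(** The value [y = f x] may be infinite; a real [c] still separates the two limits up to [e]. *)
Lemma ereal_split (l m : \bar R) (y : \bar R) e : 0 < e -> (-oo < l)%E -> (m < +oo)%E ->
  (y <= l)%E -> (m <= y)%E -> exists c, ((c - e)%:E < l)%E /\ (m < (c + e)%:E)%E.
Proof.
move=> e0; case: y => [r| |] l0 m0 yl my.
- exists r; split; first by apply: lt_le_trans yl; rewrite lte_fin; lra.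
  by apply: le_lt_trans my _; rewrite lte_fin; lra.
- move: yl; rewrite leye_eq => /eqP ->; case: m m0 {my} => [r _| |_]//.
    by exists r; rewrite ltry lte_fin; split=> //; lra.
  by exists 0; rewrite ltry ltNyr.
- move: my; rewrite leeNy_eq => /eqP ->; case: l l0 {yl} => [r _|_|]//.
    by exists r; rewrite ltNyr lte_fin; split=> //; lra.
  by exists 0; rewrite ltry ltNyr.
Qed.

(** [positivity] is applied to [e P + (u - v)]. Off the null set the means of [u - v] are eventually
    at least [- e * gauss 1], and the penalty adds [2 * e * gauss 1]. On the null set they are
    merely bounded below, and the penalty is as large as desired. Finally [e] is taken small against
    [P psi]. *)
Lemma major_minor_ge0 (f : R -> \bar R) a b u U v V psi : a <= b ->
  major_pair f a b u U -> minor_pair f a b v V -> testf psi -> (forall x, 0 <= psi x) ->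
  v psi <= u psi.
Proof.
move=> ab [su lU dU _ [E1 [Z1 [cE1 nZ1 fu uE]]]] [sv lV dV _ [E2 [Z2 [cE2 nZ2 vf vE]]]] tp psi0.
have nZ : mu.-negligible (Z1 `|` Z2) by exact: negligibleU.
have [P [eP nP P1 P2]] := penalty_exists ab nZ.
have eu := edist_cpairing ab su; have ev := edist_cpairing ab sv.
have nu := null_of_loj ab su lU dU; have nv := null_of_loj ab sv lV dV.
pose T0 f := cpairing a b u f - cpairing a b v f.
have eT0 : edist a b T0 by exact: edist_sub.
have nT0 x : null_at T0 x by exact: null_at_sub.
have [g1 g0] := @gauss_test1 R.
suff H e : 0 < e -> 0 <= e * P psi + T0 psi.
  rewrite -subr_ge0; have -> : u psi - v psi = T0 psi by rewrite /T0 !cpairing_test.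
  rewrite leNgt; apply/negP => Tneg.
  have e0 : 0 < - T0 psi / (2 * (`|P psi| + 1)) by rewrite divr_gt0//; lra.
  have := H _ e0; set d := _ / _ in e0 *.
  have Ed : d * (2 * (`|P psi| + 1)) = - T0 psi.
    by rewrite /d; field; have := normr_ge0 (P psi); clear -ab; lra.
  have := ler_wpM2l (ltW e0) (ler_norm (P psi)); nra.
move=> e0; have eT := edist_lin e eP eT0.
have nT x : null_at (fun f => e * P f + T0 f) x by exact: null_at_lin.
(* The endpoints join the countable set, since the penalty is bounded below in the open interval
   only. *)
have cE : countable (E1 `|` E2 `|` [set a; b]).
  by apply: countable_setU; [exact: countable_setU|exact: finite_set_countable].
apply: (positivity eT nT cE) => //.
move=> x ax xb /not_orP[/not_orP[nE1 nE2] nab].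
have ax' : a < x by rewrite lt_neqAle ax andbT; apply/eqP => E; apply: nab; left.
have xb' : x < b by rewrite lt_neqAle xb andbT; apply/eqP => E; apply: nab; right.
have abx : `[a, b]%classic x by rewrite /= in_itv/= ax.
have lu : (-oo < lower_value a b u gauss x)%E by apply: uE.
have uv : (upper_value a b v gauss x < +oo)%E by apply: vE.
have Glow c d : (c%:E < lower_value a b u gauss x)%E -> (upper_value a b v gauss x < d%:E)%E ->
    exists2 r, 0 < r & forall t, 0 < t -> t < r -> c - d <= gmean T0 x t.
  move=> /lower_gt[r1 r10 H1] /upper_lt[r2 r20 H2].
  exists (Num.min r1 r2); first by rewrite lt_min r10.
  move=> t t0; rewrite lt_min => /andP[tr1 tr2].
  have := H1 t t0 tr1; have := H2 t t0 tr2; rewrite !lee_fin !gmean_pairing//.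
  by rewrite /gmean /T0 mulrBr; clear -ab; lra.
have gT r t : 0 < t -> r * gmean P x t + gmean T0 x t = gmean (fun f => r * P f + T0 f) x t.
  by move=> t0; rewrite /gmean; ring.
have gp : 0 < gauss 1 :> R by exact: gauss_gt0.
have [Zx|nZx] := pselect ((Z1 `|` Z2) x).
  have [c Hc] : exists c, (c%:E < lower_value a b u gauss x)%E.
    case: (lower_value _ _ _ _ _) lu => [r _|_|]//; first by exists (r - 1); rewrite lte_fin; clear -ab; lra.
    by exists 0; rewrite ltry.
  have [d Hd] : exists d, (upper_value a b v gauss x < d%:E)%E.
    case: (upper_value _ _ _ _ _) uv => [r _| |_]//; first by exists (r + 1); rewrite lte_fin; clear -ab; lra.
    by exists 0; rewrite ltNyr.
  have [r r0 Hr] := Glow c d Hc Hd.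
  have [r2 r20 Hr2] := P2 x (`|c - d| / e + 1 / e) ax' xb' Zx.
  exists 1, (Num.min r r2); split => //; first by rewrite lt_min r0.
  move=> t t0; rewrite lt_min => /andP[tr tr2].
  rewrite -gT//; have := Hr t t0 tr; have := ler_wpM2l (ltW e0) (Hr2 t t0 tr2).
  have -> : e * (`|c - d| / e + 1 / e) = `|c - d| + 1 by field; rewrite gt_eqF.
  by have := ler_norm (- (c - d)); rewrite normrN; clear -ab; lra.
have nZ1x : ~ Z1 x by move=> h; apply: nZx; left.
have nZ2x : ~ Z2 x by move=> h; apply: nZx; right.
have eg : 0 < e * gauss 1 / 2 by rewrite divr_gt0// mulr_gt0.
have [||c [Hc Hd]] := @ereal_split _ _ (f x) _ eg lu uv.
- by apply: fu.
- by apply: vf.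
have [r r0 Hr] := Glow _ _ Hc Hd.
have [r2 r20 Hr2] := P1 x ax' xb'.
exists (e * gauss 1), (Num.min r r2); split; [exact: mulr_gt0|by rewrite lt_min r0|].
move=> t t0; rewrite lt_min => /andP[tr tr2].
rewrite -gT//; have := Hr t t0 tr; have := ler_wpM2l (ltW e0) (Hr2 t t0 tr2); clear -ab; lra.
Qed.

End MajorMinor.

(** * Point values of a primitive in terms of its derivative [T] *)

Section PointValues.
Context {R : realType}.
Implicit Types (f g phi psi theta F : R -> R) (T S : (R -> R) -> R) (a b c x y z h s t p q w B C d e M K : R) (n k m j J N : nat).
Local Notation mu := (@lebesgue_measure R).

(** The primitive of [- phi] vanishing towards [+oo]. Integrating by parts, [T (tailf phi)] is the
    value at [phi] of the primitive of [T] that vanishes to the left of the support. *)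
Definition tailf phi z := \int[mu]_y phi y - prim phi z.

Lemma tailf_der phi z : testf phi -> is_derive z 1 (tailf phi) (- phi z).
Proof. by move=> tp; rewrite -sub0r; exact: (derB (der_cst _ z) (testf_prim_der tp z)). Qed.

Lemma Cinf_tailf phi : testf phi -> Cinf (tailf phi).
Proof.
by move=> tp; apply: (@smooth_primitive _ _ (fun z => - phi z)); [move=> z; exact: tailf_der|exact: smoothN tp.1].
Qed.

Lemma tailf_far phi : testf phi -> exists M, 0 < M /\ forall x, (x <= - M -> tailf phi x = \int[mu]_y phi y) /\
  (M <= x -> tailf phi x = 0).
Proof.
move=> tp; have [M [M0 H]] := prim_far tp; exists M; split => // x; rewrite /tailf; split => xM.
  by rewrite (H x).1// subr0.
by rewrite (H x).2// subrr.
Qed.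

Lemma tailf_unique phi F : testf phi -> (forall z, is_derive z 1 F (- phi z)) ->
  (exists M, forall x, M <= x -> F x = 0) -> F = tailf phi.
Proof.
move=> tp dF [M HM]; have [M1 [_ H1]] := tailf_far tp.
apply: (@der_unique _ _ _ (fun z => - phi z) (Num.max M M1)) => //.
  by move=> z; exact: tailf_der.
by rewrite HM ?(H1 _).2// le_max lexx ?orbT.
Qed.

Lemma tailf_scale phi x s z : 0 < s -> testf phi ->
  tailf (fun y => phi ((y - x) / s)) z = s * tailf phi ((z - x) / s).
Proof.
move=> s0 tp; have sn : s != 0 by rewrite gt_eqF.
suff E : (fun z => s * tailf phi ((z - x) / s)) = tailf (fun y => phi ((y - x) / s)).
  exact: (esym (congr1 (fun f => f z) E)).
apply: tailf_unique; first exact: testf_scale.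
  move=> w; have := @der_comp _ (tailf phi) _ (fun z => (z - x) / s) _ w (tailf_der _ tp) (der_scale x s w).
  move=> /(derZ s); rewrite mulrA mulfV// mul1r; exact.
have [M [M0 HM]] := tailf_far tp; exists (M * s + x) => y yM.
by rewrite (HM _).2 ?mulr0// ler_pdivlMr//; lra.
Qed.

Lemma tailf_D1 phi : testf phi -> tailf (D 1 phi) = fun z => - phi z.
Proof.
move=> tp; apply/esym; apply: tailf_unique; first exact: testf_D.
  by move=> z; apply: derN; exact: smooth_der0 tp.1 _.
have [_ [M HM]] := tp; exists (`|M| + 1) => x xM; rewrite HM ?oppr0//.
by have := ler_norm x; have := ler_norm M; lra.
Qed.

Lemma tailfZD c phi psi : testf phi -> testf psi ->
  tailf (fun x => c * phi x + psi x) = fun z => c * tailf phi z + tailf psi z.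
Proof. by move=> tp ts; apply/funext => z; rewrite /tailf RintZD// primZD//; ring. Qed.

(* [ramp] has integral 1, and its tail is [lam]. *)
Definition ramp : R -> R := fun y => - D 1 lam y.

Lemma testf_ramp : testf ramp.
Proof.
split; first by apply: smoothN; apply: smooth_D; exact: Cinf_lam.
exists 3 => x; rewrite lter_normr => /orP[x3|x3].
  rewrite /ramp (@D_local _ lam (fun=> 0) 1 x 1) ?D_zero ?oppr0//.
  - exact: Cinf_lam.
  - exact: smooth_cst.
  - by move=> y; rewrite ltr_norml => /andP[? ?]; apply: lam0; lra.
rewrite /ramp (@D_local _ lam (fun=> 1) 1 x 1) ?D_cst ?oppr0//.
- exact: Cinf_lam.
- exact: smooth_cst.
- by move=> y; rewrite ltr_norml => /andP[? ?]; apply: lam1; lra.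
Qed.

Lemma tailf_ramp : tailf ramp = lam.
Proof.
apply/esym; apply: tailf_unique; first exact: testf_ramp.
  by move=> z; rewrite /ramp opprK; apply: smooth_der0; exact: Cinf_lam.
by exists 2 => x; exact: lam0.
Qed.

Lemma int_ramp : \int[mu]_y ramp y = 1.
Proof.
have [M [M0 HM]] := tailf_far testf_ramp; rewrite -(HM (- M)).1// tailf_ramp lam1//; lra.
Qed.

(** Every tail is a multiple of [lam] up to a test function. In the presence of [null_at], a point
    value of the primitive is therefore decided by [lam] alone. *)
Lemma tail_lam phi : testf phi -> testf (fun y => tailf phi y - (\int[mu]_y phi y) * lam y).
Proof.
move=> tp; split; first by apply: smoothB; [exact: Cinf_tailf|apply: smoothZ; exact: Cinf_lam].
have [M [M0 HM]] := tailf_far tp; exists (M + 2) => x; rewrite lter_normr => /orP[xM|xM].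
  by rewrite (HM x).2 ?lam0; [ring|lra|lra].
by rewrite (HM x).1 ?lam1; [ring|lra|lra].
Qed.

(** The primitive of [T] vanishing on the left has the point value [c] at [x], expressed on [T]:
    [lam ((z - x) / s)] is a smoothed indicator of [z <= x]. *)
Definition pv T x c := null_at T x /\ forall eps, 0 < eps ->
  exists2 d, 0 < d & forall s, 0 < s -> s < d -> `|T (fun z => lam ((z - x) / s)) - c| <= eps.

Lemma pv_lin c T S x p q : pv T x p -> pv S x q -> pv (fun f => c * T f + S f) x (c * p + q).
Proof.
move=> [nT HT] [nS HS]; split; first exact: null_at_lin.
move=> e e0; have c1 : 0 < `|c| + 1 by have := normr_ge0 c; lra.
have e1 : 0 < e / 2 / (`|c| + 1) by rewrite !divr_gt0.
have e2 : 0 < e / 2 by lra.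
have [d1 d10 H1] := HT _ e1; have [d2 d20 H2] := HS _ e2.
exists (Num.min d1 d2); first by rewrite lt_min d10.
move=> s s0; rewrite lt_min => /andP[sd1 sd2].
have h2 := H2 s s0 sd2; have h1 := H1 s s0 sd1.
set u := T _ in h1 *; set v := S _ in h2 *.
have -> : c * u + v - (c * p + q) = c * (u - p) + (v - q) by ring.
apply: le_trans (ler_normD _ _) _; rewrite normrM.
have h3 : `|c| * `|u - p| <= (`|c| + 1) * (e / 2 / (`|c| + 1)).
  by apply: ler_pM => //; clear; lra.
have E : (`|c| + 1) * (e / 2 / (`|c| + 1)) = e / 2 by field; rewrite gt_eqF.
clear -h2 h3 E; lra.
Qed.

Lemma lim_unique (A : R -> R) p q :
  (forall eps, 0 < eps -> exists2 d, 0 < d & forall s, 0 < s -> s < d -> `|A s - p| <= eps) ->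
  (forall eps, 0 < eps -> exists2 d, 0 < d & forall s, 0 < s -> s < d -> `|A s - q| <= eps) -> p = q.
Proof.
move=> H1 H2; apply/eqP; rewrite -subr_eq0 -normr_le0; apply/ler_addgt0Pl => e e0.
have e2 : 0 < e / 2 by lra.
have [d1 d10 h1] := H1 _ e2; have [d2 d20 h2] := H2 _ e2.
pose s := Num.min d1 d2 / 2; have m0 : 0 < Num.min d1 d2 by rewrite lt_min d10.
have s0 : 0 < s by rewrite /s; clear -m0; lra.
have [m1 m2] : Num.min d1 d2 <= d1 /\ Num.min d1 d2 <= d2 by rewrite !ge_min !lexx orbT.
have := h1 s s0; have := h2 s s0; rewrite /s; move=> /(_ _) g2 /(_ _) g1.
have {}g1 : `|A s - p| <= e / 2 by apply: h1; rewrite // /s; clear -d10 m1; lra.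
have {}g2 : `|A s - q| <= e / 2 by apply: h2; rewrite // /s; clear -d20 m2; lra.
have -> : p - q = (A s - q) - (A s - p) by ring.
by apply: le_trans (ler_normB _ _) _; clear -g1 g2; lra.
Qed.

Lemma pv_unique T x p q : pv T x p -> pv T x q -> p = q.
Proof. by move=> [_ H1] [_ H2]; exact: lim_unique H1 H2. Qed.

Section WithEdist.
Variables (a b : R) (T : (R -> R) -> R).
Hypothesis eT : edist a b T.

Lemma pv_tail phi x c : pv T x c -> testf phi -> forall eps, 0 < eps ->
  exists2 d, 0 < d & forall s, 0 < s -> s < d ->
  `|T (fun z => tailf phi ((z - x) / s)) - c * \int[mu]_y phi y| <= eps.
Proof.
move=> [nT HT] tp e e0; set I := \int[mu]_y phi y.
have I1 : 0 < `|I| + 1 by have := normr_ge0 I; lra.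
have e1 : 0 < e / 2 / (`|I| + 1) by rewrite !divr_gt0.
have e2 : 0 < e / 2 by lra.
have [d1 d10 H1] := HT _ e1; have [d2 d20 H2] := nT _ (tail_lam tp) _ e2.
exists (Num.min d1 d2); first by rewrite lt_min d10.
move=> s s0; rewrite lt_min => /andP[sd1 sd2].
have := H2 s s0 sd2; rewrite -/I.
have sl : Cinf (fun z => lam ((z - x) / s)) by apply: smooth_scale; exact: Cinf_lam.
have st : Cinf (fun z => tailf phi ((z - x) / s)) by apply: smooth_scale; exact: Cinf_tailf.
rewrite (edistB eT)//; last exact: smoothZ.
rewrite (edistZ eT)//; have := H1 s s0 sd1.
set u := T _; set v := T _ => h1 h2.
have -> : v - c * I = (v - I * u) + I * (u - c) by ring.
apply: le_trans (ler_normD _ _) _; rewrite normrM.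
have h3 : `|I| * `|u - c| <= (`|I| + 1) * (e / 2 / (`|I| + 1)).
  by apply: ler_pM => //; clear -eT; lra.
have E : (`|I| + 1) * (e / 2 / (`|I| + 1)) = e / 2 by field; rewrite gt_eqF.
clear -eT h2 h3 E; lra.
Qed.

Lemma pv_right x : null_at T x -> b <= x -> pv T x (T (fun=> 1)).
Proof.
move=> nT bx; split => // e e0; exists 1 => // s s0 _.
rewrite (@edist_local _ _ _ _ eT _ (fun=> 1) s) ?subrr ?normr0//; first exact: ltW.
- by apply: smooth_scale; exact: Cinf_lam.
- exact: smooth_cst.
- by move=> y /andP[_ yb]; apply: lam1; rewrite ler_pdivrMr//; lra.
Qed.

(** [lam] is no test function, but its difference with the translate [lam (y + 3)] is one. At scale
    [s] around [x <= a] this translate vanishes on the support of [T], so [null_at] gives the limit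
    0. *)
Lemma pv_left x : null_at T x -> x <= a -> pv T x 0.
Proof.
move=> nT xa; split => // e e0.
have sl : Cinf (@lam R) by exact: Cinf_lam.
have sl3 : Cinf (fun y : R => lam (y - - 3)) by exact: Cinf_shift.
have tt : testf (fun y : R => lam y - lam (y - - 3)).
  split; first exact: smoothB.
  by exists 4 => y; rewrite lter_normr => /orP[h|h]; [rewrite !lam0|rewrite !lam1]; clear -eT h; lra.
have [d d0 Hd] := nT _ tt _ e0; exists d => // s s0 sd.
have := Hd s s0 sd; rewrite subr0 (edistB eT); [|exact: smooth_scale|].
  rewrite [X in _ - X](@edist_local _ _ _ _ eT _ (fun=> 0) s) ?(edist0 eT) ?subr0//.
  - by apply: (smooth_scale x s sl3).
  - exact: smooth_cst.
  - by move=> y /andP[ya _]; apply: lam0; rewrite opprK -lerBlDr ler_pdivlMr//; lra.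
exact: (smooth_scale x s sl3).
Qed.

Lemma tailf_bound M k : 0 <= M -> exists2 C, 0 <= C & forall phi B, testf phi ->
  (forall x, M < `|x| -> phi x = 0) -> (forall j x, (j <= k)%N -> `|D j phi x| <= B) ->
  forall j x, (j <= k)%N -> `|D j (tailf phi) x| <= C * B.
Proof.
move=> M0; exists (4 * (M + 1)); first by lra.
move=> phi B tp phiM HB j x jk.
have B0 : 0 <= B by apply: le_trans (HB 0%N 0 isT).
case: j jk => [_|j jk].
  have HB0 y : `|phi y| <= B by have := HB 0%N y isT; rewrite D0.
  rewrite D0 /tailf; have [N HN] := RintE tp; rewrite -(HN N)//.
  apply: le_trans (ler_normB _ _) _.
  have := prim_bound N tp M0 phiM HB0; have := prim_bound x tp M0 phiM HB0; clear -eT; lra.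
rewrite DS (der_D1 (fun z => tailf_der z tp)) D_N; last exact: tp.1.
rewrite normrN; apply: le_trans (HB j x (ltnW jk)) _; rewrite -[leLHS]mul1r ler_wpM2r//; lra.
Qed.

Lemma primD_linear c phi psi : test_fun phi -> test_fun psi ->
  T (tailf (fun x => c * phi x + psi x)) = c * T (tailf phi) + T (tailf psi).
Proof.
move=> /test_testf tp /test_testf ts; rewrite tailfZD// (edistZD eT)//; exact: Cinf_tailf.
Qed.

Lemma primD_continuous (K : set R) : compact K -> exists (C : R) (k : nat),
  forall phi, test_fun phi -> tsupp phi `<=` K -> `|T (tailf phi)| <= C * Ck_norm k phi.
Proof.
move=> /compact_bounded[M0 [_ HM]]; pose M := Num.max (M0 + 1) 0.
have M00 : 0 <= M by rewrite le_max lexx orbT.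
have KM x : K x -> `|x| <= M by apply: (HM M); rewrite lt_max ltrDl ltr01.
have [C0 [k [C00 HC0]]] := edist_bound eT; have [C1 C10 HC1] := tailf_bound k M00.
exists (C0 * C1), k => phi tp sK; have tp' := test_testf tp.
rewrite -mulrA; apply: HC0; first exact: Cinf_tailf.
move=> j x jk _; apply: (HC1 phi) => //; last by move=> i y ik; exact: Ck_norm_ge.
move=> y yM; apply/eqP; apply/negPn/negP => py.
have : `|y| <= M by apply: KM; apply: sK; apply: subset_closure.
by rewrite leNgt yM.
Qed.

Definition primD : schwartz_distr R := Distribution primD_linear primD_continuous.

Lemma primD_pv x c : pv T x c -> pval primD x c.
Proof.
move=> pT phi tp e e0; have [d d0 Hd] := pv_tail pT tp e0; exists d => // s s0 sd.
have sn : s != 0 by rewrite gt_eqF.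
have := Hd s s0 sd; congr (`|_ - _| <= _); rewrite /=.
have -> : tailf (fun y => phi ((y - x) / s)) = fun z => s * tailf phi ((z - x) / s).
  by apply/funext => z; exact: tailf_scale.
by rewrite (edistZ eT) ?mulKf//; apply: smooth_scale; exact: Cinf_tailf.
Qed.

Lemma primD_derivative (h : schwartz_distr R) : (forall phi, testf phi -> h phi = T phi) ->
  is_distr_derivative primD h.
Proof.
move=> hT phi /test_testf tp; rewrite -D1E /= tailf_D1// (edistN eT) ?opprK ?hT//.
exact: tp.1.
Qed.

End WithEdist.

(* A distribution whose derivative vanishes is a constant, so every primitive
   of [u] is [primD] up to a constant; the constant is fixed at [a]. *)
Lemma pv_of_pval a b u U (G : R -> R) : a <= b -> supported_in u `[a, b] ->
  is_distr_derivative U u -> (forall x, pval U x (G x)) -> G a = 0 ->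
  forall x, pv (cpairing a b u) x (G x).
Proof.
move=> ab su dU pU Ga; have eT := edist_cpairing ab su.
have uT phi : testf phi -> u phi = cpairing a b u phi by move=> tp; rewrite cpairing_test.
have nT x : null_at (cpairing a b u) x by exact: (null_of_pval ab su dU (pU x)).
move: (cpairing a b u) eT uT nT => T eT uT nT.
pose c := U ramp - T (tailf ramp).
have UE phi : testf phi -> U phi = T (tailf phi) + (\int[mu]_y phi y) * c.
  move=> tp; pose I := \int[mu]_y phi y.
  pose r z := phi z - I * ramp z.
  have tr : testf r by apply: testfB => //; apply: testfZ; exact: testf_ramp.
  have tq : testf (tailf r).
    split; first exact: Cinf_tailf.
    have [M [M0 HM]] := tailf_far tr; exists M => x; rewrite lter_normr => /orP[xM|xM].
      by rewrite (HM x).2// ltW.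
    rewrite (HM x).1; last by lra.
    have -> : r = fun y => - I * ramp y + phi y by apply/funext => y; rewrite /r; ring.
    by rewrite RintZD// ?int_ramp; [rewrite /I; ring|exact: testf_ramp].
  have : u (tailf r) = U r.
    rewrite (is_distr_derivativeE dU tq) (der_D1 (fun z => tailf_der z tr)).
    rewrite -mulN1r -distrZ; last by apply: testfN.
    by congr (distr_fun U _); apply/funext => z; rewrite mulN1r opprK.
  rewrite uT// /r distrB//; last by apply: testfZ; exact: testf_ramp.
  rewrite distrZ; last exact: testf_ramp.
  have -> : tailf (fun z => phi z - I * ramp z) = fun z => - I * tailf ramp z + tailf phi z.
    rewrite -tailfZD//; last exact: testf_ramp.
    by congr tailf; apply/funext => z; ring.
  rewrite (edistZD eT); [|apply: Cinf_tailf; exact: testf_ramp|exact: Cinf_tailf].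
  rewrite /c -/I; lra.
have pc x : pv T x (G x - c).
  split=> // e e0; have [d d0 Hd] := pU x _ testf_ramp _ e0; exists d => // s s0 sd.
  have sn : s != 0 by rewrite gt_eqF.
  have := Hd s s0 sd; rewrite int_ramp mulr1.
  have ts := testf_scale x sn testf_ramp.
  have sl : Cinf (fun z => lam ((z - x) / s)) by apply: smooth_scale; exact: Cinf_lam.
  have E : tailf (fun y => ramp ((y - x) / s)) = fun z => s * lam ((z - x) / s).
    by apply/funext => z; rewrite tailf_scale//; [rewrite tailf_ramp|exact: testf_ramp].
  have Is : \int[mu]_y ramp ((y - x) / s) = s.
    have [M [M0 HM]] := tailf_far ts.
    pose M1 := Num.max M (`|x| + s).
    have h1 : M <= M1 by rewrite le_max lexx.
    have h2 : `|x| + s <= M1 by rewrite le_max lexx orbT.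
    rewrite -(HM (- M1)).1; last by clear -ab eT h1; lra.
    rewrite E lam1 ?mulr1// ler_pdivrMr//; have := ler_norm (- x); rewrite normrN; clear -ab eT s0 h2; lra.
  rewrite UE// Is E (edistZ eT)// mulrDr !mulKf//.
  by congr (`|_| <= _); ring.
have c0 : c = 0.
  have := pv_unique (pc a) (pv_left eT (nT a) (lexx a)); rewrite Ga; lra.
by move=> x; have := pc x; rewrite c0 subr0.
Qed.

End PointValues.

(** * Major functionals, a common form for major and minor pairs *)

Section MajorFunctionals.
Context {R : realType}.
Implicit Types (f g : R -> \bar R) (phi psi theta F : R -> R) (T S : (R -> R) -> R) (a b c x y z h s t p q w B C d e m M K : R) (n k j J N : nat).
Local Notation mu := (@lebesgue_measure R).

Definition avg T phi x t := t^-1 * T (fun y => phi ((y - x) / t)).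

(** A lower limit at least [y], by [lowgeP], spelled out so that sums and products can be estimated
    directly. *)
Definition lowge T phi x (y : \bar R) := forall c, (c%:E < y)%E ->
  exists2 d, 0 < d & forall t, 0 < t -> t < d -> c <= avg T phi x t.

(** The pair [(u, U)] reduced to one functional: [U] is recovered as [primD]. A minor pair for [f]
    corresponds to a major functional for [- f], so one notion serves both sides. *)
Definition majF f a b T := [/\ edist a b T, forall x, exists c, pv T x c &
  exists E Z : set R, [/\ countable E, mu.-negligible Z,
    forall x phi, a <= x -> x <= b -> ~ Z x -> test_class0 phi -> lowge T phi x (f x) &
    forall x phi, a <= x -> x <= b -> ~ E x -> test_class1 phi -> exists c, lowge T phi x c%:E]].

Definition lowF T phi x := limf_einf (fun t => (`|t|^-1 * T (fun y => phi ((y - x) / t)))%:E) 0^'+.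

Lemma ereal_le_real (y l : \bar R) : (forall c, (c%:E < y)%E -> (c%:E <= l)%E) -> (y <= l)%E.
Proof.
move=> H; case: y H => [r| |] H; last exact: leNye.
  apply/lee_subgt0Pr => e e0; rewrite -EFinB; apply: H; rewrite lte_fin; lra.
rewrite leye_eq; apply/eqP; apply: contrapT => ly; case: l ly H => [r| |]// ly H.
  by have := H (r + 1) (ltry _); rewrite lee_fin; lra.
by have := H 0 (ltry _).
Qed.

Lemma lowgeP T phi x (y : \bar R) : lowge T phi x y <-> (y <= lowF T phi x)%E.
Proof.
split=> [H|H c cy].
  apply: ereal_le_real => c /H[d d0 Hd]; apply: (lower_ge d0) => t t0 td.
  by rewrite lee_fin gtr0_norm//; exact: Hd.
have /lower_gt[d d0 Hd] := lt_le_trans cy H; exists d => // t t0 td.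
by have := Hd t t0 td; rewrite lee_fin gtr0_norm.
Qed.

Lemma lowge_finP T phi x : (exists c, lowge T phi x c%:E) <-> (-oo < lowF T phi x)%E.
Proof.
split=> [[c /lowgeP]|]; first by apply: lt_le_trans; exact: ltNyr.
case E : (lowF T phi x) => [r| |]// _; first by exists r; apply/lowgeP; rewrite E.
by exists 0; apply/lowgeP; rewrite E leey.
Qed.

Lemma limf_esupN (g : R -> R) : (- limf_esup (fun t => (g t)%:E) 0^'+)%E =
  limf_einf (fun t => (- g t)%:E) 0^'+.
Proof.
rewrite /limf_einf; congr (- limf_esup _ _)%E; apply/funext => t /=.
by rewrite opprK.
Qed.

Lemma upper_valueN a b v phi x :
  (- upper_value a b v phi x)%E = lowF (fun psi => - cpairing a b v psi) phi x.
Proof.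
rewrite /upper_value limf_esupN /lowF; congr limf_einf; apply/funext => t.
by rewrite /cpairing_scaled mulrN.
Qed.

(** With [U a = 0] the distribution [U] is the primitive of [u] vanishing on the left of [a], so its
    value at [b] is the total mass. *)
Lemma majF_of_major f a b u U : a <= b -> major_pair f a b u U ->
  majF f a b (cpairing a b u) /\ has_point_value U b (cpairing a b u (fun=> 1)).
Proof.
move=> ab [su [G HG] dU Ua [E [Z [cE nZ fu uE]]]].
have eT := edist_cpairing ab su.
have pU x : pval U x (G x) by apply/pvalP; exact: HG.
have Ga : G a = 0 by apply: pval_unique (pU a) _; apply/pvalP.
have pvT := pv_of_pval ab su dU pU Ga.
split; last first.
  have nb : null_at (cpairing a b u) b by case: (pvT b).
  by rewrite -(pv_unique (pvT b) (pv_right eT nb (lexx b))); exact: HG.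
split => //; first by move=> x; exists (G x).
exists E, Z; split => // x phi ax xb nx tp.
  by apply/lowgeP; apply: fu => //; split => //; rewrite /= in_itv/= ax.
by apply/lowge_finP; apply: uE => //; split => //; rewrite /= in_itv/= ax.
Qed.

Lemma majF_of_minor f a b v V : a <= b -> minor_pair f a b v V ->
  majF (fun x => - f x)%E a b (fun psi => - cpairing a b v psi) /\
  has_point_value V b (cpairing a b v (fun=> 1)).
Proof.
move=> ab [sv [G HG] dV Va [E [Z [cE nZ fv vE]]]].
have eT := edist_cpairing ab sv.
have pV x : pval V x (G x) by apply/pvalP; exact: HG.
have Ga : G a = 0 by apply: pval_unique (pV a) _; apply/pvalP.
have pvT := pv_of_pval ab sv dV pV Ga.
split; last first.
  have nb : null_at (cpairing a b v) b by case: (pvT b).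
  by rewrite -(pv_unique (pvT b) (pv_right eT nb (lexx b))); exact: HG.
split => //; first exact: edist_opp.
  move=> x; exists (-2 * G x + G x); have := pv_lin (-2) (pvT x) (pvT x).
  by congr pv; apply/funext => f0; ring.
exists E, Z; split => // x phi ax xb nx tp.
  apply/lowgeP; rewrite -upper_valueN leeN2.
  by apply: fv => //; split => //; rewrite /= in_itv/= ax.
apply/lowge_finP; rewrite -upper_valueN lteNr.
by apply: vE => //; split => //; rewrite /= in_itv/= ax.
Qed.

Lemma cpairing_mkdistr a b T (eT : edist a b T) phi : Cinf phi ->
  cpairing a b (mkdistr eT) phi = T phi.
Proof.
move=> sp; rewrite /cpairing /=; have [e e0 He] := @cutoff1 R a b.
have tc := @testf_cutoff R a b.
apply: (edist_local eT _ sp e0); first by apply: smoothM => //; exact: tc.1.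
by move=> x /He ->; rewrite mul1r.
Qed.

Lemma major_of_majF f a b T : majF f a b T ->
  exists u U, [/\ major_pair f a b u U, has_point_value U b (T (fun=> 1)) &
    forall phi, testf phi -> u phi = T phi].
Proof.
move=> [eT pT [E [Z [cE nZ H0 H1]]]].
have nT x : null_at T x by have [c []] := pT x.
have [G HG] : exists G : R -> R, forall x, pv T x (G x).
  by have [G HG] := choice pT; exists G.
exists (mkdistr eT), (primD eT).
have lowE phi x : Cinf phi -> lower_value a b (mkdistr eT) phi x = lowF T phi x.
  move=> sp; rewrite /lower_value /lowF; congr limf_einf; apply/funext => t.
  by rewrite /cpairing_scaled cpairing_mkdistr//; exact: smooth_scale.
split=> //; last by apply/pvalP; apply: primD_pv; exact: (pv_right eT).
split.
- exact: mkdistr_supported.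
- by exists G => x; apply/pvalP; apply: primD_pv.
- by apply: primD_derivative.
- by apply/pvalP; apply: primD_pv; exact: (pv_left eT).
- exists E, Z; split => // x phi [/= xab nx] tp; move: xab; rewrite in_itv/= => /andP[ax xb].
    rewrite lowE; last by case: tp; rewrite Cinf.unlock.
    by apply/lowgeP; exact: H0.
  rewrite lowE; last by case: tp => -[]; rewrite Cinf.unlock.
  by apply/lowge_finP; exact: H1.
Qed.

Lemma minor_of_majF f a b S : majF (fun x => - f x)%E a b S ->
  exists v V, [/\ minor_pair f a b v V, has_point_value V b (- S (fun=> 1)) &
    forall phi, testf phi -> v phi = - S phi].
Proof.
move=> [eS pS [E [Z [cE nZ H0 H1]]]].
have eT := edist_opp eS.
have [x|G HG] := @choice _ _ (fun x c => pv (fun psi => - S psi) x c).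
  have [c Hc] := pS x; exists (-2 * c + c).
  by have := pv_lin (-2) Hc Hc; congr pv; apply/funext => f0; ring.
have nT x : null_at (fun psi => - S psi) x by case: (HG x).
exists (mkdistr eT), (primD eT).
have lowE phi x : Cinf phi -> (- upper_value a b (mkdistr eT) phi x)%E = lowF S phi x.
  move=> sp; rewrite upper_valueN /lowF; congr limf_einf; apply/funext => t.
  by rewrite cpairing_mkdistr ?opprK//; exact: smooth_scale.
split=> //; last by apply/pvalP; apply: (primD_pv eT); exact: (pv_right eT).
split.
- exact: mkdistr_supported.
- by exists G => x; apply/pvalP; apply: primD_pv.
- by apply: (primD_derivative eT).
- by apply/pvalP; apply: primD_pv; exact: (pv_left eT).
- exists E, Z; split => // x phi [/= xab nx] tp; move: xab; rewrite in_itv/= => /andP[ax xb].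
    rewrite -leeN2 lowE; last by case: tp; rewrite Cinf.unlock.
    by apply/lowgeP; exact: H0.
  rewrite -lteN2 lowE; last by case: tp => -[]; rewrite Cinf.unlock.
  by apply/lowge_finP; exact: H1.
Qed.

Lemma test1_local a b T (psi : R -> R) : a <= b -> edist a b T -> Cinf psi ->
  (forall x, 0 <= psi x) -> exists chi, [/\ testf chi, forall x, 0 <= chi x & T psi = T chi].
Proof.
move=> ab eT sp psi0; have [chi [tc c01 c1 _]] := @cutoff_exists R a b 1 ltr01.
exists (fun x => chi x * psi x); split; first by apply: testfMr.
  by move=> x; rewrite mulr_ge0//; case/andP: (c01 x).
apply: (edist_local eT sp _ ltr01); first by apply: smoothM => //; exact: tc.1.
by move=> x /c1 ->; rewrite mul1r.
Qed.

Lemma majF_ge0 f a b T S psi : a <= b -> majF f a b T -> majF (fun x => - f x)%E a b S ->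
  Cinf psi -> (forall x, 0 <= psi x) -> 0 <= T psi + S psi.
Proof.
move=> ab mT mS sp psi0.
have [eT _ _] := mT; have [eS _ _] := mS.
have eP : edist a b (fun phi => T phi + S phi).
  by have := edist_lin 1 eT eS; congr edist; apply/funext => f0; rewrite mul1r.
have [chi [tc c0 ->]] := test1_local ab eP sp psi0.
have [u [U [HU _ uT]]] := major_of_majF mT; have [v [V [HV _ vS]]] := minor_of_majF mS.
by have := major_minor_ge0 ab HU HV tc c0; rewrite uT// vS//; lra.
Qed.

(** Integrability and the value [m] in one statement, symmetric under [f |-> - f]. *)
Definition dintF f a b m := forall e, 0 < e -> exists T S,
  [/\ majF f a b T, majF (fun x => - f x)%E a b S, T (fun=> 1) <= m + e & S (fun=> 1) <= - m + e].

Lemma dintF_integral f a b : a <= b -> dist_integrable f a b -> dintF f a b (dist_integral f a b).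
Proof.
move=> ab [[u0 [U0 H0]] [v0 [V0 K0]] supinf].
have [mT0 pU0] := majF_of_major ab H0; have [mS0 pV0] := majF_of_minor ab K0.
rewrite /dist_integral; move: supinf; set s := ereal_sup _ => supinf.
have sU : (s <= (cpairing a b u0 (fun=> 1))%:E)%E.
  by rewrite supinf; apply: ereal_inf_lbound; exists (cpairing a b u0 (fun=> 1)) => //; exists u0, U0.
have sV : ((cpairing a b v0 (fun=> 1))%:E <= s)%E.
  by apply: ereal_sup_ubound; exists (cpairing a b v0 (fun=> 1)) => //; exists v0, V0.
have sfin : s \is a fin_num.
  by rewrite fin_numElt (lt_le_trans (ltNyr _) sV) (le_lt_trans sU (ltry _)).
move=> e e0; have [c [u [U [HU Uc]]] cs] : exists2 c, exists u U, major_pair f a b u U /\ has_point_value U b c & c <= fine s + e.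
  have : (ereal_inf (major_values f a b) < (fine s + e)%:E)%E.
    by rewrite -supinf EFinD fineK// lteDl.
  by move=> /ereal_inf_lt[_ [c Hc <-]]; rewrite lte_fin => /ltW; exists c.
have [d [v [V [HV Vd]]] ds] : exists2 d, exists v V, minor_pair f a b v V /\ has_point_value V b d & fine s - e <= d.
  have : ((fine s - e)%:E < ereal_sup (minor_values f a b))%E.
    by rewrite -/s EFinB fineK// lteBlDr// lteDl.
  by move=> /ereal_sup_gt[_ [d Hd <-]]; rewrite lte_fin => /ltW; exists d.
have [mT pU] := majF_of_major ab HU; have [mS pV] := majF_of_minor ab HV.
exists (cpairing a b u), (fun psi => - cpairing a b v psi); split => //.
  by rewrite (pval_unique ((pvalP _ _ _).1 pU) ((pvalP _ _ _).1 Uc)).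
by rewrite (pval_unique ((pvalP _ _ _).1 pV) ((pvalP _ _ _).1 Vd)); lra.
Qed.

Lemma dintF_le f a b m T : a <= b -> dintF f a b m -> majF f a b T -> m <= T (fun=> 1).
Proof.
move=> ab dm mT; apply/ler_addgt0Pl => e e0; have [_ [S [_ mS _ S1]]] := dm _ e0.
have := majF_ge0 ab mT mS (@smooth_cst R 1) (fun=> ler01); lra.
Qed.

Lemma dintF_opp f a b m : dintF f a b m -> dintF (fun x => - f x)%E a b (- m).
Proof.
move=> dm e /dm[T [S [mT mS T1 S1]]]; exists S, T; split => //.
  by move: mT; congr majF; apply/funext => x; rewrite oppeK.
by rewrite opprK.
Qed.

Lemma integral_dintF f a b m : a <= b -> dintF f a b m ->
  dist_integrable f a b /\ dist_integral f a b = m.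
Proof.
move=> ab dm.
have sE : ereal_sup (minor_values f a b) = m%:E.
  apply/eqP; rewrite eq_le; apply/andP; split.
    apply: ub_ereal_sup => _ [c [v [V [HV Vc]]] <-]; rewrite lee_fin.
    have [mS pV] := majF_of_minor ab HV.
    rewrite (pval_unique ((pvalP _ _ _).1 Vc) ((pvalP _ _ _).1 pV)).
    have := dintF_le ab (dintF_opp dm) mS; lra.
  apply: ereal_le_real => c; rewrite lte_fin => cm.
  have e0 : 0 < m - c by lra.
  have [T [S [mT mS T1 S1]]] := dm _ e0; have [v [V [HV Vv _]]] := minor_of_majF mS.
  apply: (@le_trans _ _ (- S (fun=> 1))%:E); first by rewrite lee_fin; lra.
  by apply: ereal_sup_ubound; exists (- S (fun=> 1)) => //; exists v, V.
have iE : ereal_inf (major_values f a b) = m%:E.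
  apply/eqP; rewrite eq_le; apply/andP; split; last first.
    apply: le_ereal_inf_tmp => _ [c [v [V [HV Vc]]] <-]; rewrite lee_fin.
    have [mT pU] := majF_of_major ab HV.
    rewrite (pval_unique ((pvalP _ _ _).1 Vc) ((pvalP _ _ _).1 pU)).
    exact: dintF_le ab dm mT.
  apply/lee_addgt0Pr => e e0.
  have [T [S [mT mS T1 S1]]] := dm _ e0; have [v [V [HV Vv _]]] := major_of_majF mT.
  apply: (@le_trans _ _ (T (fun=> 1))%:E); last by rewrite -EFinD lee_fin.
  by apply: ereal_inf_lbound; exists (T (fun=> 1)) => //; exists v, V.
split; last by rewrite /dist_integral sE.
have [T [S [mT mS _ _]]] := dm _ ltr01.
split; last by rewrite sE iE.
  by have [u [U [HU _ _]]] := major_of_majF mT; exists u, U.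
by have [u [U [HU _ _]]] := minor_of_majF mS; exists u, U.
Qed.

Lemma dintF_unique f a b p q : a <= b -> dintF f a b p -> dintF f a b q -> p = q.
Proof.
by move=> ab /(integral_dintF ab)[_ <-] /(integral_dintF ab)[_ <-].
Qed.

Lemma dintF_of_gap f a b : a <= b -> (forall e, 0 < e -> exists T S,
    [/\ majF f a b T, majF (fun x => - f x)%E a b S & T (fun=> 1) + S (fun=> 1) <= e]) ->
  exists m, dintF f a b m.
Proof.
move=> ab H; pose A := [set c | exists2 T, majF f a b T & c = T (fun=> 1)].
have [T0 [S0 [mT0 mS0 _]]] := H 1 ltr01.
have AS S : majF (fun x => - f x)%E a b S -> lbound A (- S (fun=> 1)).
  move=> mS _ [T mT ->]; have := majF_ge0 ab mT mS (@smooth_cst R 1) (fun=> ler01); lra.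
have An : A !=set0 by exists (T0 (fun=> 1)), T0.
have Alb : has_lbound A by exists (- S0 (fun=> 1)); exact: AS.
exists (inf A) => e e0; have [T [S [mT mS TS]]] := H e e0; exists T, S; split => //.
  have : - S (fun=> 1) <= inf A by apply: lb_le_inf => //; exact: AS.
  lra.
have : inf A <= T (fun=> 1) by apply: ge_inf => //; exists T.
lra.
Qed.

End MajorFunctionals.

(** * Tails of the tests in [test_class0] *)

Section Tails.
Context {R : realType}.
Implicit Types (f g : R -> \bar R) (phi psi theta F : R -> R) (T S : (R -> R) -> R) (a b c x y z h s t p q w B C d e m M K : R) (n k j J N : nat).
Local Notation mu := (@lebesgue_measure R).

(** The ratio [r = 2 ^ (1 + alpha)] is below 1 because [alpha < -1]. The factor [1 / 2 ^+ j]
    compensates the [t^-1] of an average when the decomposition reaches the scale [2 ^+ j * t]. *)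
Lemma class0_dyadic phi : test_class0 phi -> exists r, [/\ 0 < r, r < 1 &
  forall k, exists C J0, 0 <= C /\ forall j n y, (J0 < j)%N -> (n <= k)%N ->
    2^-1 <= `|y| -> `|y| <= 2 ->
    (2 ^+ j) ^+ n * `|D n phi (2 ^+ j * y)| <= C * (r ^+ j / 2 ^+ j)].
Proof.
move=> [_ _ _ [al al1 Hal]]; pose r := 2 * 2 `^ al.
have p20 : 0 < 2 `^ al by exact: powR_gt0.
have r0 : 0 < r by exact: mulr_gt0.
have r1 : r < 1.
  rewrite /r /powR gt_eqF// mulrC -ltr_pdivlMr// mul1r -[2^-1](@lnK R) ?posrE//.
  by rewrite ltr_expR lnV ?posrE// -mulN1r ltr_pM2r// ln_gt0//; lra.
exists r; split => // k.
have E j : (2 ^+ j) `^ al = r ^+ j / 2 ^+ j.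
  rewrite /r exprMn mulrAC mulfV ?expf_neq0// mul1r -[2 ^+ j]powR_mulrn// powRAC.
  by rewrite powR_mulrn// ltW.
have one n : exists C J0, 0 <= C /\ forall j y, (J0 < j)%N -> 2^-1 <= `|y| -> `|y| <= 2 ->
    (2 ^+ j) ^+ n * `|D n phi (2 ^+ j * y)| <= C * (r ^+ j / 2 ^+ j).
  have [C [M HC]] := Hal n.
  exists (`|C| * (2^-1 `^ (n%:R - al))^-1), (Num.truncn (2 * `|M|)).+1; split.
    by rewrite mulr_ge0// invr_ge0 powR_ge0.
  move=> j y Jj y1 y2; set X := 2 ^+ j.
  have X0 : 0 < X by rewrite exprn_gt0.
  have yX : `|X * y| = X * `|y| by rewrite normrM gtr0_norm.
  have MX : M < `|X * y|.
    rewrite yX; apply: le_lt_trans (ler_norm M) _.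
    have h1 : 2 * `|M| < X.
      apply: lt_le_trans (truncnS_gt _) _.
      apply: (@le_trans _ _ j%:R); first by rewrite ler_nat ltnW.
      by rewrite /X -natrX ler_nat ltnW// ltn_expl.
    have : X * 2^-1 <= X * `|y| by rewrite ler_wpM2l// ltW.
    lra.
  have := HC _ MX; rewrite -(DE n) yX => h.
  apply: (@le_trans _ _ (X ^+ n * (`|C| * (X * `|y|) `^ (al - n%:R)))).
    rewrite ler_wpM2l ?exprn_ge0 ?(ltW X0)//; apply: le_trans h _.
    by rewrite ler_wpM2r ?powR_ge0// ler_norm.
  rewrite powRM ?(ltW X0)//; have -> : X `^ (al - n%:R) = X `^ al / X ^+ n.
    by rewrite powRB; [rewrite (powR_mulrn n (ltW X0))|rewrite (gt_eqF X0) implybT].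
  rewrite E -/X -[al - n%:R]opprB powRN.
  have Xn : X ^+ n != 0 by rewrite expf_neq0// gt_eqF.
  set Y := (`|y| `^ _)^-1; set A := r ^+ j / X.
  have -> : X ^+ n * (`|C| * (A / X ^+ n * Y)) = `|C| * Y * A by field.
  have A0 : 0 <= A by rewrite mulr_ge0 ?exprn_ge0 ?invr_ge0 ?ltW.
  rewrite ler_wpM2r// ler_wpM2l//.
  have na : 0 <= n%:R - al by rewrite subr_ge0; apply: (@le_trans _ _ 0) => //; clear -al1; lra.
  rewrite /Y lef_pV2 ?posrE ?powR_gt0//; last by apply: lt_le_trans y1.
  by apply: ge0_ler_powR => //; rewrite nnegrE.
elim: k => [|k [C [J0 [C0 IH]]]].
  have [C [J0 [C0 HC]]] := one 0%N; exists C, J0; split => // j n y Jj.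
  by rewrite leqn0 => /eqP ->; exact: HC.
have [C1 [J1 [C10 H1]]] := one k.+1.
exists (C + C1), (maxn J0 J1); split; first exact: addr_ge0.
move=> j n y; rewrite gtn_max => /andP[j0 j1]; rewrite leq_eqVlt => /predU1P[->|nk] y1 y2.
  apply: le_trans (H1 j y j1 y1 y2) _; rewrite ler_wpM2r ?lerDr//.
  by rewrite divr_ge0// exprn_ge0// ltW.
apply: le_trans (IH j n y j0 nk y1 y2) _; rewrite ler_wpM2r ?lerDl//.
by rewrite divr_ge0// exprn_ge0// ltW.
Qed.

Lemma class0_Cinf phi : test_class0 phi -> Cinf phi.
Proof. by case; rewrite Cinf.unlock. Qed.

Lemma exp_lt_eps r C e : 0 < r -> r < 1 -> 0 < e -> exists J, forall j, (J <= j)%N -> C * r ^+ j <= e.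
Proof.
move=> r0 r1 e0; have q1 : `|r| < 1 by rewrite gtr0_norm.
have := @cvg_geometric R C r q1; move=> /cvgrPdist_le/(_ _ e0)[J _ HJ].
exists J => j Jj; have := HJ j Jj; rewrite /= sub0r normrN; apply: le_trans; exact: ler_norm.
Qed.

(** Tests in [test_class0] have no compact support, so an average at [x] sees the distant support of
    [T]. In the dyadic decomposition stopped just short of that support the central part vanishes
    and the remainder is [O(r ^+ J)]. *)
Lemma avg_off a b T phi x : edist a b T -> null_at T x -> test_class0 phi -> (x < a \/ b < x) ->
  forall e, 0 < e -> exists2 d, 0 < d & forall t, 0 < t -> t < d -> `|avg T phi x t| <= e.
Proof.
move=> eT nT tp xab e e0.
have [r [r0 r1 Hr]] := class0_dyadic tp.
pose S := `|x - a| + `|x - b| + 1.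
have S0 : 0 < S by rewrite /S; have := normr_ge0 (x - a); have := normr_ge0 (x - b); lra.
have S1 : x - S <= a - 1.
  by rewrite /S; have := ler_norm (x - a); have := normr_ge0 (x - b); lra.
have S2 : b + 1 <= x + S.
  by rewrite /S; have := ler_norm (- (x - b)); rewrite normrN; have := normr_ge0 (x - a); lra.
have [C [k [C0 HC]]] := dyadic_core eT nT S0 S1 S2.
have [C1 [J0 [C10 HC1]]] := Hr k.
have [dl dl0 Hdl] : exists2 dl, 0 < dl & forall y, a - dl <= y <= b + dl -> dl <= `|y - x|.
  case: xab => h; [exists ((a - x) / 2)|exists ((x - b) / 2)]; try (clear -h; lra).
    by move=> y /andP[? _]; rewrite ger0_norm; lra.
  by move=> y /andP[_ ?]; rewrite ler0_norm; lra.
pose m0 := Num.min (dl / 4) S.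
have m00 : 0 < m0 by rewrite lt_min S0; clear -dl0; lra.
pose K := C * (C1 / m0) / (1 - r).
have [J1 HJ1] := exp_lt_eps K r0 r1 e0.
pose X : R := 2 ^+ (maxn J0 J1).+2.
have X0 : 0 < X by rewrite exprn_gt0.
exists (m0 / X); first by rewrite divr_gt0.
move=> t t0; rewrite ltr_pdivlMr// => tX.
(* The last scale [2 ^+ J * t] not exceeding [m0]: the plateau misses the support of [T], and [J] is
   large because [t] is small. *)
have [J [JJ [J2 J3]]] : exists J, (maxn J0 J1 < J)%N /\ 2 ^+ J * t <= m0 /\ m0 < 2 ^+ J.+1 * t.
  have [N HN] : exists N, m0 < 2 ^+ N.+1 * t.
    exists (Num.truncn (m0 / t)); rewrite -ltr_pdivrMr//.
    apply: lt_le_trans (truncnS_gt _) _.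
    by rewrite -natrX ler_nat ltnW// ltn_expl.
  have exN : exists N, m0 < 2 ^+ N.+1 * t by exists N.
  have [J HJ Jmin] := ex_minnP exN; exists J; split; last split => //.
    rewrite ltnNge; apply/negP => JM.
    have : 2 ^+ J.+1 * t <= X * t.
      by rewrite ler_wpM2r ?(ltW t0)// ler_weXn2l//; [clear; lra|rewrite ltnS (leq_trans JM)].
    rewrite mulrC in tX; clear -HJ tX; lra.
  case: J HJ Jmin => [|J] HJ Jmin.
    rewrite expr0 mul1r; have : t <= t * X.
      by rewrite ler_peMr ?(ltW t0)// exprn_ege1//; clear; lra.
    clear -tX; lra.
  by rewrite leNgt; apply/negP => /Jmin; rewrite ltnn.
have m1 : m0 <= dl / 4 by rewrite ge_min lexx.
have m2 : m0 <= S by rewrite ge_min lexx orbT.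
pose eta y := t^-1 * phi y.
have sp := class0_Cinf tp.
have seta : Cinf eta by exact: smoothZ.
have J4 : 2 ^+ J * t <= S by clear -J2 m2; lra.
have it0 : 0 < t^-1 by rewrite invr_gt0.
have N0 : 0 <= C1 / m0 by rewrite divr_ge0// ltW.
have := HC t J eta (C1 / m0) r t0 J4 seta N0 r0 r1.
rewrite [X in _ - X](@edist_local _ _ _ _ eT _ (fun=> 0) dl)//; last first.
- move=> z /Hdl zx; rewrite plateau0 ?mul0r// normrM normfV (@gtr0_norm _ (2 ^+ J)) ?exprn_gt0//.
  by rewrite normrM normfV (gtr0_norm t0) !ler_pdivlMr ?exprn_gt0//; clear -dl0 J2 m1 zx; lra.
- exact: smooth_cst.
- apply: smoothM; last exact: smooth_scale.
  have := smooth_scale x (t * 2 ^+ J) (@Cinf_plateau R); congr Cinf.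
  by apply/funext => z; rewrite invfM mulrA.
rewrite (edist0 eT) subr0 /avg /eta (edistZ eT); last exact: smooth_scale.
move=> H; apply: le_trans (H _) _.
  move=> j n y Jj jS nk y1 y2.
  have j0 : (J0 < j)%N by apply: leq_ltn_trans Jj; apply: leq_trans (ltnW JJ); exact: leq_maxl.
  rewrite D_Z// normrM (gtr0_norm it0) mulrCA.
  have := HC1 j n y j0 nk y1 y2 => h.
  apply: le_trans (ler_wpM2l (ltW it0) h) _.
  have -> : t^-1 * (C1 * (r ^+ j / 2 ^+ j)) = C1 * (t * 2 ^+ j)^-1 * r ^+ j by rewrite invfM; ring.
  rewrite ler_wpM2r ?exprn_ge0 ?(ltW r0)// ler_wpM2l// lef_pV2 ?posrE ?mulr_gt0 ?exprn_gt0//.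
  apply: (@le_trans _ _ (2 ^+ J.+1 * t)); first exact: ltW.
  by rewrite mulrC ler_wpM2l ?(ltW t0)// ler_weXn2l//; clear; lra.
have := HJ1 J (leq_trans (leq_maxr _ _) (ltnW JJ)); apply: le_trans.
by rewrite /K; clear; lra.
Qed.

End Tails.

(** * Additivity over adjacent intervals *)

Section Gluing.
Context {R : realType}.
Implicit Types (f g : R -> \bar R) (phi psi theta F : R -> R) (T S : (R -> R) -> R) (a b c x y z h s t p q w B C d e m M K : R) (n k j J N : nat).
Local Notation mu := (@lebesgue_measure R).

Lemma between (y : \bar R) c : (c%:E < y)%E -> exists2 d, c < d & (d%:E < y)%E.
Proof.
case: y => [r| |]//; rewrite ?lte_fin => cr; last by exists (c + 1); rewrite ?ltry//; lra.
by exists ((c + r) / 2); rewrite ?lte_fin; lra.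
Qed.

Lemma lowge_add T S phi x (y : \bar R) : lowge T phi x y ->
  (forall e, 0 < e -> exists2 d, 0 < d & forall t, 0 < t -> t < d -> `|avg S phi x t| <= e) ->
  lowge (fun phi => T phi + S phi) phi x y.
Proof.
move=> HT HS c /between[c1 cc /HT[d1 d10 H1]]; have e0 : 0 < c1 - c by lra.
have [d2 d20 H2] := HS _ e0; exists (Num.min d1 d2); first by rewrite lt_min d10.
move=> t t0; rewrite lt_min => /andP[td1 td2].
have := H1 t t0 td1; have := H2 t t0 td2; rewrite ler_norml => /andP[? _] ?.
rewrite /avg mulrDr -/(avg T phi x t) -/(avg S phi x t); lra.
Qed.

Lemma edistD2 a b T S : edist a b T -> edist a b S -> edist a b (fun phi => T phi + S phi).
Proof.
by move=> eT eS; have := edist_lin 1 eT eS; congr edist; apply/funext => f0; rewrite mul1r.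
Qed.

Lemma pvD T S x p q : pv T x p -> pv S x q -> pv (fun phi => T phi + S phi) x (p + q).
Proof.
move=> pT pS; have := pv_lin 1 pT pS; rewrite mul1r; congr pv.
by apply/funext => f0; rewrite mul1r.
Qed.

(** Away from [b] one of the two functionals has its support at a distance, and its averages tend to
    0 by [avg_off]. The point [b] itself joins both exceptional sets. *)
Lemma majF_glue f a b c T S : a <= b -> b <= c -> majF f a b T -> majF f b c S ->
  majF f a c (fun phi => T phi + S phi).
Proof.
move=> ab bc [eT pT [E1 [Z1 [cE1 nZ1 T0 T1]]]] [eS pS [E2 [Z2 [cE2 nZ2 S0 S1]]]].
have nT x : null_at T x by have [? []] := pT x.
have nS x : null_at S x by have [? []] := pS x.
split.
- by apply: edistD2; [exact: (edist_widen eT)|exact: (edist_widen eS)].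
- by move=> x; have [p Hp] := pT x; have [q Hq] := pS x; exists (p + q); exact: pvD.
have nb : mu.-negligible [set b] by exists [set b]; split => //; exact: lebesgue_measure_set1.
exists (E1 `|` E2 `|` [set b]), (Z1 `|` Z2 `|` [set b]); split.
- by apply: countable_setU; [exact: countable_setU|exact: countable1].
- by apply: negligibleU; [exact: negligibleU|].
- move=> x phi ax xc /not_orP[/not_orP[z1 z2] /eqP xb] tp.
  have [lt|lt|E] := ltgtP x b; last by rewrite E eqxx in xb.
    apply: lowge_add; first by apply: T0 => //; exact: ltW.
    by apply: (avg_off eS) => //; left.
  have -> : (fun phi => T phi + S phi) = fun phi => S phi + T phi.
    by apply/funext => f0; rewrite addrC.
  apply: lowge_add; first by apply: S0 => //; exact: ltW.
  by apply: (avg_off eT) => //; right.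
- move=> x phi ax xc /not_orP[/not_orP[z1 z2] /eqP xb] tp.
  have [lt|lt|E] := ltgtP x b; last by rewrite E eqxx in xb.
    have [d Hd] := T1 x phi ax (ltW lt) z1 tp; exists d.
    by apply: lowge_add => //; apply: (avg_off eS) => //; [case: tp|left].
  have -> : (fun phi => T phi + S phi) = fun phi => S phi + T phi.
    by apply/funext => f0; rewrite addrC.
  have [d Hd] := S1 x phi (ltW lt) xc z2 tp; exists d.
  by apply: lowge_add => //; apply: (avg_off eT) => //; [case: tp|right].
Qed.

Lemma dintF_add f a b c p q : a <= b -> b <= c -> dintF f a b p -> dintF f b c q ->
  dintF f a c (p + q).
Proof.
move=> ab bc dp dq e e0; have e2 : 0 < e / 2 by lra.
have [T [S [mT mS T1 S1]]] := dp _ e2; have [T' [S' [mT' mS' T1' S1']]] := dq _ e2.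
exists (fun phi => T phi + T' phi), (fun phi => S phi + S' phi).
by split; [exact: majF_glue mT mT'|exact: majF_glue mS mS'|clear -ab T1 T1'; lra|clear -ab S1 S1'; lra].
Qed.

Lemma edist_zero a b : edist a b (fun=> 0).
Proof.
split => //; first by move=> *; ring.
by exists 0, 0%N; split => // *; rewrite normr0 mul0r.
Qed.

Lemma majF_zero f a b (Z : set R) : mu.-negligible Z ->
  (forall x, a <= x -> x <= b -> ~ Z x -> (f x <= 0)%E) -> majF f a b (fun=> 0).
Proof.
move=> nZ fZ; split; first exact: edist_zero.
  move=> x; exists 0; split => [th _ e e0|e e0]; exists 1 => // s _ _.
    by rewrite normr0 ltW.
  by rewrite subrr normr0 ltW.
exists set0, Z; split => //.
- move=> x phi ax xb nz _ c cf; exists 1 => // t _ _; rewrite /avg mulr0.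
  by have := lt_le_trans cf (fZ x ax xb nz); rewrite lte_fin => /ltW.
- move=> x phi _ _ _ _; exists 0 => c; rewrite lte_fin => c0; exists 1 => // t _ _.
  by rewrite /avg mulr0 ltW.
Qed.

Lemma dintF_zero f a b (Z : set R) : mu.-negligible Z ->
  (forall x, a <= x -> x <= b -> ~ Z x -> f x = 0) -> dintF f a b 0.
Proof.
move=> nZ fZ e e0; exists (fun=> 0), (fun=> 0); split; try (clear -e0; lra).
  by apply: (majF_zero nZ) => x ax xb nz; rewrite fZ.
by apply: (majF_zero nZ) => x ax xb nz; rewrite fZ// oppe0.
Qed.

End Gluing.

(** * Products with a smooth function: point values *)

Section Products.
Context {R : realType}.
Implicit Types (phi psi theta F q : R -> R) (T S : (R -> R) -> R) (a b c x y z h s t B C d e m M K : R) (n k j J N : nat).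
Local Notation mu := (@lebesgue_measure R).

(** A Cauchy criterion over scales of ratio at most 2. The constant 6: with the dyadic scale
    [r n <= 2 * s] just above [s], comparing [s] to [r n] costs [2 * K * s] and [r n] to the limit
    [4 * K * s]. *)
Lemma halving_limit (A : R -> R) K : 0 <= K ->
  (forall s t, 0 < t -> t <= s -> s <= 1 -> s <= 2 * t -> `|A s - A t| <= K * s) ->
  exists l, forall s, 0 < s -> s <= 1 -> `|A s - l| <= 6 * K * s.
Proof.
move=> K0 HA; pose r n : R := 2^-1 ^+ n.
have r0 n : 0 < r n by rewrite exprn_gt0.
have rS n : r n = 2 * r n.+1 by rewrite /r exprS mulrA mulfV ?mul1r.
have r1 n : r n <= 1 by rewrite /r exprn_ile1//; clear -K0; lra.
have [||n _|l Hl] := @geometric_limit R (fun n => A (r n)) (fun n => K * r n) 0.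
- by move=> n; rewrite mulr_ge0// ltW.
- by move=> n; rewrite (rS n); clear -K0; lra.
- have := rS n; have := r0 n.+1 => h1 h2.
  by rewrite distrC; apply: HA => //; clear -K0 h1 h2; lra.
exists l => s s0 s1.
have exN : exists n, r n.+1 < s.
  have [N HN] := half_small 1 s0; exists N; apply: lt_le_trans HN.
  by rewrite mul1r; have := rS N; have := r0 N.+1; rewrite /r; clear -K0; lra.
have [n Hn nmin] := ex_minnP exN.
have sn : s <= r n.
  case: n Hn nmin => [|n] Hn nmin; first by rewrite /r expr0.
  by rewrite leNgt; apply/negP => /nmin; rewrite ltnn.
have h1 : `|A (r n) - A s| <= K * r n.
  by apply: HA => //; have := rS n; lra.
have h2 := Hl n isT.
have -> : A s - l = - (A (r n) - A s) - (l - A (r n)) by ring.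
apply: le_trans (ler_normB _ _) _; rewrite normrN.
have : K * r n <= K * (2 * s) by rewrite ler_wpM2l//; have := rS n; lra.
lra.
Qed.

Section WithEdist.
Variables (a b : R) (T : (R -> R) -> R) (x : R).
Hypotheses (eT : edist a b T) (nT : null_at T x).

(** [null_bound] for a product: [q] has to be bounded only where [theta] lives. *)
Lemma scaled_bound M : 0 <= M -> exists C k, 0 <= C /\ forall s q theta B1 B2,
  0 < s -> s <= 1 -> Cinf q -> testM M theta -> 0 <= B1 -> 0 <= B2 ->
  (forall j y, (j <= k)%N -> `|y| <= M -> `|D j q y| <= B1) ->
  (forall j y, (j <= k)%N -> `|D j theta y| <= B2) ->
  `|T (fun z => q ((z - x) / s) * theta ((z - x) / s))| <= C * (B1 * B2).
Proof.
move=> M0; have [C [k [C0 HC]]] := null_bound eT nT M 1.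
exists (C * 2 ^+ k), k; split; first by rewrite mulr_ge0 ?exprn_ge0.
move=> s q th B1 B2 s0 s1 sq [tth thM] B10 B20 Hq Hth.
rewrite -mulrA; apply: (HC s (fun y => q y * th y)) => //.
  by split; [exact: testfMl|move=> y /thM ->; rewrite mulr0].
move=> j y jk; have [yM|yM] := ltP M `|y|.
  rewrite (@D_out _ _ _ _ M) ?normr0 ?mulr_ge0 ?exprn_ge0//.
    by apply: smoothM => //; exact: tth.1.
  by move=> z /thM ->; rewrite mulr0.
apply: (le_trans (@leibniz_bound _ _ _ j y B1 B2 sq tth.1 _ _)).
- by move=> i ij; apply: Hq => //; exact: leq_trans jk.
- by move=> i ij; apply: Hth; exact: leq_trans jk.
by rewrite ler_wpM2r ?mulr_ge0// ler_weXn2l//; lra.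
Qed.

Lemma incr_bound psi k M : Cinf psi -> 0 <= M -> exists2 B, 0 <= B & forall s j y, 0 < s -> s <= 1 ->
  (j <= k)%N -> `|y| <= M -> `|D j (fun y => psi (x + s * y) - psi x) y| <= B * s.
Proof.
move=> sp M0; have [B B0 HB] := Cinf_bounded k.+1 (`|x| + M) sp.
exists (B * (1 + M)); first by rewrite mulr_ge0//; lra.
move=> s j y s0 s1 jk yM.
have in1 z : `|z| <= M -> `|x + s * z| <= `|x| + M.
  move=> zM; rewrite (le_trans (ler_normD _ _))// lerD2l normrM (gtr0_norm s0).
  by have := normr_ge0 z; nra.
case: j jk => [_|j jk].
  rewrite D0; have [w wy ->] := mvt_norm x (x + s * y) (smooth_der0 sp).
  have xy : x + s * y - x = s * y by ring.
  rewrite xy in wy *; rewrite normrM [`|s * y|]normrM (gtr0_norm s0).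
  have h1 : `|D 1 psi w| <= B.
    apply: HB => //; rewrite -[w](subrK x) addrC; apply: le_trans (ler_normD _ _) _.
    rewrite lerD2l (le_trans wy)// normrM (gtr0_norm s0).
    by have := normr_ge0 y; nra.
  have h2 : s * `|y| <= s * M by rewrite ler_wpM2l// ltW.
  have h3 : `|D 1 psi w| * (s * `|y|) <= B * (s * M).
    by apply: ler_pM => //; rewrite mulr_ge0// ltW.
  apply: le_trans h3 _; have : 0 <= B * s by rewrite mulr_ge0// ltW.
  lra.
rewrite D_B; [|exact: smooth_affine|exact: smooth_cst].
rewrite D_cst subr0 D_affine// exprS normrM normrM (gtr0_norm s0).
have h1 : `|D j.+1 psi (x + s * y)| <= B by apply: HB; [exact: leqW|exact: in1].
have h2 : `|s ^+ j| <= 1 by rewrite ger0_norm ?exprn_ge0 ?exprn_ile1//; exact: ltW.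
have h3 : s * `|s ^+ j| * `|D j.+1 psi (x + s * y)| <= s * 1 * B.
  by apply: ler_pM => //; [rewrite mulr_ge0// ltW|rewrite ler_wpM2l// ltW].
apply: le_trans h3 _; have : 0 <= B * s * M by rewrite !mulr_ge0// ltW.
lra.
Qed.

(** After the first-order term is removed, a factor [s] is left over even once an average has
    divided by [s]. *)
Lemma incr_bound2 psi k M : Cinf psi -> 0 <= M -> exists2 B, 0 <= B & forall s j y, 0 < s -> s <= 1 ->
  (j <= k)%N -> `|y| <= M ->
  `|D j (fun y => psi (x + s * y) - psi x - D 1 psi x * (s * y)) y| <= B * s ^+ 2.
Proof.
move=> sp M0; have [B B0 HB] := Cinf_bounded k.+2 (`|x| + M) sp.
exists (B * (1 + M + M ^+ 2)).
  by rewrite mulr_ge0// !addr_ge0// exprn_ge0.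
move=> s j y s0 s1 jk yM.
have in1 z : `|z| <= M -> `|x + s * z| <= `|x| + M.
  move=> zM; rewrite (le_trans (ler_normD _ _))// lerD2l normrM (gtr0_norm s0).
  by have := normr_ge0 z; nra.
have xsy w : `|w - x| <= `|s * y| -> `|w| <= `|x| + M.
  move=> wy; rewrite -[w](subrK x) addrC; apply: le_trans (ler_normD _ _) _.
  rewrite lerD2l (le_trans wy)// normrM (gtr0_norm s0).
  by have := normr_ge0 y; nra.
have s2 : 0 <= s ^+ 2 by rewrite exprn_ge0// ltW.
have K1 : 0 <= B * s ^+ 2 by exact: mulr_ge0.
have K2 : 0 <= B * s ^+ 2 * M by exact: mulr_ge0.
have K3 : 0 <= B * s ^+ 2 * M ^+ 2 by rewrite mulr_ge0// exprn_ge0.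
have y2 : y ^+ 2 <= M ^+ 2 by rewrite -[y ^+ 2]real_normK ?num_real// ler_pXn2r// nnegrE.
have dp := smooth_der0 sp; have dp1 := smooth_der 1 sp.
case: j jk => [_|[|j] jk].
- rewrite D0; have := @taylor1 _ _ _ _ x (s * y) B dp dp1.
  rewrite [D 1 psi x * _]mulrC; move=> H; apply: le_trans (H _) _.
    by move=> w wy; apply: HB => //; exact: xsy.
  rewrite exprMn mulrA; have : B * s ^+ 2 * y ^+ 2 <= B * s ^+ 2 * M ^+ 2 by rewrite ler_wpM2l.
  lra.
- have d1 (w : R) : is_derive w 1 (fun y : R => psi (x + s * y) - psi x - D 1 psi x * (s * y))
      (s * D 1 psi (x + s * w) - 0 - D 1 psi x * (s * 1)).
    exact: (derB (derB (@der_comp _ psi _ (fun y => x + s * y) _ w (dp _) (der_affine x s w))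
      (der_cst (psi x) w)) (derZ _ (derZ s (der_id w)))).
  rewrite (der_D1 d1).
  have -> : s * D 1 psi (x + s * y) - 0 - D 1 psi x * (s * 1) = s * (D 1 psi (x + s * y) - D 1 psi x) by ring.
  have [w wy ->] := mvt_norm x (x + s * y) dp1.
  have xy : x + s * y - x = s * y by ring.
  rewrite xy in wy *; rewrite !normrM (gtr0_norm s0).
  have h1 : `|D 2 psi w| <= B by apply: HB => //; exact: xsy.
  have h2 : `|D 2 psi w| * `|y| <= B * M by exact: ler_pM.
  have h3 : s ^+ 2 * (`|D 2 psi w| * `|y|) <= s ^+ 2 * (B * M) by rewrite ler_wpM2l.
  have -> : s * (`|D 2 psi w| * (s * `|y|)) = s ^+ 2 * (`|D 2 psi w| * `|y|) by ring.
  lra.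
have sl : Cinf (fun y => D 1 psi x * (s * y)) by do 2 apply: smoothZ; exact: smooth_id.
have sc : Cinf (fun y => psi (x + s * y) - psi x) by apply: smoothB; [exact: smooth_affine|exact: smooth_cst].
rewrite D_B// D_B; [|exact: smooth_affine|exact: smooth_cst].
have -> : D j.+2 (fun y => D 1 psi x * (s * y)) = fun=> 0.
  have d1 (w : R) : is_derive w 1 (fun y : R => D 1 psi x * (s * y)) (D 1 psi x * (s * 1)).
    exact: (derZ _ (derZ s (der_id w))).
  by rewrite DS (der_D1 d1) D_cst.
rewrite D_cst !subr0 D_affine// !exprS mulrA -expr2 normrM normrM (@ger0_norm _ (s ^+ 2))//.
have h1 : `|D j.+2 psi (x + s * y)| <= B by apply: HB; [exact: leqW (leqW _)|exact: in1].
have h2 : `|s ^+ j| <= 1 by rewrite ger0_norm ?exprn_ge0 ?exprn_ile1//; exact: ltW.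
have h3 : s ^+ 2 * `|s ^+ j| * `|D j.+2 psi (x + s * y)| <= s ^+ 2 * 1 * B.
  by apply: ler_pM => //; [rewrite mulr_ge0|rewrite ler_wpM2l].
lra.
Qed.

Lemma lam_D k : exists2 B, 0 <= B & forall j y, (j <= k)%N -> `|D j lam y| <= B :> R.
Proof.
have [B B0 HB] := testf_bounded k (@testf_ramp R); exists (B + 1); first by lra.
case=> [|j] y jk; first by rewrite D0 ger0_norm ?lam_ge0//; have := lam_le1 y; lra.
have -> : D j.+1 lam = fun y => - D j ramp y :> R.
  by rewrite DS -D_N; [congr D; apply/funext => z; rewrite /ramp opprK|exact: (@testf_ramp R).1].
rewrite normrN; have := HB j y (ltnW jk); lra.
Qed.

(** The part [psi x * lam] has a limit by hypothesis. For the increment of [psi], passing from one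
    scale to another of ratio at most 2 changes the value by [O(s)]: the two copies of [lam] differ
    only at distance about [s] from [x], where the increment is [O(s)]. The limit [l] need not be 0,
    and only its existence matters. *)
Lemma mul_pv psi c : Cinf psi -> pv T x c -> exists d, pv (fun phi => T (fun z => psi z * phi z)) x d.
Proof.
move=> sp pT; pose A s := T (fun z => (psi z - psi x) * lam ((z - x) / s)).
have slam : Cinf (@lam R) by exact: Cinf_lam.
have sls s : Cinf (fun z => lam ((z - x) / s)) by exact: smooth_scale.
have spx : Cinf (fun z => psi z - psi x) by apply: smoothB => //; exact: smooth_cst.
have [C [k [C0 HC]]] := scaled_bound (ler0n R 2).
have [B B0 HB] := incr_bound k sp (ler0n R 2).
have [L L0 HL] := lam_D k.
have L2 : 0 <= (1 + 2 ^+ k) * L by rewrite mulr_ge0// addr_ge0// exprn_ge0.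
have [|s t t0 ts s1 st|l Hl] := @halving_limit A (C * (B * ((1 + 2 ^+ k) * L))).
- by rewrite !mulr_ge0.
- have s0 : 0 < s by lra.
  have sn : s != 0 by rewrite gt_eqF.
  have tn : t != 0 by rewrite gt_eqF.
  pose rho := s / t; have rho1 : 1 <= rho by rewrite /rho ler_pdivlMr// mul1r.
  have rho2 : rho <= 2 by rewrite /rho ler_pdivrMr.
  have srho : Cinf (fun y => lam (0 + rho * y)) by exact: smooth_affine.
  pose q y := psi (x + s * y) - psi x; pose th y := lam y - lam (0 + rho * y).
  have -> : A s - A t = T (fun z => q ((z - x) / s) * th ((z - x) / s)).
    rewrite /A -(edistB eT); [|exact: smoothM|exact: smoothM].
    congr T; apply/funext => z; rewrite /q /th /rho.
    have -> : x + s * ((z - x) / s) = z by field.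
    have -> : 0 + s / t * ((z - x) / s) = (z - x) / t by field; rewrite sn tn.
    by ring.
  have -> : C * (B * ((1 + 2 ^+ k) * L)) * s = C * (B * s * ((1 + 2 ^+ k) * L)) by ring.
  apply: HC => //.
  - by apply: smoothB; [exact: smooth_affine|exact: smooth_cst].
  - have th0 y : 2 < `|y| -> th y = 0.
      rewrite lter_normr /th add0r => /orP[y2|y2].
        by rewrite !lam0 ?subrr//; [nra|clear -eT nT y2; lra].
      by rewrite !lam1 ?subrr//; [nra|clear -eT nT y2; lra].
    by split=> //; split; [exact: smoothB|exists 2].
  - by rewrite mulr_ge0// ltW.
  - by move=> j y jk y2; apply: HB.
  - move=> j y jk; rewrite /th D_B// D_affine//.
    apply: le_trans (ler_normB _ _) _; rewrite mulrDl mul1r; apply: lerD; first exact: HL.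
    rewrite normrM; apply: ler_pM => //; last exact: HL.
    rewrite ger0_norm; last by rewrite exprn_ge0//; clear -eT nT rho1; lra.
    apply: (@le_trans _ _ (2 ^+ j)); last by rewrite ler_weXn2l//; clear -eT nT; lra.
    by apply: lerXn2r; rewrite ?nnegrE//; clear -eT nT rho1; lra.
exists (l + psi x * c); split; first exact: (null_mul eT nT).
move=> e e0; set K := 6 * _ in Hl.
have K0 : 0 <= K by rewrite /K !mulr_ge0.
have e2 : 0 < e / 2 / (`|psi x| + 1) by rewrite !divr_gt0// ltr_wpDl.
have [d d0 Hd] := pT.2 _ e2.
have e3 : 0 < e / 2 / (K + 1) by rewrite !divr_gt0//; clear -eT nT K0; lra.
exists (Num.min 1 (Num.min d (e / 2 / (K + 1)))); first by rewrite !lt_min ltr01 d0.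
move=> s s0; rewrite !lt_min => /and3P[s1 sd]; rewrite ltr_pdivlMr; last by clear -eT nT K0; lra.
move=> sK.
have -> : T (fun z => psi z * lam ((z - x) / s)) = A s + psi x * T (fun z => lam ((z - x) / s)).
  rewrite /A -(edistZ eT)// -(edistD eT); [|exact: smoothM|exact: smoothZ].
  by congr T; apply/funext => z; ring.
have h1 := Hl s s0 (ltW s1); have h2 := Hd s s0 sd.
set u := T _ in h2 *.
have -> : A s + psi x * u - (l + psi x * c) = (A s - l) + psi x * (u - c) by ring.
apply: le_trans (ler_normD _ _) _; rewrite normrM.
have h3 : `|psi x| * `|u - c| <= (`|psi x| + 1) * (e / 2 / (`|psi x| + 1)).
  by apply: ler_pM => //; clear -eT nT K0; lra.
have E : (`|psi x| + 1) * (e / 2 / (`|psi x| + 1)) = e / 2 by field; rewrite gt_eqF// ltr_wpDl.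
clear -eT nT K0 s0 sK h1 h3 E; lra.
Qed.

End WithEdist.

End Products.

(** * Products with a smooth function: averages against [test_class0] *)

Section ProductAverages.
Context {R : realType}.
Implicit Types (f g : R -> \bar R) (phi psi theta F q : R -> R) (T S : (R -> R) -> R) (a b c x y z h s t B C d e m M K r : R) (n k j J N : nat).
Local Notation mu := (@lebesgue_measure R).

(** Expansion of [psi (x + t * y) - psi x] divided by [t]. The linear term is [T] on the test
    function [y * th y], small by [null_at]; the quadratic one is [O(t)] by [incr_bound2]. On the
    ring of radius [2 ^+ j] the divided increment is [O(2 ^+ j)], which the decay of [class0_dyadic]
    absorbs. *)
Lemma mul_avg a b T psi phi x : edist a b T -> null_at T x -> bsmooth psi -> test_class0 phi ->
  forall e, 0 < e -> exists2 d, 0 < d & forall t, 0 < t -> t < d ->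
  `|avg (fun phi => T (fun z => psi z * phi z)) phi x t - psi x * avg T phi x t| <= e.
Proof.
move=> eT nT [sp bp] tp e e0.
have [r [r0 r1 Hr]] := class0_dyadic tp.
have sph := class0_Cinf tp.
pose S := `|x - a| + `|x - b| + 1.
have S0 : 0 < S by rewrite /S; have := normr_ge0 (x - a); have := normr_ge0 (x - b); lra.
have S1 : x - S <= a - 1.
  by rewrite /S; have := ler_norm (x - a); have := normr_ge0 (x - b); lra.
have S2 : b + 1 <= x + S.
  by rewrite /S; have := ler_norm (- (x - b)); rewrite normrN; have := normr_ge0 (x - a); lra.
have [C [k [C0 HC]]] := dyadic_core eT nT S0 S1 S2.
have [C1 [J0 [C10 HC1]]] := Hr k.
have [B B0 HB] : exists2 B, 0 <= B & forall j y, (j <= k.+1)%N -> `|D j psi y| <= B.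
  elim: k.+1 => [|i [B B0 IH]].
    by have [B B0 HB] := bp 0%N; exists B => // j y; rewrite leqn0 => /eqP ->.
  have [B1 B10 HB1] := bp i.+1; exists (B + B1); first exact: addr_ge0.
  move=> j y; rewrite leq_eqVlt => /predU1P[->|/IH H]; first by have := HB1 y; clear -B0; lra.
  by have := H y; clear -B10; lra.
pose A := B * (2 + (1 + 2 * S) ^+ k).
have S20 : 0 <= 1 + 2 * S by clear -S0; lra.
have S10 : 0 <= (1 + 2 * S) ^+ k by rewrite exprn_ge0//; lra.
have A0 : 0 <= A by rewrite mulr_ge0//; clear -S10; lra.
pose N := 2 ^+ k * (A * C1).
have N0 : 0 <= N by apply: mulr_ge0; [exact: exprn_ge0|exact: mulr_ge0].
have e3 : 0 < e / 3 by clear -e0; lra.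
have [J1 HJ1] := exp_lt_eps (C * N / (1 - r)) r0 r1 e3.
pose J := maxn J0 J1.
have HJ : C * N / (1 - r) * r ^+ J <= e / 3 by apply: HJ1; exact: leq_maxr.
pose th y := plateau (y / 2 ^+ J) * phi y.
have spl : Cinf (fun y : R => plateau (y / 2 ^+ J)).
  have := smooth_scale 0 (2 ^+ J) (@Cinf_plateau R); congr Cinf.
  by apply/funext => z; rewrite subr0.
have X0 : 0 < 2 ^+ J :> R by rewrite exprn_gt0.
have tth : testf th.
  split; first exact: smoothM.
  exists (2 * 2 ^+ J) => y yJ; rewrite /th plateau0 ?mul0r//.
  by rewrite normrM normfV (gtr0_norm X0) ler_pdivlMr// ltW.
have tk : testf (fun y => y * th y) by apply: testfMl => //; exact: smooth_id.
have [M0 HM0] := tth.2; pose M := Num.max M0 0.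
have M0' : 0 <= M by rewrite le_max lexx orbT.
have tM : testM M th by split => // y; rewrite gt_max => /andP[/HM0].
have [C2 [k2 [C20 HC2]]] := scaled_bound eT nT M0'.
have [B2 B20 HB2] := @incr_bound2 R x psi k2 M sp M0'.
have [B3 B30 HB3] := testf_bounded k2 tth.
have P1 : 0 < `|D 1 psi x| + 1 by have := normr_ge0 (D 1 psi x); clear; lra.
have e4 : 0 < e / 3 / (`|D 1 psi x| + 1) by rewrite divr_gt0.
have [d1 d10 Hd1] := nT _ tk _ e4.
pose K := C2 * (B2 * B3).
have K0 : 0 <= K by rewrite !mulr_ge0.
pose m0 := Num.min (S / 2 ^+ J) (Num.min 1 (Num.min d1 (e / 3 / (K + 1)))).
have m00 : 0 < m0 by rewrite !lt_min ltr01 d10 !divr_gt0//; clear -K0; lra.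
exists m0 => // t t0; rewrite !lt_min => /and4P[tS t1 td1 tK].
have tn : t != 0 by rewrite gt_eqF.
have it0 : 0 < t^-1 by rewrite invr_gt0.
have tJS : 2 ^+ J * t <= S by rewrite mulrC -ler_pdivlMr// ltW.
pose f1 y := psi (x + t * y) - psi x.
have sf1 : Cinf f1 by apply: smoothB; [exact: smooth_affine|exact: smooth_cst].
pose eta y := t^-1 * (f1 y * phi y).
have seta : Cinf eta by apply: smoothZ; exact: smoothM.
have sphx : Cinf (fun z => phi ((z - x) / t)) by exact: smooth_scale.
have -> : avg (fun phi => T (fun z => psi z * phi z)) phi x t - psi x * avg T phi x t =
    T (fun z => eta ((z - x) / t)).
  rewrite /avg mulrCA -mulrBr -(edistZ eT)// -(edistB eT); [|exact: smoothM|exact: smoothZ].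
  rewrite -(edistZ eT); last by apply: smoothB; [exact: smoothM|exact: smoothZ].
  congr T; apply/funext => z; rewrite /eta /f1.
  have -> : x + t * ((z - x) / t) = z by field.
  by rewrite -mulrBl.
have rest := HC t J eta N r t0 tJS seta N0 r0 r1.
have {}rest : `|T (fun z => eta ((z - x) / t)) -
    T (fun z => plateau ((z - x) / t / 2 ^+ J) * eta ((z - x) / t))| <= e / 3.
  apply: le_trans (rest _) _; last by apply: le_trans HJ; rewrite mulrA mulrAC.
  move=> j n y Jj jS nk y1 y2; have J0j : (J0 < j)%N by apply: leq_ltn_trans Jj; exact: leq_maxl.
  set X : R := 2 ^+ j; have X1 : 0 < X by rewrite exprn_gt0.
  (* [t^-1] goes with the increment, of size at most [X * A] on this ring; the factor [X] cancels
     against the [1 / X] in the decay of [phi]. *)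
  pose F1 y := t^-1 * f1 (0 + X * y); pose F2 y := phi (0 + X * y).
  have sF1 : Cinf F1 by apply: smoothZ; exact: smooth_affine.
  have sF2 : Cinf F2 by exact: smooth_affine.
  have -> : X ^+ n * `|D n eta (X * y)| = `|D n (fun y => F1 y * F2 y) y|.
    have -> : (fun y => F1 y * F2 y) = fun y => eta (0 + X * y).
      by apply/funext => w; rewrite /eta /F1 /F2; ring.
    by rewrite D_affine// add0r normrM (@ger0_norm _ (X ^+ n))// exprn_ge0// ltW.
  have rX : 0 <= r ^+ j / X by rewrite divr_ge0 ?exprn_ge0// ltW.
  apply: (@le_trans _ _ (2 ^+ n * ((X * A) * (C1 * (r ^+ j / X))))); last first.
    have -> : X * A * (C1 * (r ^+ j / X)) = A * C1 * r ^+ j by field; rewrite gt_eqF.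
    have -> : N * r ^+ j = 2 ^+ k * (A * C1 * r ^+ j) by rewrite /N -mulrA.
    apply: ler_wpM2r; last by rewrite ler_weXn2l ?ler1n.
    by apply: mulr_ge0; [exact: mulr_ge0|rewrite exprn_ge0// ltW].
  apply: leibniz_bound => //; last first.
    move=> i ik; rewrite /F2 D_affine// add0r normrM (@ger0_norm _ (X ^+ i)); last by rewrite exprn_ge0// ltW.
    by apply: HC1 => //; exact: leq_trans nk.
  move=> i ik; have ik2 : (i <= k)%N by exact: leq_trans nk.
  rewrite /F1 D_Z; last exact: smooth_affine.
  case: i ik ik2 => [|i] ik ik2.
    rewrite D0 /f1 add0r; have HB1 z : `|D 1 psi z| <= B by apply: HB.
    have := mvt_le x (x + t * (X * y)) (smooth_der0 sp) HB1.
    have -> : x + t * (X * y) - x = t * X * y by ring.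
    rewrite !normrM (gtr0_norm t0) (gtr0_norm X1) (gtr0_norm it0) => h.
    apply: (@le_trans _ _ (t^-1 * (B * (t * X * `|y|)))); first by rewrite ler_wpM2l// ltW.
    have -> : t^-1 * (B * (t * X * `|y|)) = X * (B * `|y|) by field.
    rewrite ler_wpM2l ?(ltW X1)// /A ler_wpM2l//; apply: le_trans y2 _; by rewrite lerDl.
  rewrite D_affine// add0r /f1 D_B; [|exact: smooth_affine|exact: smooth_cst].
  rewrite D_cst subr0 D_affine//.
  have -> : t^-1 * (X ^+ i.+1 * (t ^+ i.+1 * D i.+1 psi (x + t * (X * y)))) =
     X * ((X * t) ^+ i * D i.+1 psi (x + t * (X * y))) by rewrite exprMn !exprS; field.
  rewrite normrM (gtr0_norm X1) ler_wpM2l ?(ltW X1)// normrM /A mulrC.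
  apply: ler_pM => //; first by apply: HB; exact: leqW.
  rewrite ger0_norm; last by rewrite exprn_ge0// mulr_ge0// ltW.
  apply: (@le_trans _ _ ((1 + 2 * S) ^+ i)).
    apply: lerXn2r; rewrite ?nnegrE//; first by rewrite mulr_ge0// ltW.
    by apply: le_trans jS _; rewrite lerDr.
  apply: (@le_trans _ _ ((1 + 2 * S) ^+ k)); last by rewrite lerDr.
  by rewrite ler_weXn2l ?lerDl ?mulr_ge0 ?(ltW S0)// ltnW.
have main : `|T (fun z => plateau ((z - x) / t / 2 ^+ J) * eta ((z - x) / t))| <= e / 3 + e / 3.
  pose q y := psi (x + t * y) - psi x - D 1 psi x * (t * y).
  have sq : Cinf q by apply: smoothB => //; do 2 apply: smoothZ; exact: smooth_id.
  have sth : Cinf (fun z => th ((z - x) / t)) by apply: smooth_scale; exact: tth.1.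
  have sqx : Cinf (fun z => q ((z - x) / t)) by exact: smooth_scale.
  have -> : T (fun z => plateau ((z - x) / t / 2 ^+ J) * eta ((z - x) / t)) =
    t^-1 * T (fun z => q ((z - x) / t) * th ((z - x) / t)) +
    D 1 psi x * T (fun z => (z - x) / t * th ((z - x) / t)).
    have skx : Cinf (fun z => (z - x) / t * th ((z - x) / t)).
      exact: (smooth_scale x t tk.1).
    rewrite -(edistZ eT (D 1 psi x) skx) -(edistZD eT); [|exact: smoothM|exact: smoothZ].
    by congr T; apply/funext => z; rewrite /eta /th /q /f1; field.
  apply: le_trans (ler_normD _ _) _; apply: lerD.
    rewrite normrM (gtr0_norm it0).
    have h : `|T (fun z => q ((z - x) / t) * th ((z - x) / t))| <= C2 * (B2 * t ^+ 2 * B3).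
      apply: HC2 => //; [exact: ltW|by rewrite mulr_ge0// exprn_ge0// ltW|].
      by move=> j y jk yM; apply: HB2 => //; exact: ltW.
    apply: le_trans (ler_wpM2l (ltW it0) h) _.
    have -> : t^-1 * (C2 * (B2 * t ^+ 2 * B3)) = K * t by rewrite /K; field.
    move: tK; rewrite ltr_pdivlMr; last by clear -K0; lra.
    clear -K0 t0; lra.
  rewrite normrM; have h := Hd1 t t0 td1.
  have h3 : `|D 1 psi x| * `|T (fun z => (z - x) / t * th ((z - x) / t))| <=
     (`|D 1 psi x| + 1) * (e / 3 / (`|D 1 psi x| + 1)) by apply: ler_pM => //; clear -K0; lra.
  by apply: le_trans h3 _; rewrite mulrC divfK// gt_eqF.
have := ler_normD (T (fun z => eta ((z - x) / t)) -
    T (fun z => plateau ((z - x) / t / 2 ^+ J) * eta ((z - x) / t))) (T (fun z => plateau ((z - x) / t / 2 ^+ J) * eta ((z - x) / t))).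
rewrite subrK; lra.
Qed.

End ProductAverages.

(** * A weak-type maximal inequality for positive functionals *)

Section WeakMaximal.
Context {R : realType}.
Implicit Types (G : set R) (phi psi theta F q : R -> R) (T S P : (R -> R) -> R) (a b c x y z h s t B C d e m M K r : R) (n k j J N : nat).
Local Notation mu := (@lebesgue_measure R).

Definition positive P := forall psi, Cinf psi -> (forall x, 0 <= psi x) -> 0 <= P psi.

Lemma edist_sum a b P (E : seq R) (F : R -> R -> R) : edist a b P -> (forall r, Cinf (F r)) ->
  Cinf (fun z => \sum_(r <- E) F r z) /\
  P (fun z => \sum_(r <- E) F r z) = \sum_(r <- E) P (F r).
Proof.
move=> eP sF; elim: E => [|r E [IH1 IH2]].
  have -> : (fun z => \sum_(r <- [::]) F r z) = fun=> 0 by apply/funext => z; rewrite big_nil.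
  by rewrite big_nil (edist0 eP); split => //; exact: smooth_cst.
have -> : (fun z => \sum_(i <- r :: E) F i z) = fun z => F r z + \sum_(i <- E) F i z.
  by apply/funext => z; rewrite big_cons.
by rewrite big_cons (edistD eP)// IH2; split => //; exact: smoothD.
Qed.

(** Where the maximal function of [P] exceeds [c], with a smooth plateau in place of the indicator
    of a ball; smoothness makes the set open. *)
Definition large_set P c := [set x | exists t, [/\ 0 < t, t < 1 & c * t < P (fun z => plateau ((z - x) / t))]].

Lemma bsmooth_plateau : bsmooth (@plateau R).
Proof.
split; first exact: Cinf_plateau.
move=> j; have [B B0 HB] := testf_bounded j (@testf_plateau R); exists B => // y; exact: HB.
Qed.

Lemma open_large_set a b P c : edist a b P -> open (large_set P c).
Proof.
move=> eP; rewrite openE => x [t [t0 t1 ct]]; have tn : t != 0 by rewrite gt_eqF.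
have [sp bp] := bsmooth_plateau.
have bp' j : exists B, forall y, `|D j.+2 plateau y| <= B :> R.
  by have [B _ HB] := bp j.+2; exists B.
have cx : continuous (fun x => P (fun z => plateau ((z - x) / t))).
  by apply: (@der_continuous _ _ (fun x => _)) => y; exact: (edist_transl eP y tn sp bp').
have e0 : 0 < P (fun z => plateau ((z - x) / t)) - c * t by rewrite subr_gt0.
have := cx x; move=> /cvgrPdist_lt/(_ _ e0); apply: filterS => y.
rewrite ltr_norml => /andP[_ h]; exists t; split => //; clear -h; lra.
Qed.

(** Vitali's lemma on a compact subset. The plateau of scale [r] is supported in the ball of radius
    [2 * r], so plateaus over disjoint balls add up to at most 1 and positivity of [P] bounds the
    sum of the scales. The constant is the length [12 * r] of the tripled ball. *)
Lemma weak_maximal a b P c : edist a b P -> positive P -> 0 < c ->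
  (mu (large_set P c) <= (12 / c * P (fun=> 1%R))%:E)%E.
Proof.
move=> eP Ppos c0; have oG := open_large_set (c := c) eP; set G := large_set P c in oG *.
rewrite lebesgue_regularity_inner_sup//; last exact: open_measurable.
apply: ub_ereal_sup => /= _ [K [cK KG <-]].
have [x|r_ Hr] := @choice _ _ (fun x t => 0 < t /\ (G x -> c * t < P (fun z => plateau ((z - x) / t)))).
  have [[t [t0 t1 ct]]|nG] := pselect (G x); first by exists t.
  by exists 1; split.
have r_pos x : 0 < r_ x by case: (Hr x).
pose B x := ball x (2 * r_ x).
have B2 x : 0 < 2 * r_ x by rewrite mulr_gt0.
have KB : K `<=` cover G B by move=> x /KG Gx; exists x => //; exact: ballxx.
have {KB}[D Dsub Kcover] : finite_subset_cover G B K.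
  move: cK; rewrite compact_cover => /(_ _ _ _ _ KB); apply.
  by move=> /= x Gx; exact: ball_open.
pose s : seq R := finmap.enum_fset D.
have KDB : K `<=` cover [set` s] B.
  by apply: (subset_trans Kcover) => /= x [r Dr] rx; exists r.
have is_ballB i : is_ball (B i) by exact: is_ball_ball.
have Bset0 i : B i !=set0 by exists i; exact: ballxx.
have [E [uE ED tEB DE]] := @vitali_lemma_finite_cover _ _ B is_ballB Bset0 s.
have h1 : (mu K <= (\sum_(i <- E) 12 * r_ i)%:E)%E.
  have {}DE := subset_trans KDB DE.
  apply: (le_trans (@content_subadditive _ _ _ mu K
      (fun i => 3 *` B (nth 0%R E i)) (size E) _ _ _)) => //.
  - by move=> k ?; rewrite scale_ballE//; exact: measurable_ball.
  - by apply: closed_measurable; apply: compact_closed => //; exact: Rhausdorff.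
  - apply: (subset_trans DE); rewrite /cover bigcup_seq.
    by rewrite (big_nth 0%R)//= big_mkord.
  - rewrite (big_nth 0%R) big_mkord -sumEFin; apply: lee_sum => i _.
    have -> : 3 *` B E`_i = ball E`_i (3 * (2 * r_ E`_i)) by rewrite scale_ballE.
    have h : 0 <= 3 * (2 * r_ E`_i) by rewrite !mulr_ge0// ltW.
    have hb := lebesgue_measure_ball E`_i h.
    apply: (@le_trans _ _ ((3 * (2 * r_ E`_i)) *+ 2)%:E); last by rewrite lee_fin; lra.
    by rewrite -hb.
apply: (le_trans h1); rewrite lee_fin.
pose F x z := plateau ((z - x) / r_ x).
have sF x : Cinf (F x) by apply: smooth_scale; exact: Cinf_plateau.
have [sS PS] := edist_sum E eP sF.
have h2 : \sum_(i <- E) 12 * r_ i <= 12 / c * \sum_(i <- E) P (F i).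
  rewrite mulr_sumr [leLHS]big_seq [leRHS]big_seq; apply: ler_sum => i iE.
  have Gi : G i by apply/set_mem/Dsub/ED.
  have [_ /(_ Gi) H] := Hr i; rewrite -mulrA ler_wpM2l// ler_pdivlMl//; exact: ltW.
apply: (le_trans h2); rewrite -PS ler_wpM2l//; first by rewrite divr_ge0// ltW.
rewrite -subr_ge0 -(edistB eP)//; last exact: smooth_cst.
apply: Ppos => [|z]; first by apply: smoothB => //; exact: smooth_cst.
rewrite subr_ge0; have Fout i : ~ B i z -> F i z = 0.
  move=> nB; apply: plateau0; rewrite normrM normfV (gtr0_norm (r_pos i)) ler_pdivlMr//.
  by rewrite leNgt; apply/negP => h; apply: nB; rewrite /B /ball/= distrC.
have [[i iE Bi]|nB] := pselect (exists2 i, i \in E & B i z).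
  rewrite (bigD1_seq i)//= big_seq_cond big1 ?addr0; first exact: plateau_le1.
  move=> j /andP[jE ji]; apply: Fout => Bj; move/eqP: ji; apply.
  by apply: (tEB j i) => //; exists z.
rewrite big_seq big1// => i iE; apply: Fout => Bi; apply: nB; by exists i.
Qed.

End WeakMaximal.

(** * Integrable functions are finite almost everywhere *)

Section ProductIntegral.
Context {R : realType}.
Implicit Types (f g : R -> \bar R) (phi psi theta F q : R -> R) (T S P : (R -> R) -> R) (a b c x y z h s t B C d e m M K r : R) (n k j J N : nat).
Local Notation mu := (@lebesgue_measure R).

Lemma class0_of_test phi : testf phi -> (forall x, 0 <= phi x) -> \int[mu]_x phi x = 1 -> test_class0 phi.
Proof.
move=> tp p0 p1; split => //; first by have := tp.1; rewrite Cinf.unlock.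
  have fin : (\int[mu]_x (phi x)%:E)%E \is a fin_num.
    by apply: integrable_fin_num => //; exact: testf_integrable.
  by rewrite -(fineK fin) -[fine _]/(\int[mu]_x phi x) p1.
exists (-2); first by lra.
have [_ [M HM]] := tp; move=> n; exists 0, M => x xM.
by rewrite -DE (D_out n tp.1 HM xM) normr0 mul0r.
Qed.

Lemma Rint_pos phi x : testf phi -> (forall x, 0 <= phi x) -> 0 < phi x -> 0 < \int[mu]_y phi y.
Proof.
move=> tp p0 px; rewrite lt_neqAle Rint_ge0// andbT eq_sym; apply/eqP => I0.
have mono := @der_nondecreasing _ _ _ _ _ (testf_prim_der tp).
have [M [M0 HM]] := prim_far tp.
have pr0 y : prim phi y = 0.
  apply/eqP; rewrite eq_le; apply/andP; split.
    have h := ler_norm y; rewrite -I0 -(HM (`|y| + M)).2; last by have := normr_ge0 y; lra.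
    by apply: mono => [|w _]; [lra|exact: p0].
  have h := ler_norm (- y); rewrite normrN in h.
  have n0 := normr_ge0 y; rewrite -(HM (- `|y| - M)).1; last by lra.
  by apply: mono => [|w _]; [lra|exact: p0].
have : phi x = 0; last by move=> E; rewrite E ltxx in px.
have d0 : is_derive x 1 (prim phi) 0.
  have -> : prim phi = fun=> 0 by apply/funext.
  exact: der_cst.
have d1 := testf_prim_der tp x.
by rewrite -(@derive_val _ _ _ _ _ _ _ d1) (@derive_val _ _ _ _ _ _ _ d0).
Qed.

Lemma plateau_int_gt0 : 0 < \int[mu]_y plateau y :> R.
Proof.
apply: (@Rint_pos _ 0); [exact: testf_plateau|exact: plateau_ge0|].
by rewrite plateau1 ?normr0.
Qed.

Definition plat1 : R -> R := fun x => (\int[mu]_y plateau y)^-1 * plateau x.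

Lemma plat1_class1 : test_class1 plat1.
Proof.
have I0 := plateau_int_gt0; have tp := @testf_plateau R.
have i0 : 0 <= (\int[mu]_y plateau y)^-1 :> R by rewrite invr_ge0 ltW.
split.
  apply: class0_of_test; first exact: testfZ.
    by move=> x; rewrite mulr_ge0// plateau_ge0.
  have := RintZD (\int[mu]_y plateau y)^-1 tp (@testf0 R).
  rewrite /plat1 => E; transitivity (\int[mu]_y ((\int[mu]_y plateau y)^-1 * plateau y + 0) : R).
    by congr (Rintegral mu _ _); apply/funext => y; rewrite addr0.
  rewrite E mulVf ?gt_eqF// [X in _ + X](_ : _ = 0) ?addr0//.
  by rewrite /Rintegral integral0.
move=> x; rewrite -D1E D_Z; last exact: Cinf_plateau.
by rewrite mulrCA mulr_ge0_le0// plateau_decr.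
Qed.

Lemma positive_majF f a b T S : a <= b -> majF f a b T -> majF (fun x => - f x)%E a b S ->
  positive (fun phi => T phi + S phi).
Proof. by move=> ab mT mS psi sp p0; exact: majF_ge0 ab mT mS sp p0. Qed.

(** The points where the maximal function of [P] is infinite; the bound of [weak_maximal] tends to 0
    as the level grows. *)
Lemma infinite_negligible a b P : edist a b P -> positive P ->
  mu.-negligible (\bigcap_n large_set P n.+1%:R).
Proof.
move=> eP Ppos; pose N := \bigcap_n large_set P n.+1%:R.
have P1 : 0 <= P (fun=> 1) by apply: Ppos => //; exact: smooth_cst.
have mN : measurable N.
  by apply: bigcapT_measurable => n; apply: open_measurable; exact: open_large_set eP.
exists N; split => //; apply/eqP; rewrite eq_le measure_ge0 andbT.
apply/lee_addgt0Pr => e e0; rewrite add0e.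
have d0 : 0 < e / (12 * P (fun=> 1) + 1) by rewrite divr_gt0//; lra.
have /= [n _ ne] := near_infty_natSinv_lt (PosNum d0).
have n0 : 0 < n.+1%:R :> R by [].
apply: (@le_trans _ _ (mu (large_set P n.+1%:R))).
  apply: le_measure; rewrite ?inE//; first by apply: open_measurable; exact: open_large_set eP.
  by move=> x; apply.
apply: le_trans (weak_maximal eP Ppos n0) _; rewrite lee_fin.
have := ne n (leqnn _) => /=; rewrite ltr_pdivlMr; last by lra.
have : 0 < n.+1%:R^-1 :> R by rewrite invr_gt0.
move: (n.+1%:R^-1) => v v0 h.
have -> : 12 * v * P (fun=> 1) = v * (12 * P (fun=> 1)) by ring.
lra.
Qed.

Lemma countable_negl (E : set R) : countable E -> mu.-negligible E.
Proof.
move=> cE; exists E; split => //; last exact: countable_lebesgue_measure0.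
by apply: countable_measurable => // x; exact: measurable_set1.
Qed.

(** If [f x = +oo], the plateau averages of [T] at [x] tend to [+oo], while those of [S] stay
    bounded below off a countable set. So the maximal function of [T + S] is infinite at [x]. *)
Lemma large_of_infinite f a b T S : a <= b -> majF f a b T -> majF (fun x => - f x)%E a b S ->
  exists2 Z : set R, mu.-negligible Z & forall x, a <= x -> x <= b -> ~ Z x -> f x <> +oo%E.
Proof.
move=> ab mT mS; have [eT pT [E1 [Z1 [cE1 nZ1 T0 T1]]]] := mT; have [eS pS [E2 [Z2 [cE2 nZ2 S0 S1]]]] := mS.
have eP := edistD2 eT eS; have Ppos := positive_majF ab mT mS.
have nE : mu.-negligible E2 by exact: countable_negl.
have nN := infinite_negligible eP Ppos.
exists (Z1 `|` E2 `|` \bigcap_n large_set (fun phi => T phi + S phi) n.+1%:R).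
  by apply: negligibleU => //; exact: negligibleU.
move=> x ax xb /not_orP[/not_orP[z1 e2] nl] fx; apply: nl => n _.
have [c0 c1] := plat1_class1.
have lT := T0 x _ ax xb z1 c0; rewrite fx in lT.
have [c lS] := S1 x _ ax xb e2 plat1_class1.
have I0 := plateau_int_gt0; set I := \int[mu]_y plateau y in I0.
have [d1 d10 H1] := lT (n.+1%:R / I - (c - 1) + 1) (ltry _).
have [|d2 d20 H2] := lS (c - 1); first by rewrite lte_fin; lra.
pose t := Num.min (Num.min d1 d2) 1 / 2.
have m0 : 0 < Num.min (Num.min d1 d2) 1 by rewrite !lt_min d10 d20 ltr01.
have [m1 m2 m3] : [/\ Num.min (Num.min d1 d2) 1 <= d1, Num.min (Num.min d1 d2) 1 <= d2 & Num.min (Num.min d1 d2) 1 <= 1].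
  by rewrite !ge_min !lexx !orbT.
have t0 : 0 < t by rewrite /t; clear -ab m0; lra.
have td1 : t < d1 by rewrite /t; clear -ab d10 m1; lra.
have td2 : t < d2 by rewrite /t; clear -ab d20 m2; lra.
exists t; split => //; first by rewrite /t; clear -ab m3; lra.
have := H1 t t0 td1; have := H2 t t0 td2.
have sp : Cinf (fun z => plateau ((z - x) / t)) by apply: smooth_scale; exact: Cinf_plateau.
rewrite /avg /plat1 -/I (edistZ eT _ sp) (edistZ eS _ sp).
set u := T _; set v := S _ => h2 h1.
have h3 : n.+1%:R / I + 1 <= t^-1 * (I^-1 * (u + v)).
  have -> : t^-1 * (I^-1 * (u + v)) = t^-1 * (I^-1 * u) + t^-1 * (I^-1 * v) by ring.
  by move: h1; set w := _ / I; clear -ab h2; lra.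
have h4 : (t * I) * (n.+1%:R / I + 1) <= (t * I) * (t^-1 * (I^-1 * (u + v))).
  by rewrite ler_wpM2l// mulr_ge0// ltW.
have tI : 0 < t * I by exact: mulr_gt0.
have E3 : (t * I) * (t^-1 * (I^-1 * (u + v))) = u + v by field; rewrite !gt_eqF.
have E4 : (t * I) * (n.+1%:R / I + 1) = n.+1%:R * t + t * I by field; rewrite gt_eqF.
by rewrite E3 E4 in h4; apply: lt_le_trans h4; rewrite ltrDl.
Qed.

Lemma finite_ae f a b T S : a <= b -> majF f a b T -> majF (fun x => - f x)%E a b S ->
  exists2 Z : set R, mu.-negligible Z & forall x, a <= x -> x <= b -> ~ Z x -> f x \is a fin_num.
Proof.
move=> ab mT mS; have [Z1 nZ1 H1] := large_of_infinite ab mT mS.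
have mT' : majF (fun x => - - f x)%E a b T.
  by move: mT; congr majF; apply/funext => x; rewrite oppeK.
have [Z2 nZ2 H2] := large_of_infinite ab mS mT'.
exists (Z1 `|` Z2); first exact: negligibleU.
move=> x ax xb /not_orP[z1 z2]; have := H1 x ax xb z1; have := H2 x ax xb z2.
by case: (f x).
Qed.

End ProductIntegral.

(** * Major functionals for [f psi] and the integral of a product *)

Section ProductMajor.
Context {R : realType}.
Implicit Types (f g : R -> \bar R) (phi psi theta F q : R -> R) (T S P : (R -> R) -> R) (a b c x y z h s t B C d e m M K r : R) (n k j J N : nat).
Local Notation mu := (@lebesgue_measure R).

Definition wsum psi C T S phi : R := T (fun z => (psi z + C) * phi z) + C * S phi.

Lemma bsmooth_addC psi C : bsmooth psi -> bsmooth (fun z => psi z + C).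
Proof.
move=> [sp bp]; split; first by apply: smoothD => //; exact: smooth_cst.
move=> j; have [B B0 HB] := bp j; exists (B + `|C|); first by rewrite addr_ge0.
move=> y; rewrite D_D//; last exact: smooth_cst.
apply: le_trans (ler_normD _ _) _; rewrite lerD//.
by case: j {HB} => [|j]; rewrite ?D0 ?D_cst ?normr0.
Qed.

Lemma avg_wsum psi C T S phi x t :
  avg (wsum psi C T S) phi x t = avg (fun phi => T (fun z => (psi z + C) * phi z)) phi x t + C * avg S phi x t.
Proof. by rewrite /avg /wsum; ring. Qed.

(** Cancelling [C * f x] against [C * (- f x)] requires a finite [f x]; the points of infinite value
    join the null set. For [test_class1] finite lower bounds of the averages of [T] and [S] are
    enough. *)
Lemma majF_mul f a b T S psi C : a <= b -> majF f a b T -> majF (fun x => - f x)%E a b S ->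
  bsmooth psi -> 0 <= C -> (forall x, 0 <= psi x + C) ->
  majF (fun x => f x * (psi x)%:E)%E a b (wsum psi C T S).
Proof.
move=> ab mT mS bp C0 psiC.
have [Z3 nZ3 ffin] := finite_ae ab mT mS.
have bpC := bsmooth_addC C bp; have [spC _] := bpC.
have [eT pT [E1 [Z1 [cE1 nZ1 T0 T1]]]] := mT.
have [eS pS [E2 [Z2 [cE2 nZ2 S0 S1]]]] := mS.
have nT x : null_at T x by have [? []] := pT x.
have eM := edist_mul eT spC.
split.
- have eZ : edist a b (fun phi => C * S phi) by have := edist_lin C eS (edist_zero a b); congr edist; apply/funext => phi; rewrite addr0.
  exact: edistD2 eM eZ.
- move=> x; have [p Hp] := pT x; have [q Hq] := pS x.
  have [d Hd] := mul_pv eT (nT x) spC Hp; exists (C * q + d).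
  by have := pv_lin C Hq Hd; congr pv; apply/funext => phi; rewrite addrC.
have low phi x c1 c2 e : test_class0 phi -> 0 < e -> lowge T phi x c1%:E -> lowge S phi x c2%:E ->
    exists2 d, 0 < d & forall t, 0 < t -> t < d ->
    (psi x + C) * (c1 - e) + C * (c2 - e) - e <= avg (wsum psi C T S) phi x t.
  move=> tp e0 lT lS.
  have [|d1 d10 H1] := lT (c1 - e); first by rewrite lte_fin; clear -ab e0; lra.
  have [|d2 d20 H2] := lS (c2 - e); first by rewrite lte_fin; lra.
  have [d3 d30 H3] := mul_avg eT (nT x) bpC tp e0.
  exists (Num.min d1 (Num.min d2 d3)); first by rewrite !lt_min d10 d20.
  move=> t t0; rewrite !lt_min => /and3P[td1 td2 td3]; rewrite avg_wsum.
  have := H3 t t0 td3; rewrite ler_norml => /andP[h3 _].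
  have h1 := ler_wpM2l (psiC x) (H1 t t0 td1); have h2 := ler_wpM2l C0 (H2 t t0 td2).
  lra.
exists (E1 `|` E2), (Z1 `|` Z2 `|` Z3); split.
- exact: countable_setU.
- by apply: negligibleU => //; exact: negligibleU.
- move=> x phi ax xb /not_orP[/not_orP[z1 z2] z3] tp c.
  have [lT lS] := (T0 x phi ax xb z1 tp, S0 x phi ax xb z2 tp).
  have fx := ffin x ax xb z3; rewrite -(fineK fx) in lT lS *.
  rewrite -EFinN in lS; rewrite -EFinM lte_fin => cf.
  set r := fine (f x) in lT lS cf.
  have K0 : 0 < 1 + (psi x + C) + C by have := psiC x; lra.
  (* The total loss in [low] is [(1 + (psi x + C) + C) * e]. *)
  have e0 : 0 < (r * psi x - c) / (1 + (psi x + C) + C) by rewrite divr_gt0//; clear -ab cf K0; lra.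
  have [d d0 Hd] := low phi x r (- r) _ tp e0 lT lS; exists d => // t t0 td.
  apply: le_trans (Hd t t0 td); set e := _ / _ in e0 *.
  have : (1 + (psi x + C) + C) * e = r * psi x - c by rewrite /e mulrC divfK// gt_eqF.
  clear -ab K0; lra.
- move=> x phi ax xb /not_orP[e1 e2] tp.
  have [c1 lT] := T1 x phi ax xb e1 tp; have [c2 lS] := S1 x phi ax xb e2 tp.
  have [tp0 _] := tp.
  have [d d0 Hd] := low phi x c1 c2 1 tp0 ltr01 lT lS.
  exists ((psi x + C) * (c1 - 1) + C * (c2 - 1) - 1) => c; rewrite lte_fin => cc.
  by exists d => // t t0 td; apply: le_trans (ltW cc) _; exact: Hd.
Qed.

Lemma majF_mulN f a b T S psi C : a <= b -> majF f a b T -> majF (fun x => - f x)%E a b S ->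
  bsmooth psi -> 0 <= C -> (forall x, 0 <= psi x + C) ->
  majF (fun x => - (f x * (psi x)%:E))%E a b (wsum psi C S T).
Proof.
move=> ab mT mS bp C0 psiC.
have mT' : majF (fun x => - - f x)%E a b T.
  by move: mT; congr majF; apply/funext => x; rewrite oppeK.
have := majF_mul ab mS mT' bp C0 psiC; congr majF; apply/funext => x.
by rewrite mulNe.
Qed.

Lemma wsum1 a b psi C T S : edist a b T -> Cinf psi ->
  wsum psi C T S (fun=> 1) = T psi + C * (T (fun=> 1) + S (fun=> 1)).
Proof.
move=> eT sp; rewrite /wsum.
have -> : (fun z : R => (psi z + C) * 1) = fun z => C * 1 + psi z.
  by apply/funext => z; ring.
rewrite (edistZD eT C (@smooth_cst R 1) sp); ring.
Qed.

Definition gap f a b T S := majF f a b T /\ majF (fun x => - f x)%E a b S.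

(** Each weighted sum exceeds [T psi], respectively [S psi], by [C] times the mass of [T + S]; a
    third such term bounds [T psi + S psi], by positivity of [T + S] on [C - psi]. *)
Lemma mul_gap f a b T S psi C : a <= b -> gap f a b T S -> bsmooth psi -> 0 <= C ->
  (forall x, `|psi x| <= C) ->
  gap (fun x => f x * (psi x)%:E)%E a b (wsum psi C T S) (wsum psi C S T) /\
  wsum psi C T S (fun=> 1) + wsum psi C S T (fun=> 1) <= 3 * C * (T (fun=> 1) + S (fun=> 1)).
Proof.
move=> ab [mT mS] bp C0 psiC; have [sp _] := bp.
have psi1 x : 0 <= psi x + C by have := psiC x; rewrite ler_norml => /andP[? _]; lra.
split; first by split; [exact: majF_mul|exact: majF_mulN].
have [eT _ _] := mT; have [eS _ _] := mS.
rewrite (wsum1 _ _ eT sp) (wsum1 _ _ eS sp).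
have s1 := @smooth_cst R 1; have sC := smoothZ C s1.
have : 0 <= T (fun x => C * 1 - psi x) + S (fun x => C * 1 - psi x).
  apply: (positive_majF ab mT mS); first exact: smoothB.
  by move=> x; have := psiC x; rewrite ler_norml => /andP[_ ?]; lra.
rewrite !(edistB eT)// !(edistB eS)// !(edistZ eT _ s1) !(edistZ eS _ s1); lra.
Qed.

Lemma dintF_gap f a b m e : dintF f a b m -> 0 < e -> exists T S, gap f a b T S /\
  T (fun=> 1) + S (fun=> 1) <= e.
Proof.
move=> dm e0; have e2 : 0 < e / 2 by lra.
by have [T [S [mT mS h1 h2]]] := dm _ e2; exists T, S; split => //; lra.
Qed.

Lemma gap1_ge0 f a b T S : a <= b -> gap f a b T S -> 0 <= T (fun=> 1) + S (fun=> 1).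
Proof.
move=> ab [mT mS]; apply: (positive_majF ab mT mS) => //; exact: smooth_cst.
Qed.

Lemma prod_dint f a b m psi C : a <= b -> dintF f a b m -> bsmooth psi -> 0 <= C ->
  (forall x, `|psi x| <= C) -> exists p, dintF (fun x => f x * (psi x)%:E)%E a b p.
Proof.
move=> ab dm bp C0 psiC; apply: dintF_of_gap => // e e0.
have e3 : 0 < e / (3 * C + 1) by rewrite divr_gt0//; lra.
have [T [S [gTS h]]] := dintF_gap dm e3.
have [[m1 m2] h2] := mul_gap ab gTS bp C0 psiC.
exists (wsum psi C T S), (wsum psi C S T); split => //; apply: le_trans h2 _.
move: h; rewrite ler_pdivlMr; last by lra.
have := gap1_ge0 ab gTS; lra.
Qed.

(** The major mass exceeds [T psi] by [C] times the mass of [T + S], and the minor one lies at most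
    three times that amount lower; [p] is between them. *)
Lemma prod_approx f a b p psi C T S : a <= b -> gap f a b T S -> bsmooth psi -> 0 <= C ->
  (forall x, `|psi x| <= C) -> dintF (fun x => f x * (psi x)%:E)%E a b p ->
  `|p - T psi| <= 2 * C * (T (fun=> 1) + S (fun=> 1)).
Proof.
move=> ab gTS bp C0 psiC dp; have [[m1 m2] h2] := mul_gap ab gTS bp C0 psiC.
have [[eT _ _] [eS _ _]] := gTS; have [sp _] := bp.
have := dintF_le ab dp m1; have := dintF_le ab (dintF_opp dp) m2.
rewrite (wsum1 _ _ eT sp) (wsum1 _ _ eS sp) => h3 h4.
have := gap1_ge0 ab gTS; move: h2; rewrite (wsum1 _ _ eT sp) (wsum1 _ _ eS sp) => h5 h6.
have Cm : 0 <= C * (T (fun=> 1) + S (fun=> 1)) by rewrite mulr_ge0.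
by rewrite ler_norml; apply/andP; split; lra.
Qed.

(** For nonnegative [psi] the choice [C = 0] is allowed in [wsum], and the error term disappears. *)
Lemma prod_ge0 f a b p psi T S : a <= b -> gap f a b T S -> bsmooth psi ->
  (forall x, 0 <= psi x) -> dintF (fun x => f x * (psi x)%:E)%E a b p ->
  p <= T psi /\ - S psi <= p.
Proof.
move=> ab [mT mS] bp psi0 dp; have [sp _] := bp.
have psi1 x : 0 <= psi x + 0 by rewrite addr0.
have [eT _ _] := mT; have [eS _ _] := mS.
have := dintF_le ab dp (majF_mul ab mT mS bp (lexx 0) psi1).
have := dintF_le ab (dintF_opp dp) (majF_mulN ab mT mS bp (lexx 0) psi1).
rewrite (wsum1 _ _ eT sp) (wsum1 _ _ eS sp) !mul0r !addr0; split; lra.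
Qed.

End ProductMajor.

(** * The distribution defined by [f] *)

Section Distribution.
Context {R : realType}.
Implicit Types (phi psi theta F q : R -> R) (T S P : (R -> R) -> R) (a b c x y z h s t B C d e m M N K r p : R) (n k j J : nat).
Local Notation mu := (@lebesgue_measure R).
Variable (f : R -> \bar R).
Hypothesis hf : locally_dist_integrable f.

Lemma loc_dint a b : a <= b -> dintF f a b (dist_integral f a b).
Proof. by move=> ab; apply: dintF_integral => //; exact: hf. Qed.

Lemma loc_gap a b e : a <= b -> 0 < e -> exists T S, gap f a b T S /\
  T (fun=> 1) + S (fun=> 1) <= e.
Proof. by move=> ab; exact: dintF_gap (loc_dint ab). Qed.

Lemma testf_bsmooth psi : testf psi -> bsmooth psi.
Proof.
move=> tp; split; first exact: tp.1.
by move=> j; have [B B0 HB] := testf_bounded j tp; exists B => // y; exact: HB.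
Qed.

Lemma testf_sup psi : testf psi -> exists2 C, 0 <= C & forall x, `|psi x| <= C.
Proof.
by move=> tp; have [B B0 HB] := testf_bounded 0 tp; exists B => // x; have := HB 0%N x isT; rewrite D0.
Qed.

Definition fmul psi x : \bar R := (f x * (psi x)%:E)%E.

Lemma fmul_dint a b psi : a <= b -> testf psi -> exists p, dintF (fmul psi) a b p.
Proof.
move=> ab tp; have [C C0 psiC] := testf_sup tp.
exact: (prod_dint ab (loc_dint ab) (testf_bsmooth tp) C0 psiC).
Qed.

Lemma fmul_zero a b psi : (forall x, a < x -> x < b -> psi x = 0) -> dintF (fmul psi) a b 0.
Proof.
move=> H; apply: (@dintF_zero _ _ _ _ [set a; b]).
  by apply: countable_negl; exact: finite_set_countable.
move=> x ax xb nab; rewrite /fmul H ?mule0//.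
  by rewrite lt_neqAle ax andbT; apply/eqP => E; apply: nab; left.
by rewrite lt_neqAle xb andbT; apply/eqP => E; apply: nab; right.
Qed.

Lemma fmul_sub a b N psi p : testf psi -> a <= b -> - N <= a -> b <= N ->
  (forall x, x < a \/ b < x -> psi x = 0) -> dintF (fmul psi) (- N) N p -> dintF (fmul psi) a b p.
Proof.
move=> tp ab Na bN psi0 dp; have [q dq] := fmul_dint ab tp.
suff -> : p = q by [].
have z1 : dintF (fmul psi) (- N) a 0 by apply: fmul_zero => x _ xa; apply: psi0; left.
have z2 : dintF (fmul psi) b N 0 by apply: fmul_zero => x xb _; apply: psi0; right.
have NN : - N <= N by lra.
apply: (dintF_unique NN dp).
have Nb : - N <= b by lra.
by have := dintF_add Nb bN (dintF_add Na ab z1 dq) z2; rewrite add0r addr0.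
Qed.

(** A choice of interval, so that [fint] is a function of [psi] alone; by [fintE] every interval
    outside which [psi] vanishes gives the same value. *)
Definition radius_of psi : R := xget 0 [set M | 0 <= M /\ forall x, M < `|x| -> psi x = 0].

Definition fint psi : R := dist_integral (fmul psi) (- radius_of psi) (radius_of psi).

Lemma radius_ofP psi : testf psi -> 0 <= radius_of psi /\ forall x, radius_of psi < `|x| -> psi x = 0.
Proof.
move=> [_ [M HM]]; rewrite /radius_of; case: xgetP => [y -> //|/(_ (Num.max M 0))].
case; split; first by rewrite le_max lexx orbT.
by move=> x; rewrite gt_max => /andP[/HM].
Qed.

Lemma fintE a b psi : testf psi -> a <= b -> (forall x, x < a \/ b < x -> psi x = 0) ->
  dintF (fmul psi) a b (fint psi).
Proof.
move=> tp ab psi0; have [M0 HM] := radius_ofP tp; set M := radius_of psi in M0 HM.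
have MM : - M <= M by lra.
have psi0' x : x < - M \/ M < x -> psi x = 0.
  by move=> h; apply: HM; rewrite lter_normr; apply/orP; case: h => ?; [right|left]; lra.
pose N := M + `|a| + `|b|.
have NN : - N <= N by rewrite /N; have := normr_ge0 a; have := normr_ge0 b; lra.
have [p dp] := fmul_dint NN tp.
have h1 := ler_norm b; have h2 := ler_norm (- a); rewrite normrN in h2.
have h3 := normr_ge0 a; have h4 := normr_ge0 b.
have -> : fint psi = p.
  rewrite /fint -/M; apply: (integral_dintF MM _).2.
  by apply: (fmul_sub tp MM _ _ psi0' dp); rewrite /N; clear -ab h1 h2; lra.
by apply: (fmul_sub tp ab _ _ psi0 dp); rewrite /N; clear -ab M0 h2 h4 h1 h3; lra.
Qed.

Lemma fint_approx a b psi C T S : a <= b -> gap f a b T S -> testf psi ->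
  (forall x, x < a \/ b < x -> psi x = 0) -> 0 <= C -> (forall x, `|psi x| <= C) ->
  `|fint psi - T psi| <= 2 * C * (T (fun=> 1) + S (fun=> 1)).
Proof.
move=> ab gTS tp psi0 C0 psiC.
exact: prod_approx ab gTS (testf_bsmooth tp) C0 psiC (fintE tp ab psi0).
Qed.

Lemma small_eq0 x C : (forall e, 0 < e -> `|x| <= C * e) -> x = 0.
Proof.
move=> H; apply/eqP; rewrite -normr_le0; apply/ler_addgt0Pl => e e0; rewrite addr0.
have C1 : 0 < `|C| + 1 by have := normr_ge0 C; lra.
have e1 : 0 < e / (`|C| + 1) by rewrite divr_gt0.
apply: le_trans (H _ e1) _; have := ler_norm C => hC.
have : C * (e / (`|C| + 1)) <= (`|C| + 1) * (e / (`|C| + 1)) by rewrite ler_wpM2r//; [exact: ltW|lra].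
by rewrite [X in _ <= X]mulrC divfK// gt_eqF.
Qed.

Lemma fint_linear c phi psi : test_fun phi -> test_fun psi ->
  fint (fun x => c * phi x + psi x) = c * fint phi + fint psi.
Proof.
move=> /test_testf tp /test_testf ts.
have tps : testf (fun x => c * phi x + psi x) by apply: testfD => //; exact: testfZ.
have [M1 H1] := radius_ofP tp; have [M2 H2] := radius_ofP ts.
pose M := radius_of phi + radius_of psi.
have MM : - M <= M by rewrite /M; lra.
have out x : x < - M \/ M < x -> radius_of phi < `|x| /\ radius_of psi < `|x|.
  rewrite !lter_normr /M => h; split; apply/orP; by case: h => ?; [right|left]; lra.
have p0 x : x < - M \/ M < x -> phi x = 0 by move=> /out[/H1].
have s0 x : x < - M \/ M < x -> psi x = 0 by move=> /out[_ /H2].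
have ps0 x : x < - M \/ M < x -> c * phi x + psi x = 0 by move=> h; rewrite p0// s0//; ring.
have [C1 C10 HC1] := testf_sup tp; have [C2 C20 HC2] := testf_sup ts; have [C3 C30 HC3] := testf_sup tps.
apply/eqP; rewrite -subr_eq0; apply/eqP.
apply: (@small_eq0 _ (2 * C3 + `|c| * (2 * C1) + 2 * C2)) => e e0.
have [T [S [gTS TS]]] := loc_gap MM e0.
have [[eT _ _] _] := gTS.
have := fint_approx MM gTS tps ps0 C30 HC3; have := fint_approx MM gTS tp p0 C10 HC1.
have := fint_approx MM gTS ts s0 C20 HC2; rewrite (edistZD eT c tp.1 ts.1).
move: (fint _) (fint phi) (fint psi) (T phi) (T psi) => u v w p q h1 h2 h3.
have g0 := gap1_ge0 MM gTS; set g := _ + _ in TS h1 h2 h3 g0.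
have -> : u - (c * v + w) = (u - (c * p + q)) - c * (v - p) - (w - q) by ring.
apply: le_trans (ler_normB _ _) _.
have h4 := ler_normB (u - (c * p + q)) (c * (v - p)); rewrite normrM in h4.
have h5 : `|c| * `|v - p| <= `|c| * (2 * C1 * g) by rewrite ler_wpM2l.
have k1 : (2 * C3 + `|c| * (2 * C1) + 2 * C2) * g <= (2 * C3 + `|c| * (2 * C1) + 2 * C2) * e.
  by rewrite ler_wpM2l// !addr_ge0// !mulr_ge0.
lra.
Qed.

Lemma fint_continuous (K : set R) : compact K -> exists (C : R) (k : nat),
  forall phi, test_fun phi -> tsupp phi `<=` K -> `|fint phi| <= C * Ck_norm k phi.
Proof.
move=> /compact_bounded[M0 [_ HM]]; pose M := Num.max (M0 + 1) 0.
have M00 : 0 <= M by rewrite le_max lexx orbT.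
have KM x : K x -> `|x| <= M by apply: (HM M); rewrite lt_max ltrDl ltr01.
have MM : - M <= M by lra.
have [T [S [gTS TS]]] := loc_gap MM ltr01.
have [[eT _ _] _] := gTS; have [C [k [C0 HC]]] := edist_bound eT.
(* [C] comes from the finite order of [T], and 2 from [fint_approx] with the sup norm of [phi]
   bounded by [Ck_norm] and the mass of [T + S] by 1. *)
exists (C + 2), k => phi tp sK; have tp' := test_testf tp.
have p0 x : x < - M \/ M < x -> phi x = 0.
  move=> xM; apply/eqP; apply/negPn/negP => px.
  have : `|x| <= M by apply: KM; apply: sK; apply: subset_closure.
  by rewrite ler_norml => /andP[? ?]; case: xM => ?; lra.
have ck x : `|phi x| <= Ck_norm k phi by have := Ck_norm_ge x tp' (leq0n k); rewrite D0.
have ck0 : 0 <= Ck_norm k phi by apply: le_trans (ck 0).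
have h1 := fint_approx MM gTS tp' p0 ck0 ck.
have h2 : `|T phi| <= C * Ck_norm k phi.
  by apply: HC; [exact: tp'.1|move=> j x jk _; exact: Ck_norm_ge].
have := ler_normD (fint phi - T phi) (T phi); rewrite subrK => h3.
have g0 := gap1_ge0 MM gTS.
have h4 : Ck_norm k phi * (T (fun=> 1) + S (fun=> 1)) <= Ck_norm k phi * 1 by rewrite ler_wpM2l.
clear -h1 h2 h3 h4; lra.
Qed.

Definition fdistr : schwartz_distr R := Distribution fint_linear fint_continuous.

Lemma fdistr_integral psi a b : test_fun psi -> a <= b -> tsupp psi `<=` `[a, b]%classic ->
  dist_integrable (fmul psi) a b /\ fdistr psi = dist_integral (fmul psi) a b.
Proof.
move=> /test_testf tp ab sab.
have p0 x : x < a \/ b < x -> psi x = 0.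
  move=> h; apply/eqP; apply/negPn/negP => px.
  have : `[a, b]%classic x by apply: sab; apply: subset_closure.
  by rewrite /= in_itv/= => /andP[? ?]; case: h => ?; lra.
by have [h1 h2] := integral_dintF ab (fintE tp ab p0); split; last exact: esym h2.
Qed.

End Distribution.

(** * The indefinite integral as a primitive of the distribution *)

Section Primitive.
Context {R : realType}.
Implicit Types (phi psi theta F q : R -> R) (T S P : (R -> R) -> R) (a b c x y z h s t B C d e m M N r p : R) (n j J : nat).
Local Notation mu := (@lebesgue_measure R).
Variable (f : R -> \bar R).
Hypothesis hf : locally_dist_integrable f.

(** [tailf phi] is not compactly supported; removing a multiple of [lam] makes it a test function
    and shifts the resulting primitive by a constant, which the parameter [c] of [pint] adjusts. *)
Definition taut phi y := tailf phi y - (\int[mu]_y phi y) * lam y.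

Definition pint c phi : R := fint f (taut phi) + c * \int[mu]_y phi y.

Lemma taut_testf phi : testf phi -> testf (taut phi).
Proof. exact: tail_lam. Qed.

Lemma fint_lin c phi psi : testf phi -> testf psi ->
  fint f (fun x => c * phi x + psi x) = c * fint f phi + fint f psi.
Proof. by move=> tp ts; apply: (fint_linear hf); exact: testf_test. Qed.

Lemma fint0 : fint f (fun=> 0) = 0.
Proof.
have := fint_lin 1 (@testf0 R) (@testf0 R).
have -> : (fun x : R => 1 * 0 + 0) = fun=> 0 :> R by apply/funext => y; ring.
lra.
Qed.

Lemma tautZD c phi psi : testf phi -> testf psi ->
  taut (fun x => c * phi x + psi x) = fun y => c * taut phi y + taut psi y.
Proof. by move=> tp ts; apply/funext => y; rewrite /taut tailfZD// RintZD//; ring. Qed.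

Lemma pint_linear c d phi psi : test_fun phi -> test_fun psi ->
  pint c (fun x => d * phi x + psi x) = d * pint c phi + pint c psi.
Proof.
move=> /test_testf tp /test_testf ts; rewrite /pint tautZD//.
rewrite (fint_lin d (taut_testf tp) (taut_testf ts)) (RintZD d tp ts).
by move: (fint f _) (fint f _) (\int[mu]_y _) (\int[mu]_y _) => u v w r; ring.
Qed.

Lemma pint_continuous c (K : set R) : compact K -> exists (C : R) (k : nat),
  forall phi, test_fun phi -> tsupp phi `<=` K -> `|pint c phi| <= C * Ck_norm k phi.
Proof.
move=> /compact_bounded[M0 [_ HM]]; pose M := Num.max (M0 + 1) 0.
have M00 : 0 <= M by rewrite le_max lexx orbT.
have KM x : K x -> `|x| <= M by apply: (HM M); rewrite lt_max ltrDl ltr01.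
(* [lam] is constant on either side of [[1, 2]], so [taut phi] vanishes off [[- N, N]] as soon as
   [phi] vanishes off [[- M, M]]. *)
pose N := M + 3; have NN : - N <= N by rewrite /N; lra.
have [T [S [gTS TS]]] := loc_gap hf NN ltr01.
have [[eT _ _] _] := gTS; have [C [k [C0 HC]]] := edist_bound eT.
have [C1 C10 HC1] := tailf_bound k M00; have [L L0 HL] := @lam_D R k.
pose C2 := C1 + 2 * (M + 1) * L.
have C20 : 0 <= C2 by rewrite addr_ge0// !mulr_ge0//; lra.
exists (C * C2 + 2 * C2 + `|c| * (2 * (M + 1))), k => phi tp sK; have tp' := test_testf tp.
have phiM y : M < `|y| -> phi y = 0.
  move=> yM; apply/eqP; apply/negPn/negP => py.
  have : `|y| <= M by apply: KM; apply: sK; apply: subset_closure.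
  by rewrite leNgt yM.
have [B EB] : exists B, B = Ck_norm k phi by exists (Ck_norm k phi).
have HB j y : (j <= k)%N -> `|D j phi y| <= B by rewrite EB; exact: Ck_norm_ge.
have HB0 y : `|phi y| <= B by have := HB 0%N y (leq0n _); rewrite D0.
have B0 : 0 <= B by apply: le_trans (HB0 0).
have HI : `|\int[mu]_y phi y| <= 2 * (M + 1) * B.
  by have [X HX] := RintE tp'; rewrite -(HX X)//; exact: prim_bound.
have st : Cinf (tailf phi) by exact: Cinf_tailf.
have slam : Cinf (fun y => (\int[mu]_y phi y) * lam y) by apply: smoothZ; exact: Cinf_lam.
have tt : testf (taut phi) by exact: tail_lam.
have Dt j y : (j <= k)%N -> `|D j (taut phi) y| <= C2 * B.
  move=> jk; rewrite /taut D_B// D_Z; last exact: Cinf_lam.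
  apply: le_trans (ler_normB _ _) _; rewrite normrM.
  have h1 := HC1 phi B tp' phiM HB j y jk.
  have h2 : `|\int[mu]_y phi y| * `|D j lam y| <= 2 * (M + 1) * B * L by apply: ler_pM => //; exact: HL.
  rewrite /C2; clear -h1 h2; lra.
have t0 x : x < - N \/ N < x -> taut phi x = 0.
  have [X [X0 HX]] := tailf_far tp'.
  have phir y : M < y -> phi y = 0 by move=> yM; apply: phiM; rewrite lter_normr yM.
  have phil y : y < - M -> phi y = 0.
    by move=> yM; apply: phiM; rewrite lter_normr; apply/orP; right; clear -yM; lra.
  rewrite /taut /tailf; case=> h.
    by rewrite (prim_left phil) ?lam1; [ring|rewrite /N in h; clear -M00 h; lra|rewrite /N in h; clear -h; lra].
  by rewrite (prim_right phir) ?lam0; [ring|rewrite /N in h; clear -M00 h; lra|rewrite /N in h; clear -h; lra].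
have ts x : `|taut phi x| <= C2 * B by have := Dt 0%N x (leq0n _); rewrite D0.
have CB : 0 <= C2 * B by exact: mulr_ge0.
have h1 := fint_approx hf NN gTS tt t0 CB ts.
have h2 : `|T (taut phi)| <= C * (C2 * B) by apply: HC; [exact: tt.1|move=> j x jk _; exact: Dt].
have := ler_normD (fint f (taut phi) - T (taut phi)) (T (taut phi)); rewrite subrK => h3.
have g0 := gap1_ge0 NN gTS.
have h4 : C2 * B * (T (fun=> 1) + S (fun=> 1)) <= C2 * B * 1 by rewrite ler_wpM2l.
have h5 := ler_normD (fint f (taut phi)) (c * \int[mu]_y phi y).
have h6 : `|c * \int[mu]_y phi y| <= `|c| * (2 * (M + 1) * B) by rewrite normrM ler_wpM2l.
rewrite /pint -EB; move: h1 h2 h3 h4 h5 h6 g0; rewrite /C2.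
move: (fint f _) (T (taut _)) (_ + S _) (\int[mu]_y _) => u v g w *; lra.
Qed.

Definition pdistr c : schwartz_distr R := Distribution (pint_linear c) (pint_continuous c).

Lemma pdistr_derivative c : is_distr_derivative (pdistr c) (fdistr hf).
Proof.
move=> phi /test_testf tp; rewrite -D1E /= /pint /taut (Rint_derive tp) tailf_D1//.
have -> : (fun y => - phi y - 0 * lam y) = fun y => -1 * phi y + 0.
  by apply/funext => y; ring.
rewrite (fint_lin _ tp (@testf0 R)) fint0.
ring.
Qed.

Lemma bsmooth_lam : bsmooth (@lam R).
Proof.
split; first exact: Cinf_lam.
by move=> j; have [B B0 HB] := @lam_D R j; exists B => // y; exact: HB.
Qed.

Lemma lam_norm x : `|lam x| <= 1 :> R.
Proof. by rewrite ger0_norm ?lam_ge0// lam_le1. Qed.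

Definition lamint M := dist_integral (fmul f lam) (- M) M.

(** [T] is glued at [x] from functionals on [[- M, x]] and [[x, M]], so its primitive has the value
    [T1 1] at [x], close to the integral up to [x]. The error of [fint] against [T] involves only
    the sup norm of the test, which stays bounded as the scale [s] tends to 0. *)
Lemma pdistr_pval c x M : `|x| < M -> 3 <= M ->
  pval (pdistr c) x (c + dist_integral f (- M) x - lamint M).
Proof.
rewrite ltr_norml => /andP[xM1 xM2] M3 phi tp e e0.
have Mx : - M <= x by lra.
have xM : x <= M by lra.
have MM : - M <= M by lra.
set m := dist_integral f (- M) x; set I := \int[mu]_y phi y.
have [q dq] := prod_dint MM (loc_dint hf MM) bsmooth_lam ler01 lam_norm.
have -> : lamint M = q by apply: (integral_dintF MM dq).2.
have [Y [Y0 HY]] := tailf_far tp.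
have [M0 HM0] := tp.2; pose M1 := Num.max M0 0.
have M10 : 0 <= M1 by rewrite le_max lexx orbT.
have HM1 y : M1 < `|y| -> phi y = 0 by rewrite gt_max => /andP[/HM0].
have [C1 C10 HC1] := @tailf_bound R M1 0 M10.
have [B B0 HB] := testf_bounded 0 tp.
have tB y : `|tailf phi y| <= C1 * B by have := HC1 phi B tp HM1 HB 0%N y isT; rewrite D0.
pose C := C1 * B + `|I|.
have C0 : 0 <= C by rewrite addr_ge0// mulr_ge0.
(* Budget: [8 * C] for [fint] against [T], the mass of [T + S] being at most [4 * dl]; [|I|] for the
   integral up to [x] and [8 * |I|] for that of [f lam]. *)
pose K := 8 * C + 9 * `|I| + 1.
have I0 : 0 <= `|I| by [].
have K0 : 0 < K by rewrite /K; clear -C0 I0; lra.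
pose dl := e / 2 / K; have dl0 : 0 < dl by rewrite !divr_gt0.
have dlK : K * dl = e / 2 by rewrite /dl mulrC divfK// gt_eqF.
have [T1 [S1 [mT1 mS1 T11 S11]]] := loc_dint hf Mx dl0.
have [T2 [S2 [mT2 mS2 T21 S21]]] := loc_dint hf xM dl0.
pose T phi := T1 phi + T2 phi; pose S phi := S1 phi + S2 phi.
have gTS : gap f (- M) M T S by split; [exact: majF_glue mT1 mT2|exact: majF_glue mS1 mS2].
have mu1 : T (fun=> 1) + S (fun=> 1) <= 4 * dl by rewrite /T /S; clear -K0 T11 S11 T21 S21; lra.
have mu0 := gap1_ge0 MM gTS.
have [[eT pT _] _] := gTS; have [eT1 pT1 _] := mT1; have [eT2 pT2 _] := mT2.
have n1 : null_at T1 x by have [? []] := pT1 x.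
have n2 : null_at T2 x by have [? []] := pT2 x.
have pvx : pv T x (T1 (fun=> 1) + 0) by apply: pvD; [exact: (pv_right eT1)|exact: (pv_left eT2)].
rewrite addr0 in pvx.
have m1 := dintF_le Mx (loc_dint hf Mx) mT1; rewrite -/m in m1 T11.
have Tlam := prod_approx MM gTS bsmooth_lam ler01 lam_norm dq.
have e4 : 0 < e / 4 by clear -e0 K0; lra.
have [d0 d00 Hd0] := pv_tail eT pvx tp e4.
have w0 : 0 < Num.min (M - x) (M + x) / Y by rewrite divr_gt0// lt_min; apply/andP; split; clear -xM2 K0 xM1; lra.
(* Below the second threshold the transition zone of [tailf phi ((z - x) / s)] stays inside
   [[- M, M]], so [psi] vanishes outside. *)
exists (Num.min d0 (Num.min (M - x) (M + x) / Y)); first by rewrite lt_min d00.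
move=> s s0; rewrite lt_min => /andP[sd0]; rewrite ltr_pdivlMr// lt_min => /andP[sY1 sY2].
have sn : s != 0 by rewrite gt_eqF.
have tps : testf (fun y => phi ((y - x) / s)) by exact: testf_scale.
pose psi z := tailf phi ((z - x) / s) - I * lam z.
have IE : \int[mu]_y phi ((y - x) / s) = s * I.
  have [X [X0 HX]] := tailf_far tps; have hx := ler_norm (- x); rewrite normrN in hx.
  have := (HX (- (X + Y * s + `|x|))).1; rewrite tailf_scale// => <-.
    congr (_ * _); apply: (HY _).1; rewrite ler_pdivrMr//.
    by clear -K0 X0 hx; lra.
  have Ys : 0 < Y * s by exact: mulr_gt0.
  by have nx := normr_ge0 x; clear -K0 Ys nx; lra.
have tautE : taut (fun y => phi ((y - x) / s)) = fun z => s * psi z + 0.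
  by apply/funext => z; rewrite /taut IE tailf_scale// /psi; ring.
have tpsi : testf psi.
  have := testfZ s^-1 (tail_lam tps); congr testf; apply/funext => z.
  by rewrite -/(taut _ z) tautE addr0 mulKf.
have psi0 z : z < - M \/ M < z -> psi z = 0.
  case=> zM; rewrite /psi.
    rewrite (HY _).1 ?lam1; [by rewrite -/I; ring|by clear -xM1 xM2 K0 zM; lra|].
    by rewrite ler_pdivrMr//; clear -K0 sY2 zM; lra.
  rewrite (HY _).2 ?lam0; [by ring|by clear -M3 K0 zM; lra|].
  by rewrite ler_pdivlMr//; clear -K0 sY1 zM; lra.
have psiC z : `|psi z| <= C.
  apply: le_trans (ler_normB _ _) _; rewrite lerD// normrM.
  by rewrite -[leRHS]mulr1 ler_wpM2l// lam_norm.
have h1 := fint_approx hf MM gTS tpsi psi0 C0 psiC.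
have h2 := Hd0 s s0 sd0; rewrite -/I in h2.
have -> : s^-1 * pdistr c (fun y => phi ((y - x) / s)) = fint f psi + c * I.
  rewrite /= /pint IE tautE (fint_lin _ tpsi (@testf0 R)) fint0.
  by field.
have sl : Cinf (@lam R) by exact: Cinf_lam.
have sls : Cinf (fun z => tailf phi ((z - x) / s)) by apply: smooth_scale; exact: Cinf_tailf.
have TE : T psi = T (fun z => tailf phi ((z - x) / s)) - I * T lam.
  by rewrite /psi (edistB eT sls (smoothZ I sl)) (edistZ eT I sl).
rewrite TE in h1; move: h1 h2 Tlam; set u := T (fun z => _); set v := T lam; set w := T1 (fun=> 1) in m1 T11 *.
set g := T (fun=> 1) + S (fun=> 1) in mu1 mu0 *; set ff := fint f psi => h1 h2 h3.
have -> : ff + c * I - (c + m - q) * I = (ff - (u - I * v)) + (u - w * I) + I * (w - m) + I * (q - v) by ring.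
have k1 : `|I * (w - m)| <= `|I| * dl by rewrite normrM ler_wpM2l// ger0_norm; clear -K0 T11 m1; lra.
have k2 : `|I * (q - v)| <= `|I| * (2 * 1 * g) by rewrite normrM ler_wpM2l.
have k3 : `|I| * (2 * 1 * g) <= `|I| * (8 * dl) by rewrite ler_wpM2l//; clear -K0 mu1; lra.
have k4 : 2 * C * g <= 2 * C * (4 * dl) by rewrite ler_wpM2l// mulr_ge0.
have t1 := ler_normD (ff - (u - I * v) + (u - w * I) + I * (w - m)) (I * (q - v)).
have t2 := ler_normD (ff - (u - I * v) + (u - w * I)) (I * (w - m)).
have t3 := ler_normD (ff - (u - I * v)) (u - w * I).
have k5 : 8 * C * dl + 9 * `|I| * dl + dl = e / 2 by rewrite -dlK /K; ring.
lra.
Qed.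

Lemma oriented_diff a x M : `|a| < M -> `|x| < M ->
  dist_integral f (- M) x - dist_integral f (- M) a = oriented_dist_integral f a x.
Proof.
rewrite !ltr_norml => /andP[a1 a2] /andP[x1 x2]; rewrite /oriented_dist_integral.
have add u v w : u <= v -> v <= w -> dist_integral f u v + dist_integral f v w = dist_integral f u w.
  move=> uv vw; have uw : u <= w by lra.
  exact: (dintF_unique uw (dintF_add uv vw (loc_dint hf uv) (loc_dint hf vw)) (loc_dint hf uw)).
case: leP => ax; first by rewrite -(add (- M) a x)//; [ring|lra].
by rewrite -(add (- M) x a)//; [ring|lra|lra].
Qed.

Lemma primitive_exists a : exists TF : schwartz_distr R,
  lojasiewicz_assoc (fun x => oriented_dist_integral f a x) TF /\
  is_distr_derivative TF (fdistr hf).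
Proof.
pose k0 := `|a| + 3; pose c := - (dist_integral f (- k0) a - lamint k0).
exists (pdistr c); split; last exact: pdistr_derivative.
move=> x; apply/pvalP; pose M := `|a| + `|x| + 3.
have ha := normr_ge0 a; have hx := normr_ge0 x.
have M3 : 3 <= M by rewrite /M; lra.
have aM : `|a| < M by rewrite /M; lra.
have xM : `|x| < M by rewrite /M; lra.
have k3 : 3 <= k0 by rewrite /k0; lra.
have ak : `|a| < k0 by rewrite /k0; lra.
have := pval_unique (pdistr_pval c aM M3) (pdistr_pval c ak k3).
rewrite -(oriented_diff aM xM) => E.
have -> : dist_integral f (- M) x - dist_integral f (- M) a = c + dist_integral f (- M) x - lamint M.
  by rewrite /c in E *; lra.
exact: pdistr_pval.
Qed.

End Primitive.

(** * Point values of the distribution almost everywhere *)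

Section AlmostEverywhere.
Context {R : realType}.
Implicit Types (phi psi theta F q : R -> R) (T S P : (R -> R) -> R) (a b c x y z h s t B C d e m M N r p : R) (n k j J : nat).
Local Notation mu := (@lebesgue_measure R).
Variable (f : R -> \bar R).
Hypothesis hf : locally_dist_integrable f.

Section AtPoint.
Variables (x r N : R).
Hypothesis xN : `|x| < N.
Hypothesis good_gap : forall e, 0 < e -> exists T S, [/\ gap f (- N) N T S,
  forall phi, test_class0 phi -> lowge T phi x r%:E,
  forall phi, test_class0 phi -> lowge S phi x (- r)%:E &
  forall t, 0 < t -> t < 1 -> T (fun z => plateau ((z - x) / t)) + S (fun z => plateau ((z - x) / t)) <= e * t].

(** For a nonnegative test the integral lies between [- S] and [T]. Averages of [T] are nearly at
    least [r], those of [- S] nearly at most [r], and the maximal bound makes their difference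
    small, so all of them are near [r]. *)
Lemma fint_lim_class0 phi : testf phi -> (forall y, 0 <= phi y) -> \int[mu]_y phi y = 1 ->
  forall e, 0 < e -> exists2 d, 0 < d & forall s, 0 < s -> s < d ->
  `|s^-1 * fint f (fun y => phi ((y - x) / s)) - r| <= e.
Proof.
move=> tp p0 p1 e e0; have tc := class0_of_test tp p0 p1.
have [B B0 HB] := testf_sup tp; have [M0 HM0] := tp.2.
pose M := Num.max M0 1; have M1 : 1 <= M by rewrite le_max lexx orbT.
have HM y : M < `|y| -> phi y = 0 by rewrite gt_max => /andP[/HM0].
have BM : 0 <= B * M by rewrite mulr_ge0//; lra.
have BM0 : 0 < 2 * (B * M + 1) by lra.
(* [B * M * eps] will bound the average of [T + S]: [phi] is at most [B * plateau (y / M)], and the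
   maximal bound is used at radius [M * s]. *)
pose eps := e / (2 * (B * M + 1)); have eps0 : 0 < eps by rewrite divr_gt0.
have epsE : B * M * eps + eps = e / 2.
  by rewrite /eps; field; move: BM0; rewrite pmulr_rgt0// => /gt_eqF ->.
have [T [S [gTS lT lS Hmax]]] := good_gap eps0.
have e2 : 0 < e / 2 by lra.
have [|d1 d10 H1] := lT phi tc (r - e / 2); first by rewrite lte_fin; lra.
have [|d2 d20 H2] := lS phi tc (- r - e / 2); first by rewrite lte_fin; clear -hf xN good_gap e0; lra.
have N0 : 0 < N - `|x| by rewrite subr_gt0.
have NN : - N <= N by have := normr_ge0 x; clear -hf xN good_gap N0; lra.
exists (Num.min (Num.min d1 d2) (Num.min M^-1 ((N - `|x|) / M))).
  by rewrite !lt_min d10 d20 invr_gt0 divr_gt0//=; clear -hf xN good_gap M1; lra.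
move=> s s0; rewrite !lt_min => /andP[/andP[sd1 sd2]] /andP[sM sN].
have Mp : 0 < M by clear -hf xN good_gap M1; lra.
have sM1 : M * s < 1 by rewrite mulrC -ltr_pdivlMr// mul1r.
have sMN : s * M < N - `|x| by rewrite -ltr_pdivlMr.
have sn : s != 0 by rewrite gt_eqF.
have is0 : 0 < s^-1 by rewrite invr_gt0.
have tps := testf_scale x sn tp; set phis := fun y => phi ((y - x) / s) in tps *.
have ps0 y : 0 <= phis y by exact: p0.
have out y : y < - N \/ N < y -> phis y = 0.
  move=> h; apply: HM; rewrite normrM normfV (gtr0_norm s0) ltr_pdivlMr//.
  have := ler_norm x; have := ler_norm (- x); rewrite normrN => ? ?.
  by rewrite lter_normr; apply/orP; case: h => ?; [right|left]; lra.
have [mT mS] := gTS; have [eT _ _] := mT; have [eS _ _] := mS.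
have [up lo] := prod_ge0 NN gTS (testf_bsmooth tps) ps0 (fintE hf tps NN out).
have Ms0 : 0 < M * s by rewrite mulr_gt0.
have spl : Cinf (fun z => plateau ((z - x) / (M * s))) by apply: smooth_scale; exact: Cinf_plateau.
have Pphi : T phis + S phis <= B * (eps * (M * s)).
  have := positive_majF NN mT mS (psi := fun z => B * plateau ((z - x) / (M * s)) - phis z).
  rewrite (edistB eT (smoothZ B spl) tps.1) (edistB eS (smoothZ B spl) tps.1).
  rewrite (edistZ eT B spl) (edistZ eS B spl) => H.
  have : 0 <= B * T (fun z => plateau ((z - x) / (M * s))) - T phis +
     (B * S (fun z => plateau ((z - x) / (M * s))) - S phis).
    apply: H => [|z]; first by apply: smoothB; [exact: smoothZ|exact: tps.1].
    rewrite subr_ge0 /phis; have [h|h] := leP `|(z - x) / (M * s)| 1.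
      by rewrite plateau1// mulr1; apply: le_trans (ler_norm _) (HB _).
    have -> : phi ((z - x) / s) = 0.
      apply: HM; move: h; rewrite !normrM 2!normfV (gtr0_norm s0) (gtr0_norm Ms0).
      by rewrite !ltr_pdivlMr// mul1r.
    by apply: mulr_ge0 => //; exact: plateau_ge0.
  have := ler_wpM2l B0 (Hmax _ Ms0 sM1).
  move: (T phis) (S phis) (T _) (S _) => u v w1 w2; clear -hf xN good_gap; lra.
have := H1 s s0 sd1; have := H2 s s0 sd2; rewrite /avg -/phis.
have k1 := ler_wpM2l (ltW is0) up; have k2 := ler_wpM2l (ltW is0) lo.
have k3 := ler_wpM2l (ltW is0) Pphi.
have k4 : s^-1 * (B * (eps * (M * s))) = B * M * eps by field.
rewrite k4 mulrDr in k3; rewrite mulrN in k2.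
move: k1 k2 k3; move: (s^-1 * _) (s^-1 * _) (s^-1 * _) => u v w k1 k2 k3 h2 h1.
rewrite ler_norml; apply/andP; split; clear -hf xN good_gap eps0 epsE k2 k3 h1 k1 h2; lra.
Qed.

(** An arbitrary test function is the difference of two nonnegative ones with positive integrals;
    each of them, divided by its integral, belongs to [test_class0]. *)
Lemma pval_fdistr : pval (fdistr hf) x r.
Proof.
move=> phi tp e e0.
have [B B0 HB] := testf_sup tp; have [M0 HM0] := tp.2.
pose M := Num.max M0 1; have M1 : 1 <= M by rewrite le_max lexx orbT.
have Mp : 0 < M by lra.
have Mn : M != 0 by rewrite gt_eqF.
have HM y : M < `|y| -> phi y = 0 by rewrite gt_max => /andP[/HM0].
(* The height [B] would make [phi + p] nonnegative; [B + 1] makes both [p] and [phi + p] positive at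
   0, hence their integrals positive. *)
pose p y := (B + 1) * plateau ((y - 0) / M).
have tq : testf p by apply: testfZ; apply: testf_scale => //; exact: testf_plateau.
have p0 y : 0 <= p y by rewrite mulr_ge0 ?plateau_ge0//; lra.
pose q y := 1 * phi y + p y.
have tqq : testf q by apply: testfD => //; exact: testfZ.
have q0 y : 0 <= q y.
  rewrite /q mul1r; have [h|h] := leP `|y| M; last by rewrite HM// add0r.
  rewrite /p plateau1 ?mulr1; last by rewrite subr0 normrM normfV (gtr0_norm Mp) ler_pdivrMr// mul1r.
  by have := HB y; rewrite ler_norml => /andP[? _]; lra.
have p00 : p 0 = B + 1 by rewrite /p subr0 mul0r plateau1 ?normr0// mulr1.
have Ip : 0 < \int[mu]_y p y by apply: (@Rint_pos _ _ 0) => //; rewrite p00; lra.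
have Iq : 0 < \int[mu]_y q y.
  apply: (@Rint_pos _ _ 0) => //; rewrite /q mul1r p00; have := HB 0; rewrite ler_norml => /andP[? _]; lra.
have key g : testf g -> (forall y, 0 <= g y) -> 0 < \int[mu]_y g y -> forall e, 0 < e ->
    exists2 d, 0 < d & forall s, 0 < s -> s < d ->
    `|s^-1 * fint f (fun y => g ((y - x) / s)) - r * \int[mu]_y g y| <= e.
  move=> tg g0 Ig e' e'0; set I := \int[mu]_y g y in Ig *.
  have In : I != 0 by rewrite gt_eqF.
  pose g1 y := I^-1 * g y + 0.
  have tg1 : testf g1 by apply: testfD; [exact: testfZ|exact: testf0].
  have g10 y : 0 <= g1 y by rewrite addr_ge0// mulr_ge0// invr_ge0 ltW.
  have I0 : \int[mu]_y (0 : R) = 0 :> R by rewrite /Rintegral integral0.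
  have I1 : \int[mu]_y g1 y = 1 by rewrite /g1 (RintZD _ tg (@testf0 R)) I0 -/I mulVf// addr0.
  have e1 : 0 < e' / I by rewrite divr_gt0.
  have [d d0 Hd] := fint_lim_class0 tg1 g10 I1 e1; exists d => // s s0 sd.
  have sn : s != 0 by rewrite gt_eqF.
  have := Hd s s0 sd; rewrite /g1 (fint_lin hf _ (testf_scale x sn tg) (@testf0 R)) (fint0 hf).
  set u := fint f _; have -> : s^-1 * (I^-1 * u + 0) - r = (s^-1 * u - r * I) / I by field; rewrite In.
  by rewrite normrM normfV (gtr0_norm Ig) ler_pM2r// invr_gt0.
have e2 : 0 < e / 2 by clear -hf xN good_gap e0; lra.
have [d1 d10 H1] := key q tqq q0 Iq _ e2; have [d2 d20 H2] := key p tq p0 Ip _ e2.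
exists (Num.min d1 d2); first by rewrite lt_min d10.
move=> s s0; rewrite lt_min => /andP[sd1 sd2].
have sn : s != 0 by rewrite gt_eqF.
have h1 := H1 s s0 sd1; have h2 := H2 s s0 sd2.
rewrite /q (fint_lin hf 1 (testf_scale x sn tp) (testf_scale x sn tq)) (RintZD 1 tp tq) in h1.
rewrite [fdistr hf _]/(fint f _) /=.
move: h1 h2; set u := fint f (fun y => phi _); set v := fint f (fun y => p _).
move: (\int[mu]_y phi y) (\int[mu]_y p y) => I1 I2 h1 h2.
have -> : s^-1 * u - r * I1 = (s^-1 * (1 * u + v) - r * (1 * I1 + I2)) - (s^-1 * v - r * I2) by ring.
by apply: le_trans (ler_normB _ _) _; clear -hf xN good_gap h1 h2; lra.
Qed.

End AtPoint.

(** Functionals are chosen whose sum [P n] has mass at most [1 / (n + 1)]. By [weak_maximal] the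
    points at which all the maximal functions exceed a fixed level [1 / (j + 1)] form a null set.
    Off the union of these sets over [j], some [P n] meets any prescribed level at [x]. *)
Lemma ae_interval (N : R) : 0 <= N -> exists2 Z : set R, mu.-negligible Z &
  forall x, `|x| < N -> ~ Z x -> exists2 c, pval (fdistr hf) x c & f x = c%:E.
Proof.
move=> N0; have NN : - N <= N by lra.
have [n|TS HTS] := @choice nat (((R -> R) -> R) * ((R -> R) -> R)) (fun n TS => gap f (- N) N TS.1 TS.2 /\
   TS.1 (fun=> 1) + TS.2 (fun=> 1) <= n.+1%:R^-1).
  have e0 : 0 < n.+1%:R^-1 :> R by rewrite invr_gt0.
  by have [T [S [h1 h2]]] := loc_gap hf NN e0; exists (T, S).
pose P n phi := (TS n).1 phi + (TS n).2 phi.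
have eP n : edist (- N) N (P n).
  by have [[[eT _ _] [eS _ _]] _] := HTS n; exact: edistD2 eT eS.
have Ppos n : positive (P n) by have [[mT mS] _] := HTS n; exact: positive_majF NN mT mS.
have [Zf nZf Hfin] : exists2 Z : set R, mu.-negligible Z & forall x, - N <= x -> x <= N -> ~ Z x -> f x \is a fin_num.
  by have [[mT mS] _] := HTS 0%N; exact: finite_ae NN mT mS.
have [n|Z1 HZ1] := @choice nat (set R) (fun n Z => mu.-negligible Z /\ forall x phi, - N <= x -> x <= N -> ~ Z x ->
    test_class0 phi -> lowge (TS n).1 phi x (f x) /\ lowge (TS n).2 phi x (- f x)).
  have [[[_ _ [_ [Z [_ nZ H _]]]] [_ _ [_ [Z' [_ nZ' H' _]]]]] _] := HTS n.
  exists (Z `|` Z'); split; first exact: negligibleU.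
  by move=> x phi xa xb /not_orP[z z'] tp; split; [exact: H|exact: H'].
pose L j := \bigcap_n large_set (P n) j.+1%:R^-1.
have nL j : mu.-negligible (L j).
  have mL : measurable (L j).
    by apply: bigcapT_measurable => n; apply: open_measurable; exact: open_large_set (eP n).
  have c0 : 0 < j.+1%:R^-1 :> R by rewrite invr_gt0.
  exists (L j); split => //; apply/eqP; rewrite eq_le measure_ge0 andbT.
  apply/lee_addgt0Pr => e e0; rewrite add0e.
  have d0 : 0 < e / (12 / j.+1%:R^-1) by rewrite !divr_gt0.
  have /= [n _ ne] := near_infty_natSinv_lt (PosNum d0).
  apply: (@le_trans _ _ (mu (large_set (P n) j.+1%:R^-1))).
    apply: le_measure; rewrite ?inE//; first by apply: open_measurable; exact: open_large_set (eP n).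
    by move=> x; apply.
  apply: le_trans (weak_maximal (eP n) (Ppos n) c0) _; rewrite lee_fin.
  have K0 : 0 < 12 / j.+1%:R^-1 :> R by rewrite divr_gt0.
  have := ne n (leqnn _) => /=; rewrite ltr_pdivlMr// => h.
  have [_ h1] := HTS n; apply: le_trans (_ : 12 / j.+1%:R^-1 * n.+1%:R^-1 <= _).
    by rewrite ler_wpM2l// ltW.
  by rewrite mulrC ltW.
exists (Zf `|` \bigcup_n Z1 n `|` \bigcup_j L j).
  apply: negligibleU; last exact: negligible_bigcup.
  by apply: negligibleU => //; apply: negligible_bigcup => n; have [] := HZ1 n.
move=> x xN /not_orP[/not_orP[zf z1] zl].
have [xa xb] : - N <= x /\ x <= N by move: xN; rewrite ltr_norml => /andP[/ltW ? /ltW ?].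
have fx := Hfin x xa xb zf; exists (fine (f x)); last by rewrite fineK.
apply: (pval_fdistr xN) => e e0.
have /= [j _ je] := near_infty_natSinv_lt (PosNum e0); have {}je := je j (leqnn _).
have [n nL'] : exists n, ~ large_set (P n) j.+1%:R^-1 x.
  by apply: contrapT => H; apply: zl; exists j => // n _; apply: contrapT => h; apply: H; exists n.
have z1n : ~ Z1 n x by move=> h; apply: z1; exists n.
exists (TS n).1, (TS n).2; split.
- by have [] := HTS n.
- by move=> phi tp; have [_ /(_ x phi xa xb z1n tp)[h _]] := HZ1 n; rewrite fineK.
- by move=> phi tp; have [_ /(_ x phi xa xb z1n tp)[_ h]] := HZ1 n; rewrite EFinN fineK.
- move=> t t0 t1; apply: (@le_trans _ _ (j.+1%:R^-1 * t)); last by apply: ler_wpM2r; exact: ltW.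
  by rewrite leNgt; apply/negP => h; apply: nL'; exists t.
Qed.

Lemma ae_point_value : {ae mu, forall x, exists2 c, has_point_value (fdistr hf) x c & f x = c%:E}.
Proof.
have [n|Z HZ] := @choice nat (set R) (fun n Z => mu.-negligible Z /\ forall x, `|x| < n%:R -> ~ Z x ->
   exists2 c, pval (fdistr hf) x c & f x = c%:E).
  by have [Z nZ H] := ae_interval (ler0n R n); exists Z.
have nB : mu.-negligible (\bigcup_n Z n).
  by apply: negligible_bigcup => n; have [] := HZ n.
apply: negligibleS nB => x /= nx; apply: contrapT => nZ; apply: nx.
have [|c pc fc] := (HZ (Num.truncn `|x|).+1).2 x (truncnS_gt _).
  by move=> h; apply: nZ; exists (Num.truncn `|x|).+1.
by exists c => //; apply/pvalP.
Qed.

End AlmostEverywhere.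

Local Open Scope classical_set_scope.

Theorem theorem7p5 (R : realType) (f : R -> \bar R)
    (hf : locally_dist_integrable f) :
  exists Tf : schwartz_distr R,
    [/\ forall psi : R -> R, test_fun psi ->
          forall a b : R, a <= b -> tsupp psi `<=` `[a, b]%classic ->
            dist_integrable (fun x => (f x * (psi x)%:E)%E) a b /\
            Tf psi = dist_integral (fun x => (f x * (psi x)%:E)%E) a b,
        forall a : R, exists TF : schwartz_distr R,
          lojasiewicz_assoc (fun x => oriented_dist_integral f a x) TF /\
          is_distr_derivative TF Tf
      & {ae (@lebesgue_measure R), forall x : R,
          exists2 c : R, has_point_value Tf x c & f x = c%:E}].
Proof.
exists (fdistr hf); split.
- by move=> psi tpsi a b ab sab; exact: fdistr_integral.
- by move=> a; exact: primitive_exists.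
- exact: ae_point_value.
Qed.
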